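(* Let $\Omega\subset\mathbb{R}^2$ be a bounded $C^\infty$-smooth domain. Assume that $\Omega$ is strictly star-shaped and centrally symmetric (with respect to the origin). Assume also that the strict inclusion $\mathcal{B}\subsetneq\Omega$ holds for the disk $\mathcal{B}\subset\mathbb{R}^2$ of radius $R>0$ centred at the origin. Then the following hold. (i) $\lambda_2^\alpha(\Omega^{\rm c})<\lambda_2^\alpha(\mathcal{B}^{\rm c})$ for all $\alpha<-\frac{1}{R}$. (ii) $\alpha_\star(\Omega^{\rm c})\ge-\frac{1}{R}$.
   Context: For a bounded smooth planar domain $\Omega$, write $\Omega^{\rm c}:=\mathbb{R}^2\setminus\overline{\Omega}$ for its exterior (and likewise $\mathcal{B}^{\rm c}:=\mathbb{R}^2\setminus\overline{\mathcal{B}}$). For $\alpha<0$ define $$\lambda_2^\alpha(\Omega^{\rm c}):=\inf_{\substack{\mathcal{L}\subset H^1(\Omega^{\rm c})\\ \dim\mathcal{L}=2}}\ \sup_{u\in\mathcal{L}\setminus\{0\}}\frac{\int_{\Omega^{\rm c}}|\nabla u|^2\,dx+\alpha\int_{\partial\Omega}|u|^2\,d\sigma}{\int_{\Omega^{\rm c}}|u|^2\,dx},$$ where the infimum is over two-dimensional linear subspaces, $u$ on $\partial\Omega$ is understood in the sense of traces and $d\sigma$ is the one-dimensional Hausdorff measure on $\partial\Omega$. If this number is negative it is the second eigenvalue (counted with multiplicity) of the Robin Laplacian $-\Delta_\alpha^{\Omega^{\rm c}}$, the self-adjoint operator in $L^2(\Omega^{\rm c})$ associated with the closed quadratic form $u\mapsto\int_{\Omega^{\rm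 c}}|\nabla u|^2\,dx+\alpha\int_{\partial\Omega}|u|^2\,d\sigma$ on $H^1(\Omega^{\rm c})$, whose essential spectrum is $[0,\infty)$; otherwise it equals $0$. The critical coupling constant $\alpha_\star(\Omega^{\rm c})\le0$ is the constant such that $-\Delta_\alpha^{\Omega^{\rm c}}$ has at least two negative eigenvalues (counted with multiplicity), equivalently $\lambda_2^\alpha(\Omega^{\rm c})<0$, if and only if $\alpha<\alpha_\star(\Omega^{\rm c})$. A bounded $C^\infty$-smooth domain $\Omega$ is strictly star-shaped if its boundary can be parametrised by $\theta\mapsto\rho(\theta)(\cos\theta,\sin\theta)^\top$, $\theta\in[0,2\pi]$, where $\rho\in C^\infty([0,2\pi])$ is a positive function with $\rho^{(k)}(0)=\rho^{(k)}(2\pi)$ for all integers $k\ge0$. The domain $\Omega$ is centrally symmetric if $\{-x:x\in\Omega\}=\Omega$. *)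

(* Defs.v *)
From HB Require Import structures.
From mathcomp Require Import all_boot all_order all_algebra.
From mathcomp Require Import complex.
From mathcomp Require Import all_classical all_reals all_analysis.

Set Implicit Arguments.
Unset Strict Implicit.
Unset Printing Implicit Defensive.

Import Order.TTheory GRing.Theory Num.Theory.
Import numFieldNormedType.Exports.

Local Open Scope classical_set_scope.
Local Open Scope ring_scope.

Section PlaneDomains.
Context {R : realType}.
Local Notation plane := (R * R)%type.

Definition dist2 (x y : plane) : R :=
  Num.sqrt ((x.1 - y.1) ^+ 2 + (x.2 - y.2) ^+ 2).

Definition disk (c : plane) (r : R) : set plane := [set x | dist2 x c < r].

Definition boundary (A : set plane) : set plane := closure A `\` A°.

Definition exterior (A : set plane) : set plane := ~` closure A.

Definition smooth1 (f : R -> R) : Prop :=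
  forall (k : nat) (t : R), derivable (derive1n k f) t 1.

(* Near each of its boundary points, and in a suitable orthonormal frame, the
   set is the strict epigraph of a smooth function.  Composing the frame
   (cos t, sin t), (- sin t, cos t) with a reflection gives nothing new, since
   g may be replaced by s |-> g (- s). *)
Definition smooth_boundary (A : set plane) : Prop :=
  forall p, boundary A p ->
    exists (r t : R) (g : R -> R), [/\ 0 < r, smooth1 g &
      forall x, disk p r x ->
        (A x <-> g (cos t * x.1 + sin t * x.2) < - sin t * x.1 + cos t * x.2)].

Definition bounded_smooth_domain (A : set plane) : Prop :=
  [/\ A !=set0, open A, connected A, bounded_set A & smooth_boundary A].

(* C^oo([0, 2 pi]) is taken to be the space of restrictions to [0, 2 pi] of the
   smooth functions on the line. *)
Definition strictly_star_shaped (A : set plane) : Prop :=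
  exists rho : R -> R,
    [/\ smooth1 rho,
        forall t, t \in `[0, 2 * pi] -> 0 < rho t,
        forall k : nat, derive1n k rho 0 = derive1n k rho (2 * pi) &
        boundary A = [set (rho t * cos t, rho t * sin t) | t in `[0, 2 * pi]] ].

Definition centrally_symmetric (A : set plane) : Prop :=
  [set - x | x in A] = A.

End PlaneDomains.

Section HausdorffMeasure.
Context {R : realType}.
Local Notation plane := (R * R)%type.
Local Notation mplane := (measurableTypeR R * measurableTypeR R)%type.
Local Open Scope ereal_scope.

(* Euclidean diameter; the maximum with 0 is only there for the empty set. *)
Definition diam (E : set plane) : \bar R :=
  maxe 0 (ereal_sup [set (dist2 p.1 p.2)%:E | p in E `*` E]).

Definition hausdorff1_pre (delta : R) (A : set plane) : \bar R :=
  ereal_inf [set \sum_(0 <= i <oo) diam (E i) | E in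
    [set E : (set plane)^nat |
      A `<=` \bigcup_i E i /\ forall i, diam (E i) <= delta%:E]].

(* One-dimensional Hausdorff measure.  mplane is the plane with its Borel sets,
   in the measurable structure over which lebesgue_measure is declared.
   hausdorff1 is an outer measure that is a measure on the Borel sets, and
   integrals with respect to it only evaluate it on Borel sets. *)
Definition hausdorff1 : set mplane -> \bar R := fun A : set plane =>
  ereal_sup [set hausdorff1_pre delta A | delta in [set d : R | (0 < d)%R]].

End HausdorffMeasure.

Section SobolevSpace.
Context {R : realType}.
Local Notation plane := (R * R)%type.
Local Notation mplane := (measurableTypeR R * measurableTypeR R)%type.

Definition e1 : plane := (1, 0).
Definition e2 : plane := (0, 1).

Fixpoint Cn (n : nat) (f : plane -> R) : Prop :=
  match n with
  | 0%N => continuous f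
  | n'.+1 => [/\ continuous f, forall x, derivable f x e1,
               forall x, derivable f x e2, Cn n' ('D_e1 f) & Cn n' ('D_e2 f)]
  end.

Definition test_function (U : set plane) (f : plane -> R) : Prop :=
  [/\ forall n, Cn n f, compact (closure [set x | f x != 0]) &
      closure [set x | f x != 0] `<=` U].

Definition leb2 : {measure set mplane -> \bar R} :=
  (@lebesgue_measure R \x @lebesgue_measure R)%E.

(* Functions stand for their classes in L^2(D, mu); the representatives are
   Borel measurable on D. *)
Definition L2 (mu : set mplane -> \bar R) (D : set mplane) (f : mplane -> R) :=
  measurable_fun D f /\ (\int[mu]_(x in D) ((f x) ^+ 2)%:E < +oo)%E.

Definition is_gradient (U : set plane) (u : plane -> R)
    (v : plane -> plane) : Prop :=
  [/\ L2 leb2 U (fun x => (v x).1), L2 leb2 U (fun x => (v x).2) &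
    forall f, test_function U f ->
      (\int[leb2]_(x in U) (u x * 'D_e1 f x)%:E =
        - \int[leb2]_(x in U) ((v x).1 * f x)%:E)%E /\
      (\int[leb2]_(x in U) (u x * 'D_e2 f x)%:E =
        - \int[leb2]_(x in U) ((v x).2 * f x)%:E)%E].

(* The weak gradient, chosen among almost everywhere equal representatives. *)
Definition grad (U : set plane) (u : plane -> R) : plane -> plane :=
  xget (fun=> 0) [set v | is_gradient U u v].

(* The real-valued functions of H^1(U), for U open. *)
Definition H1r (U : set plane) (u : plane -> R) : Prop :=
  L2 leb2 U u /\ exists v, is_gradient U u v.

(* The trace operator H^1(exterior A) -> L^2(boundary A) is the continuous
   extension of the restriction to the boundary from the dense subspace of
   (restrictions to the exterior of) smooth compactly supported functions on
   the plane. *)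
Definition is_trace (A : set plane) (u g : plane -> R) : Prop :=
  L2 hausdorff1 (boundary A) g /\
  exists f : (plane -> R)^nat,
    [/\ forall n, test_function setT (f n),
        (\int[leb2]_(x in exterior A) ((f n x - u x) ^+ 2)%:E
          @[n --> \oo] --> 0)%E,
        (\int[leb2]_(x in exterior A)
            (('D_e1 (f n) x - (grad (exterior A) u x).1) ^+ 2 +
             ('D_e2 (f n) x - (grad (exterior A) u x).2) ^+ 2)%:E
          @[n --> \oo] --> 0)%E &
        (\int[hausdorff1]_(x in boundary A) ((f n x - g x) ^+ 2)%:E
          @[n --> \oo] --> 0)%E].

Definition trace (A : set plane) (u : plane -> R) : plane -> R :=
  xget (fun=> 0) [set g | is_trace A u g].

End SobolevSpace.

Section RobinForm.
Context {R : realType}.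
Local Notation plane := (R * R)%type.
Local Notation C := (complex R).

Definition re (u : plane -> C) : plane -> R := fun x => complex.Re (u x).
Definition im (u : plane -> C) : plane -> R := fun x => complex.Im (u x).

(* The complex space H^1(U). *)
Definition H1 (U : set plane) (u : plane -> C) : Prop :=
  H1r U (re u) /\ H1r U (im u).

(* For a complex-valued u, each of the three integrals below is the sum of
   those of its real and imaginary parts, since the gradient and the trace act
   on these parts separately. *)
Definition dirichlet_sq (A : set plane) (u : plane -> C) : R :=
  let U := exterior A in
  fine (\int[leb2]_(x in U)
    ((grad U (re u) x).1 ^+ 2 + (grad U (re u) x).2 ^+ 2 +
     (grad U (im u) x).1 ^+ 2 + (grad U (im u) x).2 ^+ 2)%:E)%E.

Definition boundary_sq (A : set plane) (u : plane -> C) : R :=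
  fine (\int[hausdorff1]_(x in boundary A)
    (trace A (re u) x ^+ 2 + trace A (im u) x ^+ 2)%:E)%E.

Definition norm_sq (A : set plane) (u : plane -> C) : R :=
  fine (\int[leb2]_(x in exterior A) (re u x ^+ 2 + im u x ^+ 2)%:E)%E.

Definition rayleigh (alpha : R) (A : set plane) (u : plane -> C) : R :=
  (dirichlet_sq A u + alpha * boundary_sq A u) / norm_sq A u.

Definition lincomb (c : C * C) (u : (plane -> C) * (plane -> C)) : plane -> C :=
  fun x => c.1 * u.1 x + c.2 * u.2 x.

(* u.1, u.2 is a basis of a two-dimensional subspace of H^1(U), whose elements
   are classes of functions modulo almost everywhere equality on U. *)
Definition H1_pair (U : set plane) (u : (plane -> C) * (plane -> C)) : Prop :=
  [/\ H1 U u.1, H1 U u.2 &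
    forall c : C * C,
      {ae leb2, forall x, U x -> lincomb c u x = 0} -> c = 0].

(* lambda_2^alpha of the exterior of A *)
Definition lambda2 (alpha : R) (A : set plane) : \bar R :=
  ereal_inf [set ereal_sup [set (rayleigh alpha A (lincomb c u))%:E |
                             c in [set c : C * C | c != 0]] |
             u in [set u | H1_pair (exterior A) u]].

(* a is the critical coupling constant alpha_star of the exterior of A; there
   is at most one such a. *)
Definition critical_coupling (A : set plane) (a : R) : Prop :=
  a <= 0 /\
  forall alpha, alpha < 0 -> ((lambda2 alpha A < 0)%E <-> alpha < a).

End RobinForm.

(* Main.v *)
(* Let al = - alpha > 1/r.  The function phi = K_1 (k .), with k > 0 chosen so
   that q = - phi' / phi equals al at r, yields the eigenvalue - k^2 of the
   exterior of the disk, with eigenfunctions phi(s) cos t and phi(s) sin t.  By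
   the ground state representation in each angular mode and Wirtinger's
   inequality on circles, the form is at least - k^2 on the functions whose
   trace has mean 0, and any two-dimensional space contains such a function;
   hence lambda_2 of the disk is at least - k^2.

   For Omega the trial functions are (cut-offs at infinity of) phi(s) and one of
   phi(s) cos t, phi(s) sin t; they are of opposite parities, so that central
   symmetry makes them orthogonal for both the form and the L^2 product.  On
   each ray, s (psi'^2 + (k^2 + s^-2) psi^2) = s phi^2 chi'^2 + (s phi phi' chi^2)'
   for psi = phi chi; the boundary measure is at least rho dt and q < al beyond
   r, so the form plus k^2 is negative on phi(s), and on the sum of the two other
   trial functions since cos^2 + sin^2 = 1.  Therefore lambda_2 < - k^2.

   The critical constant is the supremum of the alpha < 0 with lambda_2 < 0; this
   set is open because of the trace inequality. *)

(* Two definitions shape the proof. [trace] returns the zero function when no trace exists, and this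
   case is treated rather than excluded: the upper bound evaluates test functions, and in the lower
   bound a function without trace has a form without boundary term, hence nonnegative. The measure
   [hausdorff1] is defined by coverings; it is compared with [dt] from both sides, being at least
   [rho dt] and at most [sqrt (L ^ 2 + M ^ 2) dt] for a radius [rho <= M] with Lipschitz constant
   [L]. On a circle the two bounds coincide and give exact boundary integrals.

   The function [K_1] is built in the variable [y = (k r / 2) ^ 2], where the equation becomes
   [y F'' = F]: a power series gives the growing solution, reduction of order the decaying one. The
   rate [k] is found from a Riccati equation, and [al > 1 / r] is what makes the prescribed slope
   attainable.

   The lower bound is first proved for test functions of arbitrary boundary mean, with a defect
   proportional to the square of that mean, because test functions approximating a function of mean
   zero need not have mean zero themselves. *)
Require Import Defs.
From HB Require Import structures.
From mathcomp Require Import all_boot all_order all_algebra.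
From mathcomp Require Import complex ring lra.
From mathcomp Require Import all_classical all_reals all_analysis.
From mathcomp Require Import measurable_realfun.

Set Implicit Arguments.
Unset Strict Implicit.
Unset Printing Implicit Defensive.

Import Order.TTheory GRing.Theory Num.Theory.
Import numFieldNormedType.Exports.

Local Open Scope classical_set_scope.
Local Open Scope ring_scope.

(** * Pointwise derivatives and continuity *)

Section pointwise_derivatives.
Context {R : realType}.

Section directional.
Context {V : normedModType R}.
Implicit Types (f g : V -> R) (x v : V).

Lemma dcst (c : R) x v : is_derive x v (fun _ : V => c) 0.
Proof. exact: is_derive_cst. Qed.

Lemma dadd f g x v a b : is_derive x v f a -> is_derive x v g b ->
  is_derive x v (fun y => f y + g y) (a + b).
Proof. exact: is_deriveD. Qed.

Lemma dsub f g x v a b : is_derive x v f a -> is_derive x v g b ->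
  is_derive x v (fun y => f y - g y) (a - b).
Proof. exact: is_deriveB. Qed.

Lemma dopp f x v a : is_derive x v f a -> is_derive x v (fun y => - f y) (- a).
Proof. exact: is_deriveN. Qed.

Lemma dmul f g x v a b : is_derive x v f a -> is_derive x v g b ->
  is_derive x v (fun y => f y * g y) (a * g x + f x * b).
Proof.
move=> fa gb; apply: (is_derive_eq (is_deriveM fa gb)).
by rewrite /GRing.scale/=; ring.
Qed.

Lemma dexp f x v a n : is_derive x v f a ->
  is_derive x v (fun y => f y ^+ n) (n%:R * f x ^+ n.-1 * a).
Proof.
move=> fa; have h := @is_deriveX _ _ f n x v a fa.
rewrite (_ : (fun y => _) = f ^+ n); last by apply/funext => y; rewrite exprfctE.
exact: (is_derive_eq h).
Qed.

(** Directional derivatives on a normed space become derivatives on the line, where the chain rule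
    for composition is available. *)
Lemma derive_ray f x v a :
  is_derive x v f a <-> is_derive (0 : R) 1 (fun t : R => f (t *: v + x)) a.
Proof.
have E : (fun h : R => h^-1 *: ((f \o shift x) (h *: v) - f x)) =
    (fun h : R => h^-1 *: (((fun t : R => f (t *: v + x)) \o shift 0) (h *: 1)
       - (fun t : R => f (t *: v + x)) 0)).
  by apply/funext => h /=; rewrite addr0 scale0r add0r /GRing.scale/= mulr1.
have dE : derivable f x v = derivable (fun t : R => f (t *: v + x)) 0 1.
  by rewrite /derivable E.
have DE : 'D_v f x = 'D_1 (fun t : R => f (t *: v + x)) 0 by rewrite /derive E.
split => -[d <-]; apply: DeriveDef.
- by rewrite -dE.
- by rewrite -DE.
- by rewrite dE.
- by rewrite DE.
Qed.
End directional.

Lemma dcomp1 (f h : R -> R) (x a b : R) : is_derive x 1 f a -> is_derive (f x) 1 h b ->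
  is_derive x 1 (fun y => h (f y)) (b * a).
Proof. by move=> fa hb; exact: (@is_derive1_comp R h f x b a hb fa). Qed.

Lemma dcomp (V : normedModType R) (f : V -> R) (h : R -> R) (x v : V) a b :
  is_derive x v f a -> is_derive (f x) 1 h b -> is_derive x v (fun y => h (f y)) (b * a).
Proof.
move=> /derive_ray fa hb; apply/derive_ray.
apply: (@dcomp1 (fun t => f (t *: v + x)) h 0 a b fa).
by rewrite scale0r add0r.
Qed.

Lemma dinv (V : normedModType R) (f : V -> R) (x v : V) a : f x != 0 ->
  is_derive x v f a -> is_derive x v (fun y => (f y)^-1) (- (f x ^- 2) * a).
Proof.
move=> f0 [df <-]; split; last by rewrite deriveV.
exact: derivableV.
Qed.

Lemma ddiv (V : normedModType R) (f g : V -> R) (x v : V) a b : g x != 0 ->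
  is_derive x v f a -> is_derive x v g b ->
  is_derive x v (fun y => f y / g y) ((a * g x - f x * b) / g x ^+ 2).
Proof.
move=> g0 fa gb; apply: (is_derive_eq (dmul fa (dinv g0 gb))).
by field.
Qed.

Lemma is_derive_continuous (f : R -> R) (x a : R) : is_derive x 1 f a -> {for x, continuous f}.
Proof. by move=> [d _]; exact/differentiable_continuous/derivable1_diffP. Qed.

Lemma dexpR (V : normedModType R) (f : V -> R) (x v : V) a :
  is_derive x v f a -> is_derive x v (fun y => expR (f y)) (expR (f x) * a).
Proof. by move=> fa; apply: (dcomp fa); exact: is_derive_expR. Qed.

End pointwise_derivatives.

(** Syntax-directed differentiation. In [der] the rules synthesise the derivative as an existential
    variable, and the equality with the expected value is left as a goal. The patterns on partial
    applications such as [GRing.mul ?c] catch functions that have been eta-reduced. *)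
Ltac dstep := first [ exact: dcst | exact: is_derive_id | exact: is_derive_sin | exact: is_derive_cos | eassumption |
  lazymatch goal with
  | |- is_derive _ _ (fun y => (@?f y - @?g y)%R) _ => eapply dsub
  | |- is_derive _ _ (fun y => (@?f y + @?g y)%R) _ => eapply dadd
  | |- is_derive _ _ (fun y => (- @?f y)%R) _ => eapply dopp
  | |- is_derive _ _ (fun y => (@?f y / @?g y)%R) _ => eapply ddiv
  | |- is_derive _ _ (fun y => ((@?f y)^-1)%R) _ => eapply dinv
  | |- is_derive _ _ (fun y => (@?f y * @?g y)%R) _ => eapply dmul
  | |- is_derive _ _ (fun y => (@?f y ^+ _)%R) _ => eapply dexp
  | |- is_derive _ _ (GRing.mul ?c) _ => eapply (dmul (f := fun=> c) (g := id))
  | |- is_derive _ _ (GRing.add ?c) _ => eapply (dadd (f := fun=> c) (g := id))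
  | |- is_derive _ _ GRing.opp _ => eapply (dopp (f := id))
  | |- is_derive _ _ GRing.inv _ => eapply (dinv (f := id))
  | |- is_derive _ _ (fun y => expR (@?f y)) _ => eapply dexpR
  | |- is_derive _ _ (fun y => sin (@?f y)) _ => eapply (dcomp (h := sin)); [|exact: is_derive_sin]
  | |- is_derive _ _ (fun y => cos (@?f y)) _ => eapply (dcomp (h := cos)); [|exact: is_derive_cos]
  end ].
Ltac der := eapply is_derive_eq; [repeat dstep|rewrite ?/=].

Ltac dcont := eapply is_derive_continuous; repeat dstep.

(** * Monotonicity from the sign of the derivative, and bounds for the sine *)

Section monotone.
Context {R : realType}.
Implicit Types (f df : R -> R) (a b x : R).

Lemma within_continuous_derive f df a b :
  (forall x, a <= x <= b -> is_derive x 1 f (df x)) -> {within `[a, b], continuous f}.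
Proof.
move=> h; apply: continuous_in_subspaceT => x; rewrite inE/= in_itv/=.
by move=> /h/is_derive_continuous.
Qed.

Lemma derive_ge0_le f df a b : a <= b ->
  (forall x, a <= x <= b -> is_derive x 1 f (df x)) ->
  (forall x, a < x < b -> 0 <= df x) -> f a <= f b.
Proof.
move=> ab hf df0.
apply: (@ger0_derive1_le_cc R f a b) => //.
- move=> x; rewrite in_itv/= => /andP[ax xb].
  have axb : a <= x <= b by rewrite !ltW.
  by have [] := hf x axb.
- move=> x; rewrite in_itv/= => axb; rewrite derive1E.
  have axb' : a <= x <= b by move: axb => /andP[? ?]; rewrite !ltW.
  by have [_ ->] := hf x axb'; exact: df0.
- exact: within_continuous_derive hf.
- by rewrite in_itv/= lexx.
- by rewrite in_itv/= lexx andbT.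
Qed.

Lemma derive_le0_ge f df a b : a <= b ->
  (forall x, a <= x <= b -> is_derive x 1 f (df x)) ->
  (forall x, a < x < b -> df x <= 0) -> f b <= f a.
Proof.
move=> ab hf df0; rewrite -lerN2.
apply: (@derive_ge0_le (fun x => - f x) (fun x => - df x)) => // x.
  by move=> /hf ?; exact: dopp.
by move=> /df0; rewrite oppr_ge0.
Qed.

Lemma sin_le_id x : 0 <= x -> sin x <= x.
Proof.
move=> x0; rewrite -subr_ge0.
have d (y : R) : 0 <= y <= x -> is_derive y 1 (fun x : R => x - sin x) (1 - cos y).
  by move=> _; der.
have := derive_ge0_le x0 d; rewrite sin0 subr0; apply => y _.
by rewrite subr_ge0 cos_le1.
Qed.

Lemma sin_ge_quad x : 0 <= x -> x - x ^+ 2 <= sin x.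
Proof.
move=> x0; rewrite -subr_ge0.
have h1 (y : R) : 0 <= y -> 0 <= cos y - 1 + 2 * y.
  move=> y0.
  have d (z : R) : 0 <= z <= y -> is_derive z 1 (fun x : R => cos x - 1 + 2 * x) (- sin z + 2).
    by move=> _; der; ring.
  have := derive_ge0_le y0 d; rewrite cos0 subrr mulr0 addr0; apply => z _.
  by have := sin_le1 z; lra.
have d (z : R) : 0 <= z <= x -> is_derive z 1 (fun x : R => sin x - (x - x ^+ 2)) (cos z - 1 + 2 * z).
  by move=> _; der; ring.
have := derive_ge0_le x0 d; rewrite sin0 expr2 mul0r !subr0; apply => y /andP[y0 _].
by apply: h1; exact: ltW.
Qed.

(** A crude slope is enough, since it only serves to bound an angle by a multiple of the chord. The
    quadratic bound yields it up to [1/2], and monotonicity of the sine together with [pi / 2 < 2]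
    beyond. *)
Lemma sin_ge_lin x : 0 <= x <= pi / 2 -> x / 8 <= sin x.
Proof.
move=> /andP[x0 xp].
have [x1|x1] := leP x (1/2).
  by apply: (le_trans _ (sin_ge_quad x0)); nra.
have h : sin (1/2 : R) <= sin x.
  apply: ltW; rewrite ltr_sin// in_itv/=; have := pihalf_ge1 R => p1; apply/andP; split; lra.
apply: (le_trans _ h); apply: (@le_trans _ _ (1/2 - (1/2)^+2)); last by apply: sin_ge_quad; lra.
by have := pihalf_lt2 R; nra.
Qed.

End monotone.

Section pointwise_continuity.
Context {R : realType} {T : topologicalType}.
Implicit Types (f g : T -> R) (x : T).

Lemma ccst (c : R) x : {for x, continuous (fun _ : T => c)}.
Proof. exact: cst_continuous. Qed.

Lemma cadd f g x : {for x, continuous f} -> {for x, continuous g} ->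
  {for x, continuous (fun y => f y + g y)}.
Proof. by move=> cf cg; exact: continuousD. Qed.

Lemma copp f x : {for x, continuous f} -> {for x, continuous (fun y => - f y)}.
Proof. by move=> cf; exact: continuousN. Qed.

Lemma cmul f g x : {for x, continuous f} -> {for x, continuous g} ->
  {for x, continuous (fun y => f y * g y)}.
Proof. by move=> cf cg; exact: continuousM. Qed.

Lemma cexp f n x : {for x, continuous f} -> {for x, continuous (fun y => f y ^+ n)}.
Proof.
move=> cf; elim: n => [|n IH]; first exact: ccst.
rewrite (_ : (fun y => _) = (fun y => f y * f y ^+ n)); last by apply/funext => y; rewrite exprS.
exact: cmul.
Qed.

Lemma cinv f x : f x != 0 -> {for x, continuous f} -> {for x, continuous (fun y => (f y)^-1)}.
Proof. by move=> fx cf; exact: continuousV. Qed.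

Lemma ccomp f (h : R -> R) x : {for x, continuous f} -> {for f x, continuous h} ->
  {for x, continuous (fun y => h (f y))}.
Proof. by move=> cf ch; exact: continuous_comp. Qed.

End pointwise_continuity.

Ltac cstep := first [ assumption | exact: ccst | exact: cvg_id
  | (lazymatch goal with H : continuous ?f |- {for _, continuous ?f} => exact: H end)
  | lazymatch goal with
  | |- {for _, continuous (fun y => (@?f y + @?g y)%R)} => refine (@cadd _ _ f g _ _ _)
  | |- {for _, continuous (fun y => (- @?f y)%R)} => refine (@copp _ _ f _ _)
  | |- {for _, continuous (fun y => (@?f y * @?g y)%R)} => refine (@cmul _ _ f g _ _ _)
  | |- {for _, continuous (fun y => ((@?f y)^-1)%R)} => refine (@cinv _ _ f _ _ _)
  | |- {for _, continuous (fun y => (@?f y ^+ _)%R)} => refine (@cexp _ _ f _ _ _)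
  | |- {for _, continuous (GRing.mul ?c)} => refine (cmul (f := fun=> c) (g := id) _ _)
  | |- {for _, continuous (GRing.add ?c)} => refine (cadd (f := fun=> c) (g := id) _ _)
  | |- {for _, continuous GRing.inv} => refine (@cinv _ _ id _ _ _)
  | |- {for _, continuous GRing.opp} => refine (copp (f := id) _)
  | |- {for _, continuous sin} => exact: continuous_sin
  | |- {for _, continuous cos} => exact: continuous_cos
  | |- {for _, continuous expR} => exact: continuous_expR
  | |- {for _, continuous fst} => exact: cvg_fst
  | |- {for _, continuous snd} => exact: cvg_snd
  | |- {for _, continuous (fun y => y.1)} => exact: cvg_fst
  | |- {for _, continuous (fun y => y.2)} => exact: cvg_snd
  | |- {for _, continuous (fun y => expR (@?f y))} => refine (ccomp (f := f) (h := expR) _ _); [|exact: continuous_expR]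
  | |- {for _, continuous (fun y => sin (@?f y))} => refine (ccomp (f := f) (h := sin) _ _); [|exact: continuous_sin]
  | |- {for _, continuous (fun y => cos (@?f y))} => refine (ccomp (f := f) (h := cos) _ _); [|exact: continuous_cos]
  | H : continuous ?h |- {for _, continuous (fun y => ?h (@?f y))} => refine (ccomp (f := f) (h := h) _ _); [|exact: H]
  end ].
Ltac cont := repeat cstep; rewrite /=.

(** * Borel measurability in the plane *)

Section plane_measurability.
Context {R : realType}.
Local Notation plane := (R * R)%type.
Local Notation mplane := (measurableTypeR R * measurableTypeR R)%type.

Lemma measurable_invr : measurable_fun [set: R] (@GRing.inv R).
Proof.
rewrite -(setvU [set (0 : R)]); apply/measurable_funU => //; first exact: measurableC.
split; last exact: measurable_fun_set1.
apply: open_continuous_measurable_fun.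
  by apply: closed_openC; exact: closed_eq.
by move=> x; rewrite inE/= => /eqP x0; exact: inv_continuous.
Qed.

Lemma measurable_div d (T : measurableType d) (D : set T) (f g : T -> R) : measurable_fun D f -> measurable_fun D g ->
  measurable_fun D (fun x => f x / g x).
Proof.
move=> mf mg; apply: measurable_funM => //.
exact: (measurableT_comp measurable_invr).
Qed.

Lemma measurable_sin : measurable_fun [set: R] (@sin R).
Proof. by apply: continuous_measurable_fun; exact: continuous_sin. Qed.

Lemma measurable_cos : measurable_fun [set: R] (@cos R).
Proof. by apply: continuous_measurable_fun; exact: continuous_cos. Qed.

(** The sigma-algebra of [mplane] is the product one, generated by rectangles; an open set is the
    countable union of the rational open rectangles contained in it. *)
Lemma open_measurable_plane (U : set plane) : open U -> measurable (U : set mplane).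
Proof.
move=> oU.
pose Q (p : (rat * rat) * (rat * rat)) : set mplane :=
  `]ratr p.1.1, ratr p.1.2[ `*` `]ratr p.2.1, ratr p.2.2[.
have mQ p : measurable (Q p) by apply: measurableX; exact: measurable_itv.
have -> : U = \bigcup_(p in [set p | Q p `<=` U]) Q p.
  apply/seteqP; split => [x Ux|x [p /= pU]]; last exact: pU.
  have /nbhs_ballP[e /= e0 eU] : nbhs x U by exact: open_nbhs_nbhs.
  have h1 (y : R) : exists q : rat, y - e < ratr q < y.
    have /rat_in_itvoo[q] : y - e < y by rewrite gtrBl.
    by rewrite in_itv/= => ?; exists q.
  have h2 (y : R) : exists q : rat, y < ratr q < y + e.
    have /rat_in_itvoo[q] : y < y + e by rewrite ltrDl.
    by rewrite in_itv/= => ?; exists q.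
  have [a /andP[a1 a2]] := h1 x.1; have [b /andP[b1 b2]] := h2 x.1.
  have [c /andP[c1 c2]] := h1 x.2; have [d /andP[d1 d2]] := h2 x.2.
  exists ((a, b), (c, d)) => /=; last by split; rewrite /= in_itv/= ?a2 ?c2.
  move=> y [/=]; rewrite !in_itv/= => /andP[y1 y2] /andP[y3 y4].
  by apply: eU; split; rewrite /ball/= ltr_norml; apply/andP; split; lra.
rewrite bigcup_mkcond; apply: countable_bigcupT_measurable => // p.
by case: ifPn.
Qed.

Lemma closed_measurable_plane (U : set plane) : closed U -> measurable (U : set mplane).
Proof.
move=> cU; rewrite -(setCK U); apply: measurableC; apply: open_measurable_plane.
exact: closed_openC.
Qed.

Lemma continuous_measurable_plane (f : plane -> R) : continuous f ->
  measurable_fun setT (f : mplane -> R).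
Proof.
move=> /continuousP cf; apply: (measurability _ (RGenOpens.measurableE R)).
move=> _ [_ [a [b ->] <-]]; rewrite setTI; apply: open_measurable_plane.
exact/cf/interval_open.
Qed.

End plane_measurability.

(** * Lebesgue measure of the plane in polar coordinates *)

Section density_pushforward.
Local Open Scope ereal_scope.
Context d1 d2 (Z : measurableType d1) (T : measurableType d2) (R : realType).
Variables (nu : {measure set Z -> \bar R}) (D : set Z) (phi : Z -> T) (g : Z -> R).
Hypotheses (mD : measurable D) (mphi : measurable_fun D phi) (mg : measurable_fun D g).
Hypothesis g0 : forall z, D z -> (0 <= g z)%R.

Let dfun (A : set T) (z : Z) : \bar R := (\1_A (phi z))%:E * (g z)%:E.
(** The image under [phi] of the measure with density [g] with respect to [nu] on [D]. *)
Definition dpush (A : set T) : \bar R := \int[nu]_(z in D) dfun A z.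

Let dfun_ge0 A z : D z -> 0 <= dfun A z.
Proof. by move=> Dz; rewrite mule_ge0// lee_fin ?g0. Qed.

Let measurable_dfun (A : set T) : measurable A -> measurable_fun D (dfun A).
Proof.
move=> mA; apply: emeasurable_funM; last exact/measurable_EFinP.
apply/measurable_EFinP; have mI : measurable_fun setT (\1_A : T -> R) by exact: measurable_indic.
by apply: (measurable_comp measurableT _ mI mphi).
Qed.

Let dpush0 : dpush set0 = 0.
Proof. by rewrite /dpush integral0_eq// => z _; rewrite /dfun indic0 mul0e. Qed.

Let dpush_ge0 A : 0 <= dpush A.
Proof. by apply: integral_ge0 => z; exact: dfun_ge0. Qed.

Let dpush_sigma_additive : semi_sigma_additive dpush.
Proof.
move=> F mF tF mUF.
rewrite [X in _ --> X](_ : _ = \sum_(n <oo) dpush (F n)).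
  by apply: is_cvg_nneseries => n _ _; exact: dpush_ge0.
rewrite /dpush -integral_nneseries//.
- apply: eq_integral => z /[!inE] Dz; rewrite /dfun.
  under [RHS]eq_eseriesr do rewrite muleC.
  rewrite nneseriesZl//.
  rewrite muleC.
  congr (_ * _); have := @measure_semi_bigcup _ R T (\d_(phi z)) F mF tF mUF.
  by rewrite /= diracE => <-; rewrite indicE.
- by move=> n; exact: measurable_dfun.
- by move=> n z Dz; exact: dfun_ge0.
Qed.

HB.instance Definition _ := isMeasure.Build _ _ _ dpush dpush0 dpush_ge0 dpush_sigma_additive.

Definition dpush_measure : {measure set T -> \bar R} := dpush.

Import HBNNSimple.
(** Monotone convergence along simple functions reduces both sides to level sets, where the identity
    is the definition of [dpush]. *)
Lemma ge0_integral_dpush (f : T -> \bar R) : measurable_fun setT f ->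
  (forall x, 0 <= f x) ->
  \int[dpush_measure]_x f x = \int[nu]_(z in D) (f (phi z) * (g z)%:E).
Proof.
rewrite /dpush_measure.
move=> mf f0.
pose f_ := nnsfun_approx measurableT mf.
have mfphi (n : nat) : measurable_fun D (fun z => f_ n (phi z)).
  by apply: (measurable_comp measurableT) => //; exact: measurable_funP.
transitivity (limn (fun n => \int[dpush]_x (f_ n x)%:E)).
  rewrite -monotone_convergence//.
  - apply: eq_integral => y _; apply/esym/cvg_lim => //.
    by apply: cvg_nnsfun_approx.
  - by move=> n; exact/measurable_EFinP/measurable_funP.
  - by move=> n y _; rewrite lee_fin.
  - by move=> y _ m n mn; rewrite lee_fin; exact/lefP/nd_nnsfun_approx.
transitivity (limn (fun n => \int[nu]_(z in D) ((f_ n (phi z))%:E * (g z)%:E))); last first.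
  rewrite -monotone_convergence//.
  - apply: eq_integral => z /[!inE] Dz; apply/cvg_lim => //.
    apply: cvgeZr => //.
    by apply: cvg_nnsfun_approx.
  - by move=> n; apply: emeasurable_funM; apply/measurable_EFinP.
  - by move=> n z Dz; rewrite mule_ge0// lee_fin// g0.
  - by move=> z Dz m n mn; rewrite lee_wpmul2r// ?lee_fin ?g0//; exact/lefP/nd_nnsfun_approx.
congr (limn _); apply/funext => n.
transitivity (\sum_(k \in range (f_ n))
    \int[dpush]_x (k * \1_(f_ n @^-1` [set k]) x)%:E).
  under eq_integral do rewrite fimfunE -fsumEFin//.
  rewrite ge0_integral_fsum//.
  - by move=> y; exact/measurable_EFinP/measurable_funM.
  - by move=> y x _; rewrite nnfun_muleindic_ge0.
transitivity (\int[nu]_(z in D) \sum_(k \in range (f_ n)) 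
   ((k * \1_(f_ n @^-1` [set k]) (phi z))%:E * (g z)%:E)); last first.
  apply: eq_integral => z _; rewrite [in RHS]fimfunE -fsumEFin// ge0_mule_fsuml//.
  by move=> k; rewrite nnfun_muleindic_ge0.
rewrite ge0_integral_fsum//; last 2 first.
- move=> k; apply: emeasurable_funM; apply/measurable_EFinP => //.
  have mk : measurable_fun setT (fun x => k * \1_(f_ n @^-1` [set k]) x)%R by exact: measurable_funM.
  exact: (measurable_comp measurableT _ mk mphi).
- by move=> k z Dz; rewrite mule_ge0// ?nnfun_muleindic_ge0// lee_fin g0.
apply: eq_fsbigr => k; rewrite inE => -[x _ <-{k}].
rewrite (integralZl_indic _ (fun k => f_ n @^-1` [set k]))//; last by move=> k0; rewrite preimage_nnfun0.
rewrite integral_indic// setIT.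
rewrite -[X in _ * X]/(\int[nu]_(z in D) dfun (f_ n @^-1` [set f_ n x]) z).
rewrite -ge0_integralZl_EFin//.
- by apply: eq_integral => z _; rewrite /dfun EFinM muleA.
- by move=> z; exact: dfun_ge0.
- by apply: measurable_dfun.
Qed.

End density_pushforward.

(** * Fundamental theorem of calculus and one-dimensional substitutions *)

Section ftc.
Context (R : realType).
Notation mu := (@lebesgue_measure R).

Lemma ftc_itv (F f : R -> R) (a b : R) : a <= b ->
  (forall x, a <= x <= b -> is_derive x 1 F (f x)) ->
  {within `[a, b], continuous f} ->
  (\int[mu]_(x in `[a, b]) (f x)%:E = (F b - F a)%:E)%E.
Proof.
rewrite le_eqVlt => /predU1P[<- _ _|ab dF cf].
  by rewrite set_itv1 integral_set1 subrr.
have cF x : a <= x <= b -> {for x, continuous F}.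
  by move=> /dF [dFx _]; exact/differentiable_continuous/derivable1_diffP.
rewrite (@continuous_FTC2 _ f F a b ab cf)//.
- split.
  + move=> x; rewrite in_itv/= => /andP[ax xb].
    by have [] : is_derive x 1 F (f x) by apply: dF; rewrite (ltW ax) (ltW xb).
  + by apply: cvg_at_right_filter; apply: cF; rewrite lexx ltW.
  + by apply: cvg_at_left_filter; apply: cF; rewrite lexx ltW.
- move=> x; rewrite in_itv/= => /andP[ax xb].
  by rewrite derive1E; have [] : is_derive x 1 F (f x) by apply: dF; rewrite (ltW ax) (ltW xb).
Qed.

End ftc.

Section substitution_affine_cot.
Local Open Scope ereal_scope.
Context (R : realType).
Notation mu := (@lebesgue_measure R).

(** Lebesgue measure is determined by its values on half-open intervals, so the image under [phi] of
    the measure with density [g] has to be computed on these intervals only. *)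
Lemma ge0_integral_subst (D : set (measurableTypeR R)) (phi g : measurableTypeR R -> R)
  (f : R -> \bar R) : measurable D -> measurable_fun D phi -> measurable_fun D g ->
  (forall z, D z -> (0 <= g z)%R) ->
  (forall a b, (a < b)%R -> \int[mu]_(z in D `&` phi @^-1` `]a, b]) (g z)%:E = (b - a)%:E) ->
  measurable_fun setT f -> (forall x, 0 <= f x) ->
  \int[mu]_x f x = \int[mu]_(z in D) (f (phi z) * (g z)%:E).
Proof.
move=> mD mphi mg g0 H mf f0.
rewrite -(@ge0_integral_dpush _ _ _ (measurableTypeR R) R mu D phi g mD mphi mg g0 f mf f0).
apply: eq_measure_integral => A mA _; apply: lebesgue_measure_unique => // X.
move=> /ocitvP[->|[[a b] /= ab ->]].
  by rewrite !measure0.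
rewrite lebesgue_measure_itv/= lte_fin ab -EFinD -H//.
rewrite [RHS]/(dpush _ _ _ _ _) integral_mkcondr.
apply: eq_integral => z _; rewrite patchE indicE.
have -> : (z \in phi @^-1` `]a, b]) = (phi z \in `]a, b]%classic).
  by apply/idP/idP; rewrite !inE.
by case: ifPn; rewrite ?mul1e ?mul0e.
Qed.

Lemma ge0_integral_affine (a b : R) (f : R -> \bar R) : (0 < a)%R ->
  measurable_fun setT f -> (forall x, 0 <= f x) ->
  \int[mu]_x f x = \int[mu]_x (f (a * x + b)%R * a%:E).
Proof.
move=> a0 mf f0; apply: (@ge0_integral_subst setT (fun x => a * x + b)%R (cst a)) => //.
- by apply: measurable_funD => //; exact: measurable_funM.
- by move=> z _; exact: ltW.
move=> c d cd; rewrite setTI.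
have -> : (fun x => a * x + b)%R @^-1` `]c, d] = `] ((c - b) / a)%R, ((d - b) / a)%R]%classic.
  apply/seteqP; split => x /=; rewrite !in_itv/=;
  by rewrite ltr_pdivrMr// ler_pdivlMr// (mulrC x) ltrBlDr lerBrDr.
rewrite -[LHS]/(integral mu _ (cst a%:E)) integral_cst//= lebesgue_measure_itv/= lte_fin.
rewrite ltr_pM2r ?invr_gt0// ltrD2r cd -EFinD -EFinM; congr EFin.
by field; rewrite gt_eqF.
Qed.

Lemma ge0_integral_opp (f : R -> \bar R) :
  measurable_fun setT f -> (forall x, 0 <= f x) ->
  \int[mu]_x f x = \int[mu]_x f (- x)%R.
Proof.
move=> mf f0; rewrite (@ge0_integral_subst setT (fun x => - x)%R (cst 1%R) f)//.
- by apply: eq_integral => x _; rewrite mule1.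
- exact: oppr_measurable.
move=> c d cd; rewrite setTI.
have -> : (fun x => - x)%R @^-1` `]c, d] = `[(- d)%R, (- c)%R[%classic.
  by apply/seteqP; split => x /=; rewrite !in_itv/= lerNl ltrNr andbC.
rewrite -[LHS]/(integral mu _ (cst 1%:E)) integral_cst//= lebesgue_measure_itv/= lte_fin.
by rewrite ltrN2 cd -EFinD mul1e opprK addrC.
Qed.

(** The substitution [x = - cot t], increasing from []0, pi[] onto the line with inverse
    [atan x + pi / 2]; it replaces the abscissa on a horizontal line by the polar angle. *)
Lemma ge0_integral_tan_shift (f : R -> \bar R) :
  measurable_fun setT f -> (forall x, 0 <= f x) ->
  \int[mu]_x f x = \int[mu]_(t in `]0%R, pi[) (f (- (cos t / sin t))%R * (sin t ^- 2)%:E).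
Proof.
move=> mf f0.
have st0 (t : R) : t \in `]0%R, pi[ -> (0 < sin t)%R by rewrite in_itv/= => ?; exact: sin_gt0_pi.
have dct (t : R) : t \in `]0%R, pi[ -> is_derive t 1%R (fun t => - (cos t / sin t))%R (sin t ^- 2).
  move=> /st0 st; have sn0 : sin t != 0%R by rewrite gt_eqF.
  by der => //; rewrite -[RHS]mul1r -(cos2Dsin2 t); field.
have cct (t : R) : t \in `]0%R, pi[ -> {for t, continuous (fun t => - (cos t / sin t))%R}.
  by move=> /dct/is_derive_continuous.
have cst2 (t : R) : t \in `]0%R, pi[ -> {for t, continuous (fun t : R => sin t ^- 2)%R}.
  by move=> /st0 st; dcont; rewrite expf_neq0// gt_eqF.
have msin : measurable_fun `]0%R, pi[ (fun t : R => sin t ^- 2)%R.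
  apply: open_continuous_measurable_fun; first exact: interval_open.
  by move=> x; rewrite inE; exact: cst2.
apply: (@ge0_integral_subst `]0%R, pi[ (fun t => - (cos t / sin t))%R (fun t => sin t ^- 2)%R) => //.
- apply: open_continuous_measurable_fun; first exact: interval_open.
  by move=> x; rewrite inE; exact: cct.
- by move=> z _; rewrite invr_ge0 exprn_even_ge0.
move=> a b ab.
pose T (c : R) := (atan c + pi / 2)%R.
have T0 c : T c \in `]0%R, pi[.
  rewrite in_itv/= /T; have := atan_gtNpi2 c; have := atan_ltpi2 c => h1 h2.
  by apply/andP; split; lra.
have TK (t : R) : t \in `]0%R, pi[ -> T (- (cos t / sin t))%R = t.
  rewrite in_itv/= => /andP[t0 tp]; rewrite /T.
  have -> : (- (cos t / sin t) = tan (t - pi/2))%R by rewrite /tan sinBpihalf cosBpihalf mulNr.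
  by rewrite tanK ?subrK// in_itv/=; apply/andP; split; lra.
have KT c : (- (cos (T c) / sin (T c)) = c)%R.
  by rewrite /T cosDpihalf sinDpihalf mulNr opprK -/(tan _) atanK.
have Tlt : {mono T : x y / (x <= y)%R}.
  by apply: le_mono => x y xy; rewrite /T ltrD2r lt_atan.
have -> : `]0%R, pi[ `&` (fun t => - (cos t / sin t))%R @^-1` `]a, b] = `]T a, T b]%classic.
  apply/seteqP; split => [t /= [t0]|t /=].
    rewrite !in_itv/=; move: (TK t t0); set c := (- _)%R => Tc.
    by rewrite -Tc (leW_mono Tlt) Tlt.
  rewrite in_itv/= => /andP[at_ tb].
  have t0 : t \in `]0%R, pi[.
    move: (T0 a) (T0 b); rewrite !in_itv/= => /andP[a0 _] /andP[_ b0].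
    by rewrite (lt_trans a0 at_) (le_lt_trans tb b0).
  split; first by move: t0; rewrite in_itv.
  rewrite in_itv/=; move: (TK t t0); set c := (- _)%R => Tc.
  by rewrite -(leW_mono Tlt) -Tlt Tc at_ tb.
have Tsub (x : R) : (T a <= x <= T b)%R -> x \in `]0%R, pi[.
  move=> /andP[ax xb]; move: (T0 a) (T0 b); rewrite !in_itv/= => /andP[a0 _] /andP[_ b0].
  by rewrite (lt_le_trans a0 ax) (le_lt_trans xb b0).
rewrite integral_itv_obnd_cbnd; last first.
  apply/measurable_EFinP; apply: (measurable_funS _ _ msin) => //.
  by move=> x /=; rewrite in_itv/= => /andP[ax xb]; apply: Tsub; rewrite (ltW ax).
transitivity ((- (cos (T b) / sin (T b))) - (- (cos (T a) / sin (T a))))%:E; last by rewrite !KT.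
apply: (@ftc_itv R (fun t => - (cos t / sin t))%R).
- by rewrite Tlt ltW.
- by move=> x /Tsub; exact: dct.
- by apply: continuous_in_subspaceT => x; rewrite inE/= in_itv/= => /Tsub; exact: cst2.
Qed.
End substitution_affine_cot.

(** * Tonelli's theorem on rectangles *)

Section tonelli_rectangle.
Local Open Scope ereal_scope.
Context d1 d2 (T1 : measurableType d1) (T2 : measurableType d2) (R : realType).
Variables (m1 : {sigma_finite_measure set T1 -> \bar R}).
Variables (m2 : {sigma_finite_measure set T2 -> \bar R}).
Variables (D1 : set T1) (D2 : set T2) (f : T1 * T2 -> \bar R).
Hypotheses (mD1 : measurable D1) (mD2 : measurable D2).
Hypothesis mf : measurable_fun (D1 `*` D2) f.
Hypothesis f0 : forall x y, D1 x -> D2 y -> 0 <= f (x, y).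

Let g := f \_ (D1 `*` D2).

Let mg : measurable_fun setT g.
Proof. by apply/(measurable_restrictT _ _).1 => //; exact: measurableX. Qed.

Let g0 z : 0 <= g z.
Proof.
by case: z => x y; rewrite /g patchE; case: ifPn => //; rewrite inE => -[/= *]; exact: f0.
Qed.

Let gF x : x \in D1 -> \int[m2]_(y in D2) f (x, y) = \int[m2]_y g (x, y).
Proof.
move=> xD; rewrite integral_mkcond; apply: eq_integral => y _.
by rewrite /g !patchE in_setX/= xD.
Qed.

Let gG y : y \in D2 -> \int[m1]_(x in D1) f (x, y) = \int[m1]_x g (x, y).
Proof.
move=> yD; rewrite integral_mkcond; apply: eq_integral => x _.
by rewrite /g !patchE in_setX/= yD andbT.
Qed.

Lemma tonelli_rectangle1 :
  \int[m1 \x m2]_(z in D1 `*` D2) f z = \int[m1]_(x in D1) \int[m2]_(y in D2) f (x, y).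
Proof.
rewrite integral_mkcond (fubini_tonelli1 g mg g0)// [RHS]integral_mkcond.
apply: eq_integral => x _; rewrite patchE /fubini_F; case: ifPn => [/gF//|xD].
by rewrite integral0_eq// => y _; rewrite /g patchE in_setX/= (negbTE xD).
Qed.

Lemma tonelli_rectangle2 :
  \int[m1 \x m2]_(z in D1 `*` D2) f z = \int[m2]_(y in D2) \int[m1]_(x in D1) f (x, y).
Proof.
rewrite integral_mkcond (fubini_tonelli2 g mg g0)// [RHS]integral_mkcond.
apply: eq_integral => y _; rewrite patchE /fubini_G; case: ifPn => [/gG//|yD].
by rewrite integral0_eq// => x _; rewrite /g patchE in_setX/= (negbTE yD) andbF.
Qed.

Lemma tonelli_rectangle : \int[m1]_(x in D1) \int[m2]_(y in D2) f (x, y) =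
  \int[m2]_(y in D2) \int[m1]_(x in D1) f (x, y).
Proof. by rewrite -tonelli_rectangle1 tonelli_rectangle2. Qed.

Lemma measurable_tonelli_rectangle1 :
  measurable_fun D1 (fun x => \int[m2]_(y in D2) f (x, y)).
Proof.
have := measurable_fun_fubini_tonelli_F (m2 := m2) g mg g0.
move=> /(measurable_funS measurableT (@subsetT _ D1)); apply: eq_measurable_fun.
by move=> x /gF ->.
Qed.

End tonelli_rectangle.

(** * Integration in polar coordinates *)

Section polar.
Local Open Scope ereal_scope.
Context (R : realType).
Notation mu := (@lebesgue_measure R).
Notation mplane := (measurableTypeR R * measurableTypeR R)%type.

Notation posR := (`](@GRing.zero R), +oo[%classic).

Lemma ge0_integral_scale (a : R) (f : R -> \bar R) : (0 < a)%R ->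
  measurable_fun posR f -> (forall x, (0 < x)%R -> 0 <= f x) ->
  \int[mu]_(x in posR) f x = \int[mu]_(x in posR) (f (a * x)%R * a%:E).
Proof.
move=> a0 mf f0; rewrite integral_mkcond (@ge0_integral_affine _ a 0)//; last 2 first.
- by apply/(measurable_restrictT _ _).1 => //; exact: measurable_funTS.
- by move=> x; rewrite patchE; case: ifPn => //; rewrite inE/= in_itv/= andbT; exact: f0.
rewrite [RHS]integral_mkcond; apply: eq_integral => x _.
rewrite !patchE addr0 !mem_setE/= !in_itv/= !andbT pmulr_rgt0//.
by case: ifPn; rewrite ?mul0e.
Qed.

Definition half_polar (F : mplane -> \bar R) :=
  \int[mu]_(t in `](@GRing.zero R), pi[) \int[mu]_(r in posR) (F (r * cos t, r * sin t)%R * r%:E).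

Let mcot : measurable_fun setT (fun t : R => cos t / sin t)%R.
Proof. apply: measurable_div; [exact: measurable_cos|exact: measurable_sin]. Qed.

(** Two one-dimensional substitutions take the place of a Jacobian: [x = y cot t] at fixed height
    [y], then, after exchanging the integrals, [y = r sin t] at fixed angle. The factors
    [y / sin t ^ 2] and [sin t] combine to [r]. *)
Lemma upper_half_polar (F : mplane -> \bar R) : measurable_fun setT F -> (forall x, 0 <= F x) ->
  \int[mu]_(y in posR) \int[mu]_x F (x, y) = half_polar F.
Proof.
move=> mF F0.
transitivity (\int[mu]_(y in posR) \int[mu]_(t in `](@GRing.zero R), pi[)
   (F (y * (cos t / sin t), y)%R * (y / sin t ^+ 2)%:E)).
  apply: eq_integral => y; rewrite inE/= in_itv/= andbT => y0.
  have mFy : measurable_fun setT (fun x : measurableTypeR R => F (x, y)).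
    exact: measurableT_comp.
  (* The reflection compensates the sign in the substitution [x = - cot t] that follows. *)
  rewrite ge0_integral_opp// (ge0_integral_affine 0%R y0); last 2 first.
  - apply: (measurableT_comp mFy); exact: oppr_measurable.
  - by [].
  rewrite ge0_integral_tan_shift; last 2 first.
  - apply: emeasurable_funM => //; apply: (measurableT_comp mFy).
    apply: measurableT_comp; first exact: oppr_measurable.
    by apply: measurable_funD => //; exact: measurable_funM.
  - by move=> x; rewrite mule_ge0// lee_fin ltW.
  by apply: eq_integral => t _; rewrite addr0 mulrN opprK -muleA -EFinM.
have mG : measurable_fun setT (fun z : mplane =>
    F (z.1 * (cos z.2 / sin z.2), z.1)%R * (z.1 / sin z.2 ^+ 2)%:E).
  have ms : measurable_fun setT (fun z : mplane => sin z.2).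
    by apply: (measurableT_comp measurable_sin).
  apply: emeasurable_funM.
    apply: (measurableT_comp mF); apply: measurable_fun_pair => //.
    by apply: measurable_funM => //; exact: (measurableT_comp mcot).
  apply/measurable_EFinP; apply: measurable_div => //.
  exact: measurable_funX.
transitivity (\int[mu]_(t in `](@GRing.zero R), pi[) \int[mu]_(y in posR)
   (F (y * (cos t / sin t), y)%R * (y / sin t ^+ 2)%:E)).
  apply: (@tonelli_rectangle _ _ _ _ _ mu mu _ _ (fun z : mplane =>
    F (z.1 * (cos z.2 / sin z.2), z.1)%R * (z.1 / sin z.2 ^+ 2)%:E)).
  - exact: measurable_itv.
  - exact: measurable_itv.
  - exact: measurable_funTS mG.
  - move=> x y /=; rewrite !in_itv/= andbT => x0 _.
    by rewrite mule_ge0// lee_fin divr_ge0 ?(ltW x0)// sqr_ge0.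
apply: eq_integral => t; rewrite inE/= in_itv/= => t0.
have s0 : (0 < sin t)%R by exact: sin_gt0_pi.
rewrite (ge0_integral_scale s0); last 2 first.
- apply: measurable_funTS; apply: (measurableT_comp mG (g := fun y : measurableTypeR R => (y, t : measurableTypeR R))).
  exact: measurable_fun_pair.
- by move=> x x0; rewrite mule_ge0// lee_fin divr_ge0 ?(ltW x0)// sqr_ge0.
apply: eq_integral => r _; rewrite -muleA -EFinM.
have sn0 : sin t != 0%R :> R by rewrite gt_eqF.
by congr (F (_, _) * _%:E); field.
Qed.

(** The lower half-plane is the image of the upper one under the central reflection, and the
    horizontal axis is a null set. In this form the invariance of [leb2] under the reflection can be
    read off. *)
Lemma leb2_half_polar (F : mplane -> \bar R) : measurable_fun setT F -> (forall x, 0 <= F x) ->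
  \int[leb2]_x F x = half_polar F + half_polar (fun x => F (- x)%R).
Proof.
move=> mF F0; rewrite (@fubini_tonelli2 _ _ _ _ _ mu mu F)//.
have mFN : measurable_fun setT (fun x : mplane => F (- x)%R).
  apply: (measurableT_comp mF (g := fun x : mplane => (- x.1, - x.2)%R)).
  by apply: measurable_fun_pair; apply: measurable_funN.
rewrite -!upper_half_polar//.
have mG : measurable_fun setT (fubini_G mu F) by exact: measurable_fun_fubini_tonelli_G.
have G0 y : 0 <= fubini_G mu F y by exact: integral_ge0.
rewrite -[in LHS](setvU posR) [in LHS]setUC ge0_integral_setU//; last 3 first.
- exact: measurableC.
- by rewrite setUv.
- by rewrite disj_set2E setICr.
congr (_ + _).
transitivity (\int[mu]_(y in `]-oo, 0%R[) fubini_G mu F y).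
  rewrite (_ : ~` posR = `]-oo, 0%R]%classic); last first.
    apply/seteqP; split => x /=; rewrite !in_itv/= andbT => h.
      by rewrite leNgt; apply/negP.
    by apply/negP; rewrite -leNgt.
  by rewrite -integral_itv_bndo_bndc//; exact: measurable_funTS.
rewrite integral_mkcond ge0_integral_opp//; last 2 first.
- by apply/(measurable_restrictT _ _).1 => //; exact: measurable_funTS.
- by move=> x; rewrite patchE; case: ifPn.
rewrite [RHS]integral_mkcond; apply: eq_integral => y _.
rewrite !patchE !mem_setE/= !in_itv/= oppr_lt0 andbT.
case: ifPn => // y0; rewrite /fubini_G ge0_integral_opp//.
exact: measurableT_comp.
Qed.

Definition ray_int (F : mplane -> \bar R) (t : R) : \bar R :=
  \int[mu]_(r in posR) (F (r * cos t, r * sin t)%R * r%:E).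

Lemma ray_int_ge0 F t : (forall x, 0 <= F x) -> 0 <= ray_int F t.
Proof.
move=> F0; apply: integral_ge0 => r /=; rewrite in_itv/= andbT => r0.
by rewrite mule_ge0// lee_fin ltW.
Qed.

Lemma measurable_ray_int F : measurable_fun setT F -> (forall x, 0 <= F x) ->
  measurable_fun setT (ray_int F).
Proof.
move=> mF F0.
apply: (@measurable_tonelli_rectangle1 _ _ _ _ _ mu setT posR (fun z => F (z.2 * cos z.1, z.2 * sin z.1)%R * z.2%:E)) => //.
- apply: measurable_funTS; apply: emeasurable_funM => //; last exact/measurable_EFinP.
  apply: (measurableT_comp mF); apply: measurable_fun_pair; apply: measurable_funM => //.
    exact: (measurableT_comp measurable_cos).
  exact: (measurableT_comp measurable_sin).
- by move=> x y _ /=; rewrite in_itv/= andbT => r0; rewrite mule_ge0// lee_fin ltW.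
Qed.

Lemma leb2_polar (F : mplane -> \bar R) : measurable_fun setT F -> (forall x, 0 <= F x) ->
  \int[leb2]_x F x = \int[mu]_(t in `[0%R, (2 * pi)%R]) ray_int F t.
Proof.
move=> mF F0; rewrite leb2_half_polar//.
have mP := measurable_ray_int mF F0.
have P0 t : 0 <= ray_int F t by exact: ray_int_ge0.
have -> : half_polar (fun x => F (- x)%R) = \int[mu]_(t in `](@pi R), (2 * pi)%R[) ray_int F t.
  rewrite [RHS]integral_mkcond (@ge0_integral_affine _ 1 pi)//; last 2 first.
  - by apply/(measurable_restrictT _ _).1 => //; exact: measurable_funTS.
  - by move=> x; rewrite patchE; case: ifPn.
  rewrite /half_polar integral_mkcond; apply: eq_integral => t _.
  rewrite !patchE !mem_setE/= !in_itv/= mule1 mul1r.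
  have -> : (pi < t + pi < 2 * pi)%R = (0 < t < pi)%R.
    by rewrite ltrDr mulr2n mulrDl mul1r ltrD2r.
  case: ifPn => // _; apply: eq_integral => r _.
  by rewrite cosDpi sinDpi !mulrN.
have pi0 := pi_gt0 R.
rewrite (_ : `[0%R, (2 * pi)%R]%classic = `[(@GRing.zero R), pi] `|` `](@pi R), (2 * pi)%R]); last first.
  apply/seteqP; split => x /=; rewrite !in_itv/=.
    by move=> /andP[x0 x2]; have [xp|xp] := leP x pi; [left|right]; apply/andP.
  by case=> /andP[h1 h2]; apply/andP; split; lra.
rewrite ge0_integral_setU//; last 2 first.
- exact: measurable_funTS.
- rewrite disj_set2E; apply/eqP/seteqP; split => // x [] /=; rewrite !in_itv/=.
  by move=> /andP[_ xp] /andP[px _]; move: (lt_le_trans px xp); rewrite ltxx.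
congr (_ + _).
  rewrite -integral_itv_bndo_bndc; last exact: measurable_funTS.
  by rewrite -integral_itv_obnd_cbnd//; exact: measurable_funTS.
by rewrite -integral_itv_bndo_bndc//; exact: measurable_funTS.
Qed.

End polar.

(** * One-dimensional Hausdorff measure *)

Section hausdorff_outer_measure.
Context {R : realType}.
Local Notation plane := (R * R)%type.
Local Notation mplane := (measurableTypeR R * measurableTypeR R)%type.
Local Open Scope ereal_scope.

Lemma dist2_ge0 (x y : plane) : (0 <= dist2 x y)%R.
Proof. exact: sqrtr_ge0. Qed.

Lemma dist2C (x y : plane) : dist2 x y = dist2 y x.
Proof. by rewrite /dist2 -(sqrrN (x.1 - _)%R) -(sqrrN (x.2 - _)%R) !opprB. Qed.

Lemma le_dist2 (x y : plane) (r : R) : (0 <= r)%R ->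
  (dist2 x y <= r)%R = ((x.1 - y.1) ^+ 2 + (x.2 - y.2) ^+ 2 <= r ^+ 2)%R.
Proof. by move=> r0; rewrite -[in LHS](ger0_norm r0) -sqrtr_sqr ler_sqrt// exprn_ge0. Qed.

Lemma dist2_fst (x y : plane) : (`|x.1 - y.1| <= dist2 x y)%R.
Proof. by rewrite -sqrtr_sqr ler_sqrt ?addr_ge0 ?sqr_ge0// lerDl sqr_ge0. Qed.

Lemma dist2_snd (x y : plane) : (`|x.2 - y.2| <= dist2 x y)%R.
Proof. by rewrite -sqrtr_sqr ler_sqrt ?addr_ge0 ?sqr_ge0// lerDr sqr_ge0. Qed.

Lemma diam_ge0 (E : set plane) : 0 <= diam E.
Proof. by rewrite /diam le_max lexx. Qed.

Lemma dist2_le_diam (E : set plane) x y : E x -> E y -> (dist2 x y)%:E <= diam E.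
Proof.
move=> Ex Ey; rewrite /diam le_max; apply/orP; right.
by apply: ereal_sup_ubound; exists (x, y).
Qed.

Lemma diam_le (E : set plane) (M : R) : (0 <= M)%R ->
  (forall x y, E x -> E y -> (dist2 x y <= M)%R) -> diam E <= M%:E.
Proof.
move=> M0 h; rewrite /diam ge_max lee_fin M0/=.
by apply: ge_ereal_sup => _ [[x y] [/= Ex Ey] <-]; rewrite lee_fin h.
Qed.

Lemma diam0 : diam (set0 : set plane) = 0.
Proof. by apply/eqP; rewrite eq_le diam_ge0 andbT; apply: diam_le. Qed.

Let allsets : set (set plane) := [set: set plane].
(** Sets of diameter above [d] get weight [+oo]. The constrained infimum [hausdorff1_pre] then
    becomes an outer extension [mu_ext] over the sigma-algebra of all sets, and inherits
    monotonicity and countable subadditivity. *)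
Let bdiam (d : R) (E : set (g_sigma_algebraType allsets)) : \bar R :=
  if diam E <= d%:E then diam E else +oo.

Let bdiam_ge0 d E : 0 <= bdiam d E.
Proof. by rewrite /bdiam; case: ifP => // _; exact: diam_ge0. Qed.

Lemma hausdorff1_pre_ext (d : R) (A : set plane) : (0 < d)%R ->
  hausdorff1_pre d A = mu_ext (bdiam d) A.
Proof.
move=> d0; apply/eqP; rewrite eq_le; apply/andP; split.
  apply: le_ereal_inf_tmp => _ [E [mE AE] <-].
  have [h|] := pselect (forall i, diam (E i) <= d%:E).
    apply: ereal_inf_lbound; exists E => //.
    by apply: eq_eseriesr => i _; rewrite /bdiam h.
  move=> /existsNP[i hi]; rewrite (eseries_pinfty (k := i))//= ?leey//.
  - by move=> n _; rewrite -ltNye (lt_le_trans _ (bdiam_ge0 d _)).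
  - by rewrite /bdiam; case: ifP.
apply: le_ereal_inf_tmp => _ [E [AE dE] <-].
apply: ereal_inf_lbound; exists E.
  by split => // i; exact: sub_sigma_algebra.
by apply: eq_eseriesr => i _; rewrite /bdiam dE.
Qed.

Lemma hausdorff1_pre_ge0 (d : R) A : (0 < d)%R -> 0 <= hausdorff1_pre d A.
Proof. by move=> d0; rewrite hausdorff1_pre_ext//; exact: mu_ext_ge0. Qed.

Lemma le_hausdorff1_pre (d : R) A B : (0 < d)%R -> A `<=` B ->
  hausdorff1_pre d A <= hausdorff1_pre d B.
Proof. by move=> d0 AB; rewrite !hausdorff1_pre_ext//; exact: le_mu_ext. Qed.

Lemma hausdorff1_pre_anti (d d' : R) A : (d <= d')%R ->
  hausdorff1_pre d' A <= hausdorff1_pre d A.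
Proof.
move=> dd; apply: le_ereal_inf_tmp => _ [E [AE dE] <-].
apply: ereal_inf_lbound; exists E => //; split => // i.
by rewrite (le_trans (dE i))// lee_fin.
Qed.

Lemma hausdorff1_pre_sigma_subadditive (d : R) (F : (set plane)^nat) : (0 < d)%R ->
  hausdorff1_pre d (\bigcup_n F n) <= \sum_(n <oo) hausdorff1_pre d (F n).
Proof.
move=> d0; rewrite hausdorff1_pre_ext//.
under eq_eseriesr do rewrite hausdorff1_pre_ext//.
exact: mu_ext_sigma_subadditive.
Qed.

Lemma hausdorff1_pre_le (d : R) (A : set mplane) : (0 < d)%R -> hausdorff1_pre d A <= hausdorff1 A.
Proof. by move=> d0; apply: ereal_sup_ubound; exists d. Qed.

Let hausdorff1_ge0 (A : set mplane) : 0 <= hausdorff1 A.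
Proof. by rewrite (le_trans _ (@hausdorff1_pre_le 1%R A _))// hausdorff1_pre_ge0. Qed.

Let hausdorff10 : hausdorff1 (set0 : set mplane) = 0.
Proof.
apply/eqP; rewrite eq_le hausdorff1_ge0 andbT.
apply: ge_ereal_sup => _ [d /= d0 <-]; apply: ereal_inf_lbound.
exists (fun=> set0); last by rewrite eseries0// => n _ _; exact: diam0.
by split => // i; rewrite diam0 lee_fin ltW.
Qed.

Lemma le_hausdorff1 (A B : set mplane) : A `<=` B -> hausdorff1 A <= hausdorff1 B.
Proof.
move=> AB; apply: ge_ereal_sup => _ [d /= d0 <-].
by rewrite (le_trans (le_hausdorff1_pre d0 AB))// hausdorff1_pre_le.
Qed.

Let hausdorff1_sigma_subadditive : sigma_subadditive (@hausdorff1 R).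
Proof.
move=> F; apply: ge_ereal_sup => _ [d /= d0 <-].
rewrite (le_trans (hausdorff1_pre_sigma_subadditive F d0))//.
by apply: lee_nneseries => *; [exact: hausdorff1_pre_ge0|exact: hausdorff1_pre_le].
Qed.

Definition hausdorff1_outer : set mplane -> \bar R := @hausdorff1 R.

HB.instance Definition _ := isOuterMeasure.Build R mplane hausdorff1_outer
  hausdorff10 hausdorff1_ge0 le_hausdorff1 hausdorff1_sigma_subadditive.

(** A covering by sets of diameter below [e] splits into the sets that meet [A] and the others; the
    former cover [A], and only the latter can contain points of [B]. *)
Lemma hausdorff1_separated (A B : set mplane) (e : R) : (0 < e)%R ->
  (forall x y, A x -> B y -> (e <= dist2 x y)%R) ->
  hausdorff1 A + hausdorff1 B <= hausdorff1 (A `|` B).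
Proof.
move=> e0 sep.
have [->|AB] := eqVneq (hausdorff1 (A `|` B)) +oo; first by rewrite leey.
have pre_sep (d : R) : (0 < d < e)%R ->
   hausdorff1_pre d A + hausdorff1_pre d B <= hausdorff1_pre d (A `|` B).
  move=> /andP[d0 de]; apply: le_ereal_inf_tmp => _ [E [ABE dE] <-].
  pose EA i := if pselect (E i `&` A !=set0) then E i else set0.
  pose EB i := if pselect (E i `&` A !=set0) then set0 else E i.
  apply: (@le_trans _ _ (\sum_(i <oo) diam (EA i) + \sum_(i <oo) diam (EB i))).
    apply: leeD; apply: ereal_inf_lbound.
      exists EA => //; split.
        move=> x Ax; have [i _ Ei] := ABE x (or_introl Ax); exists i => //.
        by rewrite /EA; case: pselect => // -[]; exists x.
      by move=> i; rewrite /EA; case: pselect => h; rewrite ?diam0 ?lee_fin ?(ltW d0)//; exact: dE.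
    exists EB => //; split.
      move=> x Bx; have [i _ Ei] := ABE x (or_intror Bx); exists i => //.
      rewrite /EB; case: pselect => // -[y [Ey Ay]].
      have := le_trans (dist2_le_diam Ey Ei) (dE i); rewrite lee_fin.
      by move=> /(le_trans (sep _ _ Ay Bx)); rewrite leNgt de.
    by move=> i; rewrite /EB; case: pselect => h; rewrite ?diam0 ?lee_fin ?(ltW d0)//; exact: dE.
  rewrite -nneseriesD; [|by move=> n _ _; exact: diam_ge0..].
  apply: lee_nneseries => [n _ _|n _]; first by rewrite adde_ge0 ?diam_ge0.
  by rewrite /EA /EB; case: pselect => h; rewrite diam0 ?adde0 ?add0e.
have sup_pre (X : set mplane) : hausdorff1 X < +oo -> forall eta : R, (0 < eta)%R ->
   exists2 d : R, (0 < d < e)%R & hausdorff1 X - eta%:E <= hausdorff1_pre d X.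
  move=> Xoo eta eta0.
  have Xfin : hausdorff1 X \is a fin_num by rewrite ge0_fin_numE.
  have [_ [d /= d0 <-] hd] := ub_ereal_sup_adherent eta0 Xfin.
  exists (Num.min d (e / 2))%R.
    by rewrite lt_min d0 divr_gt0//= gt_min ltr_pdivrMr// ltr_pMr// ltr1n orbT.
  apply: (le_trans (ltW hd)); apply: hausdorff1_pre_anti.
  by rewrite ge_min lexx.
have ABoo : hausdorff1 (A `|` B) < +oo by rewrite ltey.
have Aoo : hausdorff1 A < +oo by rewrite (le_lt_trans _ ABoo)// le_hausdorff1// => x; left.
have Boo : hausdorff1 B < +oo by rewrite (le_lt_trans _ ABoo)// le_hausdorff1// => x; right.
apply/lee_addgt0Pr => eta eta0.
have eta2 : (0 < eta / 2)%R by rewrite divr_gt0.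
have [d1 /andP[d10 d1e] h1] := sup_pre A Aoo _ eta2.
have [d2 /andP[d20 d2e] h2] := sup_pre B Boo _ eta2.
pose d := Num.min d1 d2.
have d0 : (0 < d)%R by rewrite lt_min d10.
have de : (d < e)%R by rewrite gt_min d1e.
have := pre_sep d; rewrite d0 de => /(_ isT) h.
have {h}h := le_trans h (hausdorff1_pre_le _ d0).
have {}h1 : hausdorff1 A - (eta / 2)%:E <= hausdorff1_pre d A.
  by apply: (le_trans h1); apply: hausdorff1_pre_anti; rewrite ge_min lexx.
have {}h2 : hausdorff1 B - (eta / 2)%:E <= hausdorff1_pre d B.
  by apply: (le_trans h2); apply: hausdorff1_pre_anti; rewrite ge_min lexx orbT.
rewrite leeBlDr// in h1; rewrite leeBlDr// in h2.
apply: (le_trans (leeD h1 h2)); rewrite addeACA -EFinD -splitr.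
exact: leeD2r.
Qed.

Lemma sume_even_odd (f : nat -> \bar R) n :
  \sum_(0 <= k < n + n) f k = \sum_(k < n) f (2 * k + 0)%N + \sum_(k < n) f (2 * k + 1)%N.
Proof.
elim: n => [|n IH]; first by rewrite addn0 big_nil !big_ord0 adde0.
rewrite addSn addnS !big_nat_recr//= IH !big_ord_recr/= -[LHS]addeA [RHS]addeACA.
by rewrite addn0 addn1 mul2n addnn.
Qed.

Section half_space.
Variables (f : plane -> R) (a : R).
Hypothesis f_lip : forall x y, (`|f x - f y| <= dist2 x y)%R.

Let A : set mplane := [set x | (a < f x)%R].

(** Caratheodory's argument for metric outer measures. The part of [E] where [f] is slightly above
    [a] is cut into shells [D k]; shells of equal parity are at positive distance from each other,
    so the measures of all shells are summable and the tail of the series tends to 0. *)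
Lemma half_space_caratheodory : (hausdorff1_outer).-caratheodory%mu A.
Proof.
apply: le_caratheodory_measurable => E.
have [Einf|Eoo] := eqVneq (hausdorff1 E) +oo; first by rewrite [leRHS](_ : _ = +oo) ?leey.
have {}Eoo : hausdorff1 E < +oo by rewrite ltey.
pose D (k : nat) : set mplane := E `&` [set x | (k.+2%:R^-1 <= f x - a < k.+1%:R^-1)%R].
pose An (n : nat) : set mplane := E `&` [set x | (n.+1%:R^-1 <= f x - a)%R].
have invlt (m n : nat) : (m < n)%N -> (n.+1%:R^-1 < m.+1%:R^-1 :> R)%R.
  by move=> mn; rewrite ltf_pV2 ?posrE ?ltr0n// ltr_nat ltnS.
have sepf (X Y : set mplane) (u v : R) : (v < u)%R -> (forall x, X x -> u <= f x - a)%R ->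
   (forall y, Y y -> f y - a < v)%R -> hausdorff1 X + hausdorff1 Y <= hausdorff1 (X `|` Y).
  move=> uv hX hY; apply: (@hausdorff1_separated _ _ (u - v)); first by rewrite subr_gt0.
  move=> x y /hX hx /hY hy; apply: (le_trans _ (f_lip x y)).
  by rewrite (le_trans _ (ler_norm _))//; lra.
have An_le n : hausdorff1 (An n) + hausdorff1 (E `&` ~` A) <= hausdorff1 E.
  apply: (@le_trans _ _ (hausdorff1 (An n `|` (E `&` ~` A)))); last first.
    by apply: le_hausdorff1 => x [[]|[]].
  apply: (sepf (An n) (E `&` ~` A) (n.+1%:R^-1)%R (n.+2%:R^-1)%R); first exact: invlt.
    by move=> x [].
  move=> y [_ /negP]; rewrite -leNgt -subr_le0 => h.
  by rewrite (le_lt_trans h)// invr_gt0 ltr0n.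
(* Between two shells of the same parity lies a whole shell, so the induction adds one separated
   shell at a time. *)
have parity (p N : nat) : \sum_(k < N) hausdorff1 (D (2 * k + p)%N) <= hausdorff1 E.
  suff h : \sum_(k < N.+1) hausdorff1 (D (2 * k + p)%N) <=
      hausdorff1 (E `&` [set x | (((2 * N + p).+2)%:R^-1 <= f x - a)%R] : set mplane).
    apply: (@le_trans _ _ (\sum_(k < N.+1) hausdorff1 (D (2 * k + p)%N))).
      by rewrite big_ord_recr/= leeDl.
    by apply: (le_trans h); apply: le_hausdorff1 => x [].
  elim: N => [|N IH].
    by rewrite big_ord1; apply: le_hausdorff1 => x [Ex /andP[h _]].
  rewrite big_ord_recr/=; apply: (le_trans (leeD2r _ IH)).
  rewrite (_ : (2 * N.+1 + p)%N = (2 * N + p).+2); last by rewrite mulnS -addnA add2n.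
  set m := (2 * N + p)%N.
  apply: (@le_trans _ _ (hausdorff1 ((E `&` [set x | (m.+2%:R^-1 <= f x - a)%R]) `|` D m.+2))).
    apply: (sepf _ _ (m.+2%:R^-1)%R (m.+3%:R^-1)%R); first exact: invlt.
      by move=> x [].
    by move=> y [_ /andP[]].
  apply: le_hausdorff1 => x [[Ex /= h]|[Ex /andP[h _]]]; split => //=.
  by apply: (le_trans _ h); apply: ltW; apply: (lt_trans (invlt m.+2 m.+3 _) (invlt m.+1 m.+2 _)).
have sumD n : \sum_(k < n) hausdorff1 (D k) <= hausdorff1 E + hausdorff1 E.
  have -> : \sum_(k < n) hausdorff1 (D k) = \sum_(0 <= k < n) hausdorff1 (D k) by rewrite big_mkord.
  apply: (@le_trans _ _ (\sum_(0 <= k < n + n) hausdorff1 (D k))).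
    by rewrite [leRHS](@big_cat_nat _ _ _ n)//= ?leq_addr// leeDl// sume_ge0.
  have -> : \sum_(0 <= k < n + n) hausdorff1 (D k) =
     \sum_(k < n) hausdorff1 (D (2 * k + 0)%N) + \sum_(k < n) hausdorff1 (D (2 * k + 1)%N).
    exact: sume_even_odd.
  exact: leeD.
have tail : \sum_(n <= k <oo) hausdorff1 (D k) @[n --> \oo] --> 0.
  apply: nneseries_tail_cvg => //; apply: (@le_lt_trans _ _ (hausdorff1 E + hausdorff1 E)).
    apply: lime_le; first exact: is_cvg_nneseries.
    by apply: nearW => n; rewrite big_mkord.
  by rewrite lte_add_pinfty.
(* The set [An n] is separated from the complement of [A]; the shells from [n] on cover the rest of
   the part of [E] inside [A]. *)
have key n : hausdorff1_outer (E `&` A) + hausdorff1_outer (E `&` ~` A) <=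
    hausdorff1 E + \sum_(n <= k <oo) hausdorff1 (D k).
  apply: (@le_trans _ _ (hausdorff1 (An n) + \sum_(n <= k <oo) hausdorff1 (D k) + hausdorff1 (E `&` ~` A))); last first.
    by rewrite addeAC leeD2r.
  apply: leeD2r.
  apply: (le_trans _ (leeD2l _ (outer_measure_sigma_subadditive_tail hausdorff1_outer n D))).
  apply: (le_trans _ (outer_measureU2 hausdorff1_outer _ _)).
  apply: le_outer_measure => x [Ex Ax].
  have [h|h] := leP (n.+1%:R^-1)%R (f x - a)%R; first by left.
  right; have fa0 : (0 < f x - a)%R by rewrite subr_gt0.
  have exm : exists m, (m.+1%:R^-1 <= f x - a)%R.
    exists (Num.truncn (f x - a)^-1)%R; rewrite -[leRHS]invrK lef_pV2 ?posrE ?invr_gt0 ?ltr0n//.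
    by apply: ltW; rewrite truncnS_gt.
  have [m hm mmin] := ex_minnP exm.
  have nm : (n < m)%N.
    rewrite ltnNge; apply/negP => mn; move: h; rewrite ltNge => /negP; apply.
    by apply: (le_trans _ hm); rewrite lef_pV2 ?posrE ?ltr0n// ler_nat ltnS.
  case: m => // m in hm mmin nm *.
  exists m; first by apply/negP; rewrite -leqNgt -ltnS.
  split => //; apply/andP; split => //.
  by rewrite ltNge; apply/negP => /mmin; rewrite ltnn.
have : hausdorff1 E + \sum_(n <= k <oo) hausdorff1 (D k) @[n --> \oo] --> hausdorff1 E + 0.
  by apply: cvgeD => //; [rewrite fin_num_adde_defl|exact: cvg_cst].
rewrite adde0 => h; rewrite -[leRHS](cvg_lim _ h)//.
by apply: lime_ge; [apply/cvg_ex; exists (hausdorff1 E)|exact: nearW].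
Qed.
End half_space.

(** The Caratheodory sets form a sigma-algebra, the coordinate half-planes generate the Borel sets,
    and the coordinates are 1-Lipschitz for [dist2]. *)
Lemma measurable_caratheodory (A : set mplane) : measurable A ->
  (hausdorff1_outer).-caratheodory%mu A.
Proof.
rewrite measurable_prod_measurableType; apply: smallest_sub.
  split.
  - exact: caratheodory_measurable_set0.
  - by move=> B MB; rewrite setTD; exact: caratheodory_measurable_setC.
  - by move=> F MF; exact: caratheodory_measurable_bigcup.
have proj (p : plane -> R) (B : set R) : (forall x y, (`|p x - p y| <= dist2 x y)%R) ->
    measurable (B : set (measurableTypeR R)) -> (hausdorff1_outer).-caratheodory%mu (p @^-1` B : set mplane).
  move=> plip; rewrite RGenOInfty.measurableE; move: B; apply: smallest_sub.
    split.
    - by rewrite preimage_set0; exact: caratheodory_measurable_set0.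
    - by move=> B MB; rewrite setTD preimage_setC; exact: caratheodory_measurable_setC.
    - by move=> F MF; rewrite preimage_bigcup; exact: caratheodory_measurable_bigcup.
  move=> _ [a ->] /=.
  rewrite (_ : p @^-1` _ = [set x | (a < p x)%R]); first exact: half_space_caratheodory.
  by apply/seteqP; split => x /=; rewrite in_itv/= andbT.
move=> _ [B1 mB1 [B2 mB2 <-]].
rewrite (_ : B1 `*` B2 = (fst @^-1` B1) `&` (snd @^-1` B2)); last by [].
by apply: caratheodory_measurable_setI; apply: proj => //; [exact: dist2_fst|exact: dist2_snd].
Qed.

Let hausdorff1_semi_sigma_additive : semi_sigma_additive (@hausdorff1 R).
Proof.
move=> F mF tF mUF.
apply: (@caratheodory_measure_sigma_additive _ mplane hausdorff1_outer F) => //.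
  by move=> i; exact: measurable_caratheodory.
exact: measurable_caratheodory.
Qed.

HB.instance Definition _ := isMeasure.Build _ _ _ (@hausdorff1 R)
  hausdorff10 hausdorff1_ge0 hausdorff1_semi_sigma_additive.

End hausdorff_outer_measure.

(** * Hausdorff measure of a curve in polar form: upper and lower estimates *)

Section curve_measure.
Context {R : realType}.
Local Notation plane := (R * R)%type.
Local Notation mplane := (measurableTypeR R * measurableTypeR R)%type.
Local Notation mu := (@lebesgue_measure R).
Variable rho : R -> R.
Hypothesis crho : continuous rho.

Definition polar_curve (t : R) : plane := (rho t * cos t, rho t * sin t).

(** The law of cosines, with [1 - cos u] written as [2 sin (u / 2) ^ 2] so that the radial and the
    angular part of the chord are separate squares. *)
Lemma polar_curve_dist2_sq (s t : R) :
  dist2 (polar_curve s) (polar_curve t) ^+ 2 =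
  (rho s - rho t) ^+ 2 + 4 * rho s * rho t * sin ((s - t) / 2) ^+ 2.
Proof.
rewrite /dist2 sqr_sqrtr ?addr_ge0 ?sqr_ge0//=.
have h : cos s * cos t + sin s * sin t = 1 - 2 * sin ((s - t) / 2) ^+ 2.
  rewrite -[LHS]/(cos s * cos t + sin s * sin t).
  have -> : cos s * cos t + sin s * sin t = cos (s - t) by rewrite cosB.
  have {1}-> : s - t = (s - t) / 2 + (s - t) / 2 by field.
  by rewrite cosD; have := cos2Dsin2 ((s - t) / 2); lra.
have e1 := cos2Dsin2 s; have e2 := cos2Dsin2 t.
transitivity (rho s ^+ 2 * (cos s ^+ 2 + sin s ^+ 2) + rho t ^+ 2 * (cos t ^+ 2 + sin t ^+ 2)
  - 2 * rho s * rho t * (cos s * cos t + sin s * sin t)); first by ring.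
by rewrite e1 e2 h; ring.
Qed.

Lemma measurable_polar_curve (D : set R) : measurable (D : set (measurableTypeR R)) ->
  measurable_fun (D : set (measurableTypeR R)) (polar_curve : measurableTypeR R -> mplane).
Proof.
move=> mD; apply: measurable_funTS; have mr : measurable_fun [set: R] rho.
  exact: continuous_measurable_fun.
apply: measurable_fun_pair; apply: measurable_funM => //.
  exact: measurable_cos.
exact: measurable_sin.
Qed.

Section upper.
Variables (a b C : R).
Hypothesis ab : a <= b.
Hypothesis C0 : 0 < C.
Hypothesis lip : forall s t, a <= s <= b -> a <= t <= b ->
  dist2 (polar_curve s) (polar_curve t) <= C * `|s - t|.

(** Over a parameter interval of length [d / C] every piece of the curve has diameter at most [d],
    so the coverings that compute Lebesgue measure are turned into admissible coverings at scale
    [d]. *)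
Let small_piece (d : R) (T : set R) (c : R) : 0 < d -> T `<=` `[a, b] ->
  T `<=` `]c, c + d / C]%classic -> measurable (T : set (measurableTypeR R)) ->
  (hausdorff1_pre d (polar_curve @` T) <= C%:E * mu T)%E.
Proof.
move=> d0 Tab Tc mT.
have dC : 0 < d / C by rewrite divr_gt0.
suff h : (C^-1%:E * hausdorff1_pre d (polar_curve @` T) <= mu T)%E.
  have := @lee_wpmul2l _ C%:E _ _ _ h; rewrite lee_fin (ltW C0) => /(_ isT).
  by rewrite muleA -EFinM mulfV ?gt_eqF// mul1e.
apply: le_ereal_inf_tmp => _ [F [mF TF] <-].
pose E i := polar_curve @` (F i `&` T).
have Fitv i : exists u v : R, u <= v /\ F i `<=` `[u, v]%classic /\
    wlength idfun (F i) = (v - u)%:E.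
  have /ocitvP[->|[[u v] /= uv ->]] := mF i.
    by exists 0, 0; rewrite lexx subrr wlength0; split => //; split.
  exists u, v; split; first exact: ltW.
  split; first by apply: subset_itv_oc_cc.
  by rewrite wlength_itv_bnd// ltW.
have dE i : (diam (E i) <= C%:E * wlength idfun (F i))%E /\ (diam (E i) <= d%:E)%E.
  have [u [v [uv [Fuv ->]]]] := Fitv i; split.
    rewrite -EFinM; apply: diam_le; first by rewrite mulr_ge0// ?(ltW C0)// subr_ge0.
    move=> _ _ [s [Fs Ts] <-] [t [Ft Tt] <-].
    have := lip (Tab _ Ts) (Tab _ Tt) => /le_trans; apply.
    rewrite ler_wpM2l ?(ltW C0)// ler_norml.
    have := Fuv _ Fs; have := Fuv _ Ft; rewrite /= !in_itv/= => /andP[? ?] /andP[? ?].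
    by apply/andP; split; lra.
  apply: diam_le; first exact: ltW.
  move=> _ _ [s [Fs Ts] <-] [t [Ft Tt] <-].
  have := lip (Tab _ Ts) (Tab _ Tt) => /le_trans; apply.
  rewrite -ler_pdivlMl// mulrC ler_norml.
  have := Tc _ Ts; have := Tc _ Tt; rewrite /= !in_itv/= => /andP[? ?] /andP[? ?].
  by apply/andP; split; lra.
apply: (@le_trans _ _ (C^-1%:E * \sum_(k <oo) diam (E k))%E).
  rewrite lee_pmul2l ?fin_numE// ?lte_fin ?invr_gt0//.
  apply: ereal_inf_lbound; exists E => //; split; last by move=> i; case: (dE i).
  move=> _ [t Tt <-]; have [i _ Fi] := TF _ Tt; exists i => //.
  by exists t.
rewrite -nneseriesZl; last by move=> *; exact: diam_ge0.
apply: lee_nneseries => [i _ _|i _]; first by rewrite mule_ge0 ?diam_ge0// lee_fin invr_ge0 ltW.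
have [h _] := dE i.
have := @lee_wpmul2l _ C^-1%:E _ _ _ h; rewrite lee_fin invr_ge0 (ltW C0) => /(_ isT).
by rewrite muleA -EFinM mulVf ?gt_eqF// mul1e.
Qed.

Lemma hausdorff1_curve_le (T : set R) : T `<=` `[a, b] -> measurable (T : set (measurableTypeR R)) ->
  (hausdorff1 (polar_curve @` T : set mplane) <= C%:E * mu T)%E.
Proof.
move=> Tab mT; apply: ge_ereal_sup => _ [d /= d0 <-].
have dC : 0 < d / C by rewrite divr_gt0.
(* The grid starts at [a - 1] because its cells are open on the left and have to contain [a] as
   well. *)
pose I (k : nat) : set R := `](a - 1 + k%:R * (d / C)), (a - 1 + k%:R * (d / C) + d / C)]%classic.
have mI k : measurable (I k : set (measurableTypeR R)) by exact: measurable_itv.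
pose TI k := T `&` I k.
have TE : T = \bigcup_k TI k.
  rewrite -setI_bigcupr; apply/esym/setIidl => t Tt.
  pose y := (t - (a - 1)) / (d / C).
  have y0 : 0 < y.
    rewrite divr_gt0//; have := Tab _ Tt; rewrite /= in_itv/= => /andP[? _]; lra.
  have exm : exists m : nat, y <= m.+1%:R.
    by exists (Num.truncn y); apply: ltW; exact: truncnS_gt.
  have [m hm mmin] := ex_minnP exm.
  exists m => //; rewrite /I /= in_itv/=.
  have -> : t = a - 1 + y * (d / C) by rewrite /y divfK ?gt_eqF//; ring.
  have h1 : y * (d / C) <= m%:R * (d / C) + d / C.
    by rewrite -[X in _ + X]mul1r -mulrDl natr1 ler_pM2r.
  have h2 : m%:R * (d / C) < y * (d / C).
    rewrite ltr_pM2r//; case: m hm mmin h1 => // m hm mmin _; rewrite ltNge; apply/negP => /mmin.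
    by rewrite ltnn.
  by apply/andP; split; lra.
have mTI k : measurable (TI k : set (measurableTypeR R)) by exact: measurableI.
apply: (@le_trans _ _ (\sum_(k <oo) hausdorff1_pre d (polar_curve @` TI k))%E).
  rewrite {1}TE image_bigcup; exact: hausdorff1_pre_sigma_subadditive.
apply: (@le_trans _ _ (\sum_(k <oo) (C%:E * mu (TI k)))%E).
  apply: lee_nneseries => [k _ _|k _]; first exact: hausdorff1_pre_ge0.
  apply: (@small_piece _ _ (a - 1 + k%:R * (d / C))) => //; first by move=> t [/Tab].
  by move=> t [].
rewrite nneseriesZl; last by move=> *; exact: measure_ge0.
rewrite lee_wpmul2l ?lee_fin ?(ltW C0)//.
rewrite [X in (_ <= mu X)%E]TE measure_bigcup//.
  rewrite [leRHS](eq_eseriesl (Q := xpredT)) => [|i]; last by rewrite mem_set.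
  exact: lexx.
apply/trivIsetP => i j _ _ ij; apply/seteqP; split => // x [[_ xi] [_ xj]].
move: xi xj; rewrite /I /= !in_itv/= => /andP[i1 i2] /andP[j1 j2].
wlog ltij : i j ij i1 i2 j1 j2 / (i < j)%N.
  move=> W; move: ij; rewrite neq_ltn => /orP[h|h]; first by apply: (W i j) => //; rewrite neq_ltn h.
  by apply: (W j i) => //; rewrite neq_ltn h.
have : i.+1%:R * (d / C) <= j%:R * (d / C) by rewrite ler_pM2r// ler_nat.
by rewrite -natr1 mulrDl mul1r; lra.
Qed.

End upper.

Section lower.
Variables (a b m M L : R).
Hypothesis bapi : b - a <= pi.
Hypotheses (m0 : 0 < m) (M0 : 0 <= M) (L0 : 0 <= L).
Hypothesis rhom : forall t, a <= t <= b -> m <= rho t <= M.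
Hypothesis rhoL : forall s t, a <= s <= b -> a <= t <= b -> `|rho s - rho t| <= L * `|s - t|.

Let kappa := 8 / m.
Let K := (M / 2 + L) * kappa ^+ 2.

(** With [u = t - s] and [n] the smaller end radius, the chord [D] is at least [2 n sin (u / 2)].
    The sine bounds give [u <= 8 D / m] and [n u <= D + (M / 2) u ^ 2], and replacing [n] by [rho x]
    costs [L u ^ 2]. Hence the constant [K]; what matters is that the error is of second order in
    [D]. *)
Let arc_bound (s t x : R) : a <= s -> s <= x -> x <= t -> t <= b ->
  rho x * (t - s) <= dist2 (polar_curve s) (polar_curve t) + K * dist2 (polar_curve s) (polar_curve t) ^+ 2.
Proof.
move=> as_ sx xt tb; set D := dist2 _ _.
have D0 : 0 <= D by exact: dist2_ge0.
have [st|st] := leP t s.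
  have -> : t = s by apply/eqP; rewrite eq_le st (le_trans sx xt).
  by rewrite subrr mulr0 addr_ge0// mulr_ge0// ?sqr_ge0// /K mulr_ge0// ?sqr_ge0// addr_ge0// divr_ge0.
have hs : a <= s <= b by rewrite as_/= (le_trans (ltW st) tb).
have ht : a <= t <= b by rewrite tb (le_trans as_ (ltW st)).
have hx : a <= x <= b by rewrite (le_trans as_ sx) (le_trans xt tb).
have /andP[ms Ms] := rhom hs; have /andP[mt Mt] := rhom ht.
pose u := t - s; have u0 : 0 < u by rewrite subr_gt0.
have upi : u <= pi.
  by apply: (le_trans _ bapi); apply: lerB.
pose w := sin (u / 2).
have w8 : u / 16 <= w.
  by have := @sin_ge_lin R (u / 2); rewrite -/w => h; apply: (le_trans _ (h _)); [lra|apply/andP; split; lra].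
have w2 : u / 2 - u ^+ 2 / 4 <= w.
  by have := @sin_ge_quad R (u / 2); rewrite -/w => h; apply: (le_trans _ (h _)); [rewrite expr_div_n; lra|lra].
have w0 : 0 < w by apply: lt_le_trans w8; rewrite divr_gt0.
have D2 : D ^+ 2 = (rho s - rho t) ^+ 2 + 4 * rho s * rho t * w ^+ 2.
  rewrite /D polar_curve_dist2_sq; congr (_ + _ * _).
  by rewrite -sqrrN -sinN /w /u; congr (sin _ ^+ 2); field.
(* the smaller of the two radii bounds the chord from below *)
pose n := Num.min (rho s) (rho t).
have nm : m <= n by rewrite le_min ms mt.
have nM : n <= M by rewrite ge_min Ms.
have Dn : 2 * n * w <= D.
  rewrite -(@ler_pXn2r _ 2)// ?nnegrE//; last by rewrite !mulr_ge0// ?(ltW w0)// (le_trans (ltW m0)).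
  rewrite D2; have h : n * n <= rho s * rho t.
    by apply: ler_pM; rewrite ?(le_trans (ltW m0) nm)// ge_min lexx ?orbT.
  have := sqr_ge0 (rho s - rho t); have := sqr_ge0 w; nra.
have rxn : rho x <= n + L * u.
  rewrite -lerBlDr le_min; apply/andP; split.
    have := rhoL hx hs; rewrite ler_norml => /andP[_]; rewrite ger0_norm ?subr_ge0// => h.
    have : L * (x - s) <= L * u by rewrite ler_wpM2l// /u; lra.
    lra.
  have := rhoL hx ht; rewrite ler_norml => /andP[_]; rewrite distrC ger0_norm ?subr_ge0// => h.
  have : L * (t - x) <= L * u by rewrite ler_wpM2l// /u; lra.
  lra.
have uD : u <= kappa * D.
  rewrite /kappa; have : m * u <= 8 * D.
    have q1 : n * (u / 16) <= n * w by rewrite ler_wpM2l// (le_trans (ltW m0)).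
    have q2 : m * u <= n * u by rewrite ler_wpM2r// ltW.
    lra.
  by move=> h; rewrite mulrAC ler_pdivlMr// mulrC.
have h1 : rho x * u <= n * u + L * u ^+ 2 by rewrite expr2 mulrA -mulrDl ler_wpM2r// ltW.
have h2 : n * u <= D + M / 2 * u ^+ 2.
  have q1 : n * (u / 2 - u ^+ 2 / 4) <= n * w by rewrite ler_wpM2l// (le_trans (ltW m0)).
  have q2 : n * u ^+ 2 <= M * u ^+ 2 by rewrite ler_wpM2r// sqr_ge0.
  lra.
have h3 : u ^+ 2 <= (kappa) ^+ 2 * D ^+ 2.
  by rewrite -exprMn ler_pXn2r// nnegrE ?(ltW u0)// (le_trans (ltW u0)).
have h4 : (M / 2 + L) * u ^+ 2 <= (M / 2 + L) * ((kappa) ^+ 2 * D ^+ 2).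
  by rewrite ler_wpM2l// addr_ge0// divr_ge0// (le_trans (ltW m0))// (le_trans nm).
rewrite /K -/u; lra.
Qed.

(** The parameters caught by a covering set span an interval whose end points are still at a chord
    distance at most the diameter of the set, so [arc_bound] bounds the [rho]-weight of the interval
    by [1 + K d] times that diameter. It remains to sum over the covering and let the scale [d] tend
    to 0. *)
Lemma hausdorff1_curve_ge (T : set R) (E : set mplane) : T `<=` `[a, b] ->
  measurable (T : set (measurableTypeR R)) -> polar_curve @` T `<=` E ->
  (\int[mu]_(t in T) (rho t)%:E <= hausdorff1 E)%E.
Proof.
move=> Tab mT TE.
have mrho : measurable_fun [set: R] rho by exact: continuous_measurable_fun.
have rho0 t : a <= t <= b -> 0 <= rho t by move=> /rhom /andP[h _]; exact: (le_trans (ltW m0)).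
have mJ : measurable (`[a, b]%classic : set (measurableTypeR R)) by exact: measurable_itv.
have rhoJ (t : measurableTypeR R) : `[a, b]%classic t -> 0 <= rho t by rewrite /= in_itv/=; exact: rho0.
(* The measure with density [rho] on [[a, b]]; its countable subadditivity is applied to the
   intervals obtained from a covering. *)
pose nu := dpush_measure mu mJ (@measurable_id _ (measurableTypeR R) `[a, b]%classic)
  (measurable_funTS mrho) rhoJ.
have nuE (A : set (measurableTypeR R)) : nu A = (\int[mu]_(t in `[a, b] `&` A) (rho t)%:E)%E.
  rewrite integral_mkcondr; apply: eq_integral => t _.
  by rewrite patchE indicE; case: ifPn; rewrite ?mul1e ?mul0e.
have -> : (\int[mu]_(t in T) (rho t)%:E = nu T)%E by rewrite nuE setIC; rewrite setIidl.
have K0 : 0 <= K by rewrite /K mulr_ge0// ?sqr_ge0// addr_ge0// divr_ge0.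
suff main (d : R) : 0 < d -> (nu T <= (1 + K * d)%:E * hausdorff1 E)%E.
  have [Hoo|Hfin] := eqVneq (hausdorff1 E) +oo%E; first by rewrite Hoo leey.
  have Hf : hausdorff1 E \is a fin_num by rewrite ge0_fin_numE// ltey.
  rewrite -(fineK Hf); set h := fine _; have h0 : 0 <= h by exact: fine_ge0.
  apply/lee_addgt0Pr => e e0.
  (* At this scale the error [K d h] is at most [e]. *)
  have d0 : 0 < e / (K * h + 1) by rewrite divr_gt0// ltr_wpDl// mulr_ge0.
  apply: (le_trans (main _ d0)); rewrite -(fineK Hf) -/h -EFinM -EFinD lee_fin mulrDl mul1r lerD2l.
  rewrite mulrAC mulrCA ger_pMr//.
  by rewrite ler_pdivrMr ?mul1r ?lerDl// ltr_wpDl// mulr_ge0.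
move=> d0.
have Kd : 0 < 1 + K * d by rewrite ltr_wpDr// mulr_ge0// ltW.
apply: (@le_trans _ _ ((1 + K * d)%:E * hausdorff1_pre d E)%E); last first.
  by rewrite lee_wpmul2l ?lee_fin ?(ltW Kd)//; exact: hausdorff1_pre_le.
suff : ((1 + K * d)^-1%:E * nu T <= hausdorff1_pre d E)%E.
  move=> h; have := @lee_wpmul2l _ (1 + K * d)%:E _ _ _ h; rewrite lee_fin (ltW Kd) => /(_ isT).
  by rewrite muleA -EFinM mulfV ?gt_eqF// mul1e.
apply: le_ereal_inf_tmp => _ [F [EF dF] <-].
have piece i : exists I : set R, [/\ measurable (I : set (measurableTypeR R)),
    T `&` polar_curve @^-1` (F i) `<=` I & (nu I <= (1 + K * d)%:E * diam (F i))%E].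
  set S := T `&` _.
  have [[t0 St0]|S0] := pselect (S !=set0); last first.
    exists set0; rewrite measure0; split => //; last by rewrite mule_ge0 ?diam_ge0// lee_fin ltW.
    by move=> t St; apply: S0; exists t.
  have diamfin : diam (F i) \is a fin_num.
    by rewrite ge0_fin_numE ?diam_ge0// (le_lt_trans (dF i))// ltry.
  pose D := fine (diam (F i)); have DE : diam (F i) = D%:E by rewrite fineK.
  have D0 : 0 <= D by rewrite fine_ge0// diam_ge0.
  have Dd : D <= d by have := dF i; rewrite DE lee_fin.
  have Sab t : S t -> a <= t <= b by move=> [/Tab]; rewrite /= in_itv.
  have hinf : has_inf S by split; [exists t0|exists a => t /Sab /andP[]].
  have hsup : has_sup S by split; [exists t0|exists b => t /Sab /andP[]].
  pose chord (s t : R) := (rho s - rho t) ^+ 2 + 4 * rho s * rho t * sin ((s - t) / 2) ^+ 2.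
  have chordS s t : S s -> S t -> chord s t <= D ^+ 2.
    move=> [_ Fs] [_ Ft]; rewrite /chord -polar_curve_dist2_sq.
    by rewrite ler_pXn2r ?nnegrE ?dist2_ge0// -lee_fin -DE; exact: dist2_le_diam.
  have chordC s t : chord s t = chord t s.
    by rewrite /chord -!polar_curve_dist2_sq dist2C.
  have cont_chord s t : {for t, continuous (chord s)}.
    by rewrite /chord; cont.
  have closedS s : closed [set t | chord s t <= D ^+ 2].
    have cC : continuous (chord s) by move=> x; exact: cont_chord.
    exact: (@closed_comp _ _ (chord s) [set y : R | y <= D ^+ 2] (fun x _ => cC x) (@closed_le _ _)).
  (* The bound on the chord is a closed condition in each variable, so it passes from [S] to its
     infimum and supremum, one variable at a time. *)
  have extend s : (forall t, S t -> chord s t <= D ^+ 2) ->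
      chord s (inf S) <= D ^+ 2 /\ chord s (sup S) <= D ^+ 2.
    move=> hs; have cS : closure S `<=` [set t | chord s t <= D ^+ 2].
      by rewrite closureE => x; apply; split => // t; exact: hs.
    split; apply: cS; last by apply: closure_sup; case: hsup.
    move=> U /nbhs_ballP[e /= e0 eU]; have [u Su ue] := inf_adherent e0 hinf.
    exists u; split => //; apply: eU; rewrite /ball/= ltr_norml.
    have h1 : inf S <= u by apply: ge_inf => //; case: hinf.
    by apply/andP; split; lra.
  have chord_is : chord (inf S) (sup S) <= D ^+ 2.
    apply: (extend _ _).2 => t St; rewrite chordC.
    by apply: (extend _ _).1 => u Su; exact: chordS.
  have dist_is : dist2 (polar_curve (inf S)) (polar_curve (sup S)) <= D.
    by rewrite -(@ler_pXn2r _ 2)// ?nnegrE ?dist2_ge0// polar_curve_dist2_sq.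
  have a_inf : a <= inf S by apply: lb_le_inf; [exists t0|move=> t /Sab /andP[]].
  have sup_b : sup S <= b by apply: sup_le_ub; [exists t0|move=> t /Sab /andP[]].
  have S_is t : S t -> inf S <= t <= sup S.
    move=> St; apply/andP; split; first by apply: ge_inf => //; case: hinf.
    by apply: ub_le_sup => //; case: hsup.
  exists `[inf S, sup S]%classic; split; first exact: measurable_itv.
    by move=> t St; rewrite /= in_itv/=; exact: S_is.
  rewrite nuE DE -EFinM.
  have -> : `[a, b] `&` `[inf S, sup S] = `[inf S, sup S]%classic.
    apply/setIidr => t; rewrite /= !in_itv/= => /andP[h1 h2].
    by rewrite (le_trans a_inf h1) (le_trans h2 sup_b).
  have is0 : inf S <= sup S by have /andP[h1 h2] := S_is _ St0; exact: le_trans h1 h2.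
  move: is0; rewrite le_eqVlt => /predU1P[<-|is_].
    by rewrite set_itv1 integral_set1 lee_fin mulr_ge0// ltW.
  (* The bound on [rho] given by [arc_bound]; integrated over the interval it gives back
     [(1 + K d) D]. *)
  pose B := (1 + K * d) * D / (sup S - inf S).
  apply: (@le_trans _ _ (\int[mu]_(t in `[inf S, sup S]) (cst B%:E) t)%E).
    apply: ge0_le_integral => //.
    - move=> t; rewrite /= in_itv/= => /andP[h1 h2].
      by rewrite lee_fin rho0// (le_trans a_inf h1) (le_trans h2 sup_b).
    - by apply/measurable_EFinP; exact: measurable_funTS.
    - move=> t; rewrite /= in_itv/= => /andP[h1 h2]; rewrite lee_fin /B ler_pdivlMr ?subr_gt0//.
      apply: (le_trans (arc_bound a_inf h1 h2 sup_b)); set D' := dist2 _ _ in dist_is *.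
      have D'0 : 0 <= D' by exact: dist2_ge0.
      have q : D' ^+ 2 <= d * D by rewrite expr2 ler_pM// (le_trans dist_is).
      have : K * D' ^+ 2 <= K * (d * D) by rewrite ler_wpM2l.
      by rewrite mulrDl mul1r -mulrA; lra.
  rewrite integral_cst//= lebesgue_measure_itv/= lte_fin is_ -EFinD -EFinM lee_fin /B divfK//.
  by rewrite gt_eqF// subr_gt0.
have [I hI] := choice piece.
apply: (@le_trans _ _ (\sum_(i <oo) diam (F i))%E) => //.
have h : (nu T <= \sum_(i <oo) nu (I i))%E.
  apply: measure_sigma_subadditive => //; first by move=> i; case: (hI i).
  move=> t Tt; have [i _ Fi] := EF _ (TE _ (ex_intro2 _ _ t Tt erefl)).
  by exists i => //; have [_ sub _] := hI i; apply: sub.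
apply: (@le_trans _ _ ((1 + K * d)^-1%:E * \sum_(i <oo) nu (I i))%E).
  by rewrite lee_wpmul2l// lee_fin invr_ge0 ltW.
rewrite -nneseriesZl; last by move=> *; exact: measure_ge0.
apply: lee_nneseries => [i _ _|i _]; first by rewrite mule_ge0// lee_fin invr_ge0 ltW.
have [_ _ h2] := hI i.
have := @lee_wpmul2l _ (1 + K * d)^-1%:E _ _ _ h2; rewrite lee_fin invr_ge0 (ltW Kd) => /(_ isT).
by rewrite muleA -EFinM mulVf ?gt_eqF// mul1e.
Qed.

End lower.
End curve_measure.

(** * Integrals over the exterior and the boundary of a polar domain *)

Section polar_domains.
Context {R : realType}.
Local Notation plane := (R * R)%type.
Local Notation mplane := (measurableTypeR R * measurableTypeR R)%type.
Local Notation mu := (@lebesgue_measure R).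

(** The polar description of a star-shaped domain, with explicit bounds and Lipschitz constant of
    the radius because they enter the constants of the boundary estimates and of the trace
    inequality. A disk has [m = M] and [L = 0]. *)
Record polar_domain (A : set plane) (rho : R -> R) (m M L : R) : Prop := PolarDomain {
  pd_cont : continuous rho;
  pd_pos : 0 < m;
  pd_lip0 : 0 <= L;
  pd_bnd : forall t, 0 <= t <= 2 * pi -> m <= rho t <= M;
  pd_lip : forall s t, 0 <= s <= 2 * pi -> 0 <= t <= 2 * pi -> `|rho s - rho t| <= L * `|s - t|;
  pd_boundary : boundary A = polar_curve rho @` `[0, 2 * pi]%classic;
  pd_exterior : forall r t, 0 < r -> 0 <= t <= 2 * pi ->
    exterior A (r * cos t, r * sin t) <-> rho t < r }.

Lemma measurable_boundary (A : set plane) : measurable (boundary A : set mplane).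
Proof.
apply: measurableD; first by apply: closed_measurable_plane; exact: closed_closure.
by apply: open_measurable_plane; exact: open_interior.
Qed.

Lemma open_exterior (A : set plane) : open (exterior A).
Proof. by apply: closed_openC; exact: closed_closure. Qed.

Lemma measurable_exterior (A : set plane) : measurable (exterior A : set mplane).
Proof. by apply: open_measurable_plane; exact: open_exterior. Qed.

Variables (A : set plane) (rho : R -> R) (m M L : R).
Hypothesis AP : polar_domain A rho m M L.

Let crho := pd_cont AP.
Let m0 := pd_pos AP.
Let ge_pi : 0 <= 2 * pi :> R. Proof. by rewrite mulr_ge0// pi_ge0. Qed.
Let mrho : measurable_fun [set: R] rho. Proof. exact: continuous_measurable_fun. Qed.
Let rho_gt0 t : 0 <= t <= 2 * pi -> 0 < rho t.
Proof. by move=> /(pd_bnd AP) /andP[h _]; exact: lt_le_trans h. Qed.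
Let M0 : 0 <= M.
Proof.
have := pd_bnd AP (t := 0); rewrite lexx => /(_ ge_pi)/andP[h1 h2].
exact: (le_trans (ltW m0) (le_trans h1 h2)).
Qed.

Let mI : measurable (`[0, 2 * pi]%classic : set (measurableTypeR R)). Proof. exact: measurable_itv. Qed.

Lemma ray_int_exterior (F : mplane -> \bar R) t : 0 <= t <= 2 * pi ->
  (ray_int (F \_ (exterior A)) t = \int[mu]_(r in `](rho t), +oo[) (F (r * cos t, r * sin t)%R * r%:E))%E.
Proof.
move=> tI; rewrite /ray_int integral_mkcond [RHS]integral_mkcond; apply: eq_integral => r _.
rewrite !patchE !mem_setE/= !in_itv/= !andbT.
have rt := rho_gt0 tI.
case: ifPn => r0; last by rewrite ifN// -leNgt (le_trans _ (ltW rt))// leNgt.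
have := pd_exterior AP r0 tI => E.
case: ifPn; rewrite ?inE ?notin_setE => h; first by rewrite (E.1 h).
by rewrite ifN ?mul0e//; apply/negP => /E.2.
Qed.

Let patch_ge0 (F : mplane -> \bar R) : (forall x, 0 <= F x)%E -> forall x, (0 <= (F \_ (exterior A)) x)%E.
Proof. by move=> F0 x; rewrite patchE; case: ifPn. Qed.

Let measurable_patch (F : mplane -> \bar R) : measurable_fun setT F -> measurable_fun setT (F \_ (exterior A)).
Proof. by move=> mF; apply/(measurable_restrictT _ _).1; [exact: measurable_exterior|exact: measurable_funTS]. Qed.

Lemma measurable_exterior_ray (F : mplane -> \bar R) : measurable_fun setT F -> (forall x, 0 <= F x)%E ->
  measurable_fun (`[0, 2 * pi]%classic : set (measurableTypeR R))
    (fun t => \int[mu]_(r in `](rho t), +oo[) (F (r * cos t, r * sin t)%R * r%:E))%E.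
Proof.
move=> mF F0; have := measurable_ray_int (measurable_patch mF) (patch_ge0 F0).
move=> /(measurable_funS measurableT (@subsetT _ `[0, 2 * pi]%classic)); apply: eq_measurable_fun.
by move=> t; rewrite inE/= in_itv/= => /ray_int_exterior.
Qed.

Lemma exterior_integral (F : mplane -> \bar R) : measurable_fun setT F -> (forall x, 0 <= F x)%E ->
  (\int[leb2]_(x in exterior A) F x =
   \int[mu]_(t in `[0%R, (2 * pi)%R]) \int[mu]_(r in `](rho t), +oo[)
      (F (r * cos t, r * sin t)%R * r%:E))%E.
Proof.
move=> mF F0; rewrite integral_mkcond leb2_polar; [|exact: measurable_patch|exact: patch_ge0].
by apply: eq_integral => t; rewrite inE/= in_itv/= => /ray_int_exterior.
Qed.

Let curve_bd t : 0 <= t <= 2 * pi -> boundary A (polar_curve rho t).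
Proof. by move=> tI; rewrite (pd_boundary AP); exists t => //=; rewrite in_itv. Qed.

Let mcurve : measurable_fun (`[0, 2 * pi]%classic : set (measurableTypeR R))
  (polar_curve rho : measurableTypeR R -> mplane).
Proof. exact: measurable_polar_curve. Qed.

Let bd_dpush (g : R -> R) (mg : measurable_fun (`[0, 2 * pi]%classic : set (measurableTypeR R)) g)
  (g0 : forall z : measurableTypeR R, `[0, 2 * pi]%classic z -> 0 <= g z) (F : mplane -> \bar R) :
  measurable_fun setT F -> (forall x, 0 <= F x)%E ->
  (\int[dpush_measure mu mI mcurve mg g0]_(x in boundary A) F x =
   \int[mu]_(t in `[0%R, (2 * pi)%R]) (F (polar_curve rho t) * (g t)%:E))%E.
Proof.
move=> mF F0; rewrite integral_mkcond ge0_integral_dpush; last 2 first.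
- by apply/(measurable_restrictT _ _).1; [exact: measurable_boundary|exact: measurable_funTS].
- by move=> x; rewrite patchE; case: ifPn.
apply: eq_integral => t; rewrite inE/= in_itv/= => tI.
by rewrite patchE mem_set//; exact: curve_bd.
Qed.

Let dpushE (g : R -> R) (mg : measurable_fun (`[0, 2 * pi]%classic : set (measurableTypeR R)) g)
  (g0 : forall z : measurableTypeR R, `[0, 2 * pi]%classic z -> 0 <= g z) (S : set mplane) :
  dpush_measure mu mI mcurve mg g0 S =
  (\int[mu]_(t in `[0%R, (2 * pi)%R] `&` polar_curve rho @^-1` S) (g t)%:E)%E.
Proof.
rewrite [RHS]integral_mkcondr; apply: eq_integral => t _.
rewrite patchE indicE.
have -> : (t \in polar_curve rho @^-1` S) = (polar_curve rho t \in S).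
  by apply/idP/idP; rewrite !inE.
by case: ifPn; rewrite ?mul1e ?mul0e.
Qed.

Let mT (S : set mplane) : measurable S ->
  measurable (`[0%R, (2 * pi)%R] `&` polar_curve rho @^-1` S : set (measurableTypeR R)).
Proof. by move=> mS; apply: mcurve. Qed.

Let lip_curve (s t : R) : 0 <= s <= 2 * pi -> 0 <= t <= 2 * pi ->
  dist2 (polar_curve rho s) (polar_curve rho t) <= Num.sqrt (L ^+ 2 + M ^+ 2) * `|s - t|.
Proof.
set C := Num.sqrt _; have C0 : 0 <= C by exact: sqrtr_ge0.
move=> sI tI.
rewrite -(@ler_pXn2r _ 2)// ?nnegrE ?dist2_ge0 ?mulr_ge0// polar_curve_dist2_sq.
rewrite exprMn sqr_sqrtr ?addr_ge0 ?sqr_ge0// [leRHS]mulrDl; apply: lerD.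
  by rewrite -exprMn -real_normK ?num_real// ler_pXn2r// ?nnegrE ?mulr_ge0 ?(pd_lip0 AP)//; exact: (pd_lip AP).
have /andP[s1 s2] := pd_bnd AP sI; have /andP[t1 t2] := pd_bnd AP tI.
have h1 : rho s * rho t <= M ^+ 2.
  by rewrite expr2; apply: ler_pM => //; exact: (le_trans (ltW m0)).
have h2 : 4 * sin ((s - t) / 2) ^+ 2 <= `|s - t| ^+ 2.
  have : `|sin ((s - t) / 2)| <= `|s - t| / 2.
    have [st|st] := leP 0 ((s - t) / 2).
      have h := sin_le_id st; rewrite ger0_norm.
        by rewrite ger0_norm//; lra.
      rewrite sin_ge0_pi// st/=; move/andP: sI => [? ?]; move/andP: tI => [? ?]; lra.
    have st' : 0 <= - ((s - t) / 2) by lra.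
    have h := sin_le_id st'; rewrite -normrN -sinN ger0_norm.
      by rewrite ltr0_norm//; lra.
    rewrite sin_ge0_pi// st'/=; move/andP: sI => [? ?]; move/andP: tI => [? ?]; lra.
  move=> h; rewrite -real_normK ?num_real//.
  have := ler_pM (normr_ge0 _) (normr_ge0 _) h h; rewrite -!expr2 expr_div_n; lra.
rewrite -mulrA -mulrA mulrC -mulrA mulrCA.
have h3 : 0 <= 4 * sin ((s - t) / 2) ^+ 2 by rewrite mulr_ge0// sqr_ge0.
rewrite [leLHS](_ : _ = (rho s * rho t) * (4 * sin ((s - t) / 2) ^+ 2)); last by ring.
by apply: ler_pM => //; rewrite mulr_ge0// ltW// rho_gt0.
Qed.

(** The polar curve is Lipschitz with constant [sqrt (L ^ 2 + M ^ 2)], so [hausdorff1] on the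
    boundary is dominated by the image of this multiple of [dt]. On a circle the constant is the
    radius and the estimate is sharp. *)
Lemma boundary_integral_le (F : mplane -> \bar R) : measurable_fun setT F -> (forall x, 0 <= F x)%E ->
  (\int[hausdorff1]_(x in boundary A) F x <=
   \int[mu]_(t in `[0%R, (2 * pi)%R]) (F (polar_curve rho t) * (Num.sqrt (L ^+ 2 + M ^+ 2))%:E))%E.
Proof.
move=> mF F0; set C := Num.sqrt _.
have C0 : 0 <= C by exact: sqrtr_ge0.
have Cp : 0 < C.
  rewrite sqrtr_gt0 ltr_wpDl ?sqr_ge0// exprn_gt0//.
  have := pd_bnd AP (t := 0); rewrite lexx => /(_ ge_pi)/andP[h1 h2].
  exact: (lt_le_trans m0 (le_trans h1 h2)).
have mC : measurable_fun (`[0, 2 * pi]%classic : set (measurableTypeR R)) (fun _ : R => C) by [].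
rewrite -(bd_dpush mC (fun _ _ => C0) mF F0).
rewrite [leLHS](eq_measure_integral (mrestr hausdorff1 (measurable_boundary A))); last first.
  move=> S mS SA; rewrite -[RHS]/(hausdorff1 (S `&` boundary A)). by rewrite setIidl.
apply: ge0_le_measure_integral => //; last exact: measurable_boundary.
move=> S mS; rewrite dpushE.
have -> : (\int[mu]_(t in `[0%R, (2 * pi)%R] `&` polar_curve rho @^-1` S) C%:E =
   C%:E * mu (`[0%R, (2 * pi)%R] `&` polar_curve rho @^-1` S))%E.
  by rewrite -integral_cst//; exact: mT.
rewrite -[leLHS]/(hausdorff1 (S `&` boundary A)); have -> : S `&` boundary A = polar_curve rho @` (`[0%R, (2 * pi)%R] `&` polar_curve rho @^-1` S).
  rewrite (pd_boundary AP); apply/seteqP; split => [x [Sx [t tI tx]]|_ [t [tI St] <-]].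
    by exists t => //; split => //=; rewrite /preimage/= tx.
  by split => //; exists t.
apply: (@hausdorff1_curve_le _ rho 0 (2 * pi) C Cp).
- exact: lip_curve.
- by move=> t [].
- exact: mT.
Qed.

(** The lower estimate for curves holds on parameter intervals of length at most [pi], so the two
    halves of the boundary are treated separately; a closed half-plane and its complement contain
    their images, and over these two sets [hausdorff1] is additive. *)
Lemma boundary_integral_ge (F : mplane -> \bar R) : measurable_fun setT F -> (forall x, 0 <= F x)%E ->
  (\int[mu]_(t in `[0%R, (2 * pi)%R]) (F (polar_curve rho t) * (rho t)%:E) <=
   \int[hausdorff1]_(x in boundary A) F x)%E.
Proof.
move=> mF F0.
have rho0 (z : measurableTypeR R) : `[0, 2 * pi]%classic z -> 0 <= rho z.
  by rewrite /= in_itv/= => zI; rewrite ltW// rho_gt0.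
rewrite -(bd_dpush (measurable_funTS mrho) rho0 mF F0).
rewrite [leRHS](eq_measure_integral (mrestr hausdorff1 (measurable_boundary A))); last first.
  by move=> S mS SA; rewrite -[RHS]/(hausdorff1 (S `&` boundary A)) setIidl.
apply: ge0_le_measure_integral => //; last exact: measurable_boundary.
move=> S mS; rewrite dpushE -[leRHS]/(hausdorff1 (S `&` boundary A)); set T := _ `&` _.
have mTS : measurable (T : set (measurableTypeR R)) by exact: mT.
have TI t : T t -> 0 <= t <= 2 * pi by case; rewrite /= in_itv.
pose U : set mplane := [set x | 0 <= x.2].
have mU : measurable U.
  apply: closed_measurable_plane; apply: (@closed_comp _ _ snd [set y : R | 0 <= y]); last exact: closed_ge.
  by move=> x _; exact: cvg_snd.
have mSb : measurable (S `&` boundary A : set mplane) by apply: measurableI => //; exact: measurable_boundary.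
have -> : hausdorff1 (S `&` boundary A) = (hausdorff1 (S `&` boundary A `&` U) + hausdorff1 (S `&` boundary A `&` ~` U))%E.
  rewrite -measureU; last 3 first.
  - exact: measurableI.
  - by apply: measurableI => //; exact: measurableC.
  - by apply/seteqP; split => // x [[_ ?] [_]].
  by rewrite -setIUr setUCr setIT.
(* The parameter [2 * pi] is left out of [T2]: it is a null set, and its image lies in the closed
   upper half-plane, which is reserved for [T1]. *)
pose T1 := T `&` `[0, pi]%classic; pose T2 := T `&` `]pi, (2 * pi)[%classic.
have pi0 := pi_gt0 R.
have -> : (\int[mu]_(t in T) (rho t)%:E = \int[mu]_(t in T1) (rho t)%:E + \int[mu]_(t in T2) (rho t)%:E)%E.
  have -> : T = T1 `|` (T `&` `]pi, (2 * pi)]%classic).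
    rewrite -setIUr; apply/esym/setIidl => t /TI /andP[t0 t2]; rewrite /= !in_itv/=.
    by have [h|h] := leP t pi; [left; rewrite t0|right].
  have mT' : measurable (T `&` `]pi, (2 * pi)%R] : set (measurableTypeR R)).
    by apply: measurableI => //; exact: measurable_itv.
  have mT1 : measurable (T1 : set (measurableTypeR R)).
    by apply: measurableI => //; exact: measurable_itv.
  rewrite ge0_integral_setU//.
  - congr (_ + _)%E; rewrite -[LHS](@integral_setD1 R _ (2 * pi)).
    + congr (integral _ _ _); apply/seteqP; split => t /=; rewrite /T2 /= !in_itv/=.
        by move=> [[Tt /andP[h1 h2]] h3]; split => //; rewrite h1 lt_neqAle h2 andbT; apply/eqP.
      move=> [Tt /andP[h1 h2]]; split; first by rewrite h1 ltW.
      by move=> tE; move: h2; rewrite tE ltxx.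
    + by apply: measurableD => //; exact: measurable_set1.
    + by apply/measurable_EFinP; apply: measurable_funTS.
  - by apply/measurable_EFinP; apply: measurable_funTS.
  - move=> t ht; rewrite lee_fin rho0//=; have Tt : T t by case: ht => -[].
    by rewrite in_itv/= TI.
  - rewrite disj_set2E; apply/eqP/seteqP; split => // t [[_ /=]]; rewrite in_itv/= => /andP[_ h1].
    by move=> [_ /=]; rewrite in_itv/= => /andP[h2 _]; move: (le_lt_trans h1 h2); rewrite ltxx.
apply: leeD.
  apply: (@hausdorff1_curve_ge R rho crho 0 pi m M L _ m0 M0 (pd_lip0 AP)).
  - by rewrite subr0.
  - by move=> t /andP[h1 h2]; apply: (pd_bnd AP); apply/andP; split; lra.
  - by move=> s t /andP[? ?] /andP[? ?]; apply: (pd_lip AP); apply/andP; split; lra.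
  - by move=> t [].
  - by apply: measurableI => //; exact: measurable_itv.
  - move=> _ [t [Tt tpi] <-]; split; first by split; [case: Tt|apply: curve_bd; exact: TI].
    move: tpi; rewrite /U /= in_itv/= => tpi.
    by rewrite mulr_ge0 ?sin_ge0_pi// ltW// rho_gt0// TI.
apply: (@hausdorff1_curve_ge R rho crho pi (2 * pi) m M L _ m0 M0 (pd_lip0 AP)).
- by rewrite mulr2n mulrDl mul1r addrK.
- by move=> t /andP[h1 h2]; apply: (pd_bnd AP); apply/andP; split; lra.
- by move=> s t /andP[? ?] /andP[? ?]; apply: (pd_lip AP); apply/andP; split; lra.
- by move=> t [_ /=]; rewrite !in_itv/= => /andP[h1 h2]; rewrite !ltW.
- by apply: measurableI => //; exact: measurable_itv.
move=> _ [t [Tt tpi] <-]; split; first by split; [case: Tt|apply: curve_bd; exact: TI].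
move: tpi; rewrite /U /= in_itv/= => /andP[t1 t2]; apply/negP; rewrite -ltNge pmulr_rlt0 ?rho_gt0 ?TI//.
have -> : t = (t - pi) + pi by ring.
by rewrite sinDpi oppr_lt0 sin_gt0_pi//; apply/andP; split; lra.
Qed.

End polar_domains.

(** * Exteriors of star-shaped domains in polar coordinates *)

Section polar_domain_topology.
Context {R : realType}.
Local Notation plane := (R * R)%type.

Definition ray_pt (t s : R) : plane := (s * cos t, s * sin t).

Lemma continuous_ray (t : R) : continuous (ray_pt t).
Proof.
move=> s; apply: (@cvg_pair _ _ _ _ (nbhs (s * cos t)) (nbhs (s * sin t))).
  have h : {for s, continuous (fun x : R => x * cos t)} by cont.
  exact: h.
have h : {for s, continuous (fun x : R => x * sin t)} by cont.
exact: h.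
Qed.

Lemma dist2_ray0 (t s : R) : 0 <= s -> dist2 (ray_pt t s) 0 = s.
Proof.
move=> s0; rewrite /dist2/= !subr0 !exprMn -mulrDr cos2Dsin2 mulr1.
by rewrite sqrtr_sqr ger0_norm.
Qed.

Lemma polar_rep (p : plane) : 0 < dist2 p 0 ->
  exists2 t, 0 <= t <= 2 * pi & p = ray_pt t (dist2 p 0).
Proof.
set s := dist2 p 0 => s0.
have s2 : p.1 ^+ 2 + p.2 ^+ 2 = s ^+ 2.
  by rewrite /s /dist2 sqr_sqrtr ?addr_ge0 ?sqr_ge0// !subr0.
pose x := p.1 / s; pose y := p.2 / s.
have xy : x ^+ 2 + y ^+ 2 = 1.
  by rewrite /x /y !expr_div_n -mulrDl s2 mulfV// expf_neq0// gt_eqF.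
have x1 : -1 <= x <= 1.
  rewrite -ler_norml -(@ler_pXn2r _ 2)// ?nnegrE// real_normK ?num_real// expr1n -xy lerDl.
  exact: sqr_ge0.
have p1 : p.1 = s * x by rewrite /x mulrC divfK ?gt_eqF.
have p2 : p.2 = s * y by rewrite /y mulrC divfK ?gt_eqF.
have a0 := acos_ge0 x1; have api := acos_lepi x1.
have ca := acosK x1.
have sa : sin (acos x) ^+ 2 = y ^+ 2 by rewrite sin2cos2 ca -xy; ring.
have sa0 : 0 <= sin (acos x) by rewrite sin_ge0_pi// a0.
have pi0 := pi_gt0 R.
have [y0|y0] := leP 0 y.
  exists (acos x); first by apply/andP; split; lra.
  have sy : sin (acos x) = y by apply/eqP; rewrite -(@eqrXn2 _ 2)// sa.
  by rewrite [LHS]surjective_pairing /ray_pt ca sy p1 p2.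
exists (2 * pi - acos x); first by apply/andP; split; lra.
have sy : sin (acos x) = - y.
  by apply/eqP; rewrite -(@eqrXn2 _ 2)// ?sa ?sqrrN// oppr_ge0 ltW.
have -> : 2 * pi - acos x = - acos x + pi *+ 2 by rewrite mulr2n; ring.
rewrite [LHS]surjective_pairing /ray_pt cosD2pi sinD2pi cosN sinN ca sy opprK.
by rewrite p1 p2.
Qed.

(** Angles range over a closed interval, so the two end points are the only ambiguity:
    [cos (t - t') = 1] in half-angle form leaves no other full turn. *)
Lemma ray_inj (s s' t t' : R) : 0 < s -> 0 < s' -> 0 <= t <= 2 * pi -> 0 <= t' <= 2 * pi ->
  ray_pt t s = ray_pt t' s' -> s = s' /\ [\/ t = t', t = 0 /\ t' = 2 * pi | t = 2 * pi /\ t' = 0].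
Proof.
move=> s0 s'0 /andP[t0 t2] /andP[t'0 t'2] E.
have ss : s = s' by rewrite -(dist2_ray0 t (ltW s0)) E dist2_ray0 ?ltW.
subst s'; split => //; case: E => /mulfI; rewrite gt_eqF// => /(_ isT) c /mulfI.
rewrite gt_eqF// => /(_ isT) si.
have h : sin ((t - t') / 2) = 0.
  have : cos (t - t') = 1 by rewrite cosB c si -!expr2 cos2Dsin2.
  have {1}-> : t - t' = (t - t') / 2 + (t - t') / 2 by field.
  rewrite cosD => h; have := cos2Dsin2 ((t - t') / 2) => h2.
  by apply/eqP; rewrite -sqrf_eq0; apply/eqP; lra.
have pi0 := pi_gt0 R.
have [tt|tt|->] := ltgtP t t'; last by apply: Or31.
  apply: Or32; have [tpi|tpi] := ltP (t' - t) (2 * pi).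
    have : 0 < sin ((t' - t) / 2) by apply: sin_gt0_pi; apply/andP; split; lra.
    have -> : (t' - t) / 2 = - ((t - t') / 2) by field.
    by rewrite sinN h oppr0 ltxx.
  by split; lra.
apply: Or33; have [tpi|tpi] := ltP (t - t') (2 * pi).
  have : 0 < sin ((t - t') / 2) by apply: sin_gt0_pi; apply/andP; split; lra.
  by rewrite h ltxx.
by split; lra.
Qed.

(** Connectedness along a curve: the parameters sent into [U] are relatively open and, being those
    not sent into [V], relatively closed. *)
Lemma interval_separation (I : set R) (f : R -> plane) (U V : set plane) (x y : R) :
  is_interval I -> continuous f -> open U -> open V -> U `&` V = set0 ->
  (forall z, I z -> U (f z) \/ V (f z)) -> I x -> U (f x) -> I y -> U (f y).
Proof.
move=> /connected_intervalP cI cf oU oV UV IUV Ix Ux Iy.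
have oF W : open W -> open (f @^-1` W) by move: cf => /continuousP; apply.
have BI : I `&` f @^-1` U = I.
  apply: cI; first by exists x.
    by exists (f @^-1` U) => //; exact: oF.
  exists (~` (f @^-1` V)); first by apply: open_closedC; exact: oF.
  apply/seteqP; split => z [Iz Uz]; split => //.
    by move=> Vz; have : (U `&` V) (f z) by []; rewrite UV.
  by case: (IUV _ Iz).
by move: Iy; rewrite -BI => -[].
Qed.

Section star_shaped.
Variables (A : set plane) (rho : R -> R).
Hypotheses (oA : open A) (bA : bounded_set A) (A0 : A 0).
Hypotheses (rho0 : forall t, 0 <= t <= 2 * pi -> 0 < rho t) (rhop : rho 0 = rho (2 * pi)).
Hypothesis bd : boundary A = polar_curve rho @` `[0, 2 * pi]%classic.

Let boundary_ray (t s : R) : 0 < s -> 0 <= t <= 2 * pi -> boundary A (ray_pt t s) <-> s = rho t.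
Proof.
move=> s0 tI; rewrite bd; split => [[t' /= t'I]|->]; last by exists t => //=; rewrite in_itv.
rewrite in_itv/= in t'I.
move=> /(ray_inj (rho0 t'I) s0 t'I tI) [<-] [->|[-> ->]|[-> ->]] //.
Qed.

Let trichotomy p : [\/ A p, boundary A p | exterior A p].
Proof.
have [Ap|nAp] := pselect (A p); first by constructor 1.
have [cp|ncp] := pselect (closure A p); last by constructor 3.
by constructor 2; split => // /interior_subset.
Qed.

Let A_boundary p : A p -> ~ boundary A p.
Proof. by move=> Ap [_]; apply; rewrite /interior; exact: open_nbhs_nbhs. Qed.

Let A_exterior : A `&` exterior A = set0.
Proof. by apply/seteqP; split => // p [Ap]; apply; exact: subset_closure. Qed.

(** The hypothesis describes the boundary only. A ray from the origin meets it once, so the ray can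
    pass from [A] to the exterior only there. Before that point it is in [A], where it starts; one
    point of [A] beyond it would force the whole rest of the ray into [A], against boundedness. *)
Lemma star_shaped_ray (t s : R) : 0 < s -> 0 <= t <= 2 * pi -> A (ray_pt t s) <-> s < rho t.
Proof.
move=> s0 tI; have ipos : forall b, is_interval [set x : R | 0 <= x < b].
  by move=> b x y /= /andP[x0 _] /andP[_ yb] z /andP[xz zy]; rewrite (le_trans x0 xz) (le_lt_trans zy yb).
split => [As|srho]; last first.
  apply: (@interval_separation [set x : R | 0 <= x < rho t] (ray_pt t) A (exterior A) 0 s (ipos _) (@continuous_ray t) oA (@open_exterior _ A) A_exterior).
  - move=> x /= /andP[x0 xr]; move: x0; rewrite le_eqVlt => /predU1P[<-|x0].
      by left; rewrite /ray_pt !mul0r.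
    case: (trichotomy (ray_pt t x)); [by left| |by right].
    by move=> /(boundary_ray x0 tI) xE; move: xr; rewrite xE ltxx.
  - by rewrite /= lexx rho0.
  - by rewrite /ray_pt !mul0r.
  - by rewrite /= (ltW s0).
rewrite ltNge; apply/negP; rewrite le_eqVlt => /predU1P[E|rs].
  by apply: (A_boundary As); apply/boundary_ray.
have iI : is_interval [set x : R | rho t < x].
  by move=> x y /= xr yr z /andP[xz zy]; exact: lt_le_trans xz.
have allA : forall y, rho t < y -> A (ray_pt t y).
  move=> y ry.
  apply: (@interval_separation _ (ray_pt t) A (exterior A) s y iI (@continuous_ray t) oA (@open_exterior _ A) A_exterior) => //.
  move=> x /= xr; have x0 : 0 < x by apply: lt_trans xr; exact: rho0.
  case: (trichotomy (ray_pt t x)); [by left| |by right].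
  by move=> /(boundary_ray x0 tI) xE; move: xr; rewrite xE ltxx.
have [K [_ hK]] := bA.
have {}hK p : A p -> `|p| <= Num.max K 0 + 1.
  by apply: hK; rewrite ltr_pwDr// le_max lexx.
(* The norm of the plane is the maximum norm, and one of [cos t], [sin t] is at least [1/2] in
   absolute value; hence the factor 2. *)
pose y := rho t + 2 * (Num.max K 0 + 1).
have K0 : 0 <= Num.max K 0 by rewrite le_max lexx orbT.
have y0 : 0 < y by rewrite addr_gt0 ?rho0// mulr_gt0// ltr_pwDr.
have ry : rho t < y by rewrite ltrDl mulr_gt0// ltr_pwDr.
have := hK (ray_pt t y) (allA y ry).
rewrite /Num.norm/= ge_max !normrM (gtr0_norm y0) => /andP[h1 h2].
have := cos2Dsin2 t; rewrite -(real_normK (num_real (cos t))) -(real_normK (num_real (sin t))) => c.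
have r0 := rho0 tI.
have [hc|hc] := leP (1/2) `|cos t|.
  have : y * (1/2) <= y * `|cos t| by rewrite ler_wpM2l// ltW.
  rewrite /y in h1 *; lra.
have hs : 1/2 <= `|sin t|.
  rewrite leNgt; apply/negP => hs; have := normr_ge0 (cos t); have := normr_ge0 (sin t); nra.
have : y * (1/2) <= y * `|sin t| by rewrite ler_wpM2l// ltW.
rewrite /y in h2 *; lra.
Qed.

Lemma star_shaped_exterior (s t : R) : 0 < s -> 0 <= t <= 2 * pi ->
  exterior A (s * cos t, s * sin t) <-> rho t < s.
Proof.
move=> s0 tI; rewrite -/(ray_pt t s); split => [es|rs].
  rewrite ltNge; apply/negP; rewrite le_eqVlt => /predU1P[E|sr].
    by have /(boundary_ray s0 tI).2 [cs _] := E; exact: es.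
  by have /(star_shaped_ray s0 tI).2 As := sr; apply: es; exact: subset_closure.
case: (trichotomy (ray_pt t s)) => //.
  by move=> /(star_shaped_ray s0 tI); rewrite ltNge (ltW rs).
by move=> /(boundary_ray s0 tI) E; move: rs; rewrite E ltxx.
Qed.

End star_shaped.

Let sqd (x : plane) : R := x.1 ^+ 2 + x.2 ^+ 2.

Let sqd_cont : continuous sqd.
Proof. by move=> x; have h : {for x, continuous sqd} by rewrite /sqd; cont; exact: h. Qed.

Let dist2_lt (x : plane) (r : R) : 0 < r -> (dist2 x 0 < r) = (sqd x < r ^+ 2).
Proof.
move=> r0; rewrite /dist2 !subr0 -[in LHS](gtr0_norm r0) -sqrtr_sqr ltr_sqrt//.
by rewrite exprn_gt0.
Qed.

Lemma open_disk (r : R) : 0 < r -> open (disk 0 r : set plane).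
Proof.
move=> r0; rewrite (_ : disk 0 r = sqd @^-1` [set y | y < r ^+ 2]).
  by apply: open_comp; [move=> ? _; exact: sqd_cont|exact: open_lt].
by apply/seteqP; split => x /=; rewrite /disk/= dist2_lt.
Qed.

Lemma closure_disk (r : R) : 0 < r -> closure (disk 0 r : set plane) = [set x | dist2 x 0 <= r].
Proof.
move=> r0; apply/seteqP; split => [x|x /= xr].
  have cD : closed [set x : plane | dist2 x 0 <= r].
    rewrite (_ : [set _ | _] = sqd @^-1` [set y | y <= r ^+ 2]).
      by apply: closed_comp; [move=> ? _; exact: sqd_cont|exact: closed_le].
    by apply/seteqP; split => y /=; rewrite le_dist2 ?(ltW r0)// !subr0.
  rewrite closureE; apply; split => // y; rewrite /disk/=; exact: ltW.
move: xr; rewrite le_eqVlt => /predU1P[xr|xr]; last by apply: subset_closure.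
have [t tI xE] : exists2 t, 0 <= t <= 2 * pi & x = ray_pt t (dist2 x 0) by apply: polar_rep; rewrite xr.
rewrite xr in xE; rewrite xE => B nB.
have /nbhs_ballP[e /= e0 eB] : nbhs r (ray_pt t @^-1` B) by exact: (@continuous_ray t r).
(* A smaller radius on the same ray: the minimum with [r] keeps it positive, and the half keeps the
   point inside the neighbourhood. *)
pose s := r - Num.min e r / 2.
have m0 : 0 < Num.min e r by rewrite lt_min e0.
have mr : Num.min e r <= r by rewrite ge_min lexx orbT.
have me : Num.min e r <= e by rewrite ge_min lexx.
exists (ray_pt t s); split.
  by rewrite /disk/= dist2_ray0 /s; lra.
apply: eB; rewrite /ball/= /s opprB addrC subrK gtr0_norm ?divr_gt0//; lra.
Qed.

Lemma polar_domain_disk (r : R) : 0 < r -> polar_domain (disk 0 r) (fun=> r) r r 0.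
Proof.
move=> r0; have oD := open_disk r0; have pi0 := pi_gt0 R.
split => //.
- by move=> x; exact: cst_continuous.
- by move=> t _; rewrite lexx.
- by move=> s t _ _; rewrite subrr normr0 mul0r.
- rewrite /boundary closure_disk// ((interior_id _).1 oD); apply/seteqP; split.
    move=> x [/= xr]; rewrite /disk/= => /negP; rewrite -leNgt => rx.
    have E : dist2 x 0 = r by apply/eqP; rewrite eq_le xr.
    have [t tI xE] : exists2 t, 0 <= t <= 2 * pi & x = ray_pt t (dist2 x 0) by apply: polar_rep; rewrite E.
    by exists t; [rewrite /= in_itv|rewrite xE E].
  move=> _ [t tI <-]; have E : dist2 (polar_curve (fun=> r) t) 0 = r by exact: (dist2_ray0 t (ltW r0)).
  by split; rewrite /= /disk/= E ?ltxx.
- move=> s t s0 tI; rewrite /exterior closure_disk// -/(ray_pt t s).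
  split=> [h|rs]; last by move=> /=; rewrite dist2_ray0 ?(ltW s0)// leNgt rs.
  by rewrite ltNge; apply/negP => sr; apply: h; rewrite /= dist2_ray0 ?(ltW s0).
Qed.

(** The strict inclusion provides a point of the domain outside the open disk. Its modulus is at
    least [r], and it lies strictly below the boundary on its ray, which gives an angle with
    [r < rho t]. The constants [M] and [L] are maxima of continuous functions. *)
Lemma polar_domain_star_shaped (A : set plane) (r : R) : 0 < r ->
  bounded_smooth_domain A -> strictly_star_shaped A -> disk 0 r `<` A ->
  exists rho m M L, [/\ polar_domain A rho m M L,
    forall t, 0 <= t <= 2 * pi -> r <= rho t &
    exists2 t, 0 <= t <= 2 * pi & r < rho t].
Proof.
move=> r0 [_ oA _ bA _] [rho [srho rho0 rhop bd]].
rewrite properEneq => -[dneq dsub].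
have pi2 : 0 <= 2 * pi :> R by rewrite mulr_ge0// pi_ge0.
have rho_gt0 t : 0 <= t <= 2 * pi -> 0 < rho t by move=> tI; apply: rho0; rewrite in_itv.
have drho (t : R) : is_derive t 1 rho (derive1 rho t) by rewrite derive1E; exact/derivableP/(srho 0%N t).
have crho : continuous rho by move=> t; exact: is_derive_continuous (drho t).
have cdrho : continuous (derive1 rho).
  move=> t; exact: (is_derive_continuous (derivableP (srho 1%N t))).
have A0 : A 0.
  by apply: dsub; rewrite /disk/= /dist2 !subrr expr0n/= addr0 sqrtr0.
have ray := star_shaped_ray oA bA A0 rho_gt0 (rhop 0%N) bd.
have ext := star_shaped_exterior oA bA A0 rho_gt0 (rhop 0%N) bd.
have rle t : 0 <= t <= 2 * pi -> r <= rho t.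
  move=> tI; rewrite leNgt; apply/negP => rr.
  have : A (ray_pt t (rho t)) by apply: dsub; rewrite /disk/= dist2_ray0// ltW// rho_gt0.
  by move=> /(ray _ _ (rho_gt0 _ tI) tI); rewrite ltxx.
have [M hM] : exists M, forall t, 0 <= t <= 2 * pi -> rho t <= M.
  have [c cI hc] := EVT_max pi2 (continuous_subspaceT crho).
  by exists (rho c) => t tI; apply: hc; rewrite in_itv.
have [L L0 hL] : exists2 L, 0 <= L & forall t, 0 <= t <= 2 * pi -> `|derive1 rho t| <= L.
  have cn : continuous (fun t => `|derive1 rho t|).
    by move=> t; apply: continuous_comp; [exact: cdrho|exact: norm_continuous].
  have [c cI hc] := EVT_max pi2 (continuous_subspaceT cn).
  by exists `|derive1 rho c| => // t tI; apply: hc; rewrite in_itv.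
exists rho, r, M, L; split => //.
- split => //.
  + by move=> t tI; rewrite rle// hM.
  + move=> s t sI tI; wlog st : s t sI tI / s <= t.
      move=> W; have [h|h] := leP s t; first exact: W.
      by rewrite distrC (distrC s); apply: W => //; exact: ltW.
    move: sI tI => /andP[s0 s2] /andP[t0 t2].
    have d1 (x : R) : s <= x <= t -> is_derive x 1 (fun x : R => L * x - rho x) (L - derive1 rho x).
      by move=> _; have := drho x => ?; der; ring.
    have d2 (x : R) : s <= x <= t -> is_derive x 1 (fun x : R => L * x + rho x) (L + derive1 rho x).
      by move=> _; have := drho x => ?; der; ring.
    have bnd x : s < x < t -> - L <= derive1 rho x <= L.
      move=> /andP[sx xt]; rewrite -ler_norml; apply: hL.
      by rewrite (le_trans s0 (ltW sx)) (le_trans (ltW xt) t2).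
    have h1 : L * s - rho s <= L * t - rho t.
      by apply: (derive_ge0_le st d1) => x /bnd /andP[]; lra.
    have h2 : L * s + rho s <= L * t + rho t.
      by apply: (derive_ge0_le st d2) => x /bnd /andP[]; lra.
    by rewrite (distrC s) (ger0_norm (x := t - s)) ?subr_ge0// ler_norml; apply/andP; split; lra.
- have [p [Ap nD]] : exists p, A p /\ ~ disk 0 r p.
    apply: contrapT => /forallNP h; move/eqP: dneq; apply; apply/seteqP; split => // x Ax.
    by apply: contrapT => nd; apply: (h x).
  have pr : r <= dist2 p 0 by rewrite leNgt; apply/negP => ?; apply: nD.
  have p0 : 0 < dist2 p 0 by exact: lt_le_trans pr.
  have [t tI pE] := polar_rep p0.
  exists t => //; apply: (le_lt_trans pr); apply/(ray _ _ p0 tI).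
  by rewrite -pE.
Qed.

End polar_domain_topology.

(** * The radial profile *)

Section bessel_function.
Context {R : realType}.
Implicit Types (x y z t : R).

Lemma derive_gt0_lt (f df : R -> R) (a b : R) : a < b ->
  (forall x, a <= x <= b -> is_derive x 1 f (df x)) ->
  (forall x, a < x < b -> 0 < df x) -> f a < f b.
Proof.
move=> ab hf df0.
have h : forall x : R, x \in `]a, b[ -> is_derive x 1 f (df x).
  by move=> x; rewrite in_itv/= => /andP[ax xb]; apply: hf; rewrite !ltW.
have [c] := MVT ab h (within_continuous_derive hf).
by rewrite in_itv/= => cab E; rewrite -subr_gt0 E mulr_gt0 ?df0// subr_gt0.
Qed.

Section factorial_series.
Variable c : R^nat.
Hypothesis c0 : forall n, 0 <= c n.
Hypothesis c1 : forall n, c n <= n`!%:R^-1.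

Lemma cvg_factorial_series x : cvgn (pseries c x).
Proof.
have h : cvgn (pseries c (`|x| + 1)).
  apply: (@series_le_cvg _ _ (exp_coeff (`|x| + 1))).
  - by move=> n; rewrite mulr_ge0// exprn_ge0// addr_ge0.
  - by move=> n; rewrite exp_coeff_ge0// addr_ge0.
  - by move=> n; rewrite /exp_coeff/= mulrC ler_wpM2l// exprn_ge0// addr_ge0.
  - exact: is_cvg_series_exp_coeff.
apply: (is_cvg_pseries_inside h).
by rewrite (@ger0_norm _ (`|x| + 1)) ?addr_ge0// ltrDl.
Qed.

Lemma factorial_series_ge x n : 0 <= x -> series (fun i => c i * x ^+ i) n <= limn (pseries c x).
Proof.
move=> x0; apply: nondecreasing_cvgn_le; last exact: cvg_factorial_series.
by apply: nondecreasing_series => i _ _; rewrite mulr_ge0// exprn_ge0.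
Qed.
End factorial_series.

(** In terms of modified Bessel functions the sums are [S1 y = sqrt y I_1 (2 sqrt y)],
    [S2 y = I_0 (2 sqrt y)] and [S3 y = I_1 (2 sqrt y) / sqrt y]. The leading zero of [c1] makes
    each of the three sequences the formal derivative of the preceding one. *)
Let c1 (n : nat) : R := if n is m.+1 then (m`! * (m.+1)`!)%:R^-1 else 0.
Let c2 (n : nat) : R := (n`! * n`!)%:R^-1.
Let c3 (n : nat) : R := (n`! * (n.+1)`!)%:R^-1.

Let inv_le (a b : nat) : (0 < a)%N -> (0 < b)%N -> (a * b)%:R^-1 <= b%:R^-1 :> R.
Proof. by move=> a0 b0; rewrite lef_pV2 ?posrE ?ltr0n ?muln_gt0 ?a0// ler_nat leq_pmull. Qed.

Let c1_0 n : 0 <= c1 n. Proof. by case: n => // n; rewrite /c1 invr_ge0. Qed.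
Let c1_1 n : c1 n <= n`!%:R^-1.
Proof. by case: n => [|n]; rewrite /c1 ?invr_ge0// inv_le// fact_gt0. Qed.
Let c2_0 n : 0 <= c2 n. Proof. by rewrite /c2 invr_ge0. Qed.
Let c2_1 n : c2 n <= n`!%:R^-1. Proof. by rewrite inv_le// fact_gt0. Qed.
Let c3_0 n : 0 <= c3 n. Proof. by rewrite /c3 invr_ge0. Qed.
Let c3_1 n : c3 n <= n`!%:R^-1. Proof. by rewrite /c3 mulnC inv_le// fact_gt0. Qed.

Let fact_neq0 n : n`!%:R != 0 :> R. Proof. by rewrite pnatr_eq0 -lt0n fact_gt0. Qed.

Let diffs1 : pseries_diffs c1 = c2.
Proof.
apply/funext => n; rewrite /pseries_diffs /c1 /c2 factS !natrM.
by field; rewrite !fact_neq0 /= addrC natr1 pnatr_eq0.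
Qed.

Let diffs2 : pseries_diffs c2 = c3.
Proof.
apply/funext => n; rewrite /pseries_diffs /c2 /c3 factS !natrM.
by field; rewrite !fact_neq0 /= addrC natr1 pnatr_eq0.
Qed.

(** Termwise differentiation of [S2] asks for convergence of the second formal derivative of its
    series. *)
Let c4 := pseries_diffs c3.
Let c4_0 n : 0 <= c4 n. Proof. by rewrite /c4 /pseries_diffs mulr_ge0. Qed.
Let c4_1 n : c4 n <= n`!%:R^-1.
Proof.
have -> : c4 n = (n`! * (n.+2)`!)%:R^-1.
  have e1 : ((n.+1)`! * (n.+2)`!)%:R = n.+1%:R * (n`!%:R * (n.+2)`!%:R) :> R.
    by rewrite (factS n) -mulnA !natrM.
  have e2 : (n`! * (n.+2)`!)%:R = n`!%:R * (n.+2)`!%:R :> R by rewrite natrM.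
  rewrite /c4 /pseries_diffs /c3 e1 e2.
  have n1 : n.+1%:R != 0 :> R by rewrite pnatr_eq0.
  have := fact_neq0 n; have := fact_neq0 n.+2; move: (n.+2)`! n`! n1 => p q; move: n.+1%:R p%:R q%:R => x y z x0 y0 z0.
  by field; rewrite x0 y0 z0.
by rewrite mulnC inv_le// fact_gt0.
Qed.

Let S1 (y : R) : R := limn (pseries c1 y).
Let S2 (y : R) : R := limn (pseries c2 y).
Let S3 (y : R) : R := limn (pseries c3 y).

Let dS1 y : is_derive y 1 S1 (S2 y).
Proof.
rewrite /S2 -diffs1; apply: (@pseries_snd_diffs R c1 (`|y| + 1)).
- exact: cvg_factorial_series.
- by rewrite diffs1; exact: cvg_factorial_series.
- by rewrite diffs1 diffs2; exact: cvg_factorial_series.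
- by rewrite (@ger0_norm _ (`|y| + 1)) ?addr_ge0// ltrDl.
Qed.

Let dS2 y : is_derive y 1 S2 (S3 y).
Proof.
rewrite /S3 -diffs2; apply: (@pseries_snd_diffs R c2 (`|y| + 1)).
- exact: cvg_factorial_series.
- by rewrite diffs2; exact: cvg_factorial_series.
- by rewrite diffs2; exact: (cvg_factorial_series c4_0 c4_1).
- by rewrite (@ger0_norm _ (`|y| + 1)) ?addr_ge0// ltrDl.
Qed.

(** As [S3] is the second derivative of [S1], this is the equation [y S1'' = S1]. *)
Let S13 y : S1 y = y * S3 y.
Proof.
have h0 : pseries c1 y @ \oo --> S1 y. by exact: (cvg_factorial_series c1_0 c1_1).
have h1 : (fun n => pseries c1 y n.+1) @ \oo --> S1 y.
  by move: h0; rewrite -(cvg_shiftS (pseries c1 y)).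
have h3 : (fun n => y * pseries c3 y n) @ \oo --> y * S3 y.
  by apply: cvgM; [exact: cvg_cst|exact: (cvg_factorial_series c3_0 c3_1)].
suff E : (fun n => pseries c1 y n.+1) = (fun n => y * pseries c3 y n).
  by rewrite E in h1; exact: (cvg_unique _ h1 h3).
apply/funext => n; rewrite /pseries /series/= big_nat_recl//= mul0r add0r mulr_sumr.
by apply: eq_bigr => i _; rewrite /c3 exprS; ring.
Qed.

Let S1_ge y : 0 <= y -> y <= S1 y.
Proof.
move=> y0; apply: (le_trans _ (factorial_series_ge c1_0 c1_1 2 y0)).
by rewrite /series/= big_nat_recr//= big_nat1 /= mul0r add0r !factE muln1 invr1 mul1r expr1.
Qed.

Let S2_ge y : 0 <= y -> 1 <= S2 y.
Proof.
move=> y0; apply: (le_trans _ (factorial_series_ge c2_0 c2_1 1 y0)).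
by rewrite /series/= big_nat1 /c2 fact0 muln1 invr1 expr0 mulr1.
Qed.

Local Notation mu := (@lebesgue_measure R).
(** Reduction of order: [y S1'' = S1] has no first order term, so [S1] times a primitive of
    [S1 ^ -2] is another solution. Integrating up to infinity selects the decaying one, a multiple
    of [sqrt y K_1 (2 sqrt y)]. *)
Let h t := (S1 t ^+ 2)^-1.
Let T y := (\int[mu]_(t in `[y, +oo[) h t)%R.

Let S1_gt0 y : 0 < y -> 0 < S1 y.
Proof. by move=> y0; apply: (lt_le_trans y0); apply: S1_ge; exact: ltW. Qed.

Let h_cont y : 0 < y -> {for y, continuous h}.
Proof.
move=> y0; have cS : {for y, continuous S1} by exact: is_derive_continuous (dS1 y).
by rewrite /h; cont; rewrite expf_neq0// gt_eqF// S1_gt0.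
Qed.

Let h_meas y : 0 < y -> measurable_fun `[y, +oo[ h.
Proof.
move=> y0; have mo : measurable_fun `](@GRing.zero R), +oo[ h.
  apply: open_continuous_measurable_fun => // z; rewrite inE/= in_itv/= andbT.
  exact: h_cont.
apply: (measurable_funS _ _ mo) => // z /=; rewrite !in_itv/= !andbT; exact: lt_le_trans.
Qed.

Let h_ge0 y : 0 <= h y. Proof. by rewrite /h invr_ge0 sqr_ge0. Qed.

Let int_inv_sq y : 0 < y -> (\int[mu]_(t in `[y, +oo[) (t ^- 2)%:E = (y^-1)%:E)%E.
Proof.
move=> y0.
have dI (z : R) : y <= z -> is_derive z 1 (fun t : R => - t^-1) (z ^- 2).
  move=> yz; have z0 : z != 0 by rewrite gt_eqF// (lt_le_trans y0).
  by der => //; field.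
have E := @ge0_continuous_FTC2y R (fun t => t ^- 2) (fun t => - t^-1) y 0.
rewrite E ?sub0r ?opprK//.
- by rewrite -EFinB sub0r opprK.
- by move=> x _; rewrite invr_ge0 sqr_ge0.
- apply: continuous_in_subspaceT => z; rewrite inE/= in_itv/= andbT => yz.
  have z0 : z != 0 by rewrite gt_eqF// (lt_le_trans y0).
  have C : {for z, continuous (fun t : R => t ^- 2)} by cont; rewrite expf_neq0.
  exact: C.
- rewrite -oppr0; apply: cvgN; apply/gtr0_cvgV0; last exact: cvg_id.
  exact: nbhs_pinfty_gt.
- by move=> x yx; have [] := dI x (ltW yx).
- apply: cvgN; apply: cvg_at_right_filter; apply: cvgV; [by rewrite gt_eqF|exact: cvg_id].
- move=> x; rewrite in_itv/= andbT => yx; rewrite derive1E.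
  by have [_ ->] := dI x (ltW yx).
Qed.

Let Tint y : 0 < y -> (\int[mu]_(t in `[y, +oo[) (h t)%:E <= (y^-1)%:E)%E.
Proof.
move=> y0; rewrite -int_inv_sq//; apply: ge0_le_integral => //.
- by move=> t _; rewrite lee_fin h_ge0.
- by apply/measurable_EFinP; apply: h_meas.
- apply/measurable_EFinP; apply: measurable_funTS.
  by apply: (measurableT_comp measurable_invr); exact: exprn_measurable.
- move=> t /=; rewrite in_itv/= andbT => yt; rewrite lee_fin.
  have t0 : 0 < t by exact: lt_le_trans yt.
  rewrite lef_pV2 ?posrE ?exprn_gt0 ?S1_gt0// ler_pXn2r ?nnegrE ?(ltW t0)//.
    exact: S1_ge (ltW t0).
  by rewrite ltW// S1_gt0.
Qed.

Let h_integrable y : 0 < y -> mu.-integrable `[y, +oo[ (EFin \o h).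
Proof.
move=> y0; apply/integrableP; split; first by apply/measurable_EFinP; apply: h_meas.
under eq_integral do rewrite /= ger0_norm//.
by rewrite (le_lt_trans (Tint y0))// ltry.
Qed.

Let h_integrable_sub a (D : set (measurableTypeR R)) : 0 < a -> measurable D ->
  D `<=` `[a, +oo[%classic -> mu.-integrable D (EFin \o h).
Proof.
move=> a0 mD sub.
exact: (@integrableS _ _ R mu `[a, +oo[%classic D (EFin \o h) (measurable_itv _) mD sub (h_integrable a0)).
Qed.

Let T_ge0 y : 0 <= T y. Proof. by apply: Rintegral_ge0. Qed.

Let T_le y : 0 < y -> T y <= y^-1.
Proof.
move=> y0; rewrite /T /Rintegral -lee_fin fineK ?Tint//.
by rewrite ge0_fin_numE ?integral_ge0// ?(le_lt_trans (Tint y0)) ?ltry// => t _; rewrite lee_fin h_ge0.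
Qed.

Let T_split a y : 0 < a -> a < y -> T a = (\int[mu]_(t in `[a, y]) h t)%R + T y.
Proof.
move=> a0 ay; rewrite /T.
have E : `[a, +oo[%classic = `[a, y] `|` `]y, +oo[%classic :> set R.
  apply/seteqP; split => z /=; rewrite !in_itv/= ?andbT.
    by move=> az; have [|] := leP z y; [left; rewrite az|right].
  by case=> [/andP[]//|yz]; rewrite ltW// (lt_trans ay).
rewrite E Rintegral_setU//; last 2 first.
- by rewrite -E; exact: h_integrable.
- rewrite disj_set2E; apply/eqP/seteqP; split => // z [] /=; rewrite !in_itv/= andbT.
  by move=> /andP[_ zy] yz; move: (lt_le_trans yz zy); rewrite ltxx.
congr (_ + _); apply: Rintegral_itv_obnd_cbnd.
have my := h_integrable (lt_trans a0 ay).
have sub : `]y, +oo[%classic `<=` `[y, +oo[%classic.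
  by move=> z /=; rewrite !in_itv/= !andbT; exact: ltW.
exact: (@integrableS _ _ R mu `[y, +oo[%classic `]y, +oo[%classic (EFin \o h) (measurable_itv _) (measurable_itv _) sub my).
Qed.

Let dT y : 0 < y -> is_derive y 1 T (- h y).
Proof.
(* The fundamental theorem is applied to the integral over [[a, x]], which differs from [- T x] by
   the constant [T a]. *)
move=> y0; pose a := y / 2; have a0 : 0 < a by rewrite divr_gt0.
have ay : a < y by rewrite /a; lra.
have yy1 : y < y + 1 by rewrite ltrDl.
have ih : mu.-integrable `[a, y + 1] (EFin \o h).
  apply: (h_integrable_sub a0); first exact: measurable_itv.
  by move=> z /=; rewrite !in_itv/= andbT => /andP[].
have [dG GE] := continuous_FTC1_closed yy1 ih ay (h_cont y0).
have dJ : is_derive y 1 (fun x => \int[mu]_(t in `[a, x]) h t)%R (h y).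
  by rewrite -GE derive1E; exact/derivableP.
apply: (@near_eq_is_derive _ _ _ (fun x => T a - (\int[mu]_(t in `[a, x]) h t)%R)).
  near=> x; rewrite (@T_split a x)//; first by rewrite addrC addKr.
  by near: x; apply: (@open_nbhs_nbhs _ y [set z : R | a < z]); split => //; exact: open_gt.
by der; rewrite sub0r.
Unshelve. all: by end_near. Qed.

Let F y := S1 y * T y.
Let F1 y := S2 y * T y - (S1 y)^-1.

Let dF y : 0 < y -> is_derive y 1 F (F1 y).
Proof.
move=> y0; have := dS1 y => d1; have := dT y0 => d2; rewrite /F; der.
have : S1 y != 0 by rewrite gt_eqF// S1_gt0.
by rewrite /F1 /h; move=> S0; field.
Qed.

Let dF1 y : 0 < y -> is_derive y 1 F1 (F y / y).
Proof.
move=> y0; have := dS1 y => d1; have := dS2 y => d2; have := dT y0 => d3.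
have S0 : S1 y != 0 by rewrite gt_eqF// S1_gt0.
rewrite /F1; der => //.
by move: S0; rewrite /F /h S13 => S0; field; move: S0; rewrite mulf_eq0 negb_or => /andP[-> ->].
Qed.

(** The integral over [[y, y + 1]] alone is positive: [S1] increases, so the integrand is at least
    its value at the right end. *)
Let F_gt0 y : 0 < y -> 0 < F y.
Proof.
move=> y0; rewrite /F mulr_gt0 ?S1_gt0// (@T_split y (y + 1))// ?ltrDl//.
rewrite ltr_pwDl//; have y1 : y <= y + 1 by rewrite lerDl.
have hm : forall z, y <= z <= y + 1 -> (S1 (y + 1) ^+ 2)^-1 <= h z.
  move=> z /andP[yz zy]; have z0 : 0 < z by exact: lt_le_trans yz.
  have Sz : S1 z <= S1 (y + 1).
    apply: (derive_ge0_le zy) => x; first by move=> _; exact: dS1.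
    by move=> /andP[zx _]; rewrite (le_trans ler01)// S2_ge// ltW// (lt_trans z0).
  rewrite lef_pV2 ?posrE ?exprn_gt0 ?S1_gt0 ?addr_gt0// ler_pXn2r// nnegrE ltW// S1_gt0//.
  by rewrite addr_gt0.
apply: (@lt_le_trans _ _ (\int[mu]_(t in `[y, y + 1]) (cst (S1 (y + 1) ^+ 2)^-1) t)%R).
  rewrite Rintegral_cst//= lebesgue_measure_itv/= lte_fin ltrDl ltr01 -EFinD/= addrAC subrr add0r mulr1.
  by rewrite invr_gt0 exprn_gt0// S1_gt0// addr_gt0.
apply: le_Rintegral => //.
- by apply: continuous_compact_integrable; [exact: segment_compact|exact: continuous_subspaceT (@cst_continuous _ _ _)].
- apply: (h_integrable_sub y0); first exact: measurable_itv.
  by move=> z /=; rewrite !in_itv/= andbT => /andP[].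
Qed.

(** One has [F1 = - S2 W]. The function [W] is decreasing and exceeds [- T], which tends to 0 at
    infinity, so it is nonnegative. *)
Let F1_le0 y : 0 < y -> F1 y <= 0.
Proof.
move=> y0; pose W z := (S1 z * S2 z)^-1 - T z.
have S20 z : 0 < z -> 0 < S2 z by move=> z0; rewrite (lt_le_trans ltr01)// S2_ge// ltW.
have dW z : 0 < z -> is_derive z 1 W (- (S1 z * S3 z) / (S1 z * S2 z) ^+ 2).
  move=> z0; have := dS1 z => d1; have := dS2 z => d2; have := dT z0 => d3.
  have s1 : S1 z != 0 by rewrite gt_eqF// S1_gt0.
  have s2 : S2 z != 0 by rewrite gt_eqF// S20.
  rewrite /W; der; first by rewrite mulf_neq0.
  by rewrite /h; field; rewrite s1 s2.
have Wmono z : y <= z -> W z <= W y.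
  move=> yz; apply: (derive_le0_ge yz) => x /andP[yx _].
    by apply: dW; exact: lt_le_trans yx.
  have x0 : 0 < x by exact: lt_trans yx.
  rewrite mulNr oppr_le0 divr_ge0 ?sqr_ge0//.
  have := S13 x => E; have : 0 < x * S3 x by rewrite -E S1_gt0.
  by rewrite pmulr_rgt0// => s3; rewrite mulr_ge0// ltW// S1_gt0.
have W0 : 0 <= W y.
  rewrite leNgt; apply/negP => Wy.
  (* So far out that [T z <= 1 / z <= - W y], hence [W z > W y], against monotonicity. *)
  pose z := y + (- W y)^-1; have z0 : 0 < z by rewrite addr_gt0// invr_gt0 oppr_gt0.
  have iz : z^-1 <= - W y.
    rewrite -[leRHS]invrK lef_pV2 ?posrE ?invr_gt0 ?oppr_gt0// lerDr ltW//.
  have yz : y < z by rewrite ltrDl invr_gt0 oppr_gt0.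
  have : - T z < W z.
    by rewrite /W ltrDr invr_gt0 mulr_gt0// ?S1_gt0// S20.
  have := Wmono z (ltW yz); have := T_le z0; lra.
have -> : F1 y = - (S2 y * W y).
  have s1 : S1 y != 0 by rewrite gt_eqF// S1_gt0.
  have s2 : S2 y != 0 by rewrite gt_eqF// S20.
  by rewrite /F1 /W; field; rewrite s1 s2.
by rewrite oppr_le0 mulr_ge0// ltW// S20.
Qed.

Lemma decaying_solution : exists F F1 : R -> R, forall y, 0 < y ->
  [/\ is_derive y 1 F (F1 y), is_derive y 1 F1 (F y / y), 0 < F y & F1 y <= 0].
Proof.
exists F, F1 => y y0; split; [exact: dF|exact: dF1|exact: F_gt0|exact: F1_le0].
Qed.

End bessel_function.

(** * Choice of the decay rate and monotonicity of the slope *)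

Section bessel_profile.
Context {R : realType}.
Implicit Types (x y z t r s : R).

(* g = - y F' / F satisfies the Riccati equation y g' = g + g ^ 2 - y, whose
   global nonnegative solutions take every positive value. *)
Lemma riccati_onto (g : R -> R) (b : R) :
  (forall y, 0 < y -> is_derive y 1 g ((g y + g y ^+ 2 - y) / y)) ->
  (forall y, 0 < y -> 0 <= g y) -> 0 < b -> exists2 y, 0 < y & g y = b.
Proof.
move=> dg g0 b0.
have [y1 y10 gy1] : exists2 y, 0 < y & b <= g y.
  apply: contrapT => /forall2NP h.
  have gb y : 0 < y -> g y <= b by move=> y0; case: (h y) => // /negP; rewrite -ltNge => /ltW.
  (* If [g] stayed below [b], its derivative would be at most [- 1/2] beyond [c], and [g] would
     become negative within the length [2 * b + 2]. *)
  pose c := 2 * (b + b ^+ 2); have c0 : 0 < c by rewrite mulr_gt0// addr_gt0// exprn_gt0.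
  have c2 : c <= c + 2 * b + 2 by lra.
  have d (z : R) : c <= z <= c + 2 * b + 2 -> is_derive z 1 (fun z : R => g z + z / 2) ((g z + g z ^+ 2 - z) / z + 1 / 2).
    move=> /andP[cz _]; have := dg z (lt_le_trans c0 cz) => ?; der => //.
    by field; rewrite gt_eqF// (lt_le_trans c0).
  have := derive_le0_ge c2 d => /(_ _) H.
  have : g (c + 2 * b + 2) + (c + 2 * b + 2) / 2 <= g c + c / 2.
    apply: H => z /andP[cz _]; have z0 : 0 < z by exact: lt_trans cz.
    have h1 := gb _ z0; have h2 := g0 _ z0.
    have h3 : g z ^+ 2 <= b ^+ 2 by rewrite ler_pXn2r// nnegrE// ltW.
    have : (g z + g z ^+ 2 - z) / z <= - (1 / 2).
      rewrite ler_pdivrMr//; rewrite /c in cz; lra.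
    lra.
  have := gb _ c0; have : 0 < c + 2 * b + 2 by lra.
  move=> /g0; lra.
have [y2 y20 gy2] : exists2 y, 0 < y & g y <= b.
  apply: contrapT => /forall2NP h.
  have gb y : 0 < y -> b <= g y by move=> y0; case: (h y) => // /negP; rewrite -ltNge => /ltW.
  pose a := b / 2; have a0 : 0 < a by rewrite divr_gt0.
  (* If [g] stayed above [b], its derivative would be at least [a / z] for [z <= a], and comparison
     with the logarithm would give [g e <= - 1]. *)
  pose e := a * expR (- ((g a + 1) / a)).
  have ga : 0 <= g a by exact: g0.
  have e0 : 0 < e by rewrite mulr_gt0// expR_gt0.
  have ea : e <= a.
    by rewrite /e ger_pMr// -expR0 ler_expR oppr_le0 divr_ge0// ?addr_ge0// ltW.
  have d (z : R) : e <= z <= a -> is_derive z 1 (fun z : R => g z - a * ln z) ((g z + g z ^+ 2 - z) / z - a * z^-1).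
    move=> /andP[ez _]; have z0 : 0 < z by exact: lt_le_trans ez.
    have := dg z z0 => d1; have d2 := is_derive1_ln z0.
    apply: (is_derive_eq (dsub d1 (dmul (dcst a z 1) d2))); ring.
  have := derive_ge0_le ea d => /(_ _) H.
  have : g e - a * ln e <= g a - a * ln a.
    apply: H => z /andP[ez za]; have z0 : 0 < z by exact: lt_trans ez.
    have h1 := gb _ z0; rewrite -mulrBl divr_ge0//; last exact: ltW.
    have := sqr_ge0 (g z); rewrite /a in za *; lra.
  have -> : ln e = ln a - (g a + 1) / a by rewrite /e lnM ?posrE ?expR_gt0// expRK.
  have := g0 _ e0; have -> : a * (ln a - (g a + 1) / a) = a * ln a - (g a + 1).
    by field; rewrite gt_eqF.
  lra.
have cg y : 0 < y -> {for y, continuous g} by move=> y0; exact: is_derive_continuous (dg y y0).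
have minp : 0 < Num.min y1 y2 by rewrite lt_min y10.
have cw : {within `[Num.min y1 y2, Num.max y1 y2], continuous g}.
  apply: continuous_in_subspaceT => z; rewrite inE/= in_itv/= => /andP[hz _].
  by apply: cg; exact: lt_le_trans hz.
have mM : Num.min y1 y2 <= Num.max y1 y2 by rewrite le_max !ge_min !lexx.
have [|c cI gc] := IVT mM cw (v := b).
  by have [h|h] := leP y1 y2; rewrite /= ge_min le_max gy2 gy1 ?orbT.
exists c => //; move: cI; rewrite in_itv/= => /andP[hc _]; exact: lt_le_trans hc.
Qed.

Section profile.
Variables (k : R) (phi phi1 : R -> R).
Hypothesis dphi : forall r, 0 < r -> is_derive r 1 phi (phi1 r).
Hypothesis dphi1 : forall r, 0 < r -> is_derive r 1 phi1 ((k ^+ 2 + r ^- 2) * phi r - phi1 r / r).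
Hypothesis phi_gt0 : forall r, 0 < r -> 0 < phi r.
Hypothesis phi1_lt0 : forall r, 0 < r -> phi1 r < 0.

(* M = r phi ^ 2 q' for q = - phi' / phi *)
Let M r := r * phi1 r ^+ 2 + phi r * phi1 r - (k ^+ 2 * r + r^-1) * phi r ^+ 2.

Let dM r : 0 < r -> is_derive r 1 M (2 * phi r ^+ 2 / r ^+ 2 - phi r * phi1 r / r).
Proof.
move=> r0; have := dphi r0 => d1; have := dphi1 r0 => d2.
have rn : r != 0 by rewrite gt_eqF.
by rewrite /M; der => //; field.
Qed.

Let dM_gt0 r : 0 < r -> 0 < 2 * phi r ^+ 2 / r ^+ 2 - phi r * phi1 r / r.
Proof.
move=> r0; rewrite subr_gt0; apply: (@lt_trans _ _ 0).
  by rewrite pmulr_llt0 ?invr_gt0// pmulr_rlt0 ?phi_gt0// phi1_lt0.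
by rewrite divr_gt0 ?exprn_gt0// mulr_gt0 ?exprn_gt0 ?phi_gt0.
Qed.

Let M_lt r s : 0 < r -> r < s -> M r < M s.
Proof.
move=> r0 rs; apply: (derive_gt0_lt rs) => x /andP[rx _].
  by apply: dM; exact: lt_le_trans rx.
by apply: dM_gt0; exact: lt_trans rx.
Qed.

(** Convexity of [phi] between [r / 2] and [r] bounds [- r phi1 r] by [2 phi 1], and all terms of
    [M] other than [r phi1 ^ 2] are nonpositive. *)
Let M_decay r : 2 <= r -> M r <= 4 * phi 1 ^+ 2 / r.
Proof.
move=> r2; have r0 : 0 < r by lra.
have h1 : - phi1 r * (r / 2) <= phi (r / 2) - phi r.
  have rr : r / 2 <= r by lra.
  have d x : r / 2 <= x <= r -> is_derive x 1 (fun s : R => phi s - phi1 r * s) (phi1 x - phi1 r).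
    move=> /andP[hx _]; have x0 : 0 < x by apply: lt_le_trans hx; rewrite divr_gt0.
    by have := dphi x0 => ?; der; ring.
  have : phi r - phi1 r * r <= phi (r / 2) - phi1 r * (r / 2).
    apply: (derive_le0_ge rr d) => x /andP[hx xr]; rewrite subr_le0.
    apply: (derive_ge0_le (ltW xr)) => z /andP[xz zr].
      by apply: dphi1; rewrite (lt_le_trans _ xz)// (lt_trans _ hx)// divr_gt0.
    have z0 : 0 < z by rewrite (lt_trans _ xz)// (lt_trans _ hx)// divr_gt0.
    rewrite subr_ge0; apply: (@le_trans _ _ 0).
      by rewrite pmulr_lle0 ?invr_gt0// ltW// phi1_lt0.
    by rewrite mulr_ge0 ?(ltW (phi_gt0 _))// addr_ge0 ?sqr_ge0// invr_ge0 sqr_ge0.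
  lra.
have h2 : phi (r / 2) <= phi 1.
  have r1 : 1 <= r / 2 by lra.
  apply: (derive_le0_ge r1) => x /andP[x1 _].
    by apply: dphi; exact: lt_le_trans x1.
  by rewrite ltW// phi1_lt0// (lt_trans _ x1).
have h3 := phi_gt0 r0; have h4 := phi1_lt0 r0.
have h5 : - phi1 r * r <= 2 * phi 1 by lra.
have p1 : 0 < phi 1 by exact: phi_gt0.
apply: (@le_trans _ _ (r * phi1 r ^+ 2)).
  rewrite /M -addrA gerDl; have a1 : phi r * phi1 r <= 0 by rewrite pmulr_rle0// ltW.
  have a2 : 0 <= (k ^+ 2 * r + r^-1) * phi r ^+ 2.
    apply: mulr_ge0; last exact: sqr_ge0.
    by apply: addr_ge0; rewrite ?invr_ge0 ?(ltW r0)// pmulr_lge0// sqr_ge0.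
  lra.
rewrite ler_pdivlMr//.
have -> : r * phi1 r ^+ 2 * r = (- phi1 r * r) ^+ 2 by ring.
have -> : 4 * phi 1 ^+ 2 = (2 * phi 1) ^+ 2 by ring.
by rewrite ler_pXn2r// nnegrE mulr_ge0// ?oppr_ge0 ltW.
Qed.

(** A strictly increasing function with an upper bound that tends to 0 at infinity is negative. *)
Let M_lt0 r : 0 < r -> M r < 0.
Proof.
move=> r0; have s0 : 0 < r + 1 by rewrite addr_gt0.
apply: (@lt_le_trans _ _ (M (r + 1))); first by apply: M_lt; rewrite ?ltrDl.
rewrite leNgt; apply/negP => Mp.
pose c := 4 * phi 1 ^+ 2; have c0 : 0 < c by rewrite mulr_gt0// exprn_gt0// phi_gt0.
pose s := r + 2 + c / M (r + 1) + 1.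
have cM : 0 < c / M (r + 1) by rewrite divr_gt0.
have s2 : 2 <= s by rewrite /s; lra.
have rs : r + 1 < s by rewrite /s; lra.
have := M_lt s0 rs; have := M_decay s2; rewrite -/c.
have : c / s < M (r + 1).
  by rewrite ltr_pdivrMr ?(lt_trans s0)// mulrC -ltr_pdivrMr// /s; lra.
lra.
Qed.

Lemma profile_slope_decreasing r s : 0 < r -> r < s -> - phi1 s / phi s < - phi1 r / phi r.
Proof.
move=> r0 rs; rewrite !mulNr ltrN2.
apply: (@derive_gt0_lt _ (fun x => phi1 x / phi x) (fun x => - M x / (x * phi x ^+ 2)) _ _ rs) => x /andP[rx _].
  have x0 : 0 < x by exact: lt_le_trans rx.
  have := dphi x0 => d1; have := dphi1 x0 => d2.
  have pn : phi x != 0 by rewrite gt_eqF// phi_gt0.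
  have xn : x != 0 by rewrite gt_eqF.
  by rewrite /M; der => //; field; rewrite ?pn ?xn.
have x0 : 0 < x by exact: lt_trans rx.
by rewrite divr_gt0 ?oppr_gt0 ?M_lt0// mulr_gt0// exprn_gt0// phi_gt0.
Qed.

End profile.

(** The function [phi r = F (k ^ 2 r ^ 2 / 4) / r] is a multiple of [K_1 (k r)]. Its slope
    [- phi1 / phi] at [r0] equals [(1 + 2 g) / r0] with [g] evaluated at [k ^ 2 r0 ^ 2 / 4], so [g]
    has to take the value [(r0 al - 1) / 2], which is positive exactly when [al > 1 / r0]; the point
    where it does determines [k]. *)
Lemma bessel_profile (r0 al : R) : 0 < r0 -> 1 / r0 < al ->
  exists k phi phi1, [/\ 0 < k, - phi1 r0 / phi r0 = al,
    forall r, 0 < r -> [/\ is_derive r 1 phi (phi1 r),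
      is_derive r 1 phi1 ((k ^+ 2 + r ^- 2) * phi r - phi1 r / r),
      0 < phi r & phi r / r <= - phi1 r] &
    forall r, r0 < r -> - phi1 r / phi r < al].
Proof.
move=> r00 ral; have [F [F1 HF]] := @decaying_solution R.
have F0 y : 0 < y -> F y != 0 by move=> /HF[_ _ h _]; rewrite gt_eqF.
pose g y := - (y * F1 y / F y).
have dg y : 0 < y -> is_derive y 1 g ((g y + g y ^+ 2 - y) / y).
  move=> y0; have [d1 d2 _ _] := HF y y0; have := F0 y y0 => Fn.
  have yn : y != 0 by rewrite gt_eqF.
  by rewrite /g; der => //; field; rewrite yn.
have g0 y : 0 < y -> 0 <= g y.
  move=> y0; have [_ _ F00 F10] := HF y y0.
  by rewrite /g oppr_ge0 pmulr_lle0 ?invr_gt0// pmulr_rle0.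
have b0 : 0 < (r0 * al - 1) / 2.
  rewrite divr_gt0// subr_gt0 mulrC -ltr_pdivrMr//.
have [y0 y00 gy0] := riccati_onto dg g0 b0.
pose k := 2 * Num.sqrt y0 / r0.
have k0 : 0 < k by rewrite divr_gt0// mulr_gt0// sqrtr_gt0.
have ky0 : k ^+ 2 * r0 ^+ 2 / 4 = y0.
  rewrite /k expr_div_n exprMn sqr_sqrtr ?ltW//; field.
  by rewrite gt_eqF.
pose Y r := k ^+ 2 * r ^+ 2 / 4.
have Y0 r : 0 < r -> 0 < Y r by move=> r0'; rewrite divr_gt0// mulr_gt0// exprn_gt0.
pose phi r := F (Y r) / r.
pose phi1 r := k ^+ 2 * F1 (Y r) / 2 - F (Y r) / r ^+ 2.
have dY r : is_derive r 1 Y (k ^+ 2 * r / 2).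
  by rewrite /Y; der => //; field.
have props r : 0 < r -> [/\ is_derive r 1 phi (phi1 r),
      is_derive r 1 phi1 ((k ^+ 2 + r ^- 2) * phi r - phi1 r / r),
      0 < phi r & phi r / r <= - phi1 r].
  move=> rp; have rn : r != 0 by rewrite gt_eqF.
  have kn : k != 0 by rewrite gt_eqF.
  have [d1 d2 Fp F1n] := HF _ (Y0 r rp).
  have dF := dcomp1 (dY r) d1; have dF1 := dcomp1 (dY r) d2.
  split.
  - by rewrite /phi; der => //; rewrite /phi1; field.
  - rewrite /phi1; der => //; rewrite ?expf_neq0//.
    by rewrite /phi /Y; field; rewrite kn rn.
  - by rewrite divr_gt0.
  - rewrite /phi /phi1 opprB -mulrA -invfM -expr2 lerBrDr gerDl.
    by rewrite pmulr_lle0 ?invr_gt0// pmulr_rle0// exprn_gt0.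
have phi10 r : 0 < r -> phi1 r < 0.
  by move=> rp; have [_ _ h1 h2] := props r rp; rewrite -oppr_gt0 (lt_le_trans _ h2)// divr_gt0.
have al0 : - phi1 r0 / phi r0 = al.
  have E : - phi1 r0 / phi r0 = (1 + 2 * g (Y r0)) / r0.
    have [_ _ Fp _] := HF _ (Y0 r0 r00).
    by rewrite /phi1 /phi /g /Y; field; rewrite !gt_eqF.
  by rewrite E /Y ky0 gy0; field; rewrite gt_eqF.
exists k, phi, phi1; split => // r rr0.
rewrite -al0.
have h1 s (s0 : 0 < s) : is_derive s 1 phi (phi1 s) by have [] := props s s0.
have h2 s (s0 : 0 < s) : is_derive s 1 phi1 ((k ^+ 2 + s ^- 2) * phi s - phi1 s / s) by have [] := props s s0.
have h3 s (s0 : 0 < s) : 0 < phi s by have [] := props s s0.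
exact: (profile_slope_decreasing h1 h2 h3 phi10 r00 rr0).
Qed.

End bessel_profile.

(** * Smooth cut-off functions *)

Section smooth_functions.
Context {R : realType}.
Implicit Types (D E : set R) (f g : R -> R) (x t : R).

(** Derivatives are given by witnesses that are constrained on [D] only, so that [sqrt], inverses
    and [phi] can be handled on the open half-line while being total functions. *)
Fixpoint smooth_to (n : nat) D f : Prop :=
  if n is m.+1 then exists2 df, (forall x, D x -> is_derive x 1 f (df x)) & smooth_to m D df
  else forall x, D x -> {for x, continuous f}.

Lemma smooth_to_pred n D f : smooth_to n.+1 D f -> smooth_to n D f.
Proof.
elim: n f => [|n IH] f [df d sdf]; last by exists df => //; exact: IH.
by move=> x Dx; exact: is_derive_continuous (d x Dx).
Qed.

Lemma smooth_to_cst n D (c : R) : smooth_to n D (fun=> c).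
Proof.
elim: n c => [|n IH] c; first by move=> x _; exact: ccst.
by exists (fun=> 0) => // x _; exact: dcst.
Qed.

Lemma smooth_to_id n D : smooth_to n D (fun x => x).
Proof.
case: n => [|n]; first by move=> x _; exact: cvg_id.
by exists (fun=> 1) => [x _|]; [exact: is_derive_id|exact: smooth_to_cst].
Qed.

Lemma smooth_to_add n D f g : smooth_to n D f -> smooth_to n D g ->
  smooth_to n D (fun x => f x + g x).
Proof.
elim: n f g => [|n IH] f g; first by move=> cf cg x Dx; apply: cadd; [exact: cf|exact: cg].
move=> [df ddf sf] [dg ddg sg]; exists (fun x => df x + dg x); last exact: IH.
by move=> x Dx; apply: dadd; [exact: ddf|exact: ddg].
Qed.

Lemma smooth_to_mul n D f g : smooth_to n D f -> smooth_to n D g ->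
  smooth_to n D (fun x => f x * g x).
Proof.
elim: n f g => [|n IH] f g; first by move=> cf cg x Dx; apply: cmul; [exact: cf|exact: cg].
move=> sf sg; have sf' := smooth_to_pred sf; have sg' := smooth_to_pred sg.
case: sf => df ddf sf; case: sg => dg ddg sg.
exists (fun x => df x * g x + f x * dg x); last by apply: smooth_to_add; exact: IH.
by move=> x Dx; apply: dmul; [exact: ddf|exact: ddg].
Qed.

Lemma smooth_to_scale n D (c : R) f : smooth_to n D f -> smooth_to n D (fun x => c * f x).
Proof. by apply: smooth_to_mul; exact: smooth_to_cst. Qed.

Lemma smooth_to_comp n D E f g : (forall x, D x -> E (f x)) ->
  smooth_to n D f -> smooth_to n E g -> smooth_to n D (fun x => g (f x)).
Proof.
move=> DE; elim: n g => [|n IH] g.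
  by move=> cf cg x Dx; apply: ccomp; [exact: cf|apply: cg; exact: DE].
move=> sf; have sf' := smooth_to_pred sf; case: sf => df ddf sf [dg ddg sg].
exists (fun x => dg (f x) * df x); last by apply: smooth_to_mul => //; exact: IH.
by move=> x Dx; apply: dcomp; [exact: ddf|apply: ddg; exact: DE].
Qed.

Lemma smooth_to_inv n D f : (forall x, D x -> f x != 0) ->
  smooth_to n D f -> smooth_to n D (fun x => (f x)^-1).
Proof.
move=> f0; elim: n => [|n IH]; first by move=> cf x Dx; apply: cinv; [exact: f0|exact: cf].
move=> sf; have sf' := smooth_to_pred sf; case: sf => df ddf sf.
exists (fun x => - 1 * ((f x)^-1 * (f x)^-1 * df x)).
  move=> x Dx; have fx := f0 x Dx; have d := ddf x Dx.
  by der => //; field.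
by apply: smooth_to_scale; apply: smooth_to_mul => //; apply: smooth_to_mul; exact: IH.
Qed.

Lemma is_derive_vanish f x : (\forall y \near x, f y = 0) -> is_derive x 1 f 0.
Proof.
move=> f0; have e : \forall y \near x, (fun=> 0) y = f y by near=> y; apply/esym; near: y.
exact: near_eq_is_derive e (dcst 0 x 1).
Unshelve. all: by end_near. Qed.

Lemma is_derive_ltl (c x : R) f : x < c -> (forall y, y < c -> f y = 0) -> is_derive x 1 f 0.
Proof.
by move=> xc f0; apply: is_derive_vanish; near=> y; apply: f0; near: y; exact: lt_nbhsl.
Unshelve. all: by end_near. Qed.

(* The product makes sense globally because the first factor vanishes near the
   complement of the domain of the second one. *)
Lemma smooth_to_glue n (c : R) f g : 0 < c -> (forall x, x < c -> f x = 0) ->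
  smooth_to n setT f -> smooth_to n [set x | 0 < x] g -> smooth_to n setT (fun x => f x * g x).
Proof.
move=> c0; elim: n f g => [|n IH] f g f0.
  move=> cf cg x _; have [x0|x0] := ltP 0 x.
    by apply: cmul; [exact: cf|exact: cg].
  apply: is_derive_continuous (@is_derive_ltl c _ _ _ _); first exact: le_lt_trans c0.
  by move=> y yc; rewrite f0// mul0r.
move=> sf sg; have sf' := smooth_to_pred sf; have sg' := smooth_to_pred sg.
case: sf => df ddf sf; case: sg => dg ddg sg.
have df0 x : x < c -> df x = 0.
  move=> xc; have [_ <-] := ddf x I; have [_ <-] := is_derive_ltl xc f0; by [].
exists (fun x => df x * g x + f x * dg x); last by apply: smooth_to_add; exact: IH.
move=> x _; have [x0|x0] := ltP 0 x.
  by apply: dmul; [exact: ddf|exact: ddg].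
have xc : x < c by exact: le_lt_trans c0.
rewrite df0// f0// !mul0r addr0; apply: (is_derive_ltl xc) => y yc.
by rewrite f0// mul0r.
Qed.

Lemma is_derive_quadratic0 f (C : R) : (forall x, `|f x| <= C * x ^+ 2) -> is_derive (0 : R) 1 f 0.
Proof.
move=> fC; have f0 : f 0 = 0.
  by apply/normr0_eq0/eqP; rewrite eq_le normr_ge0 andbT; have := fC 0; rewrite expr0n mulr0.
have H : h^-1 *: (f (h *: 1 + 0) - f 0) @[h --> (0 : R)^'] --> (0 : R).
  apply: norm_cvg0.
  have C0 : 0 <= C by have := le_trans (normr_ge0 _) (fC 1); rewrite expr1n mulr1.
  apply: (@squeeze_cvgr _ _ _ _ (cst 0) (fun h : R => C * `|h|)).
  - near=> h; rewrite normr_ge0/= addr0 f0 subr0 /GRing.scale/= mulr1 normrM normfV.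
    have h0 : 0 < `|h| by rewrite normr_gt0; near: h; exact: nbhs_dnbhs_neq.
    rewrite mulrC ler_pdivrMr//; apply: (le_trans (fC h)).
    by rewrite -mulrA -expr2 real_normK ?num_real.
  - exact: cvg_cst.
  - have h0 : C * `|h| @[h --> (0 : R)^'] --> C * `|0 : R|.
      by apply: cvgM; [exact: cvg_cst|apply: cvg_norm; exact: cvg_within].
    by rewrite normr0 mulr0 in h0.
apply: DeriveDef; first by apply/cvg_ex; exists 0.
exact: cvg_lim H.
Unshelve. all: by end_near. Qed.

(** The classical flat function is the case [m = 0]. The powers of [1 / t] are included because the
    span of the whole family is closed under differentiation. *)
Definition flat (m : nat) t : R := if 0 < t then t^-1 ^+ m * expR (- t^-1) else 0.

(** A single term of the exponential series gives [t ^ -(m + 2) <= (m + 2)! exp (1 / t)]. The two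
    spare powers of [t] make the function differentiable at 0 with derivative 0. *)
Lemma flat_quadratic m t : `|flat m t| <= (m.+2)`!%:R * t ^+ 2.
Proof.
rewrite /flat; case: ifPn => [t0|_]; last by rewrite normr0 mulr_ge0// sqr_ge0.
have i0 : 0 < t^-1 by rewrite invr_gt0.
rewrite ger0_norm; last by rewrite mulr_ge0 ?expR_ge0// exprn_ge0// ltW.
have : t^-1 ^+ m.+2 / m.+2`!%:R <= expR t^-1.
  by apply: le_trans (expR_ge1Dxn m.+1 (ltW i0)); rewrite lerDr.
rewrite ler_pdivrMr ?ltr0n ?fact_gt0// => h.
rewrite expRN ler_pdivrMr ?expR_gt0//.
have -> : t^-1 ^+ m = t^-1 ^+ m.+2 * t ^+ 2.
  by rewrite -addn2 exprD -mulrA -exprMn mulVf ?gt_eqF// expr1n mulr1.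
by rewrite [leRHS]mulrAC ler_wpM2r ?sqr_ge0// mulrC.
Qed.

Lemma is_derive_flat m t : is_derive t 1 (flat m) (flat m.+2 t - m%:R * flat m.+1 t).
Proof.
have [t0|t0|->] := ltgtP t 0.
- have -> : flat m.+2 t - m%:R * flat m.+1 t = 0 by rewrite /flat ltNge (ltW t0)/= mulr0 subrr.
  by apply: (is_derive_ltl t0) => y y0; rewrite /flat ltNge (ltW y0).
- apply: (@near_eq_is_derive _ _ _ (fun t => t^-1 ^+ m * expR (- t^-1))).
    by near=> y; rewrite /flat ifT//; near: y; exact: lt_nbhsr.
  have tn : t != 0 by rewrite gt_eqF.
  rewrite /flat t0; der => //; case: m => [|m].
    by rewrite !expr0; field.
  by rewrite !exprS /= ; field.
- rewrite /flat ltxx mulr0 subrr; exact: is_derive_quadratic0 (flat_quadratic m).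
Unshelve. all: by end_near. Qed.

Lemma smooth_to_flat n m : smooth_to n setT (flat m).
Proof.
elim: n m => [|n IH] m; first by move=> x _; exact: is_derive_continuous (is_derive_flat m x).
exists (fun t => flat m.+2 t + (- m%:R) * flat m.+1 t).
  by move=> x _; rewrite mulNr; exact: is_derive_flat.
by apply: smooth_to_add => //; exact: smooth_to_scale.
Qed.

Lemma flat_gt0 t : 0 < t -> 0 < flat 0 t.
Proof. by move=> t0; rewrite /flat t0 expr0 mul1r expR_gt0. Qed.

Lemma flat_ge0 t : 0 <= flat 0 t.
Proof. by rewrite /flat; case: ifP => // _; rewrite expr0 mul1r expR_ge0. Qed.

Lemma flat_le0 m t : t <= 0 -> flat m t = 0.
Proof. by move=> t0; rewrite /flat ltNge t0. Qed.

(** A smooth transition from 0 for [t <= 0] to 1 for [t >= 1]; the denominator is positive because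
    [t] or [1 - t] is. *)
Definition smooth_step t : R := flat 0 t / (flat 0 t + flat 0 (1 - t)).

Let step_den t : 0 < flat 0 t + flat 0 (1 - t).
Proof.
have [t0|t0] := ltP 0 t; first by rewrite ltr_pwDl// ?flat_gt0// flat_ge0.
by rewrite ltr_wpDl ?flat_ge0// flat_gt0// subr_gt0 (le_lt_trans t0).
Qed.

Lemma smooth_to_step n : smooth_to n setT smooth_step.
Proof.
have s0 := smooth_to_flat n 0.
apply: smooth_to_mul => //; apply: smooth_to_inv => [x _|]; first by rewrite gt_eqF.
apply: smooth_to_add => //; apply: (smooth_to_comp (E := setT)) => //.
apply: smooth_to_add; first exact: smooth_to_cst.
rewrite (_ : -%R = fun x => -1 * x); last by apply/funext => x; rewrite mulN1r.
exact: smooth_to_scale (smooth_to_id _ _).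
Qed.

Lemma smooth_step_ge0 t : 0 <= smooth_step t.
Proof. by rewrite /smooth_step divr_ge0 ?flat_ge0// ltW. Qed.

Lemma smooth_step_le1 t : smooth_step t <= 1.
Proof. by rewrite /smooth_step ler_pdivrMr// mul1r lerDl flat_ge0. Qed.

Lemma smooth_step_le0 t : t <= 0 -> smooth_step t = 0.
Proof. by move=> t0; rewrite /smooth_step flat_le0// mul0r. Qed.

Lemma smooth_step_ge1 t : 1 <= t -> smooth_step t = 1.
Proof.
move=> t1; rewrite /smooth_step (@flat_le0 0 (1 - t)) ?subr_le0// addr0 divff//.
by rewrite gt_eqF// flat_gt0// (lt_le_trans _ t1).
Qed.

Lemma smooth_to_affine n (a b : R) f : smooth_to n setT f -> smooth_to n setT (fun x => f (a * x + b)).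
Proof.
apply: smooth_to_comp => //; apply: smooth_to_add; last exact: smooth_to_cst.
exact: smooth_to_scale (smooth_to_id _ _).
Qed.

Lemma smooth_to_sqrt n : smooth_to n [set x | 0 < x] (@Num.sqrt R).
Proof.
elim: n => [|n IH]; first by move=> x _; exact: sqrt_continuous.
exists (fun x => (2 * Num.sqrt x)^-1); first by move=> x x0; exact: is_derive1_sqrt.
apply: smooth_to_inv; last exact: smooth_to_scale.
by move=> x /= x0; rewrite mulf_neq0// gt_eqF// sqrtr_gt0.
Qed.

(** Bootstrapping: the right-hand side of the system is as smooth as the solution, which therefore
    gains one derivative at a time. *)
Lemma smooth_to_ode n D (p q f g : R -> R) :
  (forall x, D x -> is_derive x 1 f (g x)) ->
  (forall x, D x -> is_derive x 1 g (p x * f x + q x * g x)) ->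
  (forall n, smooth_to n D p) -> (forall n, smooth_to n D q) ->
  smooth_to n D f /\ smooth_to n D g.
Proof.
move=> df dg sp sq; elim: n => [|n [IHf IHg]].
  by split => x Dx; [exact: is_derive_continuous (df x Dx)|exact: is_derive_continuous (dg x Dx)].
split; first by exists g.
by exists (fun x => p x * f x + q x * g x) => //; apply: smooth_to_add; exact: smooth_to_mul.
Qed.

End smooth_functions.

(** * Smooth functions of two variables *)

Section plane_smoothness.
Context {R : realType}.
Local Notation plane := (R * R)%type.
Implicit Types (f g : plane -> R).

Lemma is_derive_fst_e1 (x : plane) : is_derive x e1 fst 1.
Proof. apply/derive_ray; rewrite (_ : (fun _ => _) = (fun t : R => t * 1 + x.1)); last by apply/funext.
by der; ring. Qed.

Lemma is_derive_fst_e2 (x : plane) : is_derive x e2 fst 0.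
Proof. apply/derive_ray; rewrite (_ : (fun _ => _) = (fun t : R => t * 0 + x.1)); last by apply/funext.
by der; ring. Qed.

Lemma is_derive_snd_e1 (x : plane) : is_derive x e1 snd 0.
Proof. apply/derive_ray; rewrite (_ : (fun _ => _) = (fun t : R => t * 0 + x.2)); last by apply/funext.
by der; ring. Qed.

Lemma is_derive_snd_e2 (x : plane) : is_derive x e2 snd 1.
Proof. apply/derive_ray; rewrite (_ : (fun _ => _) = (fun t : R => t * 1 + x.2)); last by apply/funext.
by der; ring. Qed.

(** [Cn] is phrased with the operators ['D_e1] and ['D_e2]; in practice the partial derivatives are
    known as explicit functions. *)
Lemma CnS n f f1 f2 : continuous f -> (forall x, is_derive x e1 f (f1 x)) ->
  (forall x, is_derive x e2 f (f2 x)) -> Cn n f1 -> Cn n f2 -> Cn n.+1 f.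
Proof.
move=> cf d1 d2 c1 c2.
have E1 : 'D_e1 f = f1 by apply/funext => x; have [] := d1 x.
have E2 : 'D_e2 f = f2 by apply/funext => x; have [] := d2 x.
by split; rewrite ?E1 ?E2.
Qed.

Lemma CnS_derive n f : Cn n.+1 f ->
  (forall x, is_derive x e1 f ('D_e1 f x)) /\ (forall x, is_derive x e2 f ('D_e2 f x)).
Proof. by move=> [_ d1 d2 _ _]; split => x; apply: DeriveDef. Qed.

Lemma Cn_continuous n f : Cn n f -> continuous f.
Proof. by case: n => [|n] // []. Qed.

Lemma Cn_pred n f : Cn n.+1 f -> Cn n f.
Proof.
elim: n f => [|n IH] f; first by case.
by move=> [cf d1 d2 c1 c2]; split; [exact: cf|exact: d1|exact: d2|exact: IH c1|exact: IH c2].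
Qed.

Lemma Cn_cst n (c : R) : Cn n (fun _ : plane => c).
Proof.
elim: n c => [|n IH] c; first exact: cst_continuous.
exact: (CnS (@cst_continuous _ _ _) (fun x => dcst c x e1) (fun x => dcst c x e2) (IH 0) (IH 0)).
Qed.

Lemma Cn_fst n : Cn n (fst : plane -> R).
Proof.
case: n => [|n]; first by move=> x; exact: cvg_fst.
have c : continuous (fst : plane -> R) by move=> x; exact: cvg_fst.
exact: (CnS c is_derive_fst_e1 is_derive_fst_e2 (Cn_cst n 1) (Cn_cst n 0)).
Qed.

Lemma Cn_snd n : Cn n (snd : plane -> R).
Proof.
case: n => [|n]; first by move=> x; exact: cvg_snd.
have c : continuous (snd : plane -> R) by move=> x; exact: cvg_snd.
exact: (CnS c is_derive_snd_e1 is_derive_snd_e2 (Cn_cst n 0) (Cn_cst n 1)).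
Qed.

Lemma Cn_add n f g : Cn n f -> Cn n g -> Cn n (fun x => f x + g x).
Proof.
elim: n f g => [|n IH] f g; first by move=> cf cg x; apply: cadd; [exact: cf|exact: cg].
move=> sf sg; have [f1 f2] := CnS_derive sf; have [g1 g2] := CnS_derive sg.
have cf := Cn_continuous sf; have cg := Cn_continuous sg.
case: sf => _ _ _ sf1 sf2; case: sg => _ _ _ sg1 sg2.
have c : continuous (fun x => f x + g x) by move=> x; apply: cadd; [exact: cf|exact: cg].
exact: (CnS c (fun x => dadd (f1 x) (g1 x)) (fun x => dadd (f2 x) (g2 x)) (IH _ _ sf1 sg1) (IH _ _ sf2 sg2)).
Qed.

Lemma Cn_mul n f g : Cn n f -> Cn n g -> Cn n (fun x => f x * g x).
Proof.
elim: n f g => [|n IH] f g; first by move=> cf cg x; apply: cmul; [exact: cf|exact: cg].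
move=> sf sg; have [f1 f2] := CnS_derive sf; have [g1 g2] := CnS_derive sg.
have cf := Cn_continuous sf; have cg := Cn_continuous sg.
have pf := Cn_pred sf; have pg := Cn_pred sg.
case: sf => _ _ _ sf1 sf2; case: sg => _ _ _ sg1 sg2.
have c : continuous (fun x => f x * g x) by move=> x; apply: cmul; [exact: cf|exact: cg].
exact: (CnS c (fun x => dmul (f1 x) (g1 x)) (fun x => dmul (f2 x) (g2 x))
  (Cn_add (IH _ _ sf1 pg) (IH _ _ pf sg1)) (Cn_add (IH _ _ sf2 pg) (IH _ _ pf sg2))).
Qed.

Lemma Cn_comp n (h : R -> R) f : smooth_to n setT h -> Cn n f -> Cn n (fun x => h (f x)).
Proof.
elim: n h => [|n IH] h.
  by move=> ch cf x; apply: ccomp; [exact: cf|exact: ch].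
move=> sh sf; have [f1 f2] := CnS_derive sf; have cf := Cn_continuous sf.
have pf := Cn_pred sf; case: sf => _ _ _ sf1 sf2.
have ch (x : R) : {for x, continuous h} by case: sh => dh ddh _; exact: is_derive_continuous (ddh x I).
case: sh => dh ddh sh.
have c : continuous (fun x => h (f x)) by move=> x; apply: ccomp; [exact: cf|exact: ch].
exact: (CnS c (fun x => dcomp (f1 x) (ddh (f x) I)) (fun x => dcomp (f2 x) (ddh (f x) I))
  (Cn_mul (IH _ sh pf) sf1) (Cn_mul (IH _ sh pf) sf2)).
Qed.

End plane_smoothness.

(** * Square-integrable functions and test functions *)

Section square_integrable.
Context {R : realType}.
Local Notation plane := (R * R)%type.
Local Notation mplane := (measurableTypeR R * measurableTypeR R)%type.
Variables (mu : {measure set mplane -> \bar R}) (D : set mplane).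
Hypothesis mD : measurable D.
Implicit Types (f g h : mplane -> R) (a b : R).

Lemma L2_lin a b f g : L2 mu D f -> L2 mu D g -> L2 mu D (fun x => a * f x + b * g x).
Proof.
move=> [mf iF] [mg ig].
have mfg : measurable_fun D (fun x => a * f x + b * g x).
  by apply: measurable_funD; apply: measurable_funM.
have msq h : measurable_fun D h -> measurable_fun D (fun x => (h x ^+ 2)%:E).
  by move=> mh; apply/measurable_EFinP; exact: measurable_funX.
have sq0 h x : (0 <= (h x ^+ 2)%:E)%E by rewrite lee_fin sqr_ge0.
split => //.
pose S x := ((2 * a ^+ 2)%:E * (f x ^+ 2)%:E + (2 * b ^+ 2)%:E * (g x ^+ 2)%:E)%E.
have a0 : (0 <= (2 * a ^+ 2)%:E)%E by rewrite lee_fin mulr_ge0// sqr_ge0.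
have b0 : (0 <= (2 * b ^+ 2)%:E)%E by rewrite lee_fin mulr_ge0// sqr_ge0.
apply: (@le_lt_trans _ _ (\int[mu]_(x in D) S x)%E).
  apply: ge0_le_integral => //.
  - by move=> x _; rewrite lee_fin sqr_ge0.
  - exact: msq.
  - by apply: emeasurable_funD; apply: emeasurable_funM => //; exact: msq.
  - move=> x _; rewrite /S -!EFinM -EFinD lee_fin.
    have -> : (a * f x + b * g x) ^+ 2 = 2 * a ^+ 2 * f x ^+ 2 + 2 * b ^+ 2 * g x ^+ 2 - (a * f x - b * g x) ^+ 2 by ring.
    by rewrite lerBlDr lerDl sqr_ge0.
rewrite /S ge0_integralD//; last 4 first.
- by move=> x _; rewrite mule_ge0.
- by apply: emeasurable_funM => //; exact: msq.
- by move=> x _; rewrite mule_ge0.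
- by apply: emeasurable_funM => //; exact: msq.
rewrite !ge0_integralZl//; try exact: msq.
by apply: lte_add_pinfty; apply: lte_mul_pinfty.
Qed.

Lemma L2_cst0 : L2 mu D (fun=> 0).
Proof.
split; first exact: measurable_cst.
by rewrite integral0_eq// => x _; rewrite expr0n.
Qed.

Lemma L2_add f g : L2 mu D f -> L2 mu D g -> L2 mu D (fun x => f x + g x).
Proof.
move=> hf hg; have := L2_lin 1 1 hf hg.
by congr L2; apply/funext => x; rewrite !mul1r.
Qed.

Lemma L2_sub f g : L2 mu D f -> L2 mu D g -> L2 mu D (fun x => f x - g x).
Proof.
move=> hf hg; have := L2_lin 1 (- 1) hf hg.
by congr L2; apply/funext => x; rewrite mul1r mulN1r.
Qed.

Lemma L2_sqr_integrable f : L2 mu D f -> mu.-integrable D (fun x => (f x ^+ 2)%:E).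
Proof.
move=> [mf iF]; apply/integrableP; split.
  by apply/measurable_EFinP; exact: measurable_funX.
apply: le_lt_trans iF; rewrite le_eqVlt; apply/orP; left; apply/eqP.
by apply: eq_integral => x _; rewrite gee0_abs// lee_fin sqr_ge0.
Qed.

Lemma L2_mul_integrable f g : L2 mu D f -> L2 mu D g -> mu.-integrable D (fun x => (f x * g x)%:E).
Proof.
move=> hf hg.
have E : (fun x => (f x * g x)%:E) =
    (fun x => (1 / 4)%:E * ((f x + g x) ^+ 2)%:E - (1 / 4)%:E * ((f x - g x) ^+ 2)%:E)%E.
  by apply/funext => x; rewrite -!EFinM -EFinB; congr EFin; field.
rewrite E; apply: integrableB => //; apply: integrableZl => //; apply: L2_sqr_integrable.
- exact: L2_add.
- exact: L2_sub.
Qed.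

Definition dot f g : R := (\int[mu]_(x in D) (f x * g x))%R.

Lemma dotC f g : dot f g = dot g f.
Proof. by congr Rintegral; apply/funext => x; rewrite mulrC. Qed.

Lemma dot_EFin f g : L2 mu D f -> L2 mu D g -> (\int[mu]_(x in D) (f x * g x)%:E)%E = (dot f g)%:E.
Proof. by move=> hf hg; rewrite /dot /Rintegral fineK//; exact: integrable_fin_num (L2_mul_integrable hf hg). Qed.

Lemma dot_sqr f : dot f f = fine (\int[mu]_(x in D) (f x ^+ 2)%:E)%E.
Proof. by rewrite /dot /Rintegral; congr fine; apply: eq_integral => x _; rewrite expr2. Qed.

Lemma dot_sqr_EFin f : L2 mu D f -> (\int[mu]_(x in D) (f x ^+ 2)%:E)%E = (dot f f)%:E.
Proof. by move=> hf; rewrite -dot_EFin//; apply: eq_integral => x _; rewrite expr2. Qed.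

Lemma dot_ge0 f : 0 <= dot f f.
Proof. by rewrite dot_sqr fine_ge0//; apply: integral_ge0 => x _; rewrite lee_fin sqr_ge0. Qed.

Lemma dot_linl a b f g h : L2 mu D f -> L2 mu D g -> L2 mu D h ->
  dot (fun x => a * f x + b * g x) h = a * dot f h + b * dot g h.
Proof.
move=> hf hg hh; have ifh := L2_mul_integrable hf hh; have igh := L2_mul_integrable hg hh.
rewrite /dot -!RintegralZl// -RintegralD//.
- by congr Rintegral; apply/funext => x; ring.
- by apply: eq_integrable (integrableZl mD a ifh) => // x _; rewrite /= EFinM.
- by apply: eq_integrable (integrableZl mD b igh) => // x _; rewrite /= EFinM.
Qed.

Lemma dot_subl f g h : L2 mu D f -> L2 mu D g -> L2 mu D h ->
  dot (fun x => f x - g x) h = dot f h - dot g h.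
Proof.
move=> hf hg hh; have := dot_linl 1 (- 1) hf hg hh; rewrite mul1r mulN1r => <-.
by congr dot; apply/funext => x; rewrite mul1r mulN1r.
Qed.

Lemma dot_lin a b f g : L2 mu D f -> L2 mu D g ->
  dot (fun x => a * f x + b * g x) (fun x => a * f x + b * g x) =
  a ^+ 2 * dot f f + 2 * a * b * dot f g + b ^+ 2 * dot g g.
Proof.
move=> hf hg; have hl := L2_lin a b hf hg.
rewrite dot_linl// ![dot _ (fun x => _ + _)]dotC !dot_linl// (dotC g f); ring.
Qed.

Lemma dot_lin_le a b f g : L2 mu D f -> L2 mu D g ->
  dot (fun x => a * f x + b * g x) (fun x => a * f x + b * g x) <=
  2 * a ^+ 2 * dot f f + 2 * b ^+ 2 * dot g g.
Proof.
move=> hf hg; have := dot_ge0 (fun x => a * f x + (- b) * g x); rewrite !dot_lin//; lra.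
Qed.

Lemma dot_CS f g : L2 mu D f -> L2 mu D g -> dot f g ^+ 2 <= dot f f * dot g g.
Proof.
move=> hf hg; have f0 := dot_ge0 f; have g0 := dot_ge0 g.
have H a b := dot_ge0 (fun x => a * f x + b * g x).
have := H (dot g g) (- dot f g); rewrite dot_lin// => h1.
have [g1|g1] := ltP 0 (dot g g).
  have : 0 <= dot g g * (dot f f * dot g g - dot f g ^+ 2) by move: h1; lra.
  by rewrite pmulr_rge0// subr_ge0.
have g00 : dot g g = 0 by apply/eqP; rewrite eq_le g1.
have [->|d0] := eqVneq (dot f g) 0; first by rewrite expr0n mulr_ge0.
(* With [dot g g = 0] the square is affine in the second coefficient, which is chosen to give the
   impossible value [- 1]. *)
have := H 1 (- ((dot f f + 1) / (2 * dot f g))); rewrite dot_lin// g00.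
have -> : 1 ^+ 2 * dot f f + 2 * 1 * - ((dot f f + 1) / (2 * dot f g)) * dot f g +
  (- ((dot f f + 1) / (2 * dot f g))) ^+ 2 * 0 = - 1 by field; rewrite d0.
lra.
Qed.

Lemma dot0_ae f : L2 mu D f -> dot f f = 0 -> {ae mu, forall x, D x -> f x = 0}.
Proof.
move=> hf f0.
have mf2 : measurable_fun D (fun x => (f x ^+ 2)%:E).
  by apply/measurable_EFinP; apply: measurable_funX; case: hf.
have : (\int[mu]_(x in D) `|(f x ^+ 2)%:E|)%E = 0%E.
  rewrite -[RHS]/(0%:E) -f0 -dot_sqr_EFin//; apply: eq_integral => x _.
  by rewrite gee0_abs// lee_fin sqr_ge0.
move=> /(ae_eq_integral_abs mu mD mf2); apply: filterS => x /= h Dx.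
by have := h Dx; move=> [] /eqP; rewrite sqrf_eq0 => /eqP.
Qed.

Lemma ae_dot f f' g g' : L2 mu D f -> L2 mu D f' -> L2 mu D g -> L2 mu D g' ->
  {ae mu, forall x, D x -> f x = f' x} -> {ae mu, forall x, D x -> g x = g' x} ->
  dot f g = dot f' g'.
Proof.
move=> hf hf' hg hg' ff gg; rewrite /dot /Rintegral; congr fine.
apply: ae_eq_integral => //.
- exact: measurable_int (L2_mul_integrable hf hg).
- exact: measurable_int (L2_mul_integrable hf' hg').
- by apply: filterS2 ff gg => x h1 h2 Dx; rewrite h1// h2.
Qed.

Definition cvgL2 (fn : nat -> mplane -> R) f :=
  dot (fun x => fn n x - f x) (fun x => fn n x - f x) @[n --> \oo] --> (0 : R).

Lemma cvgL2_lin a b (fn gn : nat -> mplane -> R) f g :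
  (forall n, L2 mu D (fn n)) -> L2 mu D f -> (forall n, L2 mu D (gn n)) -> L2 mu D g ->
  cvgL2 fn f -> cvgL2 gn g ->
  cvgL2 (fun n x => a * fn n x + b * gn n x) (fun x => a * f x + b * g x).
Proof.
move=> hfn hf hgn hg cf cg.
apply: (@squeeze_cvgr _ _ _ _ (cst 0) (fun n => 2 * a ^+ 2 * dot (fun x => fn n x - f x) (fun x => fn n x - f x) +
   2 * b ^+ 2 * dot (fun x => gn n x - g x) (fun x => gn n x - g x))).
- apply: nearW => n; rewrite dot_ge0/=.
  have := dot_lin_le a b (L2_sub (hfn n) hf) (L2_sub (hgn n) hg).
  by congr (dot _ _ <= _); apply/funext => x; ring.
- exact: cvg_cst.
- rewrite (_ : 0 = 2 * a ^+ 2 * 0 + 2 * b ^+ 2 * 0); last by ring.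
  by apply: cvgD; apply: cvgM => //; exact: cvg_cst.
Qed.

Lemma cvgL2_dotl (fn : nat -> mplane -> R) f g :
  (forall n, L2 mu D (fn n)) -> L2 mu D f -> L2 mu D g ->
  cvgL2 fn f -> dot (fn n) g @[n --> \oo] --> dot f g.
Proof.
move=> hfn hf hg cf; apply/subr_cvg0.
have H : (dot (fn n) g - dot f g) ^+ 2 @[n --> \oo] --> (0 : R).
  apply: (@squeeze_cvgr _ _ _ _ (cst 0) (fun n => dot (fun x => fn n x - f x) (fun x => fn n x - f x) * dot g g)).
  - apply: nearW => n; rewrite sqr_ge0/= -dot_subl//; apply: dot_CS => //; exact: L2_sub.
  - exact: cvg_cst.
  - by rewrite -[X in _ --> X](mul0r (dot g g)); apply: cvgM => //; exact: cvg_cst.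
apply: norm_cvg0.
have : Num.sqrt ((dot (fn n) g - dot f g) ^+ 2) @[n --> \oo] --> Num.sqrt (0 : R).
  by apply: continuous_cvg H; exact: sqrt_continuous.
by rewrite sqrtr0; under eq_fun do rewrite sqrtr_sqr.
Qed.

Lemma cvgL2_sqr (fn : nat -> mplane -> R) f :
  (forall n, L2 mu D (fn n)) -> L2 mu D f ->
  cvgL2 fn f -> dot (fn n) (fn n) @[n --> \oo] --> dot f f.
Proof.
move=> hfn hf cf.
have E : (fun n => dot (fn n) (fn n)) = (fun n => dot (fun x => fn n x - f x) (fun x => fn n x - f x) +
    (2 * dot (fn n) f - dot f f)).
  apply/funext => n; have := dot_lin 1 (-1) (hfn n) hf.
  rewrite (_ : (fun x => 1 * _ + _) = (fun x => fn n x - f x)); last by apply/funext => x; ring.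
  by move=> ->; ring.
rewrite E [X in _ --> X](_ : _ = 0 + (2 * dot f f - dot f f)); last by ring.
apply: cvgD => //; apply: cvgB; last exact: cvg_cst.
by apply: cvgM; [exact: cvg_cst|exact: cvgL2_dotl].
Qed.

Lemma cvgL2_EFin (fn : nat -> mplane -> R) f : (forall n, L2 mu D (fn n)) -> L2 mu D f ->
  ((\int[mu]_(x in D) ((fn n x - f x) ^+ 2)%:E)%E @[n --> \oo] --> 0%E) <-> cvgL2 fn f.
Proof.
move=> hfn hf; rewrite (_ : (fun n => _) = (fun n => (dot (fun x => fn n x - f x) (fun x => fn n x - f x))%:E)).
  split => [h|h]; first by move/fine_cvg: h.
  by apply/fine_cvgP; split => //; exact: nearW.
by apply/funext => n; rewrite -dot_sqr_EFin//; exact: L2_sub.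
Qed.

End square_integrable.

(** * Test functions and integration by parts *)

Section test_functions.
Context {R : realType}.
Local Notation plane := (R * R)%type.
Local Notation mplane := (measurableTypeR R * measurableTypeR R)%type.
Local Notation mu := (@lebesgue_measure R).
Implicit Types (f g u : plane -> R) (U : set plane) (x : plane).

Lemma cpair (T : topologicalType) (f g : T -> R) (x : T) : {for x, continuous f} -> {for x, continuous g} ->
  {for x, continuous (fun y => (f y, g y) : plane)}.
Proof. by move=> cf cg; apply: (@cvg_pair _ _ _ _ (nbhs (f x)) (nbhs (g x))). Qed.

Lemma compact_rectangle (a b c d : R) : compact (`[a, b] `*` `[c, d] : set plane).
Proof.
pose S (i : 'I_2) : set R := if i == ord0 then `[a, b]%classic else `[c, d]%classic.
have cS : compact [set v : 'rV[R]_2 | forall i, S i (v ord0 i)].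
  by apply: rV_compact => i; rewrite /S; case: ifP => _; exact: segment_compact.
have -> : (`[a, b] `*` `[c, d] : set plane) =
    (fun v : 'rV[R]_2 => (v ord0 ord0, v ord0 ord_max)) @` [set v : 'rV[R]_2 | forall i, S i (v ord0 i)].
  apply/seteqP; split => [[x y] [/= hx hy]|_ [v Sv <-]]; last first.
    by split; [have := Sv ord0|have := Sv ord_max]; rewrite /S ?eqxx.
  exists (\row_i if i == ord0 then x else y); last by rewrite !mxE.
  by move=> i; rewrite /S mxE; case: ifP.
apply: continuous_compact cS; apply: continuous_subspaceT => v.
by apply: cpair; exact: coord_continuous.
Qed.

Lemma test_continuous U f : test_function U f -> continuous f.
Proof. by case=> /(_ 0%N). Qed.

Lemma test_intro U (K : set plane) f : (forall n, Cn n f) -> (forall x, f x != 0 -> K x) ->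
  compact K -> K `<=` U -> test_function U f.
Proof.
move=> cf fK cK KU.
have clK : closure [set x | f x != 0] `<=` K.
  have /closure_id -> : closed K by apply: compact_closed => //; exact: norm_hausdorff.
  exact: closureS.
split => //; last exact: subset_trans KU.
by apply: subclosed_compact cK clK; exact: closed_closure.
Qed.

Lemma test_derive1 U f : test_function U f -> test_function U ('D_e1 f).
Proof.
move=> [cf cK KU]; apply: (@test_intro _ (closure [set x | f x != 0])) => //.
  by move=> n; have [] := cf n.+1.
move=> x dx; apply: contrapT => nx; have hx : nbhs x (~` closure [set x | f x != 0]).
  by apply: open_nbhs_nbhs; split => //; exact: closed_openC (@closed_closure _ _).
have e : \forall y \near x, (fun=> 0) y = f y.
  near=> y; apply/esym/eqP; apply/negPn/negP => fy.
  have : (~` closure [set x | f x != 0]) y by near: y.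
  by apply; exact: subset_closure.
by move: dx; have [_ ->] := near_eq_is_derive e (dcst 0 x e1); rewrite eqxx.
Unshelve. all: by end_near. Qed.

Lemma test_derive2 U f : test_function U f -> test_function U ('D_e2 f).
Proof.
move=> [cf cK KU]; apply: (@test_intro _ (closure [set x | f x != 0])) => //.
  by move=> n; have [] := cf n.+1.
move=> x dx; apply: contrapT => nx; have hx : nbhs x (~` closure [set x | f x != 0]).
  by apply: open_nbhs_nbhs; split => //; exact: closed_openC (@closed_closure _ _).
have e : \forall y \near x, (fun=> 0) y = f y.
  near=> y; apply/esym/eqP; apply/negPn/negP => fy.
  have : (~` closure [set x | f x != 0]) y by near: y.
  by apply; exact: subset_closure.
by move: dx; have [_ ->] := near_eq_is_derive e (dcst 0 x e2); rewrite eqxx.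
Unshelve. all: by end_near. Qed.

Lemma test_is_derive U f : test_function U f -> forall x,
  is_derive x e1 f ('D_e1 f x) /\ is_derive x e2 f ('D_e2 f x).
Proof. by case=> /(_ 1%N)/CnS_derive[d1 d2] _ _ x. Qed.

Lemma test_notin U f x : test_function U f -> ~ U x -> f x = 0.
Proof.
move=> [_ _ fU] nU; apply/eqP/negPn/negP => fx; apply: nU; apply: fU.
exact: subset_closure.
Qed.

Lemma test_mulr U f u : (forall n, Cn n u) -> test_function U f -> test_function U (fun x => u x * f x).
Proof.
move=> cu [cf cK KU]; apply: (@test_intro _ (closure [set x | f x != 0])) => //.
  by move=> n; exact: Cn_mul.
move=> x; rewrite mulf_eq0 negb_or => /andP[_ fx]; exact: subset_closure.
Qed.

Lemma test_lin U a b f g : test_function U f -> test_function U g ->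
  test_function U (fun x => a * f x + b * g x).
Proof.
move=> [cf cK KU] [cg cL LU].
apply: (@test_intro _ (closure [set x | f x != 0] `|` closure [set x | g x != 0])) => //.
- by move=> n; apply: Cn_add; apply: Cn_mul => //; exact: Cn_cst.
- move=> x; have [f0|f0] := eqVneq (f x) 0; last by move=> _; left; exact: subset_closure.
  have [g0|g0] := eqVneq (g x) 0; last by move=> _; right; exact: subset_closure.
  by rewrite f0 g0 !mulr0 addr0 eqxx.
- exact: compactU.
- by move=> x [/KU|/LU].
Qed.

Lemma test_box U f : test_function U f -> exists2 B : R, 0 < B &
  forall x, f x != 0 -> (- B < x.1 < B) /\ (- B < x.2 < B).
Proof.
move=> [_ /compact_bounded[M [_ HM]] _]; exists (`|M| + 2); first by rewrite ltr_wpDl.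
move=> x fx; have : `|x| <= `|M| + 1.
  by apply: HM; [rewrite ltr_pwDr// ler_norm|exact: subset_closure].
rewrite prod_normE/= ge_max => /andP[h1 h2].
by rewrite -!ltr_norml; split; [apply: le_lt_trans h1 _|apply: le_lt_trans h2 _]; rewrite ltrD2l ltr1n.
Qed.

Lemma test_bounded U f : test_function U f -> exists2 C : R, 0 <= C & forall x, `|f x| <= C.
Proof.
move=> hf; have cf := test_continuous hf; case: hf => _ cK _.
have /compact_bounded[M [_ HM]] : compact (f @` closure [set x | f x != 0]).
  by apply: continuous_compact cK; exact: continuous_subspaceT.
exists (`|M| + 1) => // x; have [->|fx] := eqVneq (f x) 0; first by rewrite normr0.
by apply: HM; [rewrite ltr_pwDr// ler_norm|exists x => //; exact: subset_closure].
Qed.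

Lemma test_measurable U f : test_function U f -> measurable_fun setT (f : mplane -> R).
Proof. by move=> /test_continuous; exact: continuous_measurable_plane. Qed.

Lemma bounded_L2 (nu : {measure set mplane -> \bar R}) (D : set mplane) (g : mplane -> R) (C : R) :
  measurable D -> (nu D < +oo)%E -> measurable_fun D g -> (forall x, D x -> `|g x| <= C) -> L2 nu D g.
Proof.
move=> mD nD mg gC; split => //.
have mg2 : measurable_fun D (fun x => (g x ^+ 2)%:E) by apply/measurable_EFinP; exact: measurable_funX.
apply: (@le_lt_trans _ _ (\int[nu]_(x in D) (cst (C ^+ 2)%:E x))%E).
  apply: ge0_le_integral => //; try by move=> x _; rewrite lee_fin sqr_ge0.
  move=> x Dx; rewrite lee_fin -(real_normK (num_real (g x))) ler_pXn2r// ?gC// nnegrE//.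
  exact: le_trans (gC x Dx).
rewrite integral_cst//; apply: lte_mul_pinfty => //; by rewrite lee_fin sqr_ge0.
Qed.

Lemma leb2_rectangle_fin (a b c d : R) : (@leb2 R (`[a, b] `*` `[c, d]) < +oo)%E.
Proof.
have -> : leb2 (`[a, b] `*` `[c, d]) = (mu `[a, b] * mu `[c, d])%E by exact: product_measure1E.
rewrite !lebesgue_measure_itv/=.
by case: ifP => _; case: ifP => _; rewrite ?mule0 ?mul0e// -EFinM ltry.
Qed.

Lemma test_L2 U f (D : set mplane) : measurable D -> test_function U f -> L2 leb2 D f.
Proof.
move=> mD hf; have mf := test_measurable hf.
have [B B0 fB] := test_box hf; have [C C0 fC] := test_bounded hf.
pose Q : set mplane := `[- B, B] `*` `[- B, B].
have mQ : measurable Q by apply: measurableX; exact: measurable_itv.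
have [_ hQ] := @bounded_L2 leb2 Q f C mQ (leb2_rectangle_fin _ _ _ _)
  (measurable_funTS mf) (fun x _ => fC x).
split; first exact: measurable_funTS.
apply: le_lt_trans hQ; rewrite [leLHS]integral_mkcond [leRHS]integral_mkcond.
apply: ge0_le_integral => //.
- by move=> x _; rewrite patchE; case: ifP => // _; rewrite lee_fin sqr_ge0.
- apply/(measurable_restrictT _ _).1 => //; apply: measurable_funTS.
  by apply/measurable_EFinP; exact: measurable_funX.
- apply/(measurable_restrictT _ _).1 => //; apply: measurable_funTS.
  by apply/measurable_EFinP; exact: measurable_funX.
- move=> x _; have [fx|fx] := eqVneq (f x) 0.
    by rewrite !patchE fx expr0n; case: ifP => _; case: ifP.
  have [/andP[h1 h2] /andP[h3 h4]] := fB x fx.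
  rewrite [X in (_ <= X)%E]patchE ifT; last by rewrite inE; split; rewrite /= in_itv/= !ltW.
  by rewrite patchE; case: ifP => // _; rewrite lee_fin sqr_ge0.
Qed.

Lemma test_integrable U f (D : set mplane) : measurable D -> test_function U f ->
  leb2.-integrable D (fun x => (f x)%:E).
Proof.
move=> mD hf; have mf := test_measurable hf.
have [B B0 fB] := test_box hf; have [C C0 fC] := test_bounded hf.
pose Q : set mplane := `[- B, B] `*` `[- B, B].
have mQ : measurable Q by apply: measurableX; exact: measurable_itv.
have Qf : (@leb2 R Q < +oo)%E by exact: leb2_rectangle_fin.
have h1 : L2 leb2 Q (fun=> 1) by apply: (@bounded_L2 _ _ _ 1) => // x _; rewrite normr1.
have h2 : L2 leb2 Q f by exact: test_L2 hf.
have : leb2.-integrable Q (fun x => (f x * 1)%:E) by exact: L2_mul_integrable.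
move=> /(integrable_mkcond _ mQ) hi.
apply: (@integrableS _ _ R leb2 setT) => //.
apply: eq_integrable hi => // x _ /=; rewrite patchE mulr1; case: ifPn => // xQ.
congr EFin; apply/esym/eqP/negPn/negP => fx; move/negP: xQ; apply.
have [/andP[a1 a2] /andP[a3 a4]] := fB x fx.
by rewrite inE; split; rewrite /= in_itv/= !ltW.
Qed.

Lemma is_derive_slice1 f (x y a : R) : is_derive (x, y) e1 f a ->
  is_derive x 1 (fun s => f (s, y)) a.
Proof.
move=> /derive_ray h.
have d : is_derive x 1 (fun s : R => s - x) 1 by der; ring.
rewrite -(subrr x) in h.
have := dcomp1 d h; rewrite mulr1; congr (is_derive _ _ _ _); apply/funext => s.
by congr f; rewrite /e1; apply: injective_projections; rewrite /= /GRing.scale/= ?mulr1 ?mulr0 ?subrK ?add0r.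
Qed.

Lemma is_derive_slice2 f (x y a : R) : is_derive (x, y) e2 f a ->
  is_derive y 1 (fun s => f (x, s)) a.
Proof.
move=> /derive_ray h.
have d : is_derive y 1 (fun s : R => s - y) 1 by der; ring.
rewrite -(subrr y) in h.
have := dcomp1 d h; rewrite mulr1; congr (is_derive _ _ _ _); apply/funext => s.
by congr f; rewrite /e2; apply: injective_projections; rewrite /= /GRing.scale/= ?mulr1 ?mulr0 ?subrK ?add0r.
Qed.

Lemma integral_vanishing_ends (F f : R -> R) (B : R) : 0 < B ->
  (forall x : R, is_derive x 1 F (f x)) -> continuous f ->
  (forall x : R, F x != 0 -> - B < x < B) -> (forall x : R, f x != 0 -> - B < x < B) ->
  (\int[mu]_x (f x)%:E = 0)%E.
Proof.
move=> B0 dF cf FB fB.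
have FB0 (x : R) : ~~ (- B < x < B) -> F x = 0 by move=> /negP h; apply/eqP/negPn/negP => /FB.
transitivity (\int[mu]_(x in `[(- B)%R, B]) (f x)%:E)%E.
  rewrite [RHS]integral_mkcond; apply: eq_integral => x _; rewrite patchE.
  case: ifPn => // /negP hx; congr EFin; apply/eqP/negPn/negP => /fB/andP[h1 h2]; apply: hx.
  by rewrite inE/= in_itv/= !ltW.
rewrite (@ftc_itv _ F) ?FB0 ?subrr ?ltxx ?andbF//; first by lra.
exact: continuous_subspaceT.
Qed.

Lemma integral_test_derive1 U f : test_function U f -> (\int[leb2]_x ('D_e1 f x)%:E = 0)%E.
Proof.
move=> hf; have hd := test_derive1 hf; have cd := test_continuous hd.
have [B B0 fB] := test_box hf; have [B' B'0 dB] := test_box hd.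
have hi := test_integrable measurableT hd.
have hB0 : 0 < B + B' by rewrite addr_gt0.
rewrite /leb2 -(@integral21_prod_meas1 _ _ _ _ _ mu mu (fun x => ('D_e1 f x)%:E) hi).
apply: integral0_eq => y _.
rewrite /fubini_G.
have d (x : R) : is_derive x 1 (fun x : R => f (x, y)) ('D_e1 f (x, y)).
  by apply: is_derive_slice1; have [] := test_is_derive hf (x, y).
have c : continuous (fun x : R => 'D_e1 f (x, y)).
  move=> x; apply: (@continuous_comp _ _ _ (fun x : R => (x, y)) ('D_e1 f)); last exact: cd.
  by apply: (@cpair R id (fun=> y)); [exact: cvg_id|exact: cvg_cst].
apply: (integral_vanishing_ends hB0 d c) => x; first by move=> /fB[/= h _]; lra.
by move=> /dB[/= h _]; lra.
Qed.

Lemma integral_test_derive2 U f : test_function U f -> (\int[leb2]_x ('D_e2 f x)%:E = 0)%E.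
Proof.
move=> hf; have hd := test_derive2 hf; have cd := test_continuous hd.
have [B B0 fB] := test_box hf; have [B' B'0 dB] := test_box hd.
have hi := test_integrable measurableT hd.
have hB0 : 0 < B + B' by rewrite addr_gt0.
rewrite /leb2 -(@integral12_prod_meas1 _ _ _ _ _ mu mu (fun x => ('D_e2 f x)%:E) hi).
apply: integral0_eq => x _.
rewrite /fubini_F.
have d (y : R) : is_derive y 1 (fun y : R => f (x, y)) ('D_e2 f (x, y)).
  by apply: is_derive_slice2; have [] := test_is_derive hf (x, y).
have c : continuous (fun y : R => 'D_e2 f (x, y)).
  move=> y; apply: (@continuous_comp _ _ _ (fun y : R => (x, y)) ('D_e2 f)); last exact: cd.
  by apply: (@cpair R (fun=> x) id); [exact: cvg_cst|exact: cvg_id].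
apply: (integral_vanishing_ends hB0 d c) => y; first by move=> /fB[/= _ h]; lra.
by move=> /dB[/= _ h]; lra.
Qed.

(** The integral over the plane of a derivative of the product [u f] vanishes. As [f] is supported
    in [U], integrating over [U] or over the plane is the same, whatever the support of [u]. *)
Lemma test_is_gradient (U V : set plane) u : measurable (U : set mplane) -> test_function V u ->
  is_gradient U u (fun x => ('D_e1 u x, 'D_e2 u x)).
Proof.
move=> mU hu; have h1 := test_derive1 hu; have h2 := test_derive2 hu.
split; [exact: test_L2 h1|exact: test_L2 h2|move=> f hf].
have cu n : Cn n u by case: hu.
have hf1 := test_derive1 hf; have hf2 := test_derive2 hf.
have huf : test_function U (fun x => u x * f x) by exact: test_mulr.
have Lu := test_L2 mU hu; have Lf := test_L2 mU hf.
have key (v g : mplane -> R) (df := fun x => u x * g x + v x * f x) :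
    L2 leb2 U g -> L2 leb2 U v -> (\int[leb2]_x (df x)%:E = 0)%E -> (forall x, ~ U x -> df x = 0) ->
    (\int[leb2]_(x in U) (u x * g x)%:E = - \int[leb2]_(x in U) (v x * f x)%:E)%E.
  move=> Lg Lv df0 dfU; rewrite !dot_EFin// -EFinN; congr EFin; apply/eqP; rewrite -addr_eq0.
  rewrite /dot -RintegralD//; [|exact: L2_mul_integrable..].
  rewrite /Rintegral (_ : \int[leb2]_(x in U) _ = 0)%E//.
  rewrite -df0 integral_mkcond; apply: eq_integral => x _; rewrite patchE; case: ifPn => // /negP xU.
  by rewrite dfU// => Ux; apply: xU; rewrite inE.
have du x := test_is_derive hu x; have df x := test_is_derive hf x.
split; apply: key; [exact: test_L2 hf1|exact: test_L2 h1| | |exact: test_L2 hf2|exact: test_L2 h2| |].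
- rewrite -(integral_test_derive1 huf); apply: eq_integral => x _; congr EFin.
  have [d _] := du x; have [d' _] := df x; have [_ ->] := dmul d d'; rewrite /=; ring.
- by move=> x nU; rewrite (test_notin hf)// (test_notin hf1)// !mulr0 addr0.
- rewrite -(integral_test_derive2 huf); apply: eq_integral => x _; congr EFin.
  have [_ d] := du x; have [_ d'] := df x; have [_ ->] := dmul d d'; rewrite /=; ring.
- by move=> x nU; rewrite (test_notin hf)// (test_notin hf2)// !mulr0 addr0.
Qed.

End test_functions.

(** * Weak gradients *)

Section weak_gradient.
Context {R : realType}.
Local Notation plane := (R * R)%type.
Local Notation mplane := (measurableTypeR R * measurableTypeR R)%type.
Local Notation mu := (@lebesgue_measure R).
Implicit Types (f g u : plane -> R) (U : set plane) (x : plane).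

(** Both factors have transition width [1 / n]; the product is supported in [[a, b]] and converges
    pointwise to the indicator of []a, b[]. *)
Definition interval_bump (a b : R) (n : nat) (t : R) : R :=
  smooth_step (n%:R * t + n%:R * - a) * smooth_step (- n%:R * t + n%:R * b).

Lemma smooth_to_interval_bump k a b n : smooth_to k setT (interval_bump a b n).
Proof. by apply: smooth_to_mul; apply: smooth_to_affine; exact: smooth_to_step. Qed.

Lemma interval_bump_itv a b n t : 0 <= interval_bump a b n t <= 1.
Proof.
rewrite /interval_bump mulr_ge0 ?smooth_step_ge0//=.
by rewrite mulr_ile1 ?smooth_step_ge0 ?smooth_step_le1.
Qed.

Lemma interval_bump_supp a b n t : interval_bump a b n t != 0 -> a < t < b.
Proof.
have n0 : (0 : R) <= n%:R by exact: ler0n.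
rewrite /interval_bump mulf_eq0 negb_or => /andP[h1 h2]; apply/andP; split; rewrite ltNge; apply/negP => h.
  by move: h1; rewrite smooth_step_le0 ?eqxx// -mulrDr mulr_ge0_le0// subr_le0.
by move: h2; rewrite smooth_step_le0 ?eqxx// mulNr addrC -mulrBr mulr_ge0_le0// subr_le0.
Qed.

Lemma interval_bump_cvg a b t : a < t < b -> interval_bump a b n t @[n --> \oo] --> (1 : R).
Proof.
move=> /andP[h1 h2]; have p1 : 0 < t - a by rewrite subr_gt0.
have p2 : 0 < b - t by rewrite subr_gt0.
apply: cvg_near_cst; near=> n.
have n1 : (t - a)^-1 + (b - t)^-1 <= n%:R :> R.
  by near: n; exact: nbhs_infty_ger.
have q1 : 0 < (t - a)^-1 by rewrite invr_gt0.
have q2 : 0 < (b - t)^-1 by rewrite invr_gt0.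
rewrite /interval_bump !smooth_step_ge1 ?mulr1//.
  by rewrite mulNr addrC -mulrBr -ler_pdivrMr// mul1r; lra.
by rewrite -mulrDr -ler_pdivrMr// mul1r; lra.
Unshelve. all: by end_near. Qed.

Definition open_box (q : (R * R) * (R * R)) : set plane := `]q.1.1, q.1.2[ `*` `]q.2.1, q.2.2[.
Definition closed_box (q : (R * R) * (R * R)) : set plane := `[q.1.1, q.1.2] `*` `[q.2.1, q.2.2].

Lemma measurable_open_box q : measurable (open_box q : set mplane).
Proof. by apply: measurableX; exact: measurable_itv. Qed.

Lemma leb2_open_box_fin q : (@leb2 R (open_box q) < +oo)%E.
Proof.
have -> : leb2 (open_box q) = (mu `]q.1.1, q.1.2[ * mu `]q.2.1, q.2.2[)%E by exact: product_measure1E.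
rewrite !lebesgue_measure_itv/=.
by case: ifP => _; case: ifP => _; rewrite ?mule0 ?mul0e// -EFinM ltry.
Qed.

Definition box_bump q n : plane -> R :=
  fun x => interval_bump q.1.1 q.1.2 n x.1 * interval_bump q.2.1 q.2.2 n x.2.

Lemma box_bump_supp q n x : box_bump q n x != 0 -> open_box q x.
Proof.
rewrite /box_bump mulf_eq0 negb_or => /andP[/interval_bump_supp h1 /interval_bump_supp h2].
by split; rewrite /= in_itv.
Qed.

Lemma test_box_bump U q n : closed_box q `<=` U -> test_function U (box_bump q n).
Proof.
apply: test_intro => [k|x /box_bump_supp[]|]; last exact: compact_rectangle.
- apply: Cn_mul.
  + by apply: (Cn_comp (smooth_to_interval_bump _ _ _ _)); exact: Cn_fst.
  + by apply: (Cn_comp (smooth_to_interval_bump _ _ _ _)); exact: Cn_snd.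
- by rewrite /= !in_itv/= => /andP[? ?] /andP[? ?]; split; rewrite /= in_itv/= !ltW.
Qed.

Lemma box_bump_itv q n x : 0 <= box_bump q n x <= 1.
Proof.
have /andP[a0 a1] := interval_bump_itv q.1.1 q.1.2 n x.1.
have /andP[b0 b1] := interval_bump_itv q.2.1 q.2.2 n x.2.
by rewrite /box_bump mulr_ge0//= mulr_ile1.
Qed.

Lemma box_bump_le_indic q n x : `|box_bump q n x| <= `|\1_(open_box q) x|.
Proof.
have /andP[b0 b1] := box_bump_itv q n x; rewrite ger0_norm// indicE.
have [qx|qx] := boolP (x \in open_box q); first by rewrite normr1.
rewrite normr0 le_eqVlt; apply/orP; left; apply/negPn/negP => hx.
by move/negP: qx; apply; rewrite inE; exact: box_bump_supp hx.
Qed.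

Lemma box_bump_cvg q x : box_bump q n x @[n --> \oo] --> (\1_(open_box q) x : R).
Proof.
rewrite indicE; have [qx|qx] := boolP (x \in open_box q).
  move: qx; rewrite inE => -[/= h1 h2]; rewrite !in_itv/= in h1 h2.
  by rewrite -[X in _ --> X](mulr1 1); apply: cvgM; exact: interval_bump_cvg.
apply: cvg_near_cst; apply: nearW => n; apply/eqP/negPn/negP => /box_bump_supp h.
by move/negP: qx; apply; rewrite inE.
Qed.

(** Boxes with arbitrary corners, empty ones included, are stable under intersection; with this
    lemma they form a pi-system generating the Borel sets. *)
Lemma borel_plane_boxes : @measurable _ mplane = <<s range open_box >>.
Proof.
apply/seteqP; split; last first.
  apply: smallest_sub; first by split; [exact: measurable0|move=> A mA; rewrite setTD; exact: measurableC|move=> F mF; exact: bigcupT_measurable].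
  by move=> _ [q _ <-]; exact: measurable_open_box.
pose T := g_sigma_algebraType (range open_box).
have mbox (q : (R * R) * (R * R)) : measurable (open_box q : set T).
  by apply: sub_sigma_algebra; exists q.
have nat_gt (y : R) : exists n : nat, - n%:R < y < n%:R.
  by exists (Num.bound `|y|); rewrite -ltr_norml archi_boundP.
have m1 : measurable_fun setT (fun x : T => x.1 : measurableTypeR R).
  apply: (measurability _ (RGenInftyO.measurableE R)) => _ [_ [a ->] <-]; rewrite setTI.
  rewrite (_ : _ @^-1` _ = \bigcup_n open_box ((- n%:R, a), (- n%:R, n%:R))).
    by apply: bigcupT_measurable => n; exact: mbox.
  apply/seteqP; split => [x /=|x [n _ [/= + _]]]; rewrite !in_itv/= => h; last by case/andP: h.
  have [n /andP[n1 n2]] := nat_gt x.1; have [m /andP[m1 m2]] := nat_gt x.2.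
  have nm : (n%:R <= (n + m)%:R :> R) by rewrite ler_nat leq_addr.
  have mm : (m%:R <= (n + m)%:R :> R) by rewrite ler_nat leq_addl.
  exists (n + m)%N => //; split; rewrite /= in_itv/=; first by rewrite h andbT; lra.
  by apply/andP; split; lra.
have m2 : measurable_fun setT (fun x : T => x.2 : measurableTypeR R).
  apply: (measurability _ (RGenInftyO.measurableE R)) => _ [_ [a ->] <-]; rewrite setTI.
  rewrite (_ : _ @^-1` _ = \bigcup_n open_box ((- n%:R, n%:R), (- n%:R, a))).
    by apply: bigcupT_measurable => n; exact: mbox.
  apply/seteqP; split => [x /=|x [n _ [/= _]]]; rewrite !in_itv/= => h; last by case/andP: h.
  have [n /andP[n1 n2]] := nat_gt x.1; have [m /andP[m1' m2]] := nat_gt x.2.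
  have nm : (n%:R <= (n + m)%:R :> R) by rewrite ler_nat leq_addr.
  have mm : (m%:R <= (n + m)%:R :> R) by rewrite ler_nat leq_addl.
  exists (n + m)%N => //; split; rewrite /= in_itv/=; last by rewrite h andbT; lra.
  by apply/andP; split; lra.
apply: smallest_sub; first exact: smallest_sigma_algebra.
move=> A [|] [B mB <-].
- exact: m1 measurableT B mB.
- exact: m2 measurableT B mB.
Qed.

Definition boxI (p q : (R * R) * (R * R)) : (R * R) * (R * R) :=
  ((Num.max p.1.1 q.1.1, Num.min p.1.2 q.1.2), (Num.max p.2.1 q.2.1, Num.min p.2.2 q.2.2)).

Lemma open_boxI p q : open_box p `&` open_box q = open_box (boxI p q).
Proof.
apply/seteqP; split => [x [[/= + +] [/=]]|x [/=]]; rewrite !in_itv/= ?gt_max ?lt_min.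
  move=> /andP[h1 h2] /andP[h3 h4] /andP[h5 h6] /andP[h7 h8].
  by split; rewrite /= in_itv/= ?gt_max ?lt_min ?h1 ?h2 ?h3 ?h4 ?h5 ?h6 ?h7 ?h8.
move=> /andP[/andP[h1 h2] /andP[h3 h4]] /andP[/andP[h5 h6] /andP[h7 h8]].
by split; split; rewrite /= in_itv/=; apply/andP.
Qed.

Lemma closed_boxI p q : closed_box (boxI p q) `<=` closed_box q.
Proof.
move=> x [/=]; rewrite !in_itv/= !ge_max !le_min.
move=> /andP[/andP[_ h2] /andP[_ h4]] /andP[/andP[_ h6] /andP[_ h8]].
by split; rewrite /= in_itv/=; apply/andP.
Qed.

Lemma setI_closed_open_box : setI_closed (range open_box).
Proof. by move=> _ _ [p _ <-] [q _ <-]; rewrite open_boxI; exists (boxI p q). Qed.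

(** Dynkin's argument: the sets over which [w] has zero integral form a Dynkin system, the vanishing
    total integral giving stability under complements. A function with zero integral over every
    Borel set vanishes almost everywhere. *)
Lemma integrable_boxes_ae0 (w : mplane -> R) : leb2.-integrable setT (EFin \o w) ->
  (\int[leb2]_x (w x)%:E = 0)%E ->
  (forall q, \int[leb2]_(x in open_box q) (w x)%:E = 0)%E ->
  {ae leb2, forall x, w x = 0}.
Proof.
move=> iw w0 wq; have mw := measurable_int _ iw.
have H (S : set mplane) : measurable S -> (\int[leb2]_(x in S) (w x)%:E = 0)%E.
  move=> mS; apply: (@dynkin_induction _ mplane (range open_box)
    (fun S => \int[leb2]_(x in S) (w x)%:E = 0)%E borel_plane_boxes setI_closed_open_box) => //.
  - by move=> _ [q _ <-].
  - move=> A mA A0.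
    have : (\int[leb2]_(x in A `|` ~` A) (w x)%:E = 0)%E by rewrite setUv.
    rewrite integral_setU ?A0 ?add0e//; [exact: measurableC|exact: measurable_funTS|].
    by rewrite disj_set2E setICr eqxx.
  - move=> F mF tF F0; rewrite integral_bigcup// ?eseries0//.
    by apply: (@integrableS _ _ R leb2 setT) => //; exact: bigcupT_measurable.
  - by rewrite -borel_plane_boxes.
have := @integral_ae_eq _ _ _ leb2 setT measurableT (fun=> 0%E) (EFin \o w) iw.
move=> /(_ _ _)[]//; first by move=> E _ mE; rewrite H// integral0.
by move=> N [mN N0 sub]; exists N; split => // x /= hx; apply: sub => /= h; apply: hx; have [] := h I.
Qed.

Lemma test_orthogonal_box U (v : mplane -> R) q : open U -> L2 leb2 U v ->
  (forall f, test_function U f -> (\int[leb2]_(x in U) (v x * f x)%:E = 0)%E) ->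
  closed_box q `<=` U -> (\int[leb2]_(x in open_box q) (v x)%:E = 0)%E.
Proof.
move=> oU Lv h qU; have mU := open_measurable_plane oU.
have mq := measurable_open_box q.
have ocq : open_box q `<=` closed_box q.
  by move=> x [/=]; rewrite !in_itv/= => /andP[? ?] /andP[? ?]; split; rewrite /= in_itv/= !ltW.
have oqU : open_box q `<=` U by exact: subset_trans qU.
have mcq : measurable (closed_box q : set mplane) by apply: measurableX; exact: measurable_itv.
have qfin := leb2_open_box_fin q.
have mind : measurable_fun U (\1_(open_box q) : mplane -> R) by exact: measurable_funTS.
have [mv _] := Lv.
have Lind : L2 leb2 U (\1_(open_box q) : mplane -> R).
  split; first exact: mind.
  apply: (@le_lt_trans _ _ (\int[leb2]_(x in U) (\1_(open_box q) x)%:E)%E).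
    rewrite le_eqVlt; apply/orP; left; apply/eqP; apply: eq_integral => x _.
    by rewrite indicE; case: (_ \in _); rewrite ?expr1n ?expr0n.
  by rewrite integral_indic// (setIidl oqU).
have ig : leb2.-integrable U (fun x => `|(v x * \1_(open_box q) x)%:E|%E).
  by apply: integrable_abse; exact: L2_mul_integrable.
have [|||//|_ _ H] := @dominated_convergence _ _ _ leb2 U mU (fun n x => (v x * box_bump q n x)%:E)
   (fun x => (v x * \1_(open_box q) x)%:E) (fun x => `|(v x * \1_(open_box q) x)%:E|%E) _ _ _ ig.
- move=> n; apply/measurable_EFinP; apply: measurable_funM => //; apply: measurable_funTS.
  exact: test_measurable (test_box_bump n qU).
- by apply/measurable_EFinP; exact: measurable_funM.
- by apply: aeW => x _; apply: cvg_EFin; [exact: nearW|apply: cvgM; [exact: cvg_cst|exact: box_bump_cvg]].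
- by apply: aeW => x n _; rewrite /= lee_fin (normrM (v x) (box_bump q n x)) (normrM (v x) (\1_(open_box q) x)) ler_wpM2l// box_bump_le_indic.
have E0 : (\int[leb2]_(x in U) (v x * \1_(open_box q) x)%:E = 0)%E.
  have E : (fun n => \int[leb2]_(x in U) (v x * box_bump q n x)%:E)%E = (fun=> 0%E).
    by apply/funext => n; apply: h; exact: test_box_bump.
  move: H; rewrite E => H; exact: cvg_unique H (cvg_cst _).
rewrite -E0 -[X in (\int[leb2]_(x in X) _)%E](setIidr oqU) integral_mkcondr.
apply: eq_integral => x _; rewrite patchE indicE; case: ifPn => _; by rewrite ?mulr1 ?mulr0.
Qed.

(** The fundamental lemma of the calculus of variations. By dominated convergence the bumps give
    zero integrals over all boxes whose closed box lies in [U], hence [v = 0] almost everywhere in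
    each such box, and countably many rational boxes cover [U]. *)
Lemma test_orthogonal_ae0 U (v : mplane -> R) : open U -> L2 leb2 U v ->
  (forall f, test_function U f -> (\int[leb2]_(x in U) (v x * f x)%:E = 0)%E) ->
  {ae leb2, forall x, U x -> v x = 0}.
Proof.
move=> oU Lv h; have mU := open_measurable_plane oU.
have hq := test_orthogonal_box oU Lv h.
have boxae q : closed_box q `<=` U -> {ae leb2, forall x, open_box q x -> v x = 0}.
  move=> qU; have mq := measurable_open_box q.
  have ocq : open_box q `<=` closed_box q.
    by move=> x [/=]; rewrite !in_itv/= => /andP[? ?] /andP[? ?]; split; rewrite /= in_itv/= !ltW.
  have oqU : open_box q `<=` U by exact: subset_trans qU.
  have Lq : L2 leb2 (open_box q) v.
    split; first by apply: measurable_funS Lv.1.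
    apply: le_lt_trans Lv.2; apply: ge0_subset_integral => //.
      by apply/measurable_EFinP; apply: measurable_funX; case: Lv.
    by move=> x _; rewrite lee_fin sqr_ge0.
  have mcq : measurable (closed_box q : set mplane) by apply: measurableX; exact: measurable_itv.
  have L1 : L2 leb2 (open_box q) (fun=> 1).
    apply: (@bounded_L2 _ _ _ _ 1) => //; first exact: leb2_open_box_fin.
    by move=> x _; rewrite normr1.
  pose w : mplane -> R := v \_ (open_box q).
  have EFw : EFin \o w = (fun x => (v x * 1)%:E) \_ (open_box q).
    by apply/funext => x; rewrite /= /w !patchE; case: ifP; rewrite ?mulr1.
  have iw : leb2.-integrable setT (EFin \o w).
    by rewrite EFw; apply/(integrable_mkcond _ mq).1; exact: L2_mul_integrable.
  have wE (A : set mplane) : (\int[leb2]_(x in A) (w x)%:E = \int[leb2]_(x in A `&` open_box q) (v x)%:E)%E.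
    rewrite integral_mkcondr; apply: eq_integral => x _.
    by rewrite /w !patchE; case: ifP.
  have : {ae leb2, forall x, w x = 0}.
    apply: integrable_boxes_ae0 => //; first by rewrite wE setTI hq.
    move=> q'; rewrite wE.
    by rewrite open_boxI; apply: hq; apply: subset_trans qU; exact: closed_boxI.
  apply: (@filterS _ _ (ae_filter_ringOfSetsType _)) => x /= wx qx; move: wx; rewrite /w patchE ifT//; last by rewrite inE.
pose Q (p : (rat * rat) * (rat * rat)) := ((ratr p.1.1 : R, ratr p.1.2 : R), (ratr p.2.1 : R, ratr p.2.2 : R)).
(* The rational boxes are enumerated through [unpickle], so that the exceptional sets are united
   over the natural numbers. *)
have : {ae leb2, forall x, forall n : nat, forall p, unpickle n = Some p -> closed_box (Q p) `<=` U -> open_box (Q p) x -> v x = 0}.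
  apply/ae_foralln => n; case: (unpickle n) => [p|]; last by apply: aeW.
  have [qU|qU] := pselect (closed_box (Q p) `<=` U); last by apply: aeW => x p' [<-].
  by have := boxae _ qU; apply: (@filterS _ _ (ae_filter_ringOfSetsType _)) => x hx p' [<-].
apply: (@filterS _ _ (ae_filter_ringOfSetsType _)) => x hx Ux.
have /nbhs_ballP[e /= e0 eU] : nbhs x U by exact: open_nbhs_nbhs.
have h1 (y : R) : exists q : rat, y - e < ratr q < y.
  have /rat_in_itvoo[q] : y - e < y by rewrite gtrBl.
  by rewrite in_itv/= => ?; exists q.
have h2 (y : R) : exists q : rat, y < ratr q < y + e.
  have /rat_in_itvoo[q] : y < y + e by rewrite ltrDl.
  by rewrite in_itv/= => ?; exists q.
have [a /andP[a1 a2]] := h1 x.1; have [b /andP[b1 b2]] := h2 x.1.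
have [c /andP[c1 c2]] := h1 x.2; have [d /andP[d1 d2]] := h2 x.2.
apply: (hx (pickle ((a, b), (c, d))) ((a, b), (c, d))); first exact: pickleK.
  move=> y [/=]; rewrite !in_itv/= => /andP[y1 y2] /andP[y3 y4].
  by apply: eU; split; rewrite /ball/= ltr_norml; apply/andP; split; lra.
by split; rewrite /= in_itv/= ?a2 ?c2.
Qed.

Lemma gradient_unique U u v w : open U -> is_gradient U u v -> is_gradient U u w ->
  {ae leb2, forall x, U x -> (v x).1 = (w x).1} /\ {ae leb2, forall x, U x -> (v x).2 = (w x).2}.
Proof.
move=> oU [v1 v2 hv] [w1 w2 hw]; have mU := open_measurable_plane oU.
have key (p q : mplane -> R) (d : (plane -> R) -> plane -> R) : L2 leb2 U p -> L2 leb2 U q ->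
    (forall f, test_function U f -> (\int[leb2]_(x in U) (u x * d f x)%:E = - \int[leb2]_(x in U) (p x * f x)%:E)%E) ->
    (forall f, test_function U f -> (\int[leb2]_(x in U) (u x * d f x)%:E = - \int[leb2]_(x in U) (q x * f x)%:E)%E) ->
    {ae leb2, forall x, U x -> p x = q x}.
  move=> Lp Lq hp hq; have Lpq := L2_sub mU Lp Lq.
  have := test_orthogonal_ae0 oU Lpq => /(_ _)[].
    move=> f hf; have Lf := test_L2 mU hf.
    have := hp f hf; rewrite (hq f hf) !dot_EFin// -!EFinN => -[] /oppr_inj e.
    by rewrite dot_subl// e subrr.
  move=> N [mN N0 sub]; exists N; split => // x /= hx; apply: sub => /= h; apply: hx => Ux.
  by apply/eqP; rewrite -subr_eq0; apply/eqP; exact: h.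
split.
- by apply: (key _ _ (fun f => 'D_e1 f)) => // f hf; [have [] := hv f hf|have [] := hw f hf].
- by apply: (key _ _ (fun f => 'D_e2 f)) => // f hf; [have [] := hv f hf|have [] := hw f hf].
Qed.

Lemma is_gradient_lin U a b u u' v v' : measurable (U : set mplane) -> L2 leb2 U u -> L2 leb2 U u' ->
  is_gradient U u v -> is_gradient U u' v' ->
  is_gradient U (fun x => a * u x + b * u' x)
    (fun x => (a * (v x).1 + b * (v' x).1, a * (v x).2 + b * (v' x).2)).
Proof.
move=> mU Lu Lu' [v1 v2 hv] [w1 w2 hw]; split; [exact: (L2_lin mU a b v1 w1)|exact: (L2_lin mU a b v2 w2)|move=> f hf].
have Lf := test_L2 mU hf; have L1 := test_L2 mU (test_derive1 hf); have L2' := test_L2 mU (test_derive2 hf).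
have Luu := L2_lin mU a b Lu Lu'.
have key (p p' d : mplane -> R) : L2 leb2 U p -> L2 leb2 U p' -> L2 leb2 U d ->
    (\int[leb2]_(x in U) (u x * d x)%:E = - \int[leb2]_(x in U) (p x * f x)%:E)%E ->
    (\int[leb2]_(x in U) (u' x * d x)%:E = - \int[leb2]_(x in U) (p' x * f x)%:E)%E ->
    (\int[leb2]_(x in U) ((a * u x + b * u' x) * d x)%:E =
      - \int[leb2]_(x in U) ((a * p x + b * p' x) * f x)%:E)%E.
  move=> Lp Lp' Ld; rewrite (dot_EFin mU Lu Ld) (dot_EFin mU Lp Lf) (dot_EFin mU Lu' Ld) (dot_EFin mU Lp' Lf).
  rewrite -!EFinN => -[e] [e']; have Lpp := L2_lin mU a b Lp Lp'.
  rewrite (dot_EFin mU Luu Ld) (dot_EFin mU Lpp Lf) -EFinN (dot_linl mU a b Lu Lu' Ld) (dot_linl mU a b Lp Lp' Lf).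
  by rewrite e e'; congr EFin; ring.
have [a1 a2] := hv f hf; have [b1 b2] := hw f hf.
by split; [exact: (key _ _ _ v1 w1 L1 a1 b1)|exact: (key _ _ _ v2 w2 L2' a2 b2)].
Qed.

Lemma gradP U u : H1r U u -> is_gradient U u (grad U u).
Proof. by move=> [_ [v hv]]; rewrite /grad; apply: (xgetPex 0 (P := [set v | is_gradient U u v])); exists v. Qed.

Lemma H1r_lin U a b u u' : measurable (U : set mplane) -> H1r U u -> H1r U u' ->
  H1r U (fun x => a * u x + b * u' x).
Proof.
move=> mU [Lu [v hv]] [Lu' [v' hv']]; split; first exact: L2_lin.
by exists (fun x => (a * (v x).1 + b * (v' x).1, a * (v x).2 + b * (v' x).2)); exact: is_gradient_lin.
Qed.

Lemma grad_lin U a b u u' : open U -> H1r U u -> H1r U u' ->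
  {ae leb2, forall x, U x -> (grad U (fun x => a * u x + b * u' x) x).1 = a * (grad U u x).1 + b * (grad U u' x).1} /\
  {ae leb2, forall x, U x -> (grad U (fun x => a * u x + b * u' x) x).2 = a * (grad U u x).2 + b * (grad U u' x).2}.
Proof.
move=> oU hu hu'; have mU := open_measurable_plane oU.
have h := is_gradient_lin a b mU hu.1 hu'.1 (gradP hu) (gradP hu').
exact: gradient_unique oU (gradP (H1r_lin a b mU hu hu')) h.
Qed.

Lemma test_H1r U V f : measurable (U : set mplane) -> test_function V f -> H1r U f.
Proof.
move=> mU hf; split; first exact: test_L2 hf.
by exists (fun x => ('D_e1 f x, 'D_e2 f x)); exact: test_is_gradient hf.
Qed.

Lemma grad_test U V f : open U -> test_function V f ->
  {ae leb2, forall x, U x -> (grad U f x).1 = 'D_e1 f x} /\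
  {ae leb2, forall x, U x -> (grad U f x).2 = 'D_e2 f x}.
Proof.
move=> oU hf; have mU := open_measurable_plane oU.
exact: gradient_unique oU (gradP (test_H1r mU hf)) (test_is_gradient mU hf).
Qed.

End weak_gradient.

(** * Chain rule and derivatives in polar coordinates *)

Section chain_rule.
Context {R : realType}.
Local Notation plane := (R * R)%type.
Implicit Types (f : plane -> R).

Lemma lipschitz_of_derive (phi dphi : R -> R) (e a b : R) :
  (forall x, Num.min a b <= x <= Num.max a b -> is_derive x 1 phi (dphi x) /\ `|dphi x| <= e) ->
  `|phi b - phi a| <= e * `|b - a|.
Proof.
wlog ab : a b / a <= b.
  move=> H h; have [ab|ab] := leP a b; first exact: H.
  rewrite distrC [`|b - a|]distrC; apply: H; first exact: ltW.
  by rewrite minC maxC.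
rewrite min_l// max_r// => h; rewrite (ger0_norm (x := b - a)) ?subr_ge0// ler_norml.
have d (x : R) : a <= x <= b -> is_derive x 1 (fun x => e * x + phi x) (e + dphi x).
  by move=> /h[d _]; der; ring.
have d' (x : R) : a <= x <= b -> is_derive x 1 (fun x => e * x - phi x) (e - dphi x).
  by move=> /h[d0 _]; der; ring.
have bd x : a < x < b -> - e <= dphi x <= e.
  by move=> /andP[ax xb]; rewrite -ler_norml; apply: (h x _).2; rewrite !ltW.
have h1 : e * a + phi a <= e * b + phi b.
  by apply: (derive_ge0_le ab d) => x /bd; lra.
have h2 : e * a - phi a <= e * b - phi b.
  by apply: (derive_ge0_le ab d') => x /bd; lra.
by apply/andP; split; lra.
Qed.

Lemma is_derive_small (F : R -> R) (s : R) :
  (forall e, 0 < e -> \forall x \near s, `|F x| <= e * `|x - s|) -> is_derive s 1 F 0.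
Proof.
move=> h; have F0 : F s = 0.
  by have := nbhs_singleton (h 1 ltr01); rewrite subrr normr0 mulr0 normr_le0 => /eqP.
have H : t^-1 *: (F (t *: 1 + s) - F s) @[t --> (0 : R)^'] --> (0 : R).
  apply/cvgrPdist_le => e e0; near=> t.
  have t0 : t != 0 by near: t; exact: nbhs_dnbhs_neq.
  have : `|F (t + s)| <= e * `|t + s - s|.
    near: t; apply: cvg_within; have : (t + s) @[t --> (0 : R)] --> s.
      by rewrite -[X in _ --> X]add0r; apply: cvgD; [exact: cvg_id|exact: cvg_cst].
    by move=> /(_ _ (h e e0)).
  rewrite addrK sub0r normrN F0 subr0 /GRing.scale/= mulr1 normrM normfV => hh.
  by rewrite mulrC ler_pdivrMr ?normr_gt0.
apply: DeriveDef; first by apply/cvg_ex; exists 0.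
exact: cvg_lim H.
Unshelve. all: by end_near. Qed.

(** Only partial derivatives are given. Their continuity yields the expansion along the path that
    changes the second coordinate first and then the first one, with the Lipschitz estimate applied
    on each leg. *)
Lemma first_order_expansion f f1 f2 (p : plane) (e : R) : 0 < e ->
  (forall x, is_derive x e1 f (f1 x)) -> (forall x, is_derive x e2 f (f2 x)) ->
  {for p, continuous f1} -> {for p, continuous f2} ->
  \forall q \near p, `|f q - f p - (f1 p * (q.1 - p.1) + f2 p * (q.2 - p.2))| <=
    e * (`|q.1 - p.1| + `|q.2 - p.2|).
Proof.
move=> e0 d1 d2 c1 c2.
have /cvgrPdist_le/(_ e e0) h1 := c1; have /cvgrPdist_le/(_ e e0) h2 := c2.
have /nbhs_ballP[d /= d0 hd] : nbhs p [set q | `|f1 p - f1 q| <= e /\ `|f2 p - f2 q| <= e].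
  by near=> q; split; near: q.
have inb (x : R) (a c : R) : ball a d c -> Num.min a c <= x <= Num.max a c -> ball a d x.
  rewrite /ball/= !ltr_distl; have [ac|ac] := leP a c; lra.
near=> q.
have [b1 b2] : ball p.1 d q.1 /\ ball p.2 d q.2.
  by have : ball p d q by near: q; exact: nbhsx_ballx.
have H1 : `|(f (q.1, q.2) - f1 p * q.1) - (f (p.1, q.2) - f1 p * p.1)| <= e * `|q.1 - p.1|.
  apply: (@lipschitz_of_derive (fun x => f (x, q.2) - f1 p * x) (fun x => f1 (x, q.2) - f1 p)) => x hx.
  have dd := is_derive_slice1 (d1 (x, q.2)); split; first by der; ring.
  have [] : [set q | `|f1 p - f1 q| <= e /\ `|f2 p - f2 q| <= e] (x, q.2).
    by apply: hd; split => //; exact: inb hx.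
  by rewrite distrC.
have H2 : `|(f (p.1, q.2) - f2 p * q.2) - (f (p.1, p.2) - f2 p * p.2)| <= e * `|q.2 - p.2|.
  apply: (@lipschitz_of_derive (fun y => f (p.1, y) - f2 p * y) (fun y => f2 (p.1, y) - f2 p)) => y hy.
  have dd := is_derive_slice2 (d2 (p.1, y)); split; first by der; ring.
  have [] : [set q | `|f1 p - f1 q| <= e /\ `|f2 p - f2 q| <= e] (p.1, y).
    by apply: hd; split; [exact: ballxx|exact: inb hy].
  by move=> _; rewrite distrC.
rewrite [leRHS]mulrDr; move: H1 H2; rewrite -!surjective_pairing => H1 H2.
apply: le_trans (le_trans (ler_normD _ _) (lerD H1 H2)).
by rewrite le_eqVlt; apply/orP; left; apply/eqP; congr `|_|; ring.
Unshelve. all: by end_near. Qed.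

(** The Lipschitz bounds on [x] and [y] convert an error that is small relative to the displacement
    in the plane into one that is small relative to [u - s]. *)
Lemma chain_rule f f1 f2 (x y : R -> R) (s a b C : R) :
  (forall x, is_derive x e1 f (f1 x)) -> (forall x, is_derive x e2 f (f2 x)) ->
  continuous f1 -> continuous f2 ->
  is_derive s 1 x a -> is_derive s 1 y b -> 0 < C ->
  (forall u, `|x u - x s| <= C * `|u - s|) -> (forall u, `|y u - y s| <= C * `|u - s|) ->
  is_derive s 1 (fun u => f (x u, y u)) (f1 (x s, y s) * a + f2 (x s, y s) * b).
Proof.
move=> d1 d2 c1 c2 dx dy C0 Cx Cy; set p := (x s, y s).
pose E u := f (x u, y u) - f p - (f1 p * (x u - x s) + f2 p * (y u - y s)).
have cx := is_derive_continuous dx; have cy := is_derive_continuous dy.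
have dE : is_derive s 1 E 0.
  apply: is_derive_small => e e0; have e1' : 0 < e / (2 * C) by rewrite divr_gt0// mulr_gt0.
  have h := first_order_expansion e1' d1 d2 (c1 p) (c2 p).
  have cp : {for s, continuous (fun u => (x u, y u) : plane)} by exact: cpair.
  near=> u; have : `|E u| <= e / (2 * C) * (`|x u - x s| + `|y u - y s|).
    by near: u; exact: (cp _ h).
  move=> /le_trans; apply; have -> : e * `|u - s| = e / (2 * C) * (C * `|u - s| + C * `|u - s|).
    by field; rewrite gt_eqF.
  by rewrite ler_wpM2l ?(ltW e1')// lerD.
have -> : (fun u => f (x u, y u)) = (fun u => E u + f p + (f1 p * (x u - x s) + f2 p * (y u - y s))).
  by apply/funext => u; rewrite /E; ring.
by der; ring.
Unshelve. all: by end_near. Qed.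

Lemma cos_lipschitz (s t : R) : `|cos t - cos s| <= 1 * `|t - s|.
Proof.
apply: (@lipschitz_of_derive _ (fun x => - sin x)) => x _; split; first exact: is_derive_cos.
by rewrite normrN ler_norml sin_geN1 sin_le1.
Qed.

Lemma sin_lipschitz (s t : R) : `|sin t - sin s| <= 1 * `|t - s|.
Proof.
apply: (@lipschitz_of_derive _ cos) => x _; split; first exact: is_derive_sin.
by rewrite ler_norml cos_geN1 cos_le1.
Qed.

Definition radial_derivative f (s t : R) : R :=
  'D_e1 f (s * cos t, s * sin t) * cos t + 'D_e2 f (s * cos t, s * sin t) * sin t.

Definition angular_derivative f (s t : R) : R :=
  'D_e1 f (s * cos t, s * sin t) * (- (s * sin t)) + 'D_e2 f (s * cos t, s * sin t) * (s * cos t).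

Lemma is_derive_radial U f (s t : R) : test_function U f ->
  is_derive s 1 (fun s => f (s * cos t, s * sin t)) (radial_derivative f s t).
Proof.
move=> hf; have h1 := test_continuous (test_derive1 hf); have h2 := test_continuous (test_derive2 hf).
have d x := test_is_derive hf x.
apply: (@chain_rule f ('D_e1 f) ('D_e2 f) (fun s => s * cos t) (fun s => s * sin t) s (cos t) (sin t) 1) => //.
- by move=> x; have [] := d x.
- by move=> x; have [] := d x.
- by der; ring.
- by der; ring.
- move=> u; rewrite -mulrBl normrM mul1r ler_piMr// ler_norml cos_geN1 cos_le1//.
- move=> u; rewrite -mulrBl normrM mul1r ler_piMr// ler_norml sin_geN1 sin_le1//.
Qed.

Lemma is_derive_angular U f (s t : R) : test_function U f ->
  is_derive t 1 (fun t => f (s * cos t, s * sin t)) (angular_derivative f s t).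
Proof.
move=> hf; have h1 := test_continuous (test_derive1 hf); have h2 := test_continuous (test_derive2 hf).
have d x := test_is_derive hf x.
have s0 : `|s| <= `|s| + 1 by rewrite lerDl.
apply: (@chain_rule f ('D_e1 f) ('D_e2 f) (fun t => s * cos t) (fun t => s * sin t) t
   (- (s * sin t)) (s * cos t) (`|s| + 1)) => //.
- by move=> x; have [] := d x.
- by move=> x; have [] := d x.
- by der; ring.
- by move=> u; rewrite -mulrBr normrM ler_pM//; have := cos_lipschitz t u; rewrite mul1r.
- by move=> u; rewrite -mulrBr normrM ler_pM//; have := sin_lipschitz t u; rewrite mul1r.
Qed.

Lemma gradient_polar f s t : s != 0 ->
  radial_derivative f s t ^+ 2 + angular_derivative f s t ^+ 2 / s ^+ 2 =
  'D_e1 f (s * cos t, s * sin t) ^+ 2 + 'D_e2 f (s * cos t, s * sin t) ^+ 2.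
Proof.
move=> s0; rewrite /radial_derivative /angular_derivative.
set p := 'D_e1 f _; set q := 'D_e2 f _.
have -> : (p * cos t + q * sin t) ^+ 2 + (p * - (s * sin t) + q * (s * cos t)) ^+ 2 / s ^+ 2 =
  (p ^+ 2 + q ^+ 2) * (cos t ^+ 2 + sin t ^+ 2) by field.
by rewrite cos2Dsin2 mulr1.
Qed.

Lemma test_radius U f : test_function U f ->
  exists2 B, 0 < B & forall s t, B <= s -> f (s * cos t, s * sin t) = 0.
Proof.
move=> /test_box[B B0 hB]; exists (2 * B); first by rewrite mulr_gt0.
move=> s t sB; apply/eqP/negPn/negP => /hB[/= h1 h2].
have : (s * cos t) ^+ 2 < B ^+ 2 by rewrite -real_normK ?num_real// ltr_pXn2r// ?nnegrE ?(ltW B0)// ltr_norml.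
have : (s * sin t) ^+ 2 < B ^+ 2 by rewrite -real_normK ?num_real// ltr_pXn2r// ?nnegrE ?(ltW B0)// ltr_norml.
have := cos2Dsin2 t; rewrite !exprMn => e a b.
have : s ^+ 2 * (cos t ^+ 2 + sin t ^+ 2) < 2 * B ^+ 2 by lra.
by rewrite e mulr1; nra.
Qed.

End chain_rule.

(** * Traces *)

Section trace_inequality.
Context {R : realType}.
Local Notation plane := (R * R)%type.
Local Notation mplane := (measurableTypeR R * measurableTypeR R)%type.
Local Notation mu := (@lebesgue_measure R).
Implicit Types (f g u : plane -> R).

Lemma dot3_EFin (nu : {measure set mplane -> \bar R}) (D : set mplane) (a b c : R) (p q r : mplane -> R) :
  measurable D -> 0 <= a -> 0 <= b -> 0 <= c -> L2 nu D p -> L2 nu D q -> L2 nu D r ->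
  (\int[nu]_(x in D) (a * p x ^+ 2 + b * q x ^+ 2 + c * r x ^+ 2)%:E =
    (a * dot nu D p p + b * dot nu D q q + c * dot nu D r r)%:E)%E.
Proof.
move=> mD a0 b0 c0 hp hq hr.
have m (k : R) (f : mplane -> R) : L2 nu D f -> measurable_fun D (fun x => (k * f x ^+ 2)%:E).
  by move=> [mf _]; apply/measurable_EFinP; apply: measurable_funM => //; exact: measurable_funX.
have E (k : R) (f : mplane -> R) : 0 <= k -> L2 nu D f ->
    (\int[nu]_(x in D) (k * f x ^+ 2)%:E = (k * dot nu D f f)%:E)%E.
  move=> k0 hf; rewrite EFinM -(dot_sqr_EFin mD hf) -ge0_integralZl//.
  - by apply/measurable_EFinP; apply: measurable_funX; case: hf.
  - by move=> x _; rewrite lee_fin sqr_ge0.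
have s0 (k : R) (f : mplane -> R) : 0 <= k -> forall x, D x -> (0 <= (k * f x ^+ 2)%:E)%E.
  by move=> k0 x _; rewrite lee_fin mulr_ge0// sqr_ge0.
under eq_integral do rewrite !EFinD.
rewrite ge0_integralD//; [|by move=> x Dx; rewrite adde_ge0// s0|by apply: emeasurable_funD; exact: m|exact: s0|exact: m].
rewrite ge0_integralD//; [|exact: s0|exact: m|exact: s0|exact: m].
by rewrite !E// !EFinD.
Qed.

Lemma measurable_quadratic (a b c : R) (p q r : plane -> R) : continuous p -> continuous q -> continuous r ->
  measurable_fun setT (fun x : mplane => (a * p x ^+ 2 + b * q x ^+ 2 + c * r x ^+ 2)%:E).
Proof.
have msq (e : R) (h : plane -> R) : continuous h -> measurable_fun setT (fun x : mplane => e * h x ^+ 2).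
  by move=> ch; apply: measurable_funM => //; apply: measurable_funX; exact: continuous_measurable_plane.
move=> cp cq cr; apply/measurable_EFinP; apply: measurable_funD; [apply: measurable_funD|]; exact: msq.
Qed.

Lemma quadratic_integral (nu : {measure set mplane -> \bar R}) (D : set mplane) (k : R) (p q r : mplane -> R) :
  measurable D -> L2 nu D p -> L2 nu D q -> L2 nu D r ->
  (\int[nu]_(x in D) (1 * p x ^+ 2 + 1 * q x ^+ 2 + k ^+ 2 * r x ^+ 2)%:E =
    (dot nu D p p + dot nu D q q + k ^+ 2 * dot nu D r r)%:E)%E.
Proof. by move=> mD hp hq hr; rewrite (dot3_EFin mD (@ler01 R) (@ler01 R) (sqr_ge0 k) hp hq hr) !mul1r. Qed.

Lemma quadratic_ge0 (k p q r : R) : 0 <= 1 * p ^+ 2 + 1 * q ^+ 2 + k ^+ 2 * r ^+ 2.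
Proof.
rewrite !mul1r; apply: addr_ge0; last by apply: mulr_ge0; exact: sqr_ge0.
by apply: addr_ge0; exact: sqr_ge0.
Qed.

(** The value [F a ^ 2] is minus the integral of the derivative of [F ^ 2], and
    [2 |F F'| <= e F' ^ 2 + F ^ 2 / e]. The factor [r / b >= 1] inserts the weight of the polar area
    element. *)
Lemma ray_sqr_bound (F p q : R -> R) (e a B b c s : R) : 0 < e -> 0 < b -> b <= a -> c ^+ 2 + s ^+ 2 = 1 ->
  continuous F -> continuous p -> continuous q ->
  (forall r : R, is_derive r 1 F (p r * c + q r * s)) -> (forall r, B <= r -> F r = 0) ->
  ((F a ^+ 2)%:E <= \int[mu]_(r in `]a, +oo[)
    ((e * p r ^+ 2 + e * q r ^+ 2 + e^-1 * F r ^+ 2)%:E * r%:E * (b^-1)%:E))%E.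
Proof.
move=> e0 b0 ba cs cF cp cq dF FB.
have e1' : 0 < e^-1 by rewrite invr_gt0.
pose B' := Num.max B a; have aB : a <= B' by rewrite le_max lexx orbT.
have d (r : R) : a <= r <= B' -> is_derive r 1 (fun r => - F r ^+ 2) (- (2 * F r * (p r * c + q r * s))).
  by move=> _; have := dF r => d1; der; ring.
pose G (r : R) := - (2 * F r * (p r * c + q r * s)).
pose H (r : R) := (e * p r ^+ 2 + e * q r ^+ 2 + e^-1 * F r ^+ 2) * r * b^-1.
have cG : continuous G.
  have h (r : R) : {for r, continuous (fun r : R => - (2 * F r * (p r * c + q r * s)))} by cont.
  exact: h.
have cH : continuous H.
  have h (r : R) : {for r, continuous (fun r : R => (e * p r ^+ 2 + e * q r ^+ 2 + e^-1 * F r ^+ 2) * r * b^-1)} by cont.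
  exact: h.
have S0 r : 0 <= e * p r ^+ 2 + e * q r ^+ 2 + e^-1 * F r ^+ 2.
  have h1 := mulr_ge0 (ltW e0) (sqr_ge0 (p r)); have h2 := mulr_ge0 (ltW e0) (sqr_ge0 (q r)).
  have h3 := mulr_ge0 (ltW e1') (sqr_ge0 (F r)); lra.
have H0 (r : R) : a < r -> 0 <= H r.
  move=> rr; have r0 : 0 < r by exact: lt_trans (lt_le_trans b0 ba) rr.
  by rewrite /H mulr_ge0 ?invr_ge0 ?(ltW b0)// mulr_ge0 ?S0// ltW.
have -> : ((F a ^+ 2)%:E = \int[mu]_(r in `[a, B']) (G r)%:E)%E.
  rewrite (ftc_itv aB d); last exact: continuous_subspaceT.
  by congr EFin; rewrite (FB B') ?le_max ?lexx//; ring.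
have ic (g : R -> R) : continuous g -> mu.-integrable `[a, B'] (EFin \o g).
  by move=> cg; apply: continuous_compact_integrable; [exact: segment_compact|exact: continuous_subspaceT].
apply: (@le_trans _ _ (\int[mu]_(r in `[a, B']) (H r)%:E)%E).
  apply: le_integral => //; [exact: (ic _ cG)|exact: (ic _ cH)|].
  move=> r; rewrite inE/= in_itv/= => /andP[rr _].
  have r0 : 0 < r by exact: lt_le_trans (lt_le_trans b0 ba) rr.
  have mr1 : 1 <= r / b by rewrite ler_pdivlMr// mul1r (le_trans ba).
  rewrite lee_fin /H /G.
  (* Cauchy-Schwarz for the component of the vector [(p, q)] in the unit direction [(c, s)]. *)
  have k0 : (p r * c + q r * s) ^+ 2 <= p r ^+ 2 + q r ^+ 2.
    have -> : (p r * c + q r * s) ^+ 2 = (p r ^+ 2 + q r ^+ 2) * (c ^+ 2 + s ^+ 2) - (p r * s - q r * c) ^+ 2 by ring.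
    by rewrite cs mulr1 lerBlDr lerDl sqr_ge0.
  move: k0 (S0 r); set z := _ + _ * s; set S := _ + _ * F r ^+ 2 => k0 S00.
  have k1 : - (2 * F r * z) <= e * z ^+ 2 + e^-1 * F r ^+ 2.
    have : 0 <= e * (z + e^-1 * F r) ^+ 2 by rewrite mulr_ge0 ?sqr_ge0// ltW.
    have -> : e * (z + e^-1 * F r) ^+ 2 = e * z ^+ 2 + e^-1 * F r ^+ 2 + 2 * F r * z by field; rewrite gt_eqF.
    lra.
  have k2 : e * z ^+ 2 <= e * (p r ^+ 2 + q r ^+ 2) by rewrite ler_wpM2l// ltW.
  have k3 : S <= S * r / b by rewrite -mulrA -[leLHS]mulr1 ler_wpM2l.
  by apply: le_trans k3; rewrite /S; lra.
have mH (D : set R) : measurable_fun (D : set (measurableTypeR R)) (fun r => (H r)%:E).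
  by apply/measurable_EFinP; apply: measurable_funTS; exact: continuous_measurable_fun.
have -> : (\int[mu]_(r in `[a, B']) (H r)%:E = \int[mu]_(r in `]a, B']) (H r)%:E)%E.
  by rewrite integral_itv_obnd_cbnd//; exact: mH.
have -> : (fun r => ((e * p r ^+ 2 + e * q r ^+ 2 + e^-1 * F r ^+ 2)%:E * r%:E * (b^-1)%:E)%E) = (fun r => (H r)%:E).
  by apply/funext => r; rewrite /H !EFinM.
apply: ge0_subset_integral; [exact: measurable_itv|exact: measurable_itv|exact: mH| |].
- by move=> r /=; rewrite in_itv/= andbT => rr; rewrite lee_fin H0.
- by move=> r /=; rewrite !in_itv/= => /andP[-> _].
Qed.

Variables (A : set plane) (rho : R -> R) (m M L : R).
Hypothesis AP : polar_domain A rho m M L.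
Local Notation ext := (exterior A : set mplane).
Local Notation bd := (boundary A : set mplane).
Let mE : measurable ext. Proof. exact: measurable_exterior. Qed.
Let mB : measurable bd. Proof. exact: measurable_boundary. Qed.
Let m0 := pd_pos AP.
Let C0 := Num.sqrt (L ^+ 2 + M ^+ 2).
Let C0_ge0 : 0 <= C0. Proof. exact: sqrtr_ge0. Qed.

Lemma boundary_finite : (@hausdorff1 R bd < +oo)%E.
Proof.
have := @boundary_integral_le R A rho m M L AP (cst 1%E) (measurable_cst _) (fun=> lee01).
rewrite integral_cst// mul1e => h; apply: le_lt_trans h _; under eq_integral do rewrite mul1e.
by rewrite (integral_cst mu (measurable_itv _))/= lebesgue_measure_itv/=; case: ifP; rewrite -?EFinM ?mule0 ltry.
Qed.

Lemma test_L2_boundary U f : test_function U f -> L2 hausdorff1 bd f.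
Proof.
move=> hf; have [C _ fC] := test_bounded hf.
apply: (@bounded_L2 _ _ _ _ C) => //; first exact: boundary_finite.
by apply: measurable_funTS; exact: test_measurable hf.
Qed.

Lemma boundary_sqr_bound f f1 f2 (e : R) : 0 < e -> continuous f -> continuous f1 -> continuous f2 ->
  (forall s t, is_derive (s : R) 1 (fun s => f (s * cos t, s * sin t))
     (f1 (s * cos t, s * sin t) * cos t + f2 (s * cos t, s * sin t) * sin t)) ->
  (exists2 B, 0 < B & forall s t, B <= s -> f (s * cos t, s * sin t) = 0) ->
  (\int[hausdorff1]_(x in bd) (f x ^+ 2)%:E <=
   (C0 / m)%:E * \int[leb2]_(x in ext) (e * f1 x ^+ 2 + e * f2 x ^+ 2 + e^-1 * f x ^+ 2)%:E)%E.
Proof.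
move=> e0 cf cf1 cf2 df [B _ fB].
have mc (g : plane -> R) : continuous g -> measurable_fun setT (g : mplane -> R).
  exact: continuous_measurable_plane.
have e1' : 0 <= e^-1 by rewrite invr_ge0 ltW.
have mf2' : measurable_fun setT (fun x : mplane => (f x ^+ 2)%:E).
  by apply/measurable_EFinP; apply: measurable_funX; exact: mc.
have f20 x : (0 <= (f x ^+ 2)%:E)%E by rewrite lee_fin sqr_ge0.
apply: le_trans (boundary_integral_le AP mf2' f20) _.
pose F x := (e * f1 x ^+ 2 + e * f2 x ^+ 2 + e^-1 * f x ^+ 2)%:E.
have mF : measurable_fun setT (F : mplane -> \bar R) by exact: (measurable_quadratic e e e^-1 cf1 cf2 cf).
have F0 x : (0 <= F x)%E.
  rewrite lee_fin; have h1 := mulr_ge0 (ltW e0) (sqr_ge0 (f1 x)); have h2 := mulr_ge0 (ltW e0) (sqr_ge0 (f2 x)).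
  have h3 := mulr_ge0 e1' (sqr_ge0 (f x)); lra.
have CM0 : (0 <= (C0 / m)%:E)%E by rewrite lee_fin divr_ge0// ltW.
have mI : measurable (`[0, 2 * pi]%classic : set (measurableTypeR R)) by exact: measurable_itv.
have inner0 t : (0 <= \int[mu]_(r in `](rho t), +oo[) (F (r * cos t, r * sin t)%R * `|r|%:E))%E.
  by apply: integral_ge0 => r _; rewrite mule_ge0// lee_fin.
rewrite -/(F _) (exterior_integral AP mF F0).
have mR := measurable_exterior_ray AP mF F0.
have R0 t : `[0, 2 * pi]%classic t -> (0 <= \int[mu]_(r in `](rho t), +oo[) (F (r * cos t, r * sin t)%R * r%:E))%E.
  move=> /=; rewrite in_itv/= => tI; apply: integral_ge0 => r /=; rewrite in_itv/= andbT => rr.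
  apply: mule_ge0; first exact: F0.
  by rewrite lee_fin ltW// (lt_trans _ rr)//; have /andP[mr _] := pd_bnd AP tI; exact: lt_le_trans mr.
rewrite -(ge0_integralZl _ mI mR R0 CM0).
apply: (@ge0_le_integral _ _ _ mu _ mI).
- by move=> t _; apply: mule_ge0; [exact: f20|rewrite lee_fin].
- apply: emeasurable_funM => //.
  exact: (measurableT_comp mf2' (measurable_polar_curve (pd_cont AP) mI)).
- by apply: emeasurable_funM.
move=> t /=; rewrite in_itv/= => tI.
have /andP[mr _] := pd_bnd AP tI.
have cpt (g : plane -> R) : continuous g -> continuous (fun r : R => g (r * cos t, r * sin t)).
  move=> cg r; apply: (@continuous_comp _ _ _ (fun r : R => (r * cos t, r * sin t)) g); last exact: cg.
  by apply: cpair; cont.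
have h := @ray_sqr_bound (fun r => f (r * cos t, r * sin t)) (fun r => f1 (r * cos t, r * sin t)) (fun r => f2 (r * cos t, r * sin t))
  e (rho t) B m (cos t) (sin t) e0 m0 mr (cos2Dsin2 t) (cpt _ cf) (cpt _ cf1) (cpt _ cf2) (fun s => df s t) (fun s => fB s t).
have C0E : (0 <= C0%:E)%E by rewrite lee_fin.
apply: le_trans (lee_wpmul2r C0E h) _.
have mFr : measurable_fun `](rho t), +oo[ (fun r : measurableTypeR R => F (r * cos t, r * sin t)%R * r%:E)%E.
  have mc' : measurable_fun setT (fun r : measurableTypeR R => (r * cos t, r * sin t) : mplane).
    by apply: measurable_fun_pair; apply: measurable_funM.
  by apply: measurable_funTS; apply: emeasurable_funM; [exact: (measurableT_comp mF mc')|exact/measurable_EFinP].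
have r0 r : `](rho t), +oo[%classic r -> (0 <= F (r * cos t, r * sin t)%R * r%:E)%E.
  rewrite /= in_itv/= andbT => rr; apply: mule_ge0; first exact: F0.
  by rewrite lee_fin ltW// (lt_trans _ rr)// (lt_le_trans m0).
have mi0 : (0 <= (m^-1)%:E)%E by rewrite lee_fin invr_ge0 ltW.
have := ge0_integralZr mu (measurable_itv _) mFr r0 mi0; rewrite /F => ->.
by rewrite [leRHS]muleC -muleA -EFinM [X in (_ * X%:E)%E]mulrC.
Qed.

(** The parameter [e] stays free: a small value lets the gradient term absorb the boundary term. The
    factor [C0 / m] is the speed bound of the boundary curve divided by the smallest radius. *)
Lemma test_trace_inequality U f (e : R) : 0 < e -> test_function U f ->
  dot hausdorff1 bd f f <= C0 / m * (e * dot leb2 ext ('D_e1 f) ('D_e1 f) + e * dot leb2 ext ('D_e2 f) ('D_e2 f) +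
    e^-1 * dot leb2 ext f f).
Proof.
move=> e0 hf; have h1 := test_derive1 hf; have h2 := test_derive2 hf.
have e1' : 0 <= e^-1 by rewrite invr_ge0 ltW.
have := boundary_sqr_bound e0 (test_continuous hf) (test_continuous h1) (test_continuous h2)
  (fun s t => is_derive_radial s t hf) (test_radius hf).
rewrite (dot_sqr_EFin mB (test_L2_boundary hf)).
rewrite (dot3_EFin mE (ltW e0) (ltW e0) e1' (test_L2 mE h1) (test_L2 mE h2) (test_L2 mE hf)).
by rewrite -EFinM lee_fin.
Qed.

Lemma grad_L2 u : H1r ext u -> L2 leb2 ext (fun x => (grad ext u x).1) /\ L2 leb2 ext (fun x => (grad ext u x).2).
Proof. by move=> /gradP[]. Qed.

Lemma trace_seq u g : H1r ext u -> is_trace A u g -> L2 hausdorff1 bd g /\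
  exists f : (plane -> R)^nat, [/\ forall n, test_function setT (f n),
    cvgL2 leb2 ext f u,
    cvgL2 leb2 ext (fun n => 'D_e1 (f n)) (fun x => (grad ext u x).1),
    cvgL2 leb2 ext (fun n => 'D_e2 (f n)) (fun x => (grad ext u x).2) &
    cvgL2 hausdorff1 bd f g].
Proof.
move=> hu [Lg [f [tf c1 c2 c3]]]; split => //; exists f.
have [G1 G2] := grad_L2 hu; have [Lu _] := hu.
have Lf n := test_L2 mE (tf n).
have L1 n := test_L2 mE (test_derive1 (tf n)); have L2' n := test_L2 mE (test_derive2 (tf n)).
pose d1 n := dot leb2 ext (fun x => 'D_e1 (f n) x - (grad ext u x).1) (fun x => 'D_e1 (f n) x - (grad ext u x).1).
pose d2 n := dot leb2 ext (fun x => 'D_e2 (f n) x - (grad ext u x).2) (fun x => 'D_e2 (f n) x - (grad ext u x).2).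
have H : d1 n + d2 n @[n --> \oo] --> (0 : R).
  have -> : (fun n => d1 n + d2 n) = (fun n => fine (\int[leb2]_(x in ext)
            (('D_e1 (f n) x - (grad ext u x).1) ^+ 2 + ('D_e2 (f n) x - (grad ext u x).2) ^+ 2)%:E)%E).
    apply/funext => n; have S1 := L2_sub mE (L1 n) G1; have S2 := L2_sub mE (L2' n) G2.
    have := dot3_EFin mE (@ler01 R) (@ler01 R) (lexx 0) S1 S2 S2; rewrite !mul1r mul0r addr0.
    rewrite -/(d1 n) -/(d2 n) => E; rewrite -[LHS]/(fine (d1 n + d2 n)%:E) -E; congr fine.
    by apply: eq_integral => x _; rewrite !mul1r mul0r addr0.
  by move/fine_cvg: c2.
split => //.
- exact/(cvgL2_EFin mE Lf Lu).
- apply: (@squeeze_cvgr _ _ _ _ (cst 0) (fun n => d1 n + d2 n)); [|exact: cvg_cst|exact: H].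
  by apply: nearW => n; rewrite dot_ge0/= lerDl; exact: dot_ge0.
- apply: (@squeeze_cvgr _ _ _ _ (cst 0) (fun n => d1 n + d2 n)); [|exact: cvg_cst|exact: H].
  by apply: nearW => n; rewrite dot_ge0/= lerDr; exact: dot_ge0.
- by apply/(cvgL2_EFin mB (fun n => test_L2_boundary (tf n)) Lg).
Qed.

Lemma is_trace_intro u g (f : (plane -> R)^nat) : H1r ext u -> L2 hausdorff1 bd g ->
  (forall n, test_function setT (f n)) -> cvgL2 leb2 ext f u ->
  cvgL2 leb2 ext (fun n => 'D_e1 (f n)) (fun x => (grad ext u x).1) ->
  cvgL2 leb2 ext (fun n => 'D_e2 (f n)) (fun x => (grad ext u x).2) ->
  cvgL2 hausdorff1 bd f g -> is_trace A u g.
Proof.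
move=> hu Lg tf c1 c2 c3 c4; split => //; exists f.
have [G1 G2] := grad_L2 hu; have [Lu _] := hu.
have Lf n := test_L2 mE (tf n).
have L1 n := test_L2 mE (test_derive1 (tf n)); have L2' n := test_L2 mE (test_derive2 (tf n)).
split => //.
- exact/(cvgL2_EFin mE Lf Lu).
- have -> : (fun n => \int[leb2]_(x in ext)
            (('D_e1 (f n) x - (grad ext u x).1) ^+ 2 + ('D_e2 (f n) x - (grad ext u x).2) ^+ 2)%:E)%E =
      (fun n => (dot leb2 ext (fun x => 'D_e1 (f n) x - (grad ext u x).1) (fun x => 'D_e1 (f n) x - (grad ext u x).1) +
        dot leb2 ext (fun x => 'D_e2 (f n) x - (grad ext u x).2) (fun x => 'D_e2 (f n) x - (grad ext u x).2))%:E).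
    apply/funext => n; have S1 := L2_sub mE (L1 n) G1; have S2 := L2_sub mE (L2' n) G2.
    have := dot3_EFin mE (@ler01 R) (@ler01 R) (lexx 0) S1 S2 S2; rewrite !mul1r mul0r addr0 => <-.
    by apply: eq_integral => x _; rewrite !mul1r mul0r addr0.
  apply/fine_cvgP; split; first exact: nearW.
  by rewrite -[X in _ --> X](addr0 0); apply: cvgD.
- by apply/(cvgL2_EFin mB (fun n => test_L2_boundary (tf n)) Lg).
Qed.

(** [grad] picks some representative, so the gradient of a combination is the combination of the
    gradients only almost everywhere; convergence in the mean does not see the difference. *)
Lemma is_trace_lin a b u u' g g' : H1r ext u -> H1r ext u' -> is_trace A u g -> is_trace A u' g' ->
  is_trace A (fun x => a * u x + b * u' x) (fun x => a * g x + b * g' x).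
Proof.
move=> hu hu' /(trace_seq hu)[Lg [f [tf f1 f2 f3 f4]]] /(trace_seq hu')[Lg' [f' [tf' f1' f2' f3' f4']]].
have hl := H1r_lin a b mE hu hu'.
have tl n := test_lin a b (tf n) (tf' n).
have Lf n := test_L2 mE (tf n); have Lf' n := test_L2 mE (tf' n).
have L1 n := test_L2 mE (test_derive1 (tf n)); have L2' n := test_L2 mE (test_derive2 (tf n)).
have M1 n := test_L2 mE (test_derive1 (tf' n)); have M2' n := test_L2 mE (test_derive2 (tf' n)).
have [G1 G2] := grad_L2 hu; have [G1' G2'] := grad_L2 hu'; have [Gl1 Gl2] := grad_L2 hl.
have [ae1 ae2] := grad_lin a b (@open_exterior R A) hu hu'.
have aecvg (h : nat -> mplane -> R) (v w : mplane -> R) : (forall n, L2 leb2 ext (h n)) -> L2 leb2 ext v -> L2 leb2 ext w ->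
    {ae leb2, forall x, ext x -> w x = v x} -> cvgL2 leb2 ext h v -> cvgL2 leb2 ext h w.
  move=> Lh Lv Lw vw; rewrite /cvgL2.
  have -> // : (fun n => dot leb2 ext (fun x => h n x - v x) (fun x => h n x - v x)) =
    (fun n => dot leb2 ext (fun x => h n x - w x) (fun x => h n x - w x)).
  apply/funext => n; have S1 := L2_sub mE (Lh n) Lv; have S2 := L2_sub mE (Lh n) Lw.
  have e : {ae leb2, forall x, ext x -> h n x - v x = h n x - w x}.
    by move: vw; apply: (@filterS _ _ (ae_filter_ringOfSetsType _)) => x hx Ex; rewrite hx.
  exact: (ae_dot mE S1 S2 S1 S2 e e).
apply: (is_trace_intro hl (L2_lin mB a b Lg Lg') tl).
- exact: (cvgL2_lin mE a b Lf hu.1 Lf' hu'.1 f1 f1').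
- have -> : (fun n => 'D_e1 (fun x => a * f n x + b * f' n x)) = (fun n x => a * 'D_e1 (f n) x + b * 'D_e1 (f' n) x).
    apply/funext => n; apply/funext => x; have [d _] := test_is_derive (tf n) x; have [d' _] := test_is_derive (tf' n) x.
    by have [_ ->] := dadd (dmul (dcst a x e1) d) (dmul (dcst b x e1) d'); rewrite !mul0r !add0r.
  apply: (aecvg _ _ _ _ _ Gl1 ae1) (cvgL2_lin mE a b L1 G1 M1 G1' f2 f2').
    by move=> n; exact: (L2_lin mE a b (L1 n) (M1 n)).
  exact: (L2_lin mE a b G1 G1').
- have -> : (fun n => 'D_e2 (fun x => a * f n x + b * f' n x)) = (fun n x => a * 'D_e2 (f n) x + b * 'D_e2 (f' n) x).
    apply/funext => n; apply/funext => x; have [_ d] := test_is_derive (tf n) x; have [_ d'] := test_is_derive (tf' n) x.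
    by have [_ ->] := dadd (dmul (dcst a x e2) d) (dmul (dcst b x e2) d'); rewrite !mul0r !add0r.
  apply: (aecvg _ _ _ _ _ Gl2 ae2) (cvgL2_lin mE a b L2' G2 M2' G2' f3 f3').
    by move=> n; exact: (L2_lin mE a b (L2' n) (M2' n)).
  exact: (L2_lin mE a b G2 G2').
- exact: (cvgL2_lin mB a b (fun n => test_L2_boundary (tf n)) Lg (fun n => test_L2_boundary (tf' n)) Lg' f4 f4').
Qed.

Lemma is_trace_inequality u g (e : R) : 0 < e -> H1r ext u -> is_trace A u g ->
  dot hausdorff1 bd g g <= C0 / m * (e * dot leb2 ext (fun x => (grad ext u x).1) (fun x => (grad ext u x).1) +
    e * dot leb2 ext (fun x => (grad ext u x).2) (fun x => (grad ext u x).2) + e^-1 * dot leb2 ext u u).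
Proof.
move=> e0 hu /(trace_seq hu)[Lg [f [tf f1 f2 f3 f4]]].
have [G1 G2] := grad_L2 hu.
have l1 := cvgL2_sqr mE (fun n => test_L2 mE (tf n)) hu.1 f1.
have l2 := cvgL2_sqr mE (fun n => test_L2 mE (test_derive1 (tf n))) G1 f2.
have l3 := cvgL2_sqr mE (fun n => test_L2 mE (test_derive2 (tf n))) G2 f3.
have l4 := cvgL2_sqr mB (fun n => test_L2_boundary (tf n)) Lg f4.
have cz (h : nat -> R) (l k : R) : h n @[n --> \oo] --> l -> k * h n @[n --> \oo] --> k * l.
  by move=> hl; apply: cvgM => //; exact: cvg_cst.
apply: (ler_cvg_to l4 (cz _ _ (C0 / m) (cvgD (cvgD (cz _ _ e l2) (cz _ _ e l3)) (cz _ _ e^-1 l1)))).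
by apply: nearW => n; exact: test_trace_inequality (tf n).
Qed.

(** The difference of two traces of [u] is a trace of [u - u], whose gradient vanishes almost
    everywhere; the trace inequality makes it zero in the mean. *)
Lemma is_trace_unique u g g' : H1r ext u -> is_trace A u g -> is_trace A u g' ->
  {ae hausdorff1, forall x, bd x -> g x = g' x}.
Proof.
move=> hu tg tg'; have hl := H1r_lin 1 (-1) mE hu hu.
have t0 := is_trace_lin 1 (-1) hu hu tg tg'.
have [Lg _] := tg; have [Lg' _] := tg'.
have Ll := L2_lin mB 1 (-1) Lg Lg'.
have [G1 G2] := grad_L2 hu; have [Gl1 Gl2] := grad_L2 hl.
have [ae1 ae2] := grad_lin 1 (-1) (@open_exterior R A) hu hu.
have z0 (v w : mplane -> R) : L2 leb2 ext v -> L2 leb2 ext w -> {ae leb2, forall x, ext x -> v x = 1 * w x + -1 * w x} ->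
    dot leb2 ext v v = 0.
  move=> Lv Lw vw; have Lz := L2_lin mE 1 (-1) Lw Lw.
  by rewrite (ae_dot mE Lv Lz Lv Lz vw vw) (dot_lin mE 1 (-1) Lw Lw); ring.
have := is_trace_inequality (@ltr01 R) hl t0; rewrite (z0 _ _ Gl1 G1 ae1) (z0 _ _ Gl2 G2 ae2).
rewrite (dot_lin mE 1 (-1) hu.1 hu.1) => h.
have : dot hausdorff1 bd (fun x => 1 * g x + -1 * g' x) (fun x => 1 * g x + -1 * g' x) = 0.
  apply/eqP; rewrite eq_le dot_ge0 andbT; apply: le_trans h _.
  by rewrite le_eqVlt; apply/orP; left; apply/eqP; ring.
move=> /(dot0_ae mB Ll); apply: (@filterS _ _ (ae_filter_ringOfSetsType _)) => x hx Bx.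
by apply/eqP; rewrite -subr_eq0 -(hx Bx); apply/eqP; ring.
Qed.

End trace_inequality.

(** * Lower bound for the exterior of the disk *)

Section circle_integral.
Context {R : realType}.
Local Notation mu := (@lebesgue_measure R).
Implicit Types (f g h : R -> R).

Definition circle_int f : R := (\int[mu]_(t in `[(0 : R), 2 * pi]) f t)%R.

Let pi2 : 0 <= 2 * pi :> R. Proof. by rewrite mulr_ge0// pi_ge0. Qed.

Let mI : measurable (`[0, 2 * pi]%classic : set (measurableTypeR R)). Proof. exact: measurable_itv. Qed.

Lemma segment_integrable f (a b : R) : {within `[a, b], continuous f} -> mu.-integrable `[a, b] (EFin \o f).
Proof. by move=> cf; apply: continuous_compact_integrable => //; exact: segment_compact. Qed.

Lemma circle_integrable f : continuous f -> mu.-integrable `[(0 : R), 2 * pi] (EFin \o f).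
Proof. by move=> cf; apply: segment_integrable; exact: continuous_subspaceT. Qed.

Lemma circle_int_EFin f : continuous f -> (\int[mu]_(t in `[0%R, (2 * pi)%R]) (f t)%:E = (circle_int f)%:E)%E.
Proof.
move=> cf; rewrite /circle_int /Rintegral fineK//.
exact: (integrable_fin_num mI (circle_integrable cf)).
Qed.

Lemma circle_int_lin a b f g : continuous f -> continuous g ->
  circle_int (fun t => a * f t + b * g t) = a * circle_int f + b * circle_int g.
Proof.
move=> cf cg; have cs (c : R) h : continuous h -> continuous (fun t => c * h t).
  by move=> ch t; apply: cmul; [exact: ccst|exact: ch].
have i1 := circle_integrable cf; have i2 := circle_integrable cg.
rewrite /circle_int (RintegralD mI (circle_integrable (cs a f cf)) (circle_integrable (cs b g cg))).
by rewrite (RintegralZl a mI i1) (RintegralZl b mI i2).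
Qed.

Lemma circle_int_ge0 f : (forall t, 0 <= f t) -> 0 <= circle_int f.
Proof. by move=> f0; apply: Rintegral_ge0. Qed.

Lemma circle_int_cst c : circle_int (fun=> c) = c * (2 * pi).
Proof.
have d (x : R) : 0 <= x <= 2 * pi -> is_derive x 1 (fun x : R => c * x) c by move=> _; der; ring.
have cc : continuous (fun _ : R => c) by exact: cst_continuous.
have := circle_int_EFin cc; rewrite (ftc_itv pi2 d); last exact: continuous_subspaceT.
by move=> [<-]; ring.
Qed.

(** Among constants the mean value minimises the mean square deviation. *)
Lemma circle_int_variance f c : continuous f ->
  circle_int (fun t => f t ^+ 2) - circle_int f ^+ 2 / (2 * pi) <= circle_int (fun t => (f t - c) ^+ 2).
Proof.
move=> cf; have p0 : 0 < pi :> R by exact: pi_gt0.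
have pn : pi != 0 :> R by rewrite gt_eqF.
have cf2 : continuous (fun t => f t ^+ 2) by move=> t; apply: cexp; exact: cf.
have c1 : continuous (fun _ : R => 1 : R) by exact: cst_continuous.
have -> : (fun t => (f t - c) ^+ 2) = (fun t => 1 * f t ^+ 2 + 1 * ((- 2 * c) * f t + c ^+ 2 * 1)).
  by apply/funext => t; ring.
have cl : continuous (fun t => (- 2 * c) * f t + c ^+ 2 * 1).
  have H (t : R) : {for t, continuous (fun t => (- 2 * c) * f t + c ^+ 2 * 1)} by cont.
  exact: H.
rewrite circle_int_lin// circle_int_lin// circle_int_cst; move: (circle_int f) (circle_int (fun t => f t ^+ 2)) => I J.
have wn : 2 * pi != 0 :> R by rewrite mulf_neq0.
have w0 : 0 < 2 * pi :> R by rewrite mulr_gt0.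
move: (2 * pi) wn w0 => w wn w0.
rewrite -subr_ge0.
have -> : 1 * J + 1 * (- 2 * c * I + c ^+ 2 * (1 * w)) - (J - I ^+ 2 / w) = (I - w * c) ^+ 2 / w.
  by field.
by rewrite divr_ge0 ?sqr_ge0// ltW.
Qed.

Lemma primitive_exists h a : continuous h -> exists P, forall x : R, a < x -> is_derive x 1 P (h x).
Proof.
move=> ch; exists (fun x => (\int[mu]_(t in `[a, x]) h t)%R) => x ax.
have xx : x < x + 1 by rewrite ltrDl.
have [d e] := continuous_FTC1_closed xx (segment_integrable (continuous_subspaceT ch)) ax (ch x).
by apply: (DeriveDef d); rewrite -derive1E; exact: e.
Qed.

Lemma circle_int_primitive h : continuous h ->
  exists2 P, (forall x : R, 0 <= x <= 2 * pi -> is_derive x 1 P (h x)) & circle_int h = P (2 * pi) - P 0.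
Proof.
move=> ch; have [P dP] := primitive_exists (-1) ch.
have d (x : R) : 0 <= x <= 2 * pi -> is_derive x 1 P (h x) by move=> /andP[x0 _]; apply: dP; lra.
exists P => //; have := circle_int_EFin ch.
by rewrite (ftc_itv pi2 d) => [[<-]|]//; exact: continuous_subspaceT.
Qed.

(** Picone's identity: [p = k tan (k (t - z))] satisfies [p' = k ^ 2 + p ^ 2], so the derivative of
    [Q + p G ^ 2] is the square of [G' + p G]. Taking [k < 1] keeps the tangent finite up to
    distance [pi / 2] from [z]. *)
Let picone_step (G G' Q : R -> R) (k x y z : R) : 0 < k < 1 -> x <= y ->
  (forall t : R, is_derive t 1 G (G' t)) ->
  (forall t : R, x <= t <= y -> is_derive t 1 Q (G' t ^+ 2 - k ^+ 2 * G t ^+ 2)) ->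
  z - pi / 2 <= x -> y <= z + pi / 2 ->
  Q x + k * (sin (k * (x - z)) / cos (k * (x - z))) * G x ^+ 2 <=
  Q y + k * (sin (k * (y - z)) / cos (k * (y - z))) * G y ^+ 2.
Proof.
move=> /andP[k0 k1] xy dG dQ zx yz.
have p0 : 0 < pi :> R by exact: pi_gt0.
have c0 t : x <= t <= y -> 0 < cos (k * (t - z)).
  move=> /andP[xt ty]; apply: cos_gt0_pihalf; nra.
have d (t : R) : x <= t <= y ->
    is_derive t 1 (fun t => Q t + k * (sin (k * (t - z)) / cos (k * (t - z))) * G t ^+ 2)
      ((G' t + k * (sin (k * (t - z)) / cos (k * (t - z))) * G t) ^+ 2).
  move=> tI; have d1 := dG t; have d2 := dQ t tI.
  have cn : cos (k * (t - z)) != 0 by rewrite gt_eqF// c0.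
  have dk : is_derive t 1 (fun t => k * (t - z)) k by der; ring.
  have ds := dcomp1 dk (is_derive_sin (k * (t - z))).
  have dc := dcomp1 dk (is_derive_cos (k * (t - z))).
  have dsc := ddiv cn ds dc.
  have dall := dadd d2 (dmul (dmul (dcst k t 1) dsc) (dexp 2 d1)).
  apply: (is_derive_eq dall) => /=; have := cos2Dsin2 (k * (t - z)).
  set c := cos _ in cn *; set s := sin _ => cs.
  have -> : (0 * (s / c) + k * ((c * k * c - s * (- s * k)) / c ^+ 2)) = k ^+ 2 * ((c ^+ 2 + s ^+ 2) / c ^+ 2) by field.
  have -> : (c ^+ 2 + s ^+ 2) / c ^+ 2 = 1 + (s / c) ^+ 2 by field.
  by rewrite expr1; ring.
exact: (derive_ge0_le xy d (fun t _ => sqr_ge0 _)).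
Qed.

(** The identity is used on three arcs cut at [a] and [a + pi], where [G] vanishes. The remaining
    terms at [0] and [2 pi] cancel by periodicity, since the centres of the outer arcs are chosen to
    give both tangents the same argument. *)
Let wirtinger_step (G G' : R -> R) (k a : R) : 0 < k < 1 -> 0 <= a <= pi ->
  (forall t : R, is_derive t 1 G (G' t)) -> continuous G' -> G 0 = G (2 * pi) ->
  G a = 0 -> G (a + pi) = 0 ->
  k ^+ 2 * circle_int (fun t => G t ^+ 2) <= circle_int (fun t => G' t ^+ 2).
Proof.
move=> k01 /andP[a0 ap] dG cG' Gp Ga Gapi.
have cG : continuous G by move=> t; exact: is_derive_continuous (dG t).
have c1 : continuous (fun t => G' t ^+ 2) by move=> t; apply: cexp; exact: cG'.
have c2 : continuous (fun t => G t ^+ 2) by move=> t; apply: cexp; exact: cG.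
have [P1 dP1 ->] := circle_int_primitive c1.
have [P2 dP2 ->] := circle_int_primitive c2.
pose Q t := P1 t - k ^+ 2 * P2 t.
have dQ (t : R) : 0 <= t <= 2 * pi -> is_derive t 1 Q (G' t ^+ 2 - k ^+ 2 * G t ^+ 2).
  move=> tI; have d1 := dP1 t tI; have d2 := dP2 t tI.
  by apply: (is_derive_eq (dsub d1 (dmul (dcst (k ^+ 2) t 1) d2))); rewrite mul0r add0r.
have p0 : 0 < pi :> R by exact: pi_gt0.
have q1 (t : R) : 0 <= t <= a -> is_derive t 1 Q (G' t ^+ 2 - k ^+ 2 * G t ^+ 2).
  by move=> /andP[? ?]; apply: dQ; apply/andP; split; lra.
have q2 (t : R) : a <= t <= a + pi -> is_derive t 1 Q (G' t ^+ 2 - k ^+ 2 * G t ^+ 2).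
  by move=> /andP[? ?]; apply: dQ; apply/andP; split; lra.
have q3 (t : R) : a + pi <= t <= 2 * pi -> is_derive t 1 Q (G' t ^+ 2 - k ^+ 2 * G t ^+ 2).
  by move=> /andP[? ?]; apply: dQ; apply/andP; split; lra.
have i2 : a <= a + pi by lra.
have i3 : a + pi <= 2 * pi by lra.
have := @picone_step G G' Q k 0 a (a - pi / 2) k01 a0 dG q1 ltac:(lra) ltac:(lra).
have := @picone_step G G' Q k a (a + pi) (a + pi / 2) k01 i2 dG q2 ltac:(lra) ltac:(lra).
have := @picone_step G G' Q k (a + pi) (2 * pi) (a + 3 * pi / 2) k01 i3 dG q3 ltac:(lra) ltac:(lra).
rewrite Ga Gapi !expr0n/= !mulr0 !addr0 Gp.
have -> : k * (2 * pi - (a + 3 * pi / 2)) = k * (0 - (a - pi / 2)) by field.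
rewrite /Q; lra.
Qed.

(* An antipodal pair where g takes the same value splits the circle into two
   half circles on which the Dirichlet eigenvalue is also 1. *)
Lemma wirtinger (g g' : R -> R) : (forall t : R, is_derive t 1 g (g' t)) -> continuous g' ->
  g 0 = g (2 * pi) ->
  circle_int (fun t => g t ^+ 2) - circle_int g ^+ 2 / (2 * pi) <= circle_int (fun t => g' t ^+ 2).
Proof.
move=> dg cg' gp; have p0 : 0 < pi :> R by exact: pi_gt0.
have cg : continuous g by move=> t; exact: is_derive_continuous (dg t).
pose w t := g t - g (t + pi).
have cw : {within `[0, pi], continuous w}.
  apply: continuous_subspaceT => t; rewrite /w.
  have H : {for t, continuous (fun t => g t - g (t + pi))} by cont.
  exact: H.
have [a aI wa] : exists2 a, a \in `[(0 : R), pi] & w a = 0.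
  apply: (IVT (ltW p0) cw); rewrite /w add0r (_ : pi + pi = 2 * pi); last by ring.
  by have [h|h] := leP (g 0) (g pi); rewrite ge_min le_max !subr_le0 !subr_ge0 -gp ?h ?(ltW h) ?orbT.
pose c := g a; pose G t := g t - c.
have dG (t : R) : is_derive t 1 G (g' t) by have := dg t => d1; rewrite /G; der; ring.
have Ga : G a = 0 by rewrite /G /c subrr.
have Gapi : G (a + pi) = 0 by move/eqP: wa; rewrite /w subr_eq0 => /eqP; rewrite /G /c => ->; rewrite subrr.
have Gp : G 0 = G (2 * pi) by rewrite /G gp.
apply: le_trans (circle_int_variance c cg) _.
have aI' : 0 <= a <= pi by move: aI; rewrite in_itv.
have step k (k01 : 0 < k < 1) := wirtinger_step k01 aI' dG cg' Gp Ga Gapi.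
move: step; set A := circle_int (fun t => g' t ^+ 2); set B := circle_int (fun t => G t ^+ 2) => step.
rewrite -/B.
have A0 : 0 <= A by apply: circle_int_ge0 => t; exact: sqr_ge0.
rewrite leNgt; apply/negP => AB; have B0 : 0 < B by exact: le_lt_trans AB.
(* This replaces the limit [k -> 1]: with [k = 1 - e] one has [k ^ 2 B >= (A + B) / 2 > A]. *)
pose e := (B - A) / (4 * B).
have e0 : 0 < e by rewrite divr_gt0 ?subr_gt0// mulr_gt0.
have e1 : e < 1 by rewrite /e ltr_pdivrMr ?mulr_gt0//; lra.
have eB : e * B = (B - A) / 4 by rewrite /e; field; rewrite gt_eqF.
have := step (1 - e); rewrite subr_gt0 e1 gtrBl e0 => /(_ isT).
have -> : (1 - e) ^+ 2 * B = B - 2 * (e * B) + e ^+ 2 * B by ring.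
rewrite eB; have : 0 <= e ^+ 2 * B by rewrite mulr_ge0 ?sqr_ge0// ltW.
lra.
Qed.

Lemma is_derive_circle_int (F dF : R -> R -> R) (a C : R) :
  (forall s t, is_derive (s : R) 1 (fun s => F s t) (dF s t)) -> (forall s, continuous (F s)) ->
  (forall s t, `|s - a| < 1 -> `|dF s t| <= C) ->
  is_derive a 1 (fun s => circle_int (F s)) (circle_int (dF a)).
Proof.
move=> d cF dC; pose I : set R := `]a - 1, a + 1[%classic.
have Ia : I a by rewrite /I/= in_itv/= gtrBl ltrDl ltr01.
have E (s t : R) : partial1of2 F s t = dF s t by rewrite partial1of2E; have [_ ->] := d s t.
have C0 : 0 <= C by apply: le_trans (dC a 0 _); rewrite // subrr normr0.
have intf s : I s -> mu.-integrable `[(0 : R), 2 * pi] (EFin \o F s) by move=> _; exact: circle_integrable.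
have derf s t : I s -> `[(0 : R), 2 * pi]%classic t -> derivable (F ^~ t) s 1 by move=> _ _; have [] := d s t.
have iG : mu.-integrable `[(0 : R), 2 * pi] (EFin \o (fun=> C)).
  by apply: circle_integrable; exact: cst_continuous.
have Gub s t : I s -> `[(0 : R), 2 * pi]%classic t -> `|partial1of2 F s t| <= C.
  by rewrite /I/= in_itv/= E => /andP[s1 s2] _; apply: dC; rewrite ltr_norml; apply/andP; split; lra.
have h1 := derivable_under_integral mI Ia intf derf (fun=> C0) iG Gub.
have h2 := differentiation_under_integral mI Ia intf derf (fun=> C0) iG Gub.
apply: DeriveDef; first exact: h1.
rewrite -derive1E h2 /circle_int; apply: eq_Rintegral => t _.
exact: E.
Qed.

Lemma continuous_circle_int (F : R -> R -> R) (C : R) :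
  (forall t, continuous (fun s => F s t)) -> (forall s, continuous (F s)) ->
  (forall s t, `|F s t| <= C) -> continuous (fun s => circle_int (F s)).
Proof.
move=> cs ct FC a; pose I : set R := `]a - 1, a + 1[%classic.
have intf s : `]a - 1, a + 1[%classic s -> mu.-integrable `[(0 : R), 2 * pi] (EFin \o F s) by move=> _; exact: circle_integrable.
have iG : mu.-integrable `[(0 : R), 2 * pi] (EFin \o (fun=> C)).
  by apply: circle_integrable; exact: cst_continuous.
apply: (@continuity_under_integral _ _ _ mu F `[(0 : R), 2 * pi]%classic mI (a - 1) (a + 1) intf _ (fun=> C) iG).
- by apply: aeW => t _ s _; exact: cs.
- by move=> s _; apply: aeW => t _; exact: FC.
- by rewrite inE/= in_itv/= gtrBl ltrDl ltr01.
Qed.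

End circle_integral.

Section continuous_functions.
Context {R : realType} {T : topologicalType}.
Implicit Types (f g : T -> R).

Lemma continuous_cst_fun (c : R) : continuous (fun _ : T => c).
Proof. exact: cst_continuous. Qed.

Lemma continuous_add f g : continuous f -> continuous g -> continuous (fun x => f x + g x).
Proof. by move=> cf cg x; apply: cadd; [exact: cf|exact: cg]. Qed.

Lemma continuous_mul f g : continuous f -> continuous g -> continuous (fun x => f x * g x).
Proof. by move=> cf cg x; apply: cmul; [exact: cf|exact: cg]. Qed.

Lemma continuous_opp f : continuous f -> continuous (fun x => - f x).
Proof. by move=> cf x; apply: copp; exact: cf. Qed.

Lemma continuous_exp f n : continuous f -> continuous (fun x => f x ^+ n).
Proof. by move=> cf x; apply: cexp; exact: cf. Qed.

End continuous_functions.
Arguments continuous_cst_fun {R T} c.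
Notation kC := continuous_cst_fun.
Notation kA := continuous_add.
Notation kM := continuous_mul.
Notation kX := continuous_exp.

(** * The ground state representation outside a disk *)

Section annulus.
Context {R : realType}.
Local Notation mu := (@lebesgue_measure R).

Variables (F Fs Ft : R -> R -> R) (C B r0 k : R) (phi phi1 : R -> R).
Hypothesis r00 : 0 < r0.
Hypothesis dFs : forall s t : R, is_derive s 1 (fun s => F s t) (Fs s t).
Hypothesis dFt : forall s t : R, is_derive t 1 (F s) (Ft s t).
Hypothesis cFs : forall s, continuous (Fs s).
Hypothesis cFs' : forall t, continuous (fun s => Fs s t).
Hypothesis cFt : forall s, continuous (Ft s).
Hypothesis FC : forall s t, `|F s t| <= C.
Hypothesis FsC : forall s t, `|Fs s t| <= C.
Hypothesis Fp : forall s, F s 0 = F s (2 * pi).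
Hypothesis FB : forall s t, B <= s -> F s t = 0.
Hypothesis dphi : forall r : R, 0 < r -> is_derive r 1 phi (phi1 r).
Hypothesis dphi1 : forall r : R, 0 < r -> is_derive r 1 phi1 ((k ^+ 2 + r ^- 2) * phi r - phi1 r / r).
Hypothesis phi_gt0 : forall r, 0 < r -> 0 < phi r.

(** The squared gradient plus [k ^ 2] times the squared function, integrated over the circle of
    radius [s] with the polar weight; [Fs] and [Ft] are the radial and angular derivatives of
    [F]. *)
Definition annulus_energy s := s * circle_int (fun t => Fs s t ^+ 2) + circle_int (fun t => Ft s t ^+ 2) / s +
  k ^+ 2 * s * circle_int (fun t => F s t ^+ 2).

Let cF s : continuous (F s).
Proof. by move=> t; exact: is_derive_continuous (dFt s t). Qed.
Let cF' t : continuous (fun s => F s t).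
Proof. by move=> s; exact: is_derive_continuous (dFs s t). Qed.
Let C0 : 0 <= C. Proof. exact: le_trans (normr_ge0 _) (FC 0 0). Qed.

Let K1 s := circle_int (F s).
Let K2 s := circle_int (fun t => F s t ^+ 2).
Let K1' s := circle_int (Fs s).
Let K2' s := circle_int (fun t => 2 * F s t * Fs s t).

Let dK1 (s : R) : is_derive s 1 K1 (K1' s).
Proof. by apply: (is_derive_circle_int dFs cF) => s' t _; exact: FsC. Qed.

Let d2 (s t : R) : is_derive s 1 (fun s => F s t ^+ 2) (2 * F s t * Fs s t).
Proof. by have := dFs s t => d; der; ring. Qed.

Let b2 s t : `|2 * F s t * Fs s t| <= 2 * C * C.
Proof.
by rewrite !normrM (ger0_norm (x := 2))//; apply: ler_pM => //; rewrite ?mulr_ge0// ler_wpM2l.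
Qed.

Let cF2 s : continuous (fun t => F s t ^+ 2).
Proof. by move=> t; apply: cexp; exact: cF. Qed.

Let dK2 (s : R) : is_derive s 1 K2 (K2' s).
Proof. by apply: (@is_derive_circle_int _ (fun s t => F s t ^+ 2) _ s (2 * C * C) d2 cF2) => s' t _; exact: b2. Qed.

Let cK1' : continuous K1'.
Proof. exact: (continuous_circle_int cFs' cFs FsC). Qed.

Let cK2' : continuous K2'.
Proof.
apply: (@continuous_circle_int _ (fun s t => 2 * F s t * Fs s t) (2 * C * C)) => //.
  move=> t s; have h1 := @cF' t; have h2 := @cFs' t.
  have H : {for s, continuous (fun s => 2 * F s t * Fs s t)} by apply: cmul; [apply: cmul; [exact: ccst|exact: h1]|exact: h2].
  exact: H.
move=> s t; have h1 := @cF s; have h2 := @cFs s.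
have H : {for t, continuous (fun t => 2 * F s t * Fs s t)} by apply: cmul; [apply: cmul; [exact: ccst|exact: h1]|exact: h2].
exact: H.
Qed.

Let q s := - phi1 s / phi s.
(** The last factor is minus the circle integral of the squared deviation from the mean: the ground
    state is substituted in the nonconstant angular modes only. *)
Let V s := s * q s * (K1 s ^+ 2 / (2 * pi) - K2 s).
Let V' s := (s * q s ^+ 2 - k ^+ 2 * s - s^-1) * (K1 s ^+ 2 / (2 * pi) - K2 s) +
   s * q s * (2 * K1 s * K1' s / (2 * pi) - K2' s).

Let w0 : 0 < 2 * pi :> R. Proof. by rewrite mulr_gt0// pi_gt0. Qed.
Let wn : 2 * pi != 0 :> R. Proof. by rewrite gt_eqF. Qed.

(** The Riccati form of the radial Bessel equation of order 1. *)
Let dq (s : R) : 0 < s -> is_derive s 1 q (q s ^+ 2 - q s / s - k ^+ 2 - s ^- 2).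
Proof.
move=> s0; have d1 := dphi s0; have d1' := dphi1 s0.
have pn : phi s != 0 by rewrite gt_eqF// phi_gt0.
have sn : s != 0 by rewrite gt_eqF.
by rewrite /q; der => //; field; rewrite ?pn ?sn.
Qed.

Let dV (s : R) : 0 < s -> is_derive s 1 V (V' s).
Proof.
move=> s0; have d1 := dK1 s; have d2' := dK2 s; have d3 := dq s0.
have sn : s != 0 by rewrite gt_eqF.
have dall := dmul (dmul (is_derive_id s 1) d3) (dsub (dmul (dexp 2 d1) (dcst (2 * pi)^-1 s 1)) d2').
apply: (is_derive_eq dall); rewrite /V' /= expr1.
move: (2 * pi) wn => w wn'; move: (K1 s) (K2 s) (K1' s) (K2' s) (q s) => a b a' b' c.
by field; rewrite ?wn' ?sn.
Qed.

Let cV' s : 0 < s -> {for s, continuous V'}.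
Proof.
move=> s0; have h1 := is_derive_continuous (dK1 s); have h2 := is_derive_continuous (dK2 s).
have h3 := is_derive_continuous (dq s0); have h4 : {for s, continuous K1'} by exact: cK1'.
have h5 : {for s, continuous K2'} by exact: cK2'.
have sn : s != 0 by rewrite gt_eqF.
move: h1 h2 h3 h4 h5; rewrite /V'; move: K1 K2 q K1' K2' => a b c a' b' h1 h2 h3 h4 h5.
by cont.
Qed.

(** The difference is a sum of four nonnegative terms: the mean square deviation of [Fs + q F],
    which is the completed square in the nonconstant modes, the radial and the zeroth order energy
    of the mean, and the deficit in Wirtinger's inequality. *)
Let V'_le s : 0 < s -> V' s <= annulus_energy s.
Proof.
move=> s0; have sn : s != 0 by rewrite gt_eqF.
have W := wirtinger (@dFt s) (@cFt s) (Fp s).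
have cw : continuous (fun t => 1 * Fs s t + q s * F s t).
  move=> t; have h1 := @cF s; have h2 := @cFs s.
  have H : {for t, continuous (fun t => 1 * Fs s t + q s * F s t)}.
    by apply: cadd; apply: cmul; [exact: ccst|exact: h2|exact: ccst|exact: h1].
  exact: H.
have Q : 0 <= circle_int (fun t => (1 * Fs s t + q s * F s t) ^+ 2) - (circle_int (fun t => 1 * Fs s t + q s * F s t)) ^+ 2 / (2 * pi).
  have c0 : continuous (fun _ : R => 0 : R) by exact: cst_continuous.
  pose m := circle_int (fun t => 1 * Fs s t + q s * F s t) / (2 * pi).
  have V0 := circle_int_ge0 (fun t => sqr_ge0 ((1 * Fs s t + q s * F s t) - m)).
  have cwm : continuous (fun t => (1 * Fs s t + q s * F s t) ^+ 2) by move=> t; exact: (@cexp _ _ (fun t => 1 * Fs s t + q s * F s t) 2 t (cw t)).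
  have c1 : continuous (fun _ : R => 1 : R) by exact: cst_continuous.
  have cl : continuous (fun t => (- 2 * m) * (1 * Fs s t + q s * F s t) + m ^+ 2 * 1).
    move=> t; have H : {for t, continuous (fun t => (- 2 * m) * (1 * Fs s t + q s * F s t) + m ^+ 2 * 1)}.
      by apply: cadd; [apply: cmul; [exact: ccst|exact: cw]|exact: ccst].
    exact: H.
  move: V0; rewrite (_ : (fun t => (_ - m) ^+ 2) = (fun t => 1 * (1 * Fs s t + q s * F s t) ^+ 2 + 1 * ((- 2 * m) * (1 * Fs s t + q s * F s t) + m ^+ 2 * 1))); last by apply/funext => t; ring.
  rewrite (circle_int_lin _ _ cwm cl) (circle_int_lin _ _ cw c1) circle_int_cst /m.
  move: (circle_int (fun t => (1 * Fs s t + q s * F s t) ^+ 2)) (circle_int (fun t => 1 * Fs s t + q s * F s t)) => a b.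
  move: (2 * pi) wn w0 => w wn' w0' h.
  have -> : a - b ^+ 2 / w = 1 * a + 1 * (-2 * (b / w) * b + (b / w) ^+ 2 * (1 * w)) by field.
  exact: h.
have cS : continuous (fun t => Fs s t ^+ 2) by move=> t; apply: cexp; exact: cFs.
have cX : continuous (fun t => 2 * F s t * Fs s t).
  move=> t; have h1 := @cF s; have h2 := @cFs s.
  have H : {for t, continuous (fun t => 2 * F s t * Fs s t)} by apply: cmul; [apply: cmul; [exact: ccst|exact: h1]|exact: h2].
  exact: H.
have cXF : continuous (fun t => q s * (2 * F s t * Fs s t) + q s ^+ 2 * F s t ^+ 2).
  move=> t; have H : {for t, continuous (fun t => q s * (2 * F s t * Fs s t) + q s ^+ 2 * F s t ^+ 2)}.
    by apply: cadd; apply: cmul; [exact: ccst|exact: cX|exact: ccst|exact: cF2].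
  exact: H.
move: Q; rewrite (_ : (fun t => (1 * _ + _) ^+ 2) = (fun t => 1 * Fs s t ^+ 2 + 1 * (q s * (2 * F s t * Fs s t) + q s ^+ 2 * F s t ^+ 2))); last by apply/funext => t; ring.
rewrite (circle_int_lin _ _ cS cXF) (circle_int_lin _ _ cX (@cF2 s)) (circle_int_lin _ _ (@cFs s) (@cF s)).
move: W; rewrite /V' /annulus_energy -/(K1 s) -/(K2 s) -/(K1' s) -/(K2' s).
move: (circle_int (fun t => Fs s t ^+ 2)) (circle_int (fun t => Ft s t ^+ 2)) => S T.
move: (K1 s) (K2 s) (K1' s) (K2' s) (q s) => a b a' b' c.
move: (2 * pi) wn w0 => w wn' w0' W Q.
rewrite -subr_ge0.
have -> : s * S + T / s + k ^+ 2 * s * b -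
  ((s * c ^+ 2 - k ^+ 2 * s - s^-1) * (a ^+ 2 / w - b) + s * c * (2 * a * a' / w - b')) =
  s * (1 * S + 1 * (c * b' + c ^+ 2 * b) - (1 * a' + c * a) ^+ 2 / w) + s * a' ^+ 2 / w +
  (T - (b - a ^+ 2 / w)) / s + k ^+ 2 * s * a ^+ 2 / w by field; rewrite ?wn' ?sn.
have p1 : 0 <= s * (1 * S + 1 * (c * b' + c ^+ 2 * b) - (1 * a' + c * a) ^+ 2 / w) by rewrite mulr_ge0// ltW.
have p2 : 0 <= s * a' ^+ 2 / w by apply: mulr_ge0; [apply: mulr_ge0; [exact: ltW|exact: sqr_ge0]|rewrite invr_ge0 ltW].
have p3 : 0 <= (T - (b - a ^+ 2 / w)) / s by rewrite divr_ge0 ?subr_ge0// ltW.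
have p4 : 0 <= k ^+ 2 * s * a ^+ 2 / w.
  apply: mulr_ge0; last by rewrite invr_ge0 ltW.
  by apply: mulr_ge0; [apply: mulr_ge0; [exact: sqr_ge0|exact: ltW]|exact: sqr_ge0].
lra.
Qed.

Lemma annulus_bound : measurable_fun `]r0, +oo[ (fun s => (annulus_energy s)%:E) ->
  ((r0 * q r0 * (K2 r0 - K1 r0 ^+ 2 / (2 * pi)))%:E <= \int[mu]_(s in `]r0, +oo[) (annulus_energy s)%:E)%E.
Proof.
move=> mJ; pose B' := Num.max B r0; have rB : r0 <= B' by rewrite le_max lexx orbT.
have pos s : r0 <= s -> 0 < s by exact: lt_le_trans.
have cw : {within `[r0, B'], continuous V'}.
  by apply: continuous_in_subspaceT => s; rewrite inE/= in_itv/= => /andP[/pos + _]; exact: cV'.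
have d (s : R) : r0 <= s <= B' -> is_derive s 1 V (V' s) by move=> /andP[/pos + _]; exact: dV.
have e := ftc_itv rB d cw.
have z : V B' = 0.
  have FB' : F B' = (fun=> 0) by apply/funext => t; apply: FB; rewrite le_max lexx.
  rewrite /V /K1 /K2 FB' (_ : (fun t => 0 ^+ 2) = (fun=> 0)); last by apply/funext => t; rewrite expr0n.
  by rewrite circle_int_cst mul0r expr0n/= mul0r subrr mulr0.
have -> : r0 * q r0 * (K2 r0 - K1 r0 ^+ 2 / (2 * pi)) = V B' - V r0 by rewrite z /V; ring.
rewrite -e.
have E0 s : 0 < s -> 0 <= annulus_energy s.
  move=> s0; rewrite /annulus_energy !addr_ge0//.
  - by apply: mulr_ge0; [exact: ltW|apply: circle_int_ge0 => t; exact: sqr_ge0].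
  - by apply: mulr_ge0; [apply: circle_int_ge0 => t; exact: sqr_ge0|rewrite invr_ge0 ltW].
  - by apply: mulr_ge0; [apply: mulr_ge0; [exact: sqr_ge0|exact: ltW]|apply: circle_int_ge0 => t; exact: sqr_ge0].
(* The positive part of [V'] is still below the energy, and its nonnegativity allows a comparison of
   integrals that asks only for measurability of the energy. *)
pose M s := (V' s + `|V' s|) / 2.
have cM : {within `[r0, B'], continuous M}.
  apply: continuous_in_subspaceT => s; rewrite inE/= in_itv/= => /andP[/pos + _] => s0.
  have h := cV' s0; have h' : {for s, continuous (fun s => `|V' s|)} by apply: continuous_comp h _; exact: norm_continuous.
  have H : {for s, continuous (fun s => (V' s + `|V' s|) / 2)} by apply: cmul; [apply: cadd|exact: ccst].
  exact: H.
have i1 := segment_integrable cw; have i2 := segment_integrable cM.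
have M0 s : 0 <= M s by rewrite /M divr_ge0//; have := ler_norm (- V' s); rewrite normrN; lra.
apply: (@le_trans _ _ (\int[mu]_(s in `[r0, B']) (M s)%:E)%E).
  apply: le_integral; [exact: measurable_itv|exact: i1|exact: i2|move=> s _; rewrite lee_fin /M].
  by have := ler_norm (V' s); lra.
apply: (@le_trans _ _ (\int[mu]_(s in `]r0, B']) (M s)%:E)%E).
  rewrite integral_itv_obnd_cbnd//; apply: (measurable_funS (measurable_itv _) _ (measurable_int _ i2)).
  by move=> s /=; rewrite !in_itv/= => /andP[/ltW -> ->].
apply: (@le_trans _ _ (\int[mu]_(s in `]r0, B']) (annulus_energy s)%:E)%E).
  apply: ge0_le_integral; first exact: measurable_itv.
  - by move=> s _; rewrite lee_fin.
  - apply: (measurable_funS (measurable_itv _) _ (measurable_int _ i2)).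
    by move=> s /=; rewrite !in_itv/= => /andP[/ltW -> ->].
  - apply: (measurable_funS (measurable_itv _) _ mJ).
    by move=> s /=; rewrite !in_itv/= => /andP[-> _].
  - move=> s /=; rewrite in_itv/= => /andP[rs _]; have s0 : 0 < s by exact: lt_trans rs.
    have h1 := V'_le s0; have h2 := E0 s s0; rewrite lee_fin /M.
    by have [h|h] := leP 0 (V' s); [rewrite ger0_norm//|rewrite ltr0_norm//]; lra.
apply: ge0_subset_integral; [exact: measurable_itv|exact: measurable_itv|exact: mJ| |].
- by move=> s /=; rewrite in_itv/= andbT => rs; rewrite lee_fin E0// (lt_trans r00).
- by move=> s /=; rewrite !in_itv/= => /andP[-> _].
Qed.

End annulus.

Lemma disk_bound_algebra (R : realType) (r0 al p a b x y z : R) : r0 != 0 -> p != 0 ->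
  r0 * al * (b - a ^+ 2 / (2 * p)) <= 1 * x + 1 * y + z ->
  - (al / (2 * p * r0)) * (r0 * a) ^+ 2 <= x + y + z - al * (r0 * b).
Proof.
move=> rn pn; rewrite !mul1r.
have -> : - (al / (2 * p * r0)) * (r0 * a) ^+ 2 = r0 * al * (b - a ^+ 2 / (2 * p)) - al * (r0 * b).
  by field; rewrite ?pn ?rn.
by rewrite lerD2r.
Qed.

(** * The Robin form of test functions outside the disk *)

Section disk_bound.
Context {R : realType}.
Local Notation plane := (R * R)%type.
Local Notation mplane := (measurableTypeR R * measurableTypeR R)%type.
Local Notation mu := (@lebesgue_measure R).
Variables (r0 : R).
Hypothesis r00 : 0 < r0.
Local Notation A := (disk (0 : plane) r0).
Local Notation ext := (exterior A : set mplane).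
Local Notation bd := (boundary A : set mplane).
Let AP := polar_domain_disk r00.
Let mE : measurable ext. Proof. exact: measurable_exterior. Qed.
Let mB : measurable bd. Proof. exact: measurable_boundary. Qed.
Let mI : measurable (`[0, 2 * pi]%classic : set (measurableTypeR R)). Proof. exact: measurable_itv. Qed.
Let mO : measurable (`]r0, +oo[%classic : set (measurableTypeR R)). Proof. exact: measurable_itv. Qed.

Let cpt (g : plane -> R) (s : R) : continuous g -> continuous (fun t : R => g (s * cos t, s * sin t)).
Proof.
move=> cg t; apply: (@continuous_comp _ _ _ (fun t : R => (s * cos t, s * sin t)) g); last exact: cg.
by apply: cpair; cont.
Qed.

Let cps (g : plane -> R) (t : R) : continuous g -> continuous (fun s : R => g (s * cos t, s * sin t)).
Proof.
move=> cg s; apply: (@continuous_comp _ _ _ (fun s : R => (s * cos t, s * sin t)) g); last exact: cg.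
by apply: cpair; cont.
Qed.

Lemma circle_int_scale c (f : R -> R) : continuous f -> circle_int (fun t => c * f t) = c * circle_int f.
Proof.
move=> cf; have := circle_int_lin c 0 cf cf; rewrite mul0r addr0 => <-.
by congr circle_int; apply/funext => t; rewrite mul0r addr0.
Qed.

(** For a circle the upper and the lower estimate of the boundary integral carry the same constant
    [r0], so the integral is known exactly. *)
Lemma circle_boundary_sqr (g : plane -> R) C : continuous g -> (forall x, `|g x| <= C) ->
  L2 hausdorff1 bd g /\
  dot hausdorff1 bd g g = r0 * circle_int (fun t => g (r0 * cos t, r0 * sin t) ^+ 2).
Proof.
move=> cg gC; have mg := continuous_measurable_plane cg.
have Lg : L2 hausdorff1 bd g.
  by apply: (bounded_L2 mB (boundary_finite AP) (measurable_funTS mg) (C := C)) => x _; exact: gC.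
split => //; apply: EFin_inj; rewrite -(dot_sqr_EFin mB Lg).
have mg2 : measurable_fun setT (fun x : mplane => (g x ^+ 2)%:E) by apply/measurable_EFinP; exact: measurable_funX.
have g20 x : (0 <= (g x ^+ 2)%:E)%E by rewrite lee_fin sqr_ge0.
have cG : continuous (fun t => g (r0 * cos t, r0 * sin t) ^+ 2).
  exact: kX (@cpt _ r0 cg).
have cG' : continuous (fun t => r0 * g (r0 * cos t, r0 * sin t) ^+ 2).
  exact: kM (kC r0) cG.
have E : (\int[mu]_(t in `[0%R, (2 * pi)%R]) ((g (polar_curve (fun=> r0) t) ^+ 2)%:E * r0%:E) =
    (r0 * circle_int (fun t => g (r0 * cos t, r0 * sin t) ^+ 2))%:E)%E.
  rewrite -circle_int_scale// -circle_int_EFin//; apply: eq_integral => t _.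
  by rewrite -EFinM mulrC.
apply/eqP; rewrite eq_le; apply/andP; split.
  have := boundary_integral_le AP mg2 g20.
  by rewrite expr0n add0r sqrtr_sqr gtr0_norm// E.
by have := boundary_integral_ge AP mg2 g20; rewrite E.
Qed.

Variables (al k : R) (phi phi1 : R -> R).
Hypothesis al_eq : - phi1 r0 / phi r0 = al.
Hypothesis dphi : forall r : R, 0 < r -> is_derive r 1 phi (phi1 r).
Hypothesis dphi1 : forall r : R, 0 < r -> is_derive r 1 phi1 ((k ^+ 2 + r ^- 2) * phi r - phi1 r / r).
Hypothesis phi_gt0 : forall r, 0 < r -> 0 < phi r.

(** In [annulus_bound] the boundary term contains only the deviation from the mean. Adding the mean
    part back, with [r0 dt] as boundary measure, produces the factor [al / (2 pi r0)]. *)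
Lemma disk_test_bound (f : plane -> R) : test_function setT f ->
  L2 hausdorff1 bd (fun=> 1) /\
  - (al / (2 * pi * r0)) * dot hausdorff1 bd f (fun=> 1) ^+ 2 <=
  dot leb2 ext ('D_e1 f) ('D_e1 f) + dot leb2 ext ('D_e2 f) ('D_e2 f) + k ^+ 2 * dot leb2 ext f f -
    al * dot hausdorff1 bd f f.
Proof.
move=> hf; have h1 := test_derive1 hf; have h2 := test_derive2 hf.
have cf := test_continuous hf; have c1 := test_continuous h1; have c2 := test_continuous h2.
have [C C0 fC] := test_bounded hf; have [C1 C10 fC1] := test_bounded h1; have [C2 C20 fC2] := test_bounded h2.
have one x : `|(fun _ : plane => 1 : R) x| <= 1 by rewrite normr1.
have cone : continuous (fun _ : plane => 1 : R) by exact: cst_continuous.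
have [L1 _] := circle_boundary_sqr cone one; split => //.
have [Lf fE] := circle_boundary_sqr cf fC.
have bl (e : R) : `|e| = 1 -> L2 hausdorff1 bd (fun x => f x + e) /\
    dot hausdorff1 bd (fun x => f x + e) (fun x => f x + e) =
      r0 * circle_int (fun t => (f (r0 * cos t, r0 * sin t) + e) ^+ 2).
  move=> e1; apply: (circle_boundary_sqr (C := C + 1)).
    by move=> x; apply: cadd; [exact: cf|exact: ccst].
  by move=> x; apply: le_trans (ler_normD _ _) _; rewrite e1 lerD.
have cF := @cpt _ r0 cf.
have cF2 : continuous (fun t => f (r0 * cos t, r0 * sin t) ^+ 2) by exact: kX cF.
have cc1 : continuous (fun _ : R => 1 : R) by exact: cst_continuous.
(* Exact values are available for squares only; the linear integral follows by polarization with the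
   constant 1. *)
have f1E : dot hausdorff1 bd f (fun=> 1) = r0 * circle_int (fun t => f (r0 * cos t, r0 * sin t)).
  have [_ e] := bl 1 (normr1 _).
  have e2 : dot hausdorff1 bd (fun x => f x + 1) (fun x => f x + 1) =
      dot hausdorff1 bd f f + 2 * dot hausdorff1 bd f (fun=> 1) + dot hausdorff1 bd (fun=> 1) (fun=> 1).
    have := dot_lin mB 1 1 Lf L1.
    rewrite (_ : (fun x => 1 * f x + 1 * 1) = (fun x => f x + 1)); last by apply/funext => x; ring.
    by rewrite expr1n !mul1r !mulr1 => ->.
  have [_ e3] := circle_boundary_sqr cone one.
  have cl : continuous (fun t => 2 * f (r0 * cos t, r0 * sin t) + 1 * 1).
    exact: kA (kM (kC 2) cF) (kC (1 * 1)).
  have e4 : circle_int (fun t => (f (r0 * cos t, r0 * sin t) + 1) ^+ 2) = circle_int (fun t => f (r0 * cos t, r0 * sin t) ^+ 2) +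
      (2 * circle_int (fun t => f (r0 * cos t, r0 * sin t)) + circle_int (fun=> 1)).
    rewrite (_ : (fun t => (_ + 1) ^+ 2) = (fun t => 1 * f (r0 * cos t, r0 * sin t) ^+ 2 + 1 * (2 * f (r0 * cos t, r0 * sin t) + 1 * 1))); last by apply/funext => t; ring.
    by rewrite (circle_int_lin _ _ cF2 cl) (circle_int_lin _ _ cF cc1) !mul1r.
  have e5 : circle_int (fun _ : R => 1 ^+ 2) = circle_int (fun=> 1 : R) by congr circle_int; apply/funext => t; rewrite expr1n.
  move: e e2 e3; rewrite e4 e5 fE => -> h1' h2'; rewrite h2' in h1'.
  have solve (r a b c d : R) : r * (a + (2 * b + c)) = r * a + 2 * d + r * c -> d = r * b.
    move=> h; have n2 : (2 : R) != 0 by rewrite pnatr_eq0.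
    apply: (mulfI n2); rewrite [LHS](_ : _ = r * a + 2 * d + r * c - r * a - r * c); last by ring.
    by rewrite -h; ring.
  exact: solve h1'.
pose Fs := radial_derivative f; pose Ft := angular_derivative f.
pose F s t := f (s * cos t, s * sin t).
have FsC s t : `|Fs s t| <= C + (C1 + C2).
  apply: le_trans (ler_normD _ _) _; rewrite !normrM; apply: ler_wpDl => //; apply: lerD.
    by rewrite -[C1]mulr1; apply: ler_pM => //; rewrite ler_norml cos_geN1 cos_le1.
  by rewrite -[C2]mulr1; apply: ler_pM => //; rewrite ler_norml sin_geN1 sin_le1.
have FC s t : `|F s t| <= C + (C1 + C2) by apply: ler_wpDr; [exact: addr_ge0|exact: fC].
have cFs s : continuous (Fs s).
  exact: kA (kM (@cpt _ s c1) (@continuous_cos R)) (kM (@cpt _ s c2) (@continuous_sin R)).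
have cFs' t : continuous (fun s => Fs s t).
  exact: kA (kM (@cps _ t c1) (kC (cos t))) (kM (@cps _ t c2) (kC (sin t))).
have cFt s : continuous (Ft s).
  exact: kA (kM (@cpt _ s c1) (continuous_opp (kM (kC s) (@continuous_sin R))))
    (kM (@cpt _ s c2) (kM (kC s) (@continuous_cos R))).
have Fp s : F s 0 = F s (2 * pi) by rewrite /F mulr_natl cos2pi sin2pi cos0 sin0.
have [B B0 FB] := test_radius hf.
have dFs (s t : R) := is_derive_radial s t hf; have dFt (s t : R) := is_derive_angular s t hf.
pose Q x := (1 * 'D_e1 f x ^+ 2 + 1 * 'D_e2 f x ^+ 2 + k ^+ 2 * f x ^+ 2)%:E.
have mQ : measurable_fun setT (Q : mplane -> \bar R) by exact: (measurable_quadratic 1 1 (k ^+ 2) c1 c2 cf).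
have Q0 x : (0 <= Q x)%E by rewrite lee_fin; exact: quadratic_ge0.
have inner s : r0 < s -> (\int[mu]_(t in `[0%R, (2 * pi)%R]) (Q (s * cos t, s * sin t)%R * s%:E) =
    (annulus_energy F Fs Ft k s)%:E)%E.
  move=> rs; have s0 : 0 < s by exact: lt_trans rs.
  have sn : s != 0 by rewrite gt_eqF.
  have w1 : continuous (fun t => Fs s t ^+ 2) by exact: kX (@cFs s).
  have w2 : continuous (fun t => Ft s t ^+ 2) by exact: kX (@cFt s).
  have w3 : continuous (fun t => F s t ^+ 2) by exact: kX (@cpt _ s cf).
  have w4 : continuous (fun t => s^-1 * Ft s t ^+ 2 + k ^+ 2 * s * F s t ^+ 2).
    exact: kA (kM (kC s^-1) w2) (kM (kC (k ^+ 2 * s)) w3).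
  have w5 : continuous (fun t => s * Fs s t ^+ 2 + 1 * (s^-1 * Ft s t ^+ 2 + k ^+ 2 * s * F s t ^+ 2)).
    exact: kA (kM (kC s) w1) (kM (kC 1) w4).
  transitivity (\int[mu]_(t in `[0%R, (2 * pi)%R]) (s * Fs s t ^+ 2 + 1 * (s^-1 * Ft s t ^+ 2 + k ^+ 2 * s * F s t ^+ 2))%:E)%E.
    apply: eq_integral => t _; rewrite /Q -EFinM; congr EFin.
    have := gradient_polar f t sn; rewrite -/(Fs s t) -/(Ft s t) -/(F s t).
    move: ('D_e1 f _) ('D_e2 f _) (Fs s t) (Ft s t) (F s t) => a b c d e H.
    by rewrite !mul1r -H; field; rewrite ?sn.
  rewrite (circle_int_EFin w5) (circle_int_lin _ _ w1 w4) (circle_int_lin _ _ w2 w3) /annulus_energy.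
  by congr EFin; move: (circle_int _) (circle_int _) (circle_int _) => a b c; ring.
have mpol : measurable_fun setT (fun z : mplane => (z.1 * cos z.2, z.1 * sin z.2) : mplane).
  by apply: measurable_fun_pair; apply: measurable_funM => //; [apply: (measurableT_comp (@measurable_cos R))|apply: (measurableT_comp (@measurable_sin R))].
have mpol' : measurable_fun setT (fun z : mplane => (z.2 * cos z.1, z.2 * sin z.1) : mplane).
  by apply: measurable_fun_pair; apply: measurable_funM => //; [apply: (measurableT_comp (@measurable_cos R))|apply: (measurableT_comp (@measurable_sin R))].
have mQp : measurable_fun setT (fun z : mplane => (Q (z.1 * cos z.2, z.1 * sin z.2)%R * z.1%:E)%E).
  by apply: emeasurable_funM; [exact: (measurableT_comp mQ mpol)|exact/measurable_EFinP].
have mQp' : measurable_fun setT (fun z : mplane => (Q (z.2 * cos z.1, z.2 * sin z.1)%R * z.2%:E)%E).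
  by apply: emeasurable_funM; [exact: (measurableT_comp mQ mpol')|exact/measurable_EFinP].
have Qpos (t s : R) : `]r0, +oo[%classic s -> (0 <= Q (s * cos t, s * sin t)%R * s%:E)%E.
  rewrite /= in_itv/= andbT => rs; apply: mule_ge0; first exact: Q0.
  by rewrite lee_fin ltW// (lt_trans r00).
have EE : ((1 * dot leb2 ext ('D_e1 f) ('D_e1 f) + 1 * dot leb2 ext ('D_e2 f) ('D_e2 f) + k ^+ 2 * dot leb2 ext f f)%:E =
    \int[mu]_(s in `]r0, +oo[) (annulus_energy F Fs Ft k s)%:E)%E.
  rewrite -(dot3_EFin mE (@ler01 R) (@ler01 R) (sqr_ge0 k) (test_L2 mE h1) (test_L2 mE h2) (test_L2 mE hf)).
  rewrite -/(Q _) (exterior_integral AP mQ Q0).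
  (* [exterior_integral] has the angle as outer variable, whereas [annulus_energy] needs the radius
     outside. *)
  rewrite (@tonelli_rectangle _ _ _ _ _ mu mu _ _ (fun z : mplane => (Q (z.2 * cos z.1, z.2 * sin z.1)%R * z.2%:E)%E) mI mO (measurable_funTS mQp')).
    by apply: eq_integral => s; rewrite inE/= in_itv/= andbT => /inner.
  by move=> t s _; exact: Qpos.
have mJ : measurable_fun `]r0, +oo[ (fun s => (annulus_energy F Fs Ft k s)%:E).
  have := @measurable_tonelli_rectangle1 _ _ _ _ _ mu _ _ (fun z : mplane => (Q (z.1 * cos z.2, z.1 * sin z.2)%R * z.1%:E)%E) mO mI (measurable_funTS mQp).
  move=> /(_ (fun s t hs _ => Qpos t s hs)); apply: eq_measurable_fun => s.
  by rewrite inE/= in_itv/= andbT => /inner.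
have := annulus_bound r00 dFs dFt cFs cFs' cFt FC FsC Fp FB dphi dphi1 phi_gt0 mJ.
rewrite -EE lee_fin al_eq f1E fE => H.
have pn : pi != 0 :> R by rewrite gt_eqF// pi_gt0.
have rn : r0 != 0 by rewrite gt_eqF.
exact: (disk_bound_algebra rn pn H).
Qed.

End disk_bound.

(** * Complex-valued functions and their Rayleigh quotients *)

Section complex_parts.
Context {R : realType}.
Local Notation C := (complex R).

Lemma ReM (x y : C) : complex.Re (x * y) = complex.Re x * complex.Re y - complex.Im x * complex.Im y.
Proof. by case: x y => [a b] [c d]. Qed.

Lemma ImM (x y : C) : complex.Im (x * y) = complex.Re x * complex.Im y + complex.Im x * complex.Re y.
Proof. by case: x y => [a b] [c d]. Qed.

Lemma ReD (x y : C) : complex.Re (x + y) = complex.Re x + complex.Re y.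
Proof. by case: x y => [a b] [c d]. Qed.

Lemma ImD (x y : C) : complex.Im (x + y) = complex.Im x + complex.Im y.
Proof. by case: x y => [a b] [c d]. Qed.

(** The redundant factors [1 *] give a nested two-term combination, the shape of the linearity
    lemmas for gradients, traces and [dot]. *)
Lemma re_lincomb (c : C * C) u : re (lincomb c u) = fun x =>
  1 * (complex.Re c.1 * re u.1 x + - complex.Im c.1 * im u.1 x) +
  1 * (complex.Re c.2 * re u.2 x + - complex.Im c.2 * im u.2 x).
Proof. by apply/funext => x; rewrite /re /im /lincomb ReD !ReM !mul1r !mulNr. Qed.

Lemma im_lincomb (c : C * C) u : im (lincomb c u) = fun x =>
  1 * (complex.Im c.1 * re u.1 x + complex.Re c.1 * im u.1 x) +
  1 * (complex.Im c.2 * re u.2 x + complex.Re c.2 * im u.2 x).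
Proof.
apply/funext => x; rewrite /re /im /lincomb ImD !ImM !mul1r.
by congr (_ + _); rewrite addrC.
Qed.

End complex_parts.

Section robin_functionals.
Context {R : realType}.
Local Notation plane := (R * R)%type.
Local Notation mplane := (measurableTypeR R * measurableTypeR R)%type.
Local Notation C := (complex R).
Implicit Types (u : plane -> R) (w : plane -> C).

Definition dirichlet (A : set plane) u : R :=
  dot leb2 (exterior A) (fun x => (grad (exterior A) u x).1) (fun x => (grad (exterior A) u x).1) +
  dot leb2 (exterior A) (fun x => (grad (exterior A) u x).2) (fun x => (grad (exterior A) u x).2).
Definition mass (A : set plane) u : R := dot leb2 (exterior A) u u.
Definition boundary_mass (A : set plane) u : R := dot hausdorff1 (boundary A) (trace A u) (trace A u).

Lemma dirichlet_ge0 A u : 0 <= dirichlet A u.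
Proof. by apply: addr_ge0; exact: dot_ge0. Qed.

Lemma mass_ge0 A u : 0 <= mass A u.
Proof. exact: dot_ge0. Qed.

Lemma boundary_mass_ge0 A u : 0 <= boundary_mass A u.
Proof. exact: dot_ge0. Qed.

(** Without a trace, [xget] returns its default, so the boundary term of the form vanishes. *)
Lemma trace_or_junk A u : is_trace A u (trace A u) \/ (~ (exists g, is_trace A u g) /\ trace A u = fun=> 0).
Proof.
have [h|h] := pselect (exists g, is_trace A u g).
  by left; have [g hg] := h; exact: (xgetPex 0 (P := [set g | is_trace A u g])) h.
right; split => //; apply: xgetPN => g hg.
by apply: h; exists g.
Qed.

Lemma trace_L2 A u : L2 hausdorff1 (boundary A) (trace A u).
Proof.
have [[]//|[_ ->]] := trace_or_junk A u; exact: L2_cst0.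
Qed.

Lemma dot2_EFin (nu : {measure set mplane -> \bar R}) (D : set mplane) (p q : mplane -> R) :
  measurable D -> L2 nu D p -> L2 nu D q ->
  (\int[nu]_(x in D) (p x ^+ 2 + q x ^+ 2)%:E = (dot nu D p p + dot nu D q q)%:E)%E.
Proof.
move=> mD hp hq; have := dot3_EFin mD (@ler01 R) (@ler01 R) (lexx 0) hp hq hq.
rewrite !mul1r mul0r addr0 => <-; apply: eq_integral => x _.
by rewrite !mul1r mul0r addr0.
Qed.

Lemma rayleighE (A : set plane) alpha w : H1 (exterior A) w ->
  rayleigh alpha A w = (dirichlet A (re w) + dirichlet A (im w) +
    alpha * (boundary_mass A (re w) + boundary_mass A (im w))) / (mass A (re w) + mass A (im w)).
Proof.
move=> [hr hi]; have mE := measurable_exterior A; have mB := measurable_boundary A.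
have [r1 r2] := grad_L2 hr; have [i1 i2] := grad_L2 hi.
rewrite /rayleigh /boundary_sq /norm_sq.
rewrite (dot2_EFin mB (trace_L2 A (re w)) (trace_L2 A (im w))).
rewrite (dot2_EFin mE hr.1 hi.1).
congr ((_ + _) / _); rewrite /dirichlet_sq /=.
rewrite (_ : (fun x => _%:E) = (fun x => ((grad (exterior A) (re w) x).1 ^+ 2 + (grad (exterior A) (re w) x).2 ^+ 2)%:E +
   ((grad (exterior A) (im w) x).1 ^+ 2 + (grad (exterior A) (im w) x).2 ^+ 2)%:E)%E); last first.
  by apply/funext => x; rewrite -EFinD !addrA.
have m2 (p q : mplane -> R) : L2 leb2 (exterior A) p -> L2 leb2 (exterior A) q ->
    measurable_fun (exterior A) (fun x => (p x ^+ 2 + q x ^+ 2)%:E).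
  move=> [mp _] [mq _]; apply/measurable_EFinP; apply: measurable_funD; exact: measurable_funX.
have p2 (p q : mplane -> R) x : exterior A x -> (0 <= (p x ^+ 2 + q x ^+ 2)%:E)%E.
  by move=> _; rewrite lee_fin addr_ge0// sqr_ge0.
rewrite (ge0_integralD leb2 mE (p2 _ _) (m2 _ _ r1 r2) (p2 _ _) (m2 _ _ i1 i2)).
by rewrite (dot2_EFin mE r1 r2) (dot2_EFin mE i1 i2) -EFinD.
Qed.

Lemma H1_lincomb (U : set plane) (c : C * C) (u : (plane -> C) * (plane -> C)) : open U -> H1 U u.1 -> H1 U u.2 -> H1 U (lincomb c u).
Proof.
move=> oU [p1 q1] [p2 q2]; have mU := open_measurable_plane oU.
rewrite /H1 re_lincomb im_lincomb; split; apply: H1r_lin => //; exact: H1r_lin.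
Qed.

Lemma rayleigh_ge A alpha kk w : H1 (exterior A) w -> 0 <= kk ->
  0 <= dirichlet A (re w) + alpha * boundary_mass A (re w) + kk * mass A (re w) ->
  0 <= dirichlet A (im w) + alpha * boundary_mass A (im w) + kk * mass A (im w) ->
  - kk <= rayleigh alpha A w.
Proof.
move=> hw k0; rewrite rayleighE//.
have := mass_ge0 A (re w); have := mass_ge0 A (im w).
move: (dirichlet A (re w)) (dirichlet A (im w)) (boundary_mass A (re w)) (boundary_mass A (im w)) (mass A (re w)) (mass A (im w)).
move=> d d' b b' n n' n0' n0 h h'; have : 0 <= n + n' by exact: addr_ge0.
(* For zero norm the quotient is 0 by the convention on division, and [- kk <= 0]. *)
rewrite le_eqVlt => /predU1P[<-|nn]; first by rewrite invr0 mulr0 oppr_le0.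
rewrite ler_pdivlMr// -subr_ge0.
have -> : d + d' + alpha * (b + b') - - kk * (n + n') = (d + alpha * b + kk * n) + (d' + alpha * b' + kk * n') by ring.
exact: addr_ge0.
Qed.

End robin_functionals.

(** * Functions without a trace *)

Section traceless.
Context {R : realType}.
Local Notation plane := (R * R)%type.
Variables (A : set plane) (rho : R -> R) (m M L : R).
Hypothesis AP : polar_domain A rho m M L.
Let has_trace u := exists g, is_trace A u g.

Let has_trace_lin a b u v : H1r (exterior A) u -> H1r (exterior A) v -> has_trace u -> has_trace v ->
  has_trace (fun x => a * u x + b * v x).
Proof. by move=> hu hv [g hg] [g' hg']; exists (fun x => a * g x + b * g' x); exact: (is_trace_lin AP a b hu hv hg hg'). Qed.

(** The two combinations are the real and imaginary parts of [(a + i b) (p + i q)]. If exactly one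
    of [p], [q] has a trace, the factor [1 + i] mixes it with the other in both parts, and a trace
    of a mixture would give a trace of the other function by linearity. *)
Lemma traceless_multiple p q : H1r (exterior A) p -> H1r (exterior A) q -> ~ (has_trace p /\ has_trace q) ->
  exists a b : R, [/\ (a != 0) || (b != 0), ~ has_trace (fun x => a * p x + - b * q x) &
    ~ has_trace (fun x => b * p x + a * q x)].
Proof.
move=> hp hq npq; have mE := measurable_exterior A.
have [tp|tp] := pselect (has_trace p).
  have tq : ~ has_trace q by move=> tq; apply: npq.
  exists 1, 1; split; first by rewrite oner_eq0.
  - move=> h; apply: tq; have h1 := H1r_lin 1 (-1) mE hp hq.
    have := has_trace_lin (-1) 1 h1 hp h tp; congr has_trace; apply/funext => x; ring.
  - move=> h; apply: tq; have h1 := H1r_lin 1 1 mE hp hq.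
    have := has_trace_lin 1 (-1) h1 hp h tp; congr has_trace; apply/funext => x; ring.
have [tq|tq] := pselect (has_trace q).
  exists 1, 1; split; first by rewrite oner_eq0.
  - move=> h; apply: tp; have h1 := H1r_lin 1 (-1) mE hp hq.
    have := has_trace_lin 1 1 h1 hq h tq; congr has_trace; apply/funext => x; ring.
  - move=> h; apply: tp; have h1 := H1r_lin 1 1 mE hp hq.
    have := has_trace_lin 1 (-1) h1 hq h tq; congr has_trace; apply/funext => x; ring.
exists 1, 0; split; first by rewrite oner_eq0.
- by move=> h; apply: tp; move: h; congr has_trace; apply/funext => x; ring.
- by move=> h; apply: tq; move: h; congr has_trace; apply/funext => x; ring.
Qed.

Lemma trace_dot u g : H1r (exterior A) u -> is_trace A u g ->
  boundary_mass A u = dot hausdorff1 (boundary A) g g.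
Proof.
move=> hu hg; have mB := measurable_boundary A.
have [ht|[h _]] := trace_or_junk A u; last by case: h; exists g.
have e := is_trace_unique AP hu ht hg.
exact: (ae_dot mB (trace_L2 A u) hg.1 (trace_L2 A u) hg.1 e e).
Qed.

End traceless.

(** * Lower bound for the second eigenvalue outside the disk *)

Section disk_lower_bound.
Context {R : realType}.
Local Notation plane := (R * R)%type.
Local Notation mplane := (measurableTypeR R * measurableTypeR R)%type.
Local Notation C := (complex R).
Variables (r0 al k : R) (phi phi1 : R -> R).
Hypothesis r00 : 0 < r0.
Hypothesis al_eq : - phi1 r0 / phi r0 = al.
Hypothesis dphi : forall r : R, 0 < r -> is_derive r 1 phi (phi1 r).
Hypothesis dphi1 : forall r : R, 0 < r -> is_derive r 1 phi1 ((k ^+ 2 + r ^- 2) * phi r - phi1 r / r).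
Hypothesis phi_gt0 : forall r, 0 < r -> 0 < phi r.
Local Notation A := (disk (0 : plane) r0).
Local Notation ext := (exterior A : set mplane).
Local Notation bd := (boundary A : set mplane).
Let AP := polar_domain_disk r00.
Let mE : measurable ext. Proof. exact: measurable_exterior. Qed.
Let mB : measurable bd. Proof. exact: measurable_boundary. Qed.
Let L1 : L2 hausdorff1 bd (fun=> 1).
Proof.
apply: (bounded_L2 mB (boundary_finite AP) _ (C := 1)); first exact: measurable_cst.
by move=> x _; rewrite normr1.
Qed.

(** The limit of [disk_test_bound] along the test functions that define the trace: their boundary
    means converge to that of [g], so the defect tends to 0. *)
Lemma disk_trace_bound u g : H1r ext u -> is_trace A u g -> dot hausdorff1 bd g (fun=> 1) = 0 ->
  0 <= dirichlet A u + - al * boundary_mass A u + k ^+ 2 * mass A u.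
Proof.
move=> hu hg g1; rewrite (trace_dot AP hu hg).
have [Lg [f [tf f1 f2 f3 f4]]] := trace_seq AP hu hg.
have [G1 G2] := grad_L2 hu.
have l1 := cvgL2_sqr mE (fun n => test_L2 mE (tf n)) hu.1 f1.
have l2 := cvgL2_sqr mE (fun n => test_L2 mE (test_derive1 (tf n))) G1 f2.
have l3 := cvgL2_sqr mE (fun n => test_L2 mE (test_derive2 (tf n))) G2 f3.
have l4 := cvgL2_sqr mB (fun n => test_L2_boundary AP (tf n)) Lg f4.
have l5 := cvgL2_dotl mB (fun n => test_L2_boundary AP (tf n)) Lg L1 f4.
have cz (h : nat -> R) (l c : R) : h n @[n --> \oo] --> l -> c * h n @[n --> \oo] --> c * l.
  by move=> hl; apply: cvgM => //; exact: cvg_cst.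
have l5' : dot hausdorff1 bd (f n) (fun=> 1) * dot hausdorff1 bd (f n) (fun=> 1) @[n --> \oo] --> (0 : R).
  by rewrite g1 in l5; rewrite -[X in _ --> X](mulr0 0); apply: cvgM.
have L := cz _ _ (- (al / (2 * pi * r0))) l5'.
have U := cvgD (cvgD (cvgD l2 l3) (cz _ _ (k ^+ 2) l1)) (cz _ _ (- al) l4).
rewrite mulr0 in L.
rewrite addrAC.
pose lo n := - (al / (2 * pi * r0)) * (dot hausdorff1 bd (f n) (fun=> 1) * dot hausdorff1 bd (f n) (fun=> 1)).
pose up n := dot leb2 ext ('D_e1 (f n)) ('D_e1 (f n)) + dot leb2 ext ('D_e2 (f n)) ('D_e2 (f n)) +
  k ^+ 2 * dot leb2 ext (f n) (f n) + - al * dot hausdorff1 bd (f n) (f n).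
have L' : lo n @[n --> \oo] --> (0 : R) by exact: L.
have U' : up n @[n --> \oo] --> dirichlet A u + k ^+ 2 * mass A u + - al * dot hausdorff1 bd g g by exact: U.
apply: (ler_cvg_to L' U'); apply: nearW => n; rewrite /lo /up.
have [_] := disk_test_bound r00 al_eq dphi dphi1 phi_gt0 (tf n).
by rewrite expr2 (mulNr al).
Qed.

(** One nonzero element of the space with quotient at least [- k ^ 2] suffices. If a part of a basis
    function lacks a trace, a complex multiple of that function has no trace in either part;
    otherwise a combination with vanishing complex boundary mean is taken. *)
Lemma lambda2_disk_ge : ((- (k ^+ 2))%:E <= lambda2 (- al) A)%E.
Proof.
apply: le_ereal_inf_tmp => _ [[u1 u2] [/= h1 h2 _] <-].
suff [c c0 hc] : exists2 c : C * C, c != 0 & - (k ^+ 2) <= rayleigh (- al) A (lincomb c (u1, u2)).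
  apply: (@le_trans _ _ (rayleigh (- al) A (lincomb c (u1, u2)))%:E); first by rewrite lee_fin.
  by apply: ereal_sup_ubound; exists c.
have oE := @open_exterior R A.
have hH c : H1 ext (lincomb c (u1, u2)) by exact: H1_lincomb.
have [hp1 hq1] := h1; have [hp2 hq2] := h2.
have junk (w : plane -> C) : H1 ext w -> ~ (exists g, is_trace A (re w) g) -> ~ (exists g, is_trace A (im w) g) ->
    - (k ^+ 2) <= rayleigh (- al) A w.
  have form_ge0 (f : plane -> R) : ~ (exists g, is_trace A f g) ->
      0 <= dirichlet A f + - al * boundary_mass A f + k ^+ 2 * mass A f.
    move=> nf; have -> : boundary_mass A f = 0.
      have [ht|[_ e]] := trace_or_junk A f; first by case: nf; exists (trace A f).
      by rewrite /boundary_mass e /dot; under eq_fun do rewrite mulr0; rewrite (Rintegral_cst _ mB) mul0r.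
    by rewrite mulr0 addr0 addr_ge0// ?dirichlet_ge0// mulr_ge0 ?sqr_ge0// mass_ge0.
  by move=> hw nr ni; apply: rayleigh_ge => //; [exact: sqr_ge0|exact: form_ge0|exact: form_ge0].
have [[[g1 tp1] [g1' tq1]]|n1] := pselect ((exists g, is_trace A (re u1) g) /\ (exists g, is_trace A (im u1) g)); last first.
  have [a [b [ab nr ni]]] := traceless_multiple AP hp1 hq1 n1.
  exists (Complex a b, 0); first by apply: contraTneq ab => -[-> ->]; rewrite !eqxx.
  apply: (junk _ (hH _)).
    rewrite re_lincomb /=; move=> ht; apply: nr; move: ht; congr (exists g, is_trace A _ g).
    by apply/funext => ?; apply/funext => x; rewrite oppr0 !mul0r addr0 mulr0 addr0 mul1r.
  rewrite im_lincomb /=; move=> ht; apply: ni; move: ht; congr (exists g, is_trace A _ g).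
  by apply/funext => ?; apply/funext => x; rewrite !mul0r addr0 mulr0 addr0 mul1r.
have [[[g2 tp2] [g2' tq2]]|n2] := pselect ((exists g, is_trace A (re u2) g) /\ (exists g, is_trace A (im u2) g)); last first.
  have [a [b [ab nr ni]]] := traceless_multiple AP hp2 hq2 n2.
  exists (0, Complex a b); first by apply: contraTneq ab => -[-> ->]; rewrite !eqxx.
  apply: (junk _ (hH _)).
    rewrite re_lincomb /=; move=> ht; apply: nr; move: ht; congr (exists g, is_trace A _ g).
    by apply/funext => ?; apply/funext => x; rewrite oppr0 !mul0r addr0 mulr0 add0r mul1r.
  rewrite im_lincomb /=; move=> ht; apply: ni; move: ht; congr (exists g, is_trace A _ g).
  by apply/funext => ?; apply/funext => x; rewrite !mul0r addr0 mulr0 add0r mul1r.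
pose mean g := dot hausdorff1 bd g (fun=> 1).
pose m1 : C := Complex (mean g1) (mean g1'); pose m2 : C := Complex (mean g2) (mean g2').
(* One linear condition over the complex numbers on two coefficients; real and imaginary parts of
   the trace get mean zero together. *)
have [c c0 cm] : exists2 c : C * C, c != 0 & c.1 * m1 + c.2 * m2 = 0.
  have [m10|m10] := eqVneq m1 0.
    by exists (1, 0); [apply/negP => /eqP[] /eqP; rewrite oner_eq0|rewrite /= m10 mulr0 mul0r addr0].
  exists (m2, - m1); last by rewrite /= mulNr mulrC subrr.
  by apply: contra_neq m10 => /(congr1 snd) /= /eqP; rewrite oppr_eq0 => /eqP.
exists c => //.
have [Lg1 _] := tp1; have [Lg1' _] := tq1; have [Lg2 _] := tp2; have [Lg2' _] := tq2.
have mean_lin a b a' b' : mean (fun x => 1 * (a * g1 x + b * g1' x) + 1 * (a' * g2 x + b' * g2' x)) =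
    1 * (a * mean g1 + b * mean g1') + 1 * (a' * mean g2 + b' * mean g2').
  have l1 := L2_lin mB a b Lg1 Lg1'; have l2 := L2_lin mB a' b' Lg2 Lg2'.
  by rewrite /mean (dot_linl mB 1 1 l1 l2 L1) (dot_linl mB a b Lg1 Lg1' L1) (dot_linl mB a' b' Lg2 Lg2' L1).
have tr a b a' b' : is_trace A (fun x => 1 * (a * re u1 x + b * im u1 x) + 1 * (a' * re u2 x + b' * im u2 x))
    (fun x => 1 * (a * g1 x + b * g1' x) + 1 * (a' * g2 x + b' * g2' x)).
  have l1 := H1r_lin a b mE hp1 hq1; have l2 := H1r_lin a' b' mE hp2 hq2.
  exact: (is_trace_lin AP 1 1 l1 l2 (is_trace_lin AP a b hp1 hq1 tp1 tq1) (is_trace_lin AP a' b' hp2 hq2 tp2 tq2)).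
have hl := hH c; have [hr hi] := hl.
have cre := congr1 (@complex.Re R) cm; have cim := congr1 (@complex.Im R) cm.
rewrite ReD !ReM /= in cre; rewrite ImD !ImM /= in cim.
apply: rayleigh_ge => //; first exact: sqr_ge0.
- move: hr; rewrite re_lincomb /= => hr; apply: (disk_trace_bound hr (tr _ _ _ _)).
  by rewrite -/(mean _) mean_lin !mul1r !mulNr.
- move: hi; rewrite im_lincomb /= => hi; apply: (disk_trace_bound hi (tr _ _ _ _)).
  by rewrite -/(mean _) mean_lin !mul1r -[RHS]cim; congr (_ + _); rewrite addrC.
Qed.

End disk_lower_bound.

(** * Upper bound for the exterior of a star-shaped domain *)

Section exterior_trial_energy.
Context {R : realType}.
Local Notation plane := (R * R)%type.
Local Notation mplane := (measurableTypeR R * measurableTypeR R)%type.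
Local Notation mu := (@lebesgue_measure R).

(** Up to a radius where [w] has died out, the integral is at most the increase of [Q], whose final
    value is nonpositive. *)
Lemma ray_integral_le (w Q Q1 : R -> R) (a B : R) : continuous w -> (forall r, B <= r -> w r = 0) ->
  (forall r, a < r -> 0 <= w r) ->
  (forall s : R, a <= s -> is_derive s 1 Q (Q1 s)) -> (forall s, a < s -> w s <= Q1 s) ->
  (forall s, a <= s -> B <= s -> Q s <= 0) ->
  (\int[mu]_(r in `]a, +oo[) (w r)%:E <= (- Q a)%:E)%E.
Proof.
move=> cw wB w0 dQ wQ QB; pose b := Num.max a B.
have ab : a <= b by rewrite le_max lexx.
have [P dP] := primitive_exists (a - 1) cw.
have dP' (x : R) : a <= x <= b -> is_derive x 1 P (w x) by move=> /andP[ax _]; apply: dP; lra.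
have mw (D : set R) : measurable_fun (D : set (measurableTypeR R)) (fun r => (w r)%:E).
  by apply/measurable_EFinP; apply: measurable_funTS; exact: continuous_measurable_fun.
have hQ : P b - Q b <= P a - Q a.
  apply: (@derive_le0_ge _ (fun x => P x - Q x) (fun x => w x - Q1 x) a b ab).
    move=> x hx; apply: dsub; first exact: dP'.
    by apply: dQ; case/andP: hx.
  by move=> x /andP[ax _]; rewrite subr_le0 wQ.
have -> : (\int[mu]_(r in `]a, +oo[) (w r)%:E = \int[mu]_(r in `]a, b]) (w r)%:E)%E.
  have -> : `]a, +oo[%classic = `]a, b]%classic `|` `]b, +oo[%classic :> set R.
    by rewrite -itv_bndbnd_setU// bnd_simp.
  rewrite ge0_integral_setU; [|exact: measurable_itv|exact: measurable_itv|exact: mw| |]; last 2 first.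
  - move=> r [] /=; rewrite in_itv/= => /andP[ar _]; rewrite lee_fin w0//; exact: le_lt_trans ar.
  - apply/disj_setPS => r [/=]; rewrite !in_itv/= => /andP[_ rb] /andP[br _].
    by move: (lt_le_trans br rb); rewrite ltxx.
  rewrite [X in (_ + X)%E]integral0_eq ?adde0// => r /=; rewrite in_itv/= andbT => br.
  by rewrite wB//; apply: ltW; apply: le_lt_trans br; rewrite le_max lexx orbT.
rewrite integral_itv_obnd_cbnd; last exact: mw.
rewrite (ftc_itv ab dP'); last exact: continuous_subspaceT.
rewrite lee_fin; have Qb : Q b <= 0 by apply: QB => //; rewrite le_max lexx orbT.
by move: hQ Qb; move: (P b) (P a) (Q b) (Q a) => x y z u h1 h2; lra.
Qed.

Lemma polar_gradient_sqr (f : plane -> R) (psi c : R -> R) (r0 psi1 c1 s t : R) : test_function setT f ->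
  0 < r0 -> r0 < s ->
  (forall s t, r0 <= s -> f (s * cos t, s * sin t) = psi s * c t) ->
  is_derive s 1 psi psi1 -> is_derive t 1 c c1 ->
  'D_e1 f (s * cos t, s * sin t) ^+ 2 + 'D_e2 f (s * cos t, s * sin t) ^+ 2 =
  psi1 ^+ 2 * c t ^+ 2 + psi s ^+ 2 * c1 ^+ 2 / s ^+ 2.
Proof.
move=> hf r00 rs fE dpsi dc; have sn : s != 0 by rewrite gt_eqF// (lt_trans r00).
rewrite -gradient_polar//; have := is_derive_radial s t hf; have := is_derive_angular s t hf.
have -> : (fun t => f (s * cos t, s * sin t)) = (fun t => psi s * c t).
  by apply/funext => u; rewrite fE// ltW.
move=> da dr; have da' : is_derive (t : R) 1 (fun t : R => psi s * c t) (psi s * c1).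
  apply: is_derive_eq (dmul (dcst (psi s) t 1) dc) _; by rewrite mul0r add0r.
have dr' : is_derive (s : R) 1 (fun s : R => f (s * cos t, s * sin t)) (psi1 * c t).
  have h : is_derive (s : R) 1 (fun s : R => psi s * c t) (psi1 * c t).
    by apply: is_derive_eq (dmul dpsi (dcst (c t) s 1)) _; rewrite mulr0 addr0.
  apply: near_eq_is_derive h; near=> u; rewrite fE//.
  by apply: ltW; near: u; exact: lt_nbhsr.
by rewrite -(@derive_val _ _ _ _ _ _ _ da) -(@derive_val _ _ _ _ _ _ _ dr)
  (@derive_val _ _ _ _ _ _ _ da') (@derive_val _ _ _ _ _ _ _ dr') !exprMn.
Unshelve. all: by end_near. Qed.

Lemma continuous_ray_quadratic (a b c t : R) (p q r : plane -> R) : continuous p -> continuous q -> continuous r ->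
  continuous (fun s : R => a * p (s * cos t, s * sin t) ^+ 2 + b * q (s * cos t, s * sin t) ^+ 2 +
    c * r (s * cos t, s * sin t) ^+ 2).
Proof.
have cpt (h : plane -> R) : continuous h -> continuous (fun s : R => h (s * cos t, s * sin t)).
  move=> ch s; apply: (@continuous_comp _ _ _ (fun s : R => (s * cos t, s * sin t)) h); last exact: ch.
  by apply: cpair; cont.
move=> /cpt cp /cpt cq /cpt cr.
have sq (e : R) (h : R -> R) : continuous h -> continuous (fun s : R => e * h s ^+ 2).
  move=> ch; have hs (s : R) : {for s, continuous (fun s : R => e * h s ^+ 2)} by cont.
  exact: hs.
exact: continuous_add (continuous_add (sq a _ cp) (sq b _ cq)) (sq c _ cr).
Qed.

Lemma robin_sum_le (al d1 d2 b1 b2 I J : R) : 0 <= al -> d1 + d2 <= I -> J <= b1 + b2 ->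
  d1 - al * b1 + (d2 - al * b2) <= I - al * J.
Proof. by move=> al0 h1 h2; have := ler_wpM2l al0 h2; lra. Qed.

(** The Robin form with coupling [- al] plus [k ^ 2] times the squared norm, written with classical
    derivatives. A negative value puts the Rayleigh quotient below [- k ^ 2]. *)
Definition trial_energy (A : set plane) (k al : R) (f : plane -> R) : R :=
  dot leb2 (exterior A) ('D_e1 f) ('D_e1 f) + dot leb2 (exterior A) ('D_e2 f) ('D_e2 f) +
  k ^+ 2 * dot leb2 (exterior A) f f - al * dot hausdorff1 (boundary A) f f.

Variables (A : set plane) (rho : R -> R) (m M L : R).
Hypothesis AP : polar_domain A rho m M L.
Variables (r0 k al : R).
Hypotheses (r00 : 0 < r0) (al0 : 0 <= al) (rrho : forall t, 0 <= t <= 2 * pi -> r0 <= rho t).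
Local Notation ext := (exterior A : set mplane).
Local Notation bd := (boundary A : set mplane).
Let mE : measurable ext. Proof. exact: measurable_exterior. Qed.
Let mB : measurable bd. Proof. exact: measurable_boundary. Qed.
Let mI : measurable (`[0, 2 * pi]%classic : set (measurableTypeR R)). Proof. exact: measurable_itv. Qed.

(** Neither function need have a good energy on a given ray, but the sum has, by
    [c ^ 2 + d ^ 2 = 1]. The same lemma serves the angular pair, with [(cos, sin)], and the radial
    function paired with zero, with [(1, 0)], whose absent angular energy is merely overestimated.
    The maximum with [r0] keeps the argument of [Q] and [psi] away from 0 for all [t], as [rho] is
    bounded below on [[0, 2 pi]] only. *)
Lemma trial_energy_pair_le (f g : plane -> R) (psi psi1 Q Q1 c c1 d d1 : R -> R) (B0 : R) :
  test_function setT f -> test_function setT g ->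
  (forall s t, r0 <= s -> f (s * cos t, s * sin t) = psi s * c t) ->
  (forall s t, r0 <= s -> g (s * cos t, s * sin t) = psi s * d t) ->
  (forall t : R, is_derive t 1 c (c1 t)) -> (forall t : R, is_derive t 1 d (d1 t)) ->
  (forall t, c t ^+ 2 + d t ^+ 2 = 1) -> (forall t, c1 t ^+ 2 + d1 t ^+ 2 <= 1) ->
  (forall s : R, r0 < s -> is_derive s 1 psi (psi1 s)) ->
  (forall s : R, r0 <= s -> is_derive s 1 Q (Q1 s)) ->
  (forall s, r0 < s -> s * (psi1 s ^+ 2 + (k ^+ 2 + s ^- 2) * psi s ^+ 2) <= Q1 s) ->
  (forall s, B0 <= s -> Q s <= 0) ->
  continuous (fun t => Q (Num.max r0 (rho t))) ->
  continuous (fun t => Num.max r0 (rho t) * psi (Num.max r0 (rho t)) ^+ 2) ->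
  trial_energy A k al f + trial_energy A k al g <=
  circle_int (fun t => - Q (Num.max r0 (rho t)) - al * (Num.max r0 (rho t) * psi (Num.max r0 (rho t)) ^+ 2)).
Proof.
move=> hf hg fE gE dc dd cd cd1 dpsi dQ hQ QB cQ cpsi.
have rmax t : 0 <= t <= 2 * pi -> Num.max r0 (rho t) = rho t by move=> /rrho h; exact/max_idPr.
have rr t : 0 <= t <= 2 * pi -> 0 < rho t by move=> /rrho; exact: lt_le_trans.
have f1 := test_derive1 hf; have f2 := test_derive2 hf; have g1 := test_derive1 hg; have g2 := test_derive2 hg.
have cf := test_continuous hf; have cf1 := test_continuous f1; have cf2 := test_continuous f2.
have cg := test_continuous hg; have cg1 := test_continuous g1; have cg2 := test_continuous g2.
pose W1 x := 1 * 'D_e1 f x ^+ 2 + 1 * 'D_e2 f x ^+ 2 + k ^+ 2 * f x ^+ 2.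
pose W2 x := 1 * 'D_e1 g x ^+ 2 + 1 * 'D_e2 g x ^+ 2 + k ^+ 2 * g x ^+ 2.
have W0 x : 0 <= W1 x + W2 x.
  exact: addr_ge0 (quadratic_ge0 _ _ _ _) (quadratic_ge0 _ _ _ _).
have mW1 := measurable_quadratic 1 1 (k ^+ 2) cf1 cf2 cf.
have mW2 := measurable_quadratic 1 1 (k ^+ 2) cg1 cg2 cg.
pose W x := ((W1 x)%:E + (W2 x)%:E)%E.
have mW : measurable_fun setT (W : mplane -> \bar R) by exact: emeasurable_funD.
have WE0 x : (0 <= W x)%E by rewrite /W -EFinD lee_fin.
have W1E : (\int[leb2]_(x in ext) W x = (dot leb2 ext ('D_e1 f) ('D_e1 f) + dot leb2 ext ('D_e2 f) ('D_e2 f) + k ^+ 2 * dot leb2 ext f f +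
    (dot leb2 ext ('D_e1 g) ('D_e1 g) + dot leb2 ext ('D_e2 g) ('D_e2 g) + k ^+ 2 * dot leb2 ext g g))%:E)%E.
  have p1 x : ext x -> (0 <= (W1 x)%:E)%E by move=> _; rewrite lee_fin; exact: quadratic_ge0.
  have p2 x : ext x -> (0 <= (W2 x)%:E)%E by move=> _; rewrite lee_fin; exact: quadratic_ge0.
  have -> := ge0_integralD leb2 mE p1 (measurable_funTS mW1) p2 (measurable_funTS mW2).
  rewrite (quadratic_integral k mE (test_L2 mE f1) (test_L2 mE f2) (test_L2 mE hf)).
  by rewrite (quadratic_integral k mE (test_L2 mE g1) (test_L2 mE g2) (test_L2 mE hg)).
have ray t : 0 <= t <= 2 * pi ->
    (\int[mu]_(s in `](rho t), +oo[) (W (s * cos t, s * sin t)%R * s%:E) <= (- Q (Num.max r0 (rho t)))%:E)%E.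
  move=> tI; rewrite rmax//; have rt := rrho tI.
  have [b1 b10 B1] := test_radius hf; have [b2 b20 B2] := test_radius f1; have [b3 b30 B3] := test_radius f2.
  have [b4 b40 B4] := test_radius hg; have [b5 b50 B5] := test_radius g1; have [b6 b60 B6] := test_radius g2.
  pose B := `|B0| + b1 + b2 + b3 + b4 + b5 + b6.
  have [s1 s2 s3 s4 s5] : [/\ b1 <= B, b2 <= B, b3 <= B, b4 <= B & b5 <= B].
    by have := normr_ge0 B0; rewrite /B; split; lra.
  have s6 : b6 <= B by have := normr_ge0 B0; rewrite /B; lra.
  have s0 : B0 <= B by have := ler_norm B0; rewrite /B; lra.
  rewrite (_ : (fun s => (W (s * cos t, s * sin t)%R * s%:E)%E) = (fun s => ((W1 (s * cos t, s * sin t) + W2 (s * cos t, s * sin t)) * s)%:E)); last first.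
    by apply/funext => s; rewrite /W -EFinD -EFinM.
  apply: (@ray_integral_le _ Q Q1 _ B).
  - have cw1 := @continuous_ray_quadratic 1 1 (k ^+ 2) t _ _ _ cf1 cf2 cf.
    have cw2 := @continuous_ray_quadratic 1 1 (k ^+ 2) t _ _ _ cg1 cg2 cg.
    have cw (s : R) : {for s, continuous (fun s : R => (W1 (s * cos t, s * sin t) + W2 (s * cos t, s * sin t)) * s)}.
      by apply: cmul; [apply: cadd; [exact: cw1|exact: cw2]|exact: cvg_id].
    exact: cw.
  - move=> s Bs; rewrite /W1 /W2 B1 ?B2 ?B3 ?B4 ?B5 ?B6; try exact: le_trans Bs.
    by rewrite expr0n/= !mulr0 !addr0 mul0r.
  - move=> s rs; apply: mulr_ge0; first exact: W0.
    by apply/ltW/(lt_trans _ rs); exact: rr.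
  - by move=> s rs; apply: dQ; exact: le_trans rs.
  - move=> s rs; have r0s : r0 < s by exact: le_lt_trans rs.
    apply: le_trans (hQ _ r0s).
    have s0' : 0 < s by exact: lt_trans r0s.
    rewrite /W1 /W2 !mul1r (polar_gradient_sqr hf r00 r0s fE (dpsi _ r0s) (dc t)).
    rewrite (polar_gradient_sqr hg r00 r0s gE (dpsi _ r0s) (dd t)) fE ?gE ?(ltW r0s)//.
    rewrite mulrC; apply: ler_wpM2l; first exact: ltW.
    have := cd t; have := cd1 t; move: (psi1 s) (psi s) (c t) (d t) (c1 t) (d1 t) => p1 p x y x1 y1 h1 h2.
    rewrite [leLHS](_ : _ = (x ^+ 2 + y ^+ 2) * (p1 ^+ 2 + k ^+ 2 * p ^+ 2) + (x1 ^+ 2 + y1 ^+ 2) * (p ^+ 2 / s ^+ 2)); last by field; rewrite gt_eqF.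
    rewrite h2 [leRHS](_ : _ = 1 * (p1 ^+ 2 + k ^+ 2 * p ^+ 2) + 1 * (p ^+ 2 / s ^+ 2)); last by field; rewrite gt_eqF.
    by rewrite lerD2l; apply: ler_wpM2r => //; apply: divr_ge0; exact: sqr_ge0.
  - by move=> s _ Bs; apply: QB; exact: le_trans Bs.
have cQ' : continuous (fun t => - Q (Num.max r0 (rho t))) by exact: (continuous_opp cQ).
have extE : dot leb2 ext ('D_e1 f) ('D_e1 f) + dot leb2 ext ('D_e2 f) ('D_e2 f) + k ^+ 2 * dot leb2 ext f f +
    (dot leb2 ext ('D_e1 g) ('D_e1 g) + dot leb2 ext ('D_e2 g) ('D_e2 g) + k ^+ 2 * dot leb2 ext g g) <=
    circle_int (fun t => - Q (Num.max r0 (rho t))).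
  rewrite -lee_fin -(circle_int_EFin cQ').
  apply: (@le_trans _ _ (\int[leb2]_(x in ext) W x)%E); first by rewrite W1E.
  rewrite (exterior_integral AP mW WE0).
  apply: (@ge0_le_integral _ _ _ mu _ mI).
  - move=> t /=; rewrite in_itv/= => tI; apply: integral_ge0 => s /=; rewrite in_itv/= andbT => rs.
    by apply: mule_ge0; [exact: WE0|rewrite lee_fin ltW// (lt_trans _ rs)// rr].
  - exact: (measurable_exterior_ray AP mW WE0).
  - by apply/measurable_EFinP; apply: measurable_funTS; exact: continuous_measurable_fun.
  - by move=> t /=; rewrite in_itv/= => /ray.
have bdE : circle_int (fun t => Num.max r0 (rho t) * psi (Num.max r0 (rho t)) ^+ 2) <=
    dot hausdorff1 bd f f + dot hausdorff1 bd g g.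
  rewrite -lee_fin -(circle_int_EFin cpsi) -(dot2_EFin mB (test_L2_boundary AP hf) (test_L2_boundary AP hg)).
  have mF : measurable_fun setT (fun x : mplane => (f x ^+ 2 + g x ^+ 2)%:E).
    apply/measurable_EFinP; apply: measurable_funD; apply: measurable_funX; exact: continuous_measurable_plane.
  apply: le_trans (boundary_integral_ge AP mF _); last by move=> x; rewrite lee_fin addr_ge0// sqr_ge0.
  rewrite le_eqVlt; apply/orP; left; apply/eqP; apply: eq_integral => t; rewrite inE/= in_itv/= => tI.
  rewrite rmax// /polar_curve fE ?gE ?rrho// -EFinM; congr EFin.
  by rewrite !exprMn -mulrDr cd mulr1 mulrC.
have c1f : continuous (fun t => -1 * Q (Num.max r0 (rho t))) by exact: (continuous_mul (continuous_cst_fun (T := R) (-1)) cQ).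
rewrite (_ : (fun t => - Q _ - _) = (fun t => 1 * (- Q (Num.max r0 (rho t))) + (- al) * (Num.max r0 (rho t) * psi (Num.max r0 (rho t)) ^+ 2))); last first.
  by apply/funext => t; rewrite mul1r mulNr.
rewrite (circle_int_lin _ _ cQ' cpsi) mul1r mulNr.
exact: robin_sum_le al0 extE bdE.
Qed.

End exterior_trial_energy.

(** * Positivity of circle integrals, and the derivative of the smooth step *)

Section circle_integral_order.
Context {R : realType}.
Implicit Types (f g : R -> R).

Lemma eq_circle_int f g : (forall t, 0 <= t <= 2 * pi -> f t = g t) -> circle_int f = circle_int g.
Proof.
by move=> fg; apply: eq_Rintegral => t; rewrite inE/= in_itv/= => /fg.
Qed.

(** A zero integral makes the monotone primitive constant, so [f] vanishes in the open interval;
    continuity then excludes a positive value, at an end point as well. *)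
Lemma circle_int_gt0 f (t0 : R) : continuous f -> (forall t, 0 <= f t) -> 0 <= t0 <= 2 * pi -> 0 < f t0 ->
  0 < circle_int f.
Proof.
move=> cf f0 tI ft0; rewrite lt0r circle_int_ge0// andbT; apply/eqP => I0.
have [P dP PE] := circle_int_primitive cf.
have mono (x y : R) : 0 <= x -> x <= y -> y <= 2 * pi -> P x <= P y.
  move=> x0 xy y2; apply: (@derive_ge0_le _ P f _ _ xy) => // z /andP[xz zy].
  by apply: dP; rewrite (le_trans x0 xz) (le_trans zy y2).
have Pc (x : R) : 0 <= x <= 2 * pi -> P x = P 0.
  move=> /andP[x0 x2]; apply/eqP; rewrite eq_le (mono 0 x)// andbT.
  by have := mono x (2 * pi) x0 x2 (lexx _); rewrite I0 in PE; lra.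
have pi2 : 0 < 2 * pi :> R by rewrite mulr_gt0// pi_gt0.
have inner (t : R) : 0 < t < 2 * pi -> f t = 0.
  move=> /andP[ta tb]; have dt : is_derive t 1 P (f t) by apply: dP; rewrite !ltW.
  have d0 : is_derive t 1 P 0.
    apply: near_eq_is_derive (dcst (P 0) t 1); near=> u; apply/esym/Pc.
    by apply/andP; split; apply: ltW; near: u; [exact: lt_nbhsr|exact: lt_nbhsl].
  by rewrite -(@derive_val _ _ _ _ _ _ _ dt) (@derive_val _ _ _ _ _ _ _ d0).
have /andP[ta tb] := tI.
have : \forall t \near t0, 0 < f t.
  by apply: (cf t0 [set y | 0 < y]); exact: lt_nbhsr.
move=> /nbhs_ballP[e /= e0 he].
pose d := Num.min (e / 2) (pi / 2).
have d0 : 0 < d by rewrite /d lt_min !divr_gt0// pi_gt0.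
have de : d < e by rewrite /d gt_min; apply/orP; left; lra.
have dpi : d <= pi / 2 by rewrite /d ge_min lexx orbT.
have pi0 := @pi_gt0 R.
have [h|h] := leP t0 pi.
  have := he (t0 + d); rewrite /ball /= opprD addrA subrr sub0r normrN gtr0_norm// => /(_ de).
  by rewrite inner ?ltxx//; apply/andP; split; lra.
have := he (t0 - d); rewrite /ball /= opprB addrCA subrr addr0 gtr0_norm// => /(_ de).
by rewrite inner ?ltxx//; apply/andP; split; lra.
Unshelve. all: by end_near. Qed.

Lemma smooth_step_derivative : exists step1 K,
  [/\ forall x : R, is_derive x 1 smooth_step (step1 x), forall x : R, step1 x ^+ 2 <= K &
    forall x : R, x < 0 -> step1 x = 0].
Proof.
have [step1 ds c1] := @smooth_to_step R 1.
have ds' (x : R) : is_derive x 1 smooth_step (step1 x) by exact: ds.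
have c1' : continuous step1 by move=> x; exact: c1.
have lt0 (x : R) : x < 0 -> step1 x = 0.
  move=> x0; have h : is_derive x 1 smooth_step 0.
    apply: near_eq_is_derive (dcst 0 x 1); near=> y; rewrite smooth_step_le0//.
    by apply: ltW; near: y; exact: lt_nbhsl.
  by rewrite -(@derive_val _ _ _ _ _ _ _ (ds' x)) (@derive_val _ _ _ _ _ _ _ h).
have gt1 (x : R) : 1 < x -> step1 x = 0.
  move=> x0; have h : is_derive x 1 smooth_step 0.
    apply: near_eq_is_derive (dcst 1 x 1); near=> y; rewrite smooth_step_ge1//.
    by apply: ltW; near: y; exact: lt_nbhsr.
  by rewrite -(@derive_val _ _ _ _ _ _ _ (ds' x)) (@derive_val _ _ _ _ _ _ _ h).
have cs : {within `[0, 1], continuous (fun x => step1 x ^+ 2)}.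
  by apply: continuous_subspaceT => x; apply: cexp; exact: c1'.
have [c _ hc] := EVT_max (@ler01 R) cs.
exists step1, (step1 c ^+ 2); split => // x.
have [x0|x0] := ltP x 0; first by rewrite lt0// expr0n sqr_ge0.
have [x1|x1] := ltP 1 x; first by rewrite gt1// expr0n sqr_ge0.
by apply: hc; rewrite in_itv/= x0.
Unshelve. all: by end_near. Qed.

End circle_integral_order.

(** * Trial functions and their energy *)

Section trial_functions.
Context {R : realType}.
Local Notation plane := (R * R)%type.
Variables (r0 k al : R) (phi phi1 : R -> R).
Hypothesis r00 : 0 < r0.
Hypothesis dphi : forall r : R, 0 < r -> is_derive r 1 phi (phi1 r).
Hypothesis dphi1 : forall r : R, 0 < r -> is_derive r 1 phi1 ((k ^+ 2 + r ^- 2) * phi r - phi1 r / r).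
Hypothesis phi_gt0 : forall r, 0 < r -> 0 < phi r.
Hypothesis phi_le : forall r, 0 < r -> phi r / r <= - phi1 r.

Lemma smooth_profile n : smooth_to n [set x | 0 < x] phi.
Proof.
pose p (x : R) := k ^+ 2 + (x * x)^-1; pose q (x : R) := -1 * x^-1.
have D0 (x : R) : [set x | 0 < x] x -> x != 0 by move=> /= x0; rewrite gt_eqF.
have [|||//] := @smooth_to_ode R n [set x | 0 < x] p q phi phi1 dphi.
- move=> x x0; apply: is_derive_eq (dphi1 x0) _.
  by rewrite /p /q -expr2 mulN1r mulNr [phi1 x / x]mulrC.
- move=> j; apply: smooth_to_add; first exact: smooth_to_cst.
  apply: smooth_to_inv; last by apply: smooth_to_mul; exact: smooth_to_id.
  by move=> x /D0 x0; rewrite mulf_neq0.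
- by move=> j; apply: smooth_to_scale; apply: smooth_to_inv => //; exact: smooth_to_id.
Qed.

(** The argument is the squared radius. The first factor is 0 up to [r0 ^ 2 / 2] and 1 from [r0 ^ 2]
    on, which removes the singularity at the origin without changes outside the disk; the second is
    1 up to [N ^ 2] and 0 from [2 N ^ 2] on. *)
Definition cutoff (N s : R) : R := smooth_step (2 / r0 ^+ 2 * s + -1) * smooth_step (- N ^- 2 * s + 2).
Definition radius_sqr (x : plane) : R := x.1 * x.1 + x.2 * x.2.
Definition radial_trial (N : R) (x : plane) : R :=
  cutoff N (radius_sqr x) * phi (Num.sqrt (radius_sqr x)).
(** For a coordinate function [i], the quotient of [i] by the radius is the cosine or the sine of
    the angle. *)
Definition angular_trial (i : plane -> R) (N : R) (x : plane) : R :=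
  i x * (cutoff N (radius_sqr x) * (phi (Num.sqrt (radius_sqr x)) * (Num.sqrt (radius_sqr x))^-1)).

(** [sqrt] and [g] are smooth on the open half-line only, but the cut-off vanishes below
    [r0 ^ 2 / 2], so the product is smooth on the line. *)
Lemma smooth_cutoff_mul n N g : smooth_to n [set x | 0 < x] g ->
  smooth_to n setT (fun s => cutoff N s * g (Num.sqrt s)).
Proof.
move=> sg; apply: (@smooth_to_glue _ n (r0 ^+ 2 / 2) (cutoff N) (fun s => g (Num.sqrt s))).
- by rewrite divr_gt0// exprn_gt0.
- move=> x xr; rewrite /cutoff smooth_step_le0 ?mul0r//.
  rewrite subr_le0 mulrAC ler_pdivrMr ?exprn_gt0// mul1r; lra.
- apply: smooth_to_mul; [apply: (@smooth_to_affine _ n (2 / r0 ^+ 2) (-1))|apply: (@smooth_to_affine _ n (- N ^- 2) 2)];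
    exact: smooth_to_step.
- apply: smooth_to_comp (smooth_to_sqrt n) sg => x /=; by rewrite sqrtr_gt0.
Qed.

Lemma test_cutoff_mul (i : plane -> R) (N : R) (g : R -> R) : 0 < N -> (forall n, Cn n i) ->
  (forall n, smooth_to n [set x | 0 < x] g) ->
  test_function setT (fun x => i x * (cutoff N (radius_sqr x) * g (Num.sqrt (radius_sqr x)))).
Proof.
(* The outer factor vanishes beyond the radius [sqrt 2 N], so the support fits into the square of
   half-side [2 * N]. *)
move=> N0 ci sg; apply: (@test_intro _ _ (`[- (2 * N), 2 * N] `*` `[- (2 * N), 2 * N])) => //.
- move=> n; apply: Cn_mul => //.
  apply: (@Cn_comp _ n (fun s => cutoff N s * g (Num.sqrt s)) radius_sqr); first exact: smooth_cutoff_mul.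
  apply: Cn_add; apply: Cn_mul; (exact: Cn_fst || exact: Cn_snd).
- move=> x; apply: contraPP => xK; apply/negP; rewrite negbK.
  suff -> : cutoff N (radius_sqr x) = 0 by rewrite mul0r mulr0.
  rewrite /cutoff [X in _ * X]smooth_step_le0 ?mulr0//.
  suff h : 2 * N ^+ 2 <= radius_sqr x.
    by rewrite mulNr addrC subr_le0 mulrC ler_pdivlMr ?exprn_gt0.
  rewrite leNgt; apply/negP => xN; apply: xK.
  have b (y : R) : y * y <= radius_sqr x -> (y \in `[- (2 * N), 2 * N]).
    move=> yx; rewrite in_itv/= -ler_norml -(@ler_pXn2r _ 2) ?nnegrE ?mulr_ge0 ?(ltW N0)//.
    rewrite real_normK ?num_real//; nra.
  by split; apply: b; rewrite /radius_sqr ?lerDl ?lerDr -expr2 sqr_ge0.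
- exact: compact_rectangle.
Qed.

Lemma test_radial N : 0 < N -> test_function setT (radial_trial N).
Proof.
move=> N0; have := test_cutoff_mul N0 (fun n => Cn_cst n 1) smooth_profile.
by congr test_function; apply/funext => x; rewrite mul1r.
Qed.

Lemma test_angular i N : (forall n, Cn n i) -> 0 < N -> test_function setT (angular_trial i N).
Proof.
move=> ci N0; apply: (@test_cutoff_mul i N (fun s => phi s * s^-1) N0 ci) => n.
apply: smooth_to_mul; first exact: smooth_profile.
by apply: smooth_to_inv; [move=> x /= x0; rewrite gt_eqF|exact: smooth_to_id].
Qed.

Let chi N s : R := smooth_step (- N ^- 2 * s ^+ 2 + 2).

Let radius_polar s t : radius_sqr (s * cos t, s * sin t) = s ^+ 2.
Proof.
rewrite /radius_sqr /= -[RHS]mulr1 -(cos2Dsin2 t); ring.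
Qed.

Let cutoff_polar N s : r0 <= s -> cutoff N (s ^+ 2) = chi N s.
Proof.
move=> rs; rewrite /cutoff smooth_step_ge1 ?mul1r//.
have h : 1 <= s ^+ 2 / r0 ^+ 2.
  by rewrite ler_pdivlMr ?exprn_gt0// mul1r ler_pXn2r// nnegrE ?(ltW r00)// (le_trans (ltW r00)).
rewrite mulrAC -mulrA; lra.
Qed.

Let sqrt_polar s : r0 <= s -> Num.sqrt (s ^+ 2) = s.
Proof. by move=> rs; rewrite sqrtr_sqr gtr0_norm// (lt_le_trans r00). Qed.

Lemma radial_polar N s t : r0 <= s -> radial_trial N (s * cos t, s * sin t) = phi s * chi N s * 1.
Proof. by move=> rs; rewrite /radial_trial radius_polar cutoff_polar// sqrt_polar// mulr1 mulrC. Qed.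

Lemma angular_polar i c N s t : r0 <= s -> i (s * cos t, s * sin t) = s * c t ->
  angular_trial i N (s * cos t, s * sin t) = phi s * chi N s * c t.
Proof.
move=> rs ie; rewrite /angular_trial radius_polar cutoff_polar// sqrt_polar// ie.
by field; rewrite gt_eqF// (lt_le_trans r00).
Qed.

Let phi1_lt0 s : 0 < s -> phi1 s < 0.
Proof. by move=> s0; rewrite -oppr_gt0; apply: lt_le_trans (phi_le s0); rewrite divr_gt0// phi_gt0. Qed.

(** By [phi / s <= - phi1] the product [s phi] decreases; this is the decay that controls the
    cut-off error. *)
Let profile_decay s : r0 <= s -> s * phi s <= r0 * phi r0.
Proof.
move=> rs; apply: (@derive_le0_ge _ (fun x => x * phi x) (fun x => 1 * phi x + x * phi1 x) _ _ rs).
  move=> x /andP[rx _]; have x0 : 0 < x by exact: lt_le_trans rx.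
  by apply: (@dmul _ _ (fun x => x) phi x 1 1 (phi1 x)); exact: dphi.
move=> x /andP[rx _]; have x0 : 0 < x by exact: lt_trans rx.
by have := phi_le x0; rewrite ler_pdivrMr// mul1r; lra.
Qed.

(** Where the derivative of the cut-off is nonzero, [s ^ 2 <= 2 N ^ 2], hence [s ^ 3 <= 8 N ^ 3] and
    [4 s / N ^ 4 <= 32 / (N s ^ 2)]. The bound is integrable in [s] and of order [1 / N]. *)
Lemma cutoff_error (C K p s t1 N : R) : 0 < s -> 0 < N -> 0 <= p -> s * p <= C -> t1 ^+ 2 <= K ->
  (- N ^- 2 * s ^+ 2 + 2 < 0 -> t1 = 0) ->
  s * p ^+ 2 * (t1 * (- N ^- 2 * (2 * s))) ^+ 2 <= 32 * C ^+ 2 * K / (N * s ^+ 2).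
Proof.
move=> s0 N0 p0 pC tK t0.
have C2 : (s * p) ^+ 2 <= C ^+ 2 by rewrite ler_pXn2r// nnegrE ?mulr_ge0 ?(ltW s0)// (le_trans _ pC)// mulr_ge0// ltW.
have K0 : 0 <= K by exact: le_trans (sqr_ge0 _) tK.
have nn : N != 0 by rewrite gt_eqF.
have sn : s != 0 by rewrite gt_eqF.
have CK : (s * p) ^+ 2 * t1 ^+ 2 <= C ^+ 2 * K by apply: ler_pM => //; exact: sqr_ge0.
have [y0|y0] := ltP (- N ^- 2 * s ^+ 2 + 2) 0.
  rewrite t0// mul0r expr0n mulr0; apply: divr_ge0; last by apply: mulr_ge0; [exact: ltW|exact: sqr_ge0].
  by apply: mulr_ge0 => //; apply: mulr_ge0; [exact: ler0n|exact: sqr_ge0].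
have s2 : s ^+ 2 <= 2 * N ^+ 2.
  by move: y0; rewrite mulNr addrC subr_ge0 mulrC ler_pdivrMr ?exprn_gt0.
have s2N : s <= 2 * N.
  by rewrite -(@ler_pXn2r _ 2) ?nnegrE ?mulr_ge0 ?(ltW s0) ?(ltW N0)//; nra.
have s3 : s ^+ 3 <= (2 * N) ^+ 3 by rewrite ler_pXn2r// nnegrE ?mulr_ge0 ?(ltW s0) ?(ltW N0).
rewrite [leLHS](_ : _ = (s * p) ^+ 2 * t1 ^+ 2 * (4 * s / N ^+ 4)); last by field.
rewrite [leRHS](_ : _ = C ^+ 2 * K * (32 / (N * s ^+ 2))); last by field; rewrite nn sn.
apply: ler_pM => //; first by rewrite mulr_ge0// sqr_ge0.
  by rewrite divr_ge0 ?exprn_ge0 ?mulr_ge0 ?(ltW s0) ?(ltW N0).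
rewrite ler_pdivrMr ?exprn_gt0// mulrAC ler_pdivlMr ?mulr_gt0 ?exprn_gt0//.
have := ler_wpM2l (ltW N0) s3; rewrite exprMn; lra.
Qed.

Lemma trial_energy0 A : trial_energy A k al (fun=> 0) = 0.
Proof.
have d0 (e : plane) : 'D_e (fun=> 0 : R) = fun=> 0.
  by apply/funext => x; exact: (@derive_val _ _ _ _ _ _ _ (dcst 0 x e)).
have z (nu : {measure set (measurableTypeR R * measurableTypeR R)%type -> \bar R}) (D : set plane) :
    dot nu D (fun=> 0) (fun=> 0) = 0.
  by rewrite /dot; under eq_Rintegral do rewrite mulr0; rewrite /Rintegral integral0.
by rewrite /trial_energy !d0 !z !mulr0 !addr0 subr0.
Qed.

Variables (A : set plane) (rho : R -> R) (m M L : R).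
Hypothesis AP : polar_domain A rho m M L.
Hypothesis al0 : 0 <= al.
Hypothesis al_eq : - phi1 r0 / phi r0 = al.
Hypothesis al_gt : forall r, r0 < r -> - phi1 r / phi r < al.
Hypothesis rrho : forall t, 0 <= t <= 2 * pi -> r0 <= rho t.
Hypothesis rho_gt : exists2 t, 0 <= t <= 2 * pi & r0 < rho t.

Lemma trial_energy_lt0 : exists2 N, 0 < N &
  trial_energy A k al (radial_trial N) < 0 /\
  trial_energy A k al (angular_trial fst N) + trial_energy A k al (angular_trial snd N) < 0.
Proof.
have [st1 [K [dst stK st0]]] := @smooth_step_derivative R.
pose q t := Num.max r0 (rho t).
have rq t : r0 <= q t by rewrite /q le_max lexx.
have q0 t : 0 < q t by exact: lt_le_trans (rq t).
have cq : continuous q.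
  move=> t; have h : {for t, continuous (fun t => Num.max r0 (rho t))}.
    by apply: continuous_max; [exact: ccst|exact: (pd_cont AP)].
  exact: h.
pose C := r0 * phi r0; pose K' := 32 * C ^+ 2 * K.
have K'0 : 0 <= K'.
  rewrite /K'; apply: mulr_ge0; first by apply: mulr_ge0; [exact: ler0n|exact: sqr_ge0].
  by apply: le_trans (stK 0); exact: sqr_ge0.
(* The gain left on the boundary once the cut-off is removed: nonnegative from [r0] on because the
   slope is at most [al], and positive where [rho > r0]. *)
pose D s := s * phi s * (al * phi s + phi1 s).
have cphi s : 0 < s -> {for s, continuous phi} by move=> /dphi; exact: is_derive_continuous.
have cphi1 s : 0 < s -> {for s, continuous phi1} by move=> /dphi1; exact: is_derive_continuous.
have cD : continuous (fun t => D (q t)).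
  move=> t; apply: (@ccomp _ _ q D); first exact: cq.
  have h1 := cphi _ (q0 t); have h2 := cphi1 _ (q0 t).
  have h : {for q t, continuous (fun s : R => s * phi s * (al * phi s + phi1 s))} by cont.
  exact: h.
have Dle s : r0 <= s -> 0 <= D s.
  move=> rs; have s0 : 0 < s by exact: lt_le_trans rs.
  have p0 := phi_gt0 s0.
  rewrite /D mulr_ge0 ?mulr_ge0 ?(ltW s0) ?(ltW p0)//.
  have : - phi1 s / phi s <= al.
    by move: rs; rewrite le_eqVlt => /predU1P[<-|/al_gt/ltW//]; rewrite al_eq.
  by rewrite ler_pdivrMr//; lra.
have [t0 t0I rt0] := rho_gt.
have Dgt : 0 < D (q t0).
  have rqt : r0 < q t0 by rewrite /q lt_max rt0 orbT.
  have p0 := phi_gt0 (q0 t0).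
  rewrite /D mulr_gt0 ?mulr_gt0//.
  by have := al_gt rqt; rewrite ltr_pdivrMr//; lra.
have ID : 0 < circle_int (fun t => D (q t)) by apply: circle_int_gt0 t0I Dgt => // t; exact: Dle.
set I := circle_int _ in ID.
(* Large enough that [N >= M], which makes the cut-off 1 on the boundary, and that the error, at
   most [K' / (N r0)] on each ray, integrates to less than [I]. *)
pose N := `|M| + 1 + K' / r0 * (2 * pi) / I.
have pi2 : 0 < 2 * pi :> R by rewrite mulr_gt0// pi_gt0.
have E0 : 0 <= K' / r0 * (2 * pi) / I by apply: divr_ge0; [apply: mulr_ge0; [apply: divr_ge0|]|]; (exact: ltW || exact: K'0).
have N0 : 0 < N by rewrite /N -addrA ltr_wpDl// ltr_wpDr.
have NM : M <= N by rewrite /N; have := ler_norm M; lra.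
have NI : K' / (N * r0) * (2 * pi) < I.
  have : K' / r0 * (2 * pi) / I < N by rewrite /N ltrDr ltr_wpDl.
  rewrite ltr_pdivrMr// => h.
  rewrite -(ltr_pM2l N0) [ltLHS](_ : _ = K' / r0 * (2 * pi))//.
  by field; rewrite !gt_eqF.
pose psi s := phi s * chi N s.
pose chi1 s := st1 (- N ^- 2 * s ^+ 2 + 2) * (- N ^- 2 * (2 * s)).
have dchi (s : R) : is_derive s 1 (chi N) (chi1 s).
  apply: (@dcomp1 _ (fun s => - N ^- 2 * s ^+ 2 + 2) smooth_step _ _ _ _ (dst _)).
  by der; ring.
pose psi1 s := phi1 s * chi N s + phi s * chi1 s.
(* The first term comes from the ground state identity; the second is a primitive of the bound
   [K' / (N s ^ 2)] on the cut-off error. *)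
pose Q s := s * phi s * phi1 s * chi N s ^+ 2 - K' / N * s^-1.
pose Q1 s := s * (psi1 s ^+ 2 + (k ^+ 2 + s ^- 2) * psi s ^+ 2) - s * phi s ^+ 2 * chi1 s ^+ 2 + K' / (N * s ^+ 2).
have dpsi s : 0 < s -> is_derive (s : R) 1 psi (psi1 s).
  by move=> s0; exact: (dmul (dphi s0) (dchi s)).
have dQ s : 0 < s -> is_derive (s : R) 1 Q (Q1 s).
  move=> s0; have h1 := dphi s0; have h2 := dphi1 s0; have h3 := dchi s.
  have sn : s != 0 by rewrite gt_eqF.
  have nn : N != 0 by rewrite gt_eqF.
  rewrite /Q; der; rewrite /Q1 /psi1 /psi.
  by move: (phi s) (phi1 s) (chi N s) (chi1 s) => a b c d; field; rewrite sn nn.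
have hQ s : r0 < s -> s * (psi1 s ^+ 2 + (k ^+ 2 + s ^- 2) * psi s ^+ 2) <= Q1 s.
  move=> rs; have s0 : 0 < s by exact: lt_trans rs.
  rewrite /Q1 -addrA lerDl addrC subr_ge0.
  apply: cutoff_error => //; [exact/ltW/phi_gt0|exact/profile_decay/ltW|exact: st0].
have QB s : 1 <= s -> Q s <= 0.
  move=> s1; have s0 : 0 < s by exact: lt_le_trans s1.
  rewrite /Q subr_le0; apply: (@le_trans _ _ 0); last first.
    by apply: mulr_ge0; [exact: divr_ge0 K'0 (ltW N0)|rewrite invr_ge0 ltW].
  rewrite mulr_le0_ge0 ?sqr_ge0// mulr_ge0_le0 ?(ltW (phi1_lt0 s0))// mulr_ge0// ltW//.
  exact: phi_gt0.
have cQ : continuous (fun t => Q (Num.max r0 (rho t))).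
  move=> t; apply: (@ccomp _ _ q Q); first exact: cq.
  exact: is_derive_continuous (dQ _ (q0 t)).
have cpsi : continuous (fun t => Num.max r0 (rho t) * psi (Num.max r0 (rho t)) ^+ 2).
  move=> t; apply: (@ccomp _ _ q (fun s => s * psi s ^+ 2)); first exact: cq.
  have h1 := is_derive_continuous (dpsi _ (q0 t)).
  have h : {for q t, continuous (fun s : R => s * psi s ^+ 2)} by cont.
  exact: h.
have bound : circle_int (fun t => - Q (Num.max r0 (rho t)) - al * (Num.max r0 (rho t) * psi (Num.max r0 (rho t)) ^+ 2)) < 0.
  have -> : circle_int (fun t => - Q (Num.max r0 (rho t)) - al * (Num.max r0 (rho t) * psi (Num.max r0 (rho t)) ^+ 2)) =
      circle_int (fun t => K' / N * (q t)^-1 + -1 * D (q t)).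
    apply: eq_circle_int => t tI; rewrite -/(q t).
    have chi1q : chi N (q t) = 1.
      rewrite /chi smooth_step_ge1// mulNr addrC.
      have qN : q t <= N.
        rewrite /q (max_idPr (rrho tI)); apply: le_trans NM.
        by have /andP[] := pd_bnd AP tI.
      have : N ^- 2 * q t ^+ 2 <= 1.
        by rewrite mulrC ler_pdivrMr ?exprn_gt0// mul1r ler_pXn2r// nnegrE ltW.
      lra.
    rewrite /Q /psi chi1q expr1n !mulr1 /D; ring.
  have cqi : continuous (fun t => (q t)^-1).
    by move=> t; apply: cinv; [rewrite gt_eqF|exact: cq].
  rewrite (circle_int_lin _ _ cqi cD) mulN1r subr_lt0 -/I.
  apply: le_lt_trans NI.
  have cr : continuous (fun _ : R => r0^-1) by exact: cst_continuous.
  have h : 0 <= circle_int (fun t => 1 * r0^-1 + -1 * (q t)^-1).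
    apply: circle_int_ge0 => t; rewrite mul1r mulN1r subr_ge0 lef_pV2 ?posrE//.
  rewrite (circle_int_lin _ _ cr cqi) circle_int_cst mul1r mulN1r subr_ge0 in h.
  have KN : 0 <= K' / N by rewrite divr_ge0// ltW.
  by have := ler_wpM2l KN h; rewrite invfM !mulrA.
have t0N := test_radial N0.
have tA i : (forall n, Cn n i) -> test_function setT (angular_trial i N) by move=> ci; exact: test_angular.
have dp s : r0 < s -> is_derive (s : R) 1 psi (psi1 s) by move=> rs; apply: dpsi; exact: lt_trans rs.
have dq s : r0 <= s -> is_derive (s : R) 1 Q (Q1 s) by move=> rs; apply: dQ; exact: lt_le_trans rs.
exists N => //; split.
(* The radial trial function is paired with the zero function. *)
- have tz : test_function setT (fun=> 0 : R).
    have := test_lin 0 0 t0N t0N; congr test_function; apply/funext => x; rewrite !mul0r addr0//.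
  apply: le_lt_trans bound; rewrite -[leLHS]addr0 -(trial_energy0 A).
  apply: (@trial_energy_pair_le _ A rho m M L AP r0 k al r00 al0 rrho (radial_trial N) (fun=> 0) psi psi1 Q Q1
    (fun=> 1) (fun=> 0) (fun=> 0) (fun=> 0) 1 t0N tz _ _ _ _ _ _ dp dq hQ QB cQ cpsi).
  + by move=> s t rs; exact: radial_polar.
  + by move=> s t rs; rewrite mulr0.
  + by move=> t; rewrite expr1n expr0n/= addr0.
  + by move=> t; rewrite !expr0n/= addr0.
- apply: le_lt_trans bound.
  apply: (@trial_energy_pair_le _ A rho m M L AP r0 k al r00 al0 rrho _ _ psi psi1 Q Q1
    cos (fun t => - sin t) sin cos 1 (tA _ (@Cn_fst R)) (tA _ (@Cn_snd R)) _ _ _ _ _ _ dp dq hQ QB cQ cpsi).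
  + by move=> s t rs; exact: angular_polar.
  + by move=> s t rs; exact: angular_polar.
  + exact: cos2Dsin2.
  + by move=> t; rewrite sqrrN addrC cos2Dsin2.
Qed.

End trial_functions.

(** * Central symmetry and orthogonality of functions of opposite parity *)

Section central_symmetry.
Context {R : realType}.
Local Notation plane := (R * R)%type.
Local Notation mplane := (measurableTypeR R * measurableTypeR R)%type.

Lemma nbhs_opp (x : plane) (B : set plane) : nbhs (- x) B -> nbhs x [set y | B (- y)].
Proof.
have oc : continuous (fun y : plane => - y) by exact: opp_continuous.
by move=> hB; exact: (oc x B hB).
Qed.

Lemma boundary_opp (A : set plane) x : centrally_symmetric A -> boundary A x -> boundary A (- x).
Proof.
move=> sA; have sA' y : A y -> A (- y) by move=> Ay; rewrite -sA; exists y.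
move=> [cx ix]; split.
  move=> B hB; have [y [Ay By]] := cx _ (nbhs_opp hB).
  by exists (- y); split => //; exact: sA'.
move=> h; apply: ix; apply: filterS (nbhs_opp h) => y /= /sA'.
by rewrite opprK.
Qed.

Lemma exterior_opp (A : set plane) x : centrally_symmetric A -> exterior A x -> exterior A (- x).
Proof.
move=> sA; have sA' y : A y -> A (- y) by move=> Ay; rewrite -sA; exists y.
move=> ex cx; apply: ex => B hB.
have [|y [Ay By]] := cx [set y | B (- y)].
  by apply: nbhs_opp; rewrite opprK.
by exists (- y); split => //; exact: sA'.
Qed.

Definition opp_invariant (nu : {measure set mplane -> \bar R}) := forall F : mplane -> \bar R,
  measurable_fun setT F -> (forall x, 0 <= F x)%E -> (\int[nu]_x F x = \int[nu]_x F (- x)%R)%E.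

Lemma measurable_oppp : measurable_fun setT (fun x : mplane => (- x : mplane)).
Proof.
have h : measurable_fun setT (fun x : mplane => (- x.1, - x.2) : mplane).
  by apply: measurable_fun_pair; apply: (measurableT_comp (@oppr_measurable R setT)).
by move: h; congr measurable_fun; apply/funext => -[].
Qed.

(** In the half-plane polar formula the reflection exchanges the two summands. *)
Lemma leb2_opp_invariant : opp_invariant (@leb2 R).
Proof.
move=> F mF F0; have mF' := measurableT_comp mF measurable_oppp.
have e1 := leb2_half_polar mF F0; have e2 := leb2_half_polar mF' (fun x => F0 (- x)).
rewrite (_ : (fun x => F (- - x)) = F) in e2; last by apply/funext => x; rewrite opprK.
by apply: etrans e1 _; apply: etrans (esym e2); rewrite addeC.
Qed.

Lemma dist2_opp (x y : plane) : dist2 (- x) (- y) = dist2 x y.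
Proof. by rewrite /dist2 /=; congr Num.sqrt; ring. Qed.

Lemma diam_opp (E : set plane) : diam [set - x | x in E] = diam E.
Proof.
rewrite /diam; congr (maxe _ (ereal_sup _)); apply/seteqP; split => [_ [p [[x Ex xp] [y Ey yp]] <-]|_ [p [Ep1 Ep2] <-]].
  by exists (x, y) => //=; rewrite -xp -yp dist2_opp.
exists (- p.1, - p.2); last by rewrite /= dist2_opp.
by split => /=; [exists p.1|exists p.2].
Qed.

(** The reflection preserves diameters, so it sends coverings to coverings of the same weight at the
    same scale. *)
Lemma le_hausdorff1_opp (A : set plane) : (hausdorff1 ([set (- x)%R | x in A] : set mplane) <= hausdorff1 (A : set mplane))%E.
Proof.
apply: ge_ereal_sup => _ [d d0 <-].
apply: (@le_trans _ _ (hausdorff1_pre d A)); last by apply: ereal_sup_ubound; exists d.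
apply: le_ereal_inf_tmp => _ [E [AE Ed] <-].
apply: ereal_inf_lbound; exists (fun i => [set - x | x in E i]).
  split; last by move=> i; rewrite diam_opp.
  by move=> _ [x /AE[i _ Ei] <-]; exists i => //; exists x.
by apply: eq_eseriesr => i _; rewrite diam_opp.
Qed.

Lemma hausdorff1_opp_invariant : opp_invariant (@hausdorff1 R).
Proof.
move=> F mF F0.
have e (B : set mplane) : hausdorff1 ((fun x : mplane => - x) @^-1` B) = hausdorff1 B.
  have -> : (fun x : mplane => - x) @^-1` B = [set - x | x in B].
    apply/seteqP; split => [x Bx|_ [x Bx <-]]; last by rewrite /= opprK.
    by exists (- x) => //; rewrite opprK.
  apply/eqP; rewrite eq_le le_hausdorff1_opp/=.
  rewrite -[X in (hausdorff1 X <= _)%E](_ : [set - x | x in [set - x | x in B]] = B).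
    exact: le_hausdorff1_opp.
  apply/seteqP; split => [_ [_ [x Bx <-] <-]|x Bx]; first by rewrite opprK.
  by exists (- x); [exists x|rewrite opprK].
have := ge0_integral_pushforward measurable_oppp (@hausdorff1 R) measurableT mF (fun x _ => F0 x).
rewrite preimage_setT => <-; apply: eq_measure_integral; first exact: measurable_oppp.
by move=> mo B mB _; rewrite /= /pushforward e.
Qed.

Variables (nu : {measure set mplane -> \bar R}) (D : set mplane).
Hypotheses (nu_opp : opp_invariant nu) (mD : measurable D) (D_opp : forall x, D x -> D (- x)).

Lemma Rintegral_odd (h : mplane -> R) : measurable_fun D h -> (forall x, D x -> h (- x) = - h x) ->
  (\int[nu]_(x in D) h x)%R = 0.
Proof.
move=> mh ho; have mE : measurable_fun D (EFin \o h) by exact/measurable_EFinP.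
rewrite /Rintegral integralE.
suff -> : (\int[nu]_(x in D) ((fun x => (h x)%:E)^\+ x) = \int[nu]_(x in D) ((fun x => (h x)%:E)^\- x))%E.
  (* When the integrals of both parts are infinite, [fine] also returns 0. *)
  by case: (integral _ _ _) => [x| |]//=; rewrite subrr.
rewrite integral_mkcond [RHS]integral_mkcond.
have mp : measurable_fun setT ((fun x => (h x)%:E)^\+ \_ D)%E.
  by apply/(measurable_restrictT _ mD); exact: measurable_funepos.
rewrite nu_opp//; last by move=> x; rewrite patchE; case: ifP.
apply: eq_integral => x _; rewrite !patchE.
have -> : (- x \in D) = (x \in D).
  by apply/idP/idP; rewrite !inE => /D_opp//; rewrite opprK.
case: ifP => // /set_mem Dx.
by rewrite funeposE funenegE ho// EFinN.
Qed.

Lemma dot_odd (f g : mplane -> R) : measurable_fun D f -> measurable_fun D g ->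
  (forall x, f (- x) = f x) -> (forall x, g (- x) = - g x) -> dot nu D f g = 0.
Proof.
move=> mf mg fe go; apply: Rintegral_odd; first exact: measurable_funM.
by move=> x _; rewrite fe go mulrN.
Qed.

End central_symmetry.

Section test_function_symmetry.
Context {R : realType}.
Local Notation plane := (R * R)%type.

Lemma test_derive_opp U (f : plane -> R) (c : R) : test_function U f -> (forall x, f (- x) = c * f x) ->
  forall x, c * 'D_e1 f x = - 'D_e1 f (- x) /\ c * 'D_e2 f x = - 'D_e2 f (- x).
Proof.
move=> hf fo [x y]; have d z := test_is_derive hf z.
have o (s : R) : is_derive (s : R) 1 (fun s : R => - s) (-1).
  by der.
split.
- have [h _] := d (x, y); have [h' _] := d (- x, - y).
  have h1 := dmul (dcst c x 1) (is_derive_slice1 h); rewrite mul0r add0r in h1.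
  have h2 := dcomp1 (o x) (is_derive_slice1 h'); rewrite mulrN1 in h2.
  have e : (fun s => f (- s, - y)) = (fun s => c * f (s, y)) by apply/funext => s; rewrite -fo.
  rewrite e in h2.
  by rewrite -(@derive_val _ _ _ _ _ _ _ h1) (@derive_val _ _ _ _ _ _ _ h2).
- have [_ h] := d (x, y); have [_ h'] := d (- x, - y).
  have h1 := dmul (dcst c y 1) (is_derive_slice2 h); rewrite mul0r add0r in h1.
  have h2 := dcomp1 (o y) (is_derive_slice2 h'); rewrite mulrN1 in h2.
  have e : (fun s => f (- x, - s)) = (fun s => c * f (x, s)) by apply/funext => s; rewrite -fo.
  rewrite e in h2.
  by rewrite -(@derive_val _ _ _ _ _ _ _ h1) (@derive_val _ _ _ _ _ _ _ h2).
Qed.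

Lemma test_derive_lin U (f g : plane -> R) (a b : R) (x : plane) : test_function U f -> test_function U g ->
  'D_e1 (fun x => a * f x + b * g x) x = a * 'D_e1 f x + b * 'D_e1 g x /\
  'D_e2 (fun x => a * f x + b * g x) x = a * 'D_e2 f x + b * 'D_e2 g x.
Proof.
move=> hf hg; have [f1 f2] := test_is_derive hf x; have [g1 g2] := test_is_derive hg x.
have l e p q : is_derive x e f p -> is_derive x e g q ->
    'D_e (fun x => a * f x + b * g x) x = a * p + b * q.
  move=> hp hq; have h := dadd (dmul (dcst a x e) hp) (dmul (dcst b x e) hq).
  by rewrite (@derive_val _ _ _ _ _ _ _ h) !mul0r !add0r.
by split; exact: l.
Qed.

End test_function_symmetry.

(** * The Robin form on test functions *)

Section test_function_form.
Context {R : realType}.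
Local Notation plane := (R * R)%type.
Local Notation mplane := (measurableTypeR R * measurableTypeR R)%type.
Variables (A : set plane) (rho : R -> R) (m M L : R).
Hypothesis AP : polar_domain A rho m M L.
Local Notation ext := (exterior A : set mplane).
Local Notation bd := (boundary A : set mplane).
Let mE : measurable ext. Proof. exact: measurable_exterior. Qed.
Let mB : measurable bd. Proof. exact: measurable_boundary. Qed.

Lemma dirichlet_test f : test_function setT f ->
  dirichlet A f = dot leb2 ext ('D_e1 f) ('D_e1 f) + dot leb2 ext ('D_e2 f) ('D_e2 f).
Proof.
move=> hf; have [G1 G2] := grad_L2 (test_H1r mE hf).
have [a1 a2] := grad_test (@open_exterior R A) hf.
have h1 := test_L2 mE (test_derive1 hf); have h2 := test_L2 mE (test_derive2 hf).
rewrite /dirichlet; congr (_ + _); [exact: (ae_dot mE G1 h1 G1 h1 a1 a1)|exact: (ae_dot mE G2 h2 G2 h2 a2 a2)].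
Qed.

Lemma cvgL2_ae_cst (nu : {measure set mplane -> \bar R}) (D : set mplane) (f g : mplane -> R) :
  measurable D -> L2 nu D f -> L2 nu D g -> {ae nu, forall x, D x -> g x = f x} -> cvgL2 nu D (fun=> f) g.
Proof.
move=> mD hf hg fg; rewrite /cvgL2.
have -> : dot nu D (fun x => f x - g x) (fun x => f x - g x) = 0; last exact: cvg_cst.
have z : L2 nu D (fun=> 0) by exact: L2_cst0.
have hd := L2_sub mD hf hg.
have ae0 : {ae nu, forall x, D x -> f x - g x = 0}.
  by apply: filterS fg => x h Dx; rewrite h// subrr.
rewrite (ae_dot mD hd z hd z ae0 ae0) /dot.
by under eq_Rintegral do rewrite mulr0; rewrite /Rintegral integral0.
Qed.

(** The constant sequence serves as approximation; the chosen weak gradient equals the classical one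
    almost everywhere. *)
Lemma is_trace_test f : test_function setT f -> is_trace A f f.
Proof.
move=> hf; have hf1 := test_derive1 hf; have hf2 := test_derive2 hf.
have hH := test_H1r mE hf; have [G1 G2] := grad_L2 hH.
have [a1 a2] := grad_test (@open_exterior R A) hf.
have tB := test_L2_boundary AP hf.
have ae_refl (nu : {measure set mplane -> \bar R}) (D : set mplane) : {ae nu, forall x, D x -> f x = f x}.
  by exact: aeW.
apply: (is_trace_intro AP hH tB (f := fun=> f)) => //.
- exact: (cvgL2_ae_cst mE (test_L2 mE hf) (test_L2 mE hf) (ae_refl _ _)).
- exact: (cvgL2_ae_cst mE (test_L2 mE hf1) G1 a1).
- exact: (cvgL2_ae_cst mE (test_L2 mE hf2) G2 a2).
- exact: (cvgL2_ae_cst mB tB tB (ae_refl _ _)).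
Qed.

Lemma trial_energyE k al f : test_function setT f ->
  dirichlet A f + - al * boundary_mass A f = trial_energy A k al f - k ^+ 2 * mass A f.
Proof.
move=> hf; rewrite (dirichlet_test hf) (trace_dot AP (test_H1r mE hf) (is_trace_test hf)).
by rewrite /trial_energy /mass; move: (dot _ _ _ _) (dot _ _ _ _) (dot _ _ _ _) (dot _ _ _ _) => a b c d; ring.
Qed.

(** If [n] were 0, the inequality with [e = 1 / (al C + 1)] would give [al b <= d], against the
    negative form. *)
Lemma mass_gt0_algebra (al C d n b k : R) : 0 <= al -> 0 <= C -> 0 <= d -> 0 <= n ->
  (forall e, 0 < e -> b <= C * (e * d + e^-1 * n)) -> d + k ^+ 2 * n - al * b < 0 -> 0 < n.
Proof.
move=> al0 C0 d0 n0 hb; rewrite lt0r n0 andbT; apply: contraTneq => nE; move: hb; rewrite nE => hb.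
have aC : 0 <= al * C by exact: mulr_ge0.
have e0 : 0 < (al * C + 1)^-1 by rewrite invr_gt0; lra.
have := hb _ e0; rewrite !mulr0 !addr0 => /(ler_wpM2l al0) h.
rewrite -leNgt subr_ge0; apply: le_trans h _.
rewrite mulrA mulrA -[leRHS]mul1r; apply: ler_wpM2r => //.
by rewrite ler_pdivrMr ?mul1r; lra.
Qed.

Lemma test_mass_gt0 k al f : 0 <= al -> test_function setT f -> trial_energy A k al f < 0 -> 0 < mass A f.
Proof.
move=> al0 hf; rewrite /trial_energy /mass.
set C := Num.sqrt (L ^+ 2 + M ^+ 2) / m.
have C0 : 0 <= C by rewrite divr_ge0 ?sqrtr_ge0// ltW// (pd_pos AP).
have d0 : 0 <= dot leb2 ext ('D_e1 f) ('D_e1 f) + dot leb2 ext ('D_e2 f) ('D_e2 f).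
  by apply: addr_ge0; exact: dot_ge0.
apply: (@mass_gt0_algebra al C _ _ _ k al0 C0 d0 (dot_ge0 _ _ _)) => e e0.
by have := test_trace_inequality AP e0 hf; rewrite (mulrDr e).
Qed.

End test_function_form.

(** * Upper bound from a two-dimensional trial space *)

Section second_eigenvalue_upper_bound.
Context {R : realType}.
Local Notation plane := (R * R)%type.
Local Notation mplane := (measurableTypeR R * measurableTypeR R)%type.
Local Notation C := (complex R).
Variables (A : set plane) (rho : R -> R) (m M L : R).
Hypothesis AP : polar_domain A rho m M L.
Hypothesis sA : centrally_symmetric A.
Local Notation ext := (exterior A : set mplane).
Local Notation bd := (boundary A : set mplane).
Let mE : measurable ext. Proof. exact: measurable_exterior. Qed.
Let mB : measurable bd. Proof. exact: measurable_boundary. Qed.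
Variables (v u : plane -> R).
Hypotheses (tv : test_function setT v) (tu : test_function setT u).
Hypotheses (v_even : forall x, v (- x) = v x) (u_odd : forall x, u (- x) = - u x).

Let ext_odd (f g : plane -> R) : L2 leb2 ext f -> L2 leb2 ext g ->
  (forall x, f (- x) = f x) -> (forall x, g (- x) = - g x) -> dot leb2 ext f g = 0.
Proof. by move=> [mf _] [mg _]; apply: (dot_odd (@leb2_opp_invariant R) mE (fun x => @exterior_opp R A x sA)). Qed.

Lemma mass_parity a b : mass A (fun x => a * v x + b * u x) = a ^+ 2 * mass A v + b ^+ 2 * mass A u.
Proof.
have hv := test_L2 mE tv; have hu := test_L2 mE tu.
by rewrite /mass (dot_lin mE a b hv hu) (ext_odd hv hu v_even u_odd) mulr0 addr0.
Qed.

(** Differentiation reverses parity, so every cross term, in the gradient, in the exterior and on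
    the boundary, pairs an even with an odd function. *)
Lemma trial_energy_parity k al a b : trial_energy A k al (fun x => a * v x + b * u x) =
  a ^+ 2 * trial_energy A k al v + b ^+ 2 * trial_energy A k al u.
Proof.
have ve' x : v (- x) = 1 * v x by rewrite mul1r.
have uo' x : u (- x) = (-1) * u x by rewrite mulN1r.
have tv1 := test_derive1 tv; have tv2 := test_derive2 tv.
have tu1 := test_derive1 tu; have tu2 := test_derive2 tu.
have hv := test_L2 mE tv; have hu := test_L2 mE tu.
have hv1 := test_L2 mE tv1; have hu1 := test_L2 mE tu1.
have hv2 := test_L2 mE tv2; have hu2 := test_L2 mE tu2.
have bv := test_L2_boundary AP tv; have bu := test_L2_boundary AP tu.
have E1 : 'D_e1 (fun x => a * v x + b * u x) = (fun x => a * 'D_e1 v x + b * 'D_e1 u x).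
  by apply/funext => x; have [] := test_derive_lin a b x tv tu.
have E2 : 'D_e2 (fun x => a * v x + b * u x) = (fun x => a * 'D_e2 v x + b * 'D_e2 u x).
  by apply/funext => x; have [] := test_derive_lin a b x tv tu.
have alg1 (p q : R) : (-1) * p = - q -> q = p by rewrite mulN1r => /oppr_inj ->.
have alg2 (p q : R) : 1 * p = - q -> q = - p by rewrite mul1r => ->; rewrite opprK.
have pu1 x : 'D_e1 u (- x) = 'D_e1 u x by have [h _] := test_derive_opp tu uo' x; exact: alg1 h.
have pu2 x : 'D_e2 u (- x) = 'D_e2 u x by have [_ h] := test_derive_opp tu uo' x; exact: alg1 h.
have pv1 x : 'D_e1 v (- x) = - 'D_e1 v x by have [h _] := test_derive_opp tv ve' x; exact: alg2 h.
have pv2 x : 'D_e2 v (- x) = - 'D_e2 v x by have [_ h] := test_derive_opp tv ve' x; exact: alg2 h.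
have z1 : dot leb2 ext ('D_e1 v) ('D_e1 u) = 0 by rewrite dotC; exact: (ext_odd hu1 hv1 pu1 pv1).
have z2 : dot leb2 ext ('D_e2 v) ('D_e2 u) = 0 by rewrite dotC; exact: (ext_odd hu2 hv2 pu2 pv2).
have zb : dot hausdorff1 bd v u = 0.
  have [mv _] := bv; have [mu' _] := bu.
  exact: (dot_odd (@hausdorff1_opp_invariant R) mB (fun x => @boundary_opp R A x sA) mv mu' v_even u_odd).
rewrite /trial_energy E1 E2 (dot_lin mE a b hv1 hu1) (dot_lin mE a b hv2 hu2) (dot_lin mE a b hv hu) (dot_lin mB a b bv bu).
rewrite z1 z2 zb (ext_odd hv hu v_even u_odd).
move: (dot _ _ _ _) (dot _ _ _ _) (dot _ _ _ _) (dot _ _ _ _) (dot _ _ _ _) (dot _ _ _ _) (dot _ _ _ _) (dot _ _ _ _).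
by move=> *; ring.
Qed.

Let vC : plane -> C := fun x => Complex (v x) 0.
Let uC : plane -> C := fun x => Complex (u x) 0.

Let reE c : re (lincomb c (vC, uC)) = fun x => complex.Re c.1 * v x + complex.Re c.2 * u x.
Proof. by rewrite re_lincomb; apply/funext => x; rewrite /re /im /= !mulr0 !addr0 !mul1r. Qed.

Let imE c : im (lincomb c (vC, uC)) = fun x => complex.Im c.1 * v x + complex.Im c.2 * u x.
Proof. by rewrite im_lincomb; apply/funext => x; rewrite /re /im /= !mulr0 !addr0 !mul1r. Qed.

Let trial_H1 (f : plane -> R) : test_function setT f -> H1 ext (fun x => Complex (f x) 0).
Proof.
move=> tf; split; first exact: (test_H1r mE tf).
have := test_lin 0 0 tf tf; rewrite (_ : (fun x => 0 * f x + 0 * f x) = (fun=> 0)).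
  exact: (test_H1r mE).
by apply/funext => x; rewrite !mul0r addr0.
Qed.

Let complex_eq0 (c : C * C) : complex.Re c.1 = 0 -> complex.Im c.1 = 0 -> complex.Re c.2 = 0 -> complex.Im c.2 = 0 -> c = 0.
Proof. by case: c => [[a b] [a' b']] /= -> -> -> ->. Qed.

Lemma quadratic_pos (a b p q x y : R) : 0 < x -> 0 < y ->
  a ^+ 2 * x + b ^+ 2 * y + (p ^+ 2 * x + q ^+ 2 * y) = 0 -> [/\ a = 0, b = 0, p = 0 & q = 0].
Proof.
move=> x0 y0 E.
have h (r s : R) : 0 < s -> 0 <= r ^+ 2 * s by move=> s0; rewrite mulr_ge0 ?sqr_ge0// ltW.
have h1 := h a x x0; have h2 := h b y y0; have h3 := h p x x0; have h4 := h q y y0.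
have z (r s : R) : 0 < s -> r ^+ 2 * s = 0 -> r = 0.
  by move=> s0 /eqP; rewrite mulf_eq0 sqrf_eq0 (gt_eqF s0) orbF => /eqP.
by split; [apply: (z _ x)|apply: (z _ y)|apply: (z _ x)|apply: (z _ y)] => //; lra.
Qed.

Lemma robin_quotient_le (d d' b b' c e e' n t : R) : 0 < n -> d + c * b = e -> d' + c * b' = e' ->
  e + e' <= t * n -> (d + d' + c * (b + b')) / n <= t.
Proof. by move=> n0 <- <- h; rewrite ler_pdivrMr// mulrDr addrACA. Qed.

Lemma lambda2_lt k al : 0 <= al -> trial_energy A k al v < 0 -> trial_energy A k al u < 0 ->
  (lambda2 (- al) A < (- k ^+ 2)%:E)%E.
Proof.
move=> al0 Ev Eu.
have Nv := test_mass_gt0 AP al0 tv Ev; have Nu := test_mass_gt0 AP al0 tu Eu.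
(* A gap common to the whole space: the supremum over all coefficients has to stay strictly below
   [- k ^ 2]. *)
pose eps := Num.min (- trial_energy A k al v / mass A v) (- trial_energy A k al u / mass A u).
have eps0 : 0 < eps by rewrite lt_min !divr_gt0// oppr_gt0.
have ev : trial_energy A k al v <= - eps * mass A v.
  by rewrite mulNr lerNr -ler_pdivlMr// ge_min lexx.
have eu : trial_energy A k al u <= - eps * mass A u.
  by rewrite mulNr lerNr -ler_pdivlMr// ge_min lexx orbT.
apply: (@le_lt_trans _ _ (- k ^+ 2 - eps)%:E); last by rewrite lte_fin ltrBlDr ltrDl.
have H1v := trial_H1 tv; have H1u := trial_H1 tu.
have oE := @open_exterior R A.
have hH c : H1 ext (lincomb c (vC, uC)) by exact: H1_lincomb.
(* A combination that vanishes almost everywhere has zero mass, while the mass is diagonal in the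
   two trial functions with positive entries. *)
have pair : H1_pair (exterior A) (vC, uC).
  split => // c h0.
  have z : L2 leb2 ext (fun=> 0) by exact: L2_cst0.
  have m0 (w : plane -> R) : H1r ext w -> {ae leb2, forall x, ext x -> w x = 0} -> mass A w = 0.
    move=> [Lw _] ae0; rewrite /mass (ae_dot mE Lw z Lw z ae0 ae0) /dot.
    by under eq_Rintegral do rewrite mulr0; rewrite /Rintegral integral0.
  have [hr hi] := hH c.
  have r0 : mass A (re (lincomb c (vC, uC))) = 0.
    by apply: m0 => //; apply: (@filterS _ _ (ae_filter_ringOfSetsType _) _ _ _ h0) => x h /h; rewrite /re => ->.
  have i0 : mass A (im (lincomb c (vC, uC))) = 0.
    by apply: m0 => //; apply: (@filterS _ _ (ae_filter_ringOfSetsType _) _ _ _ h0) => x h /h; rewrite /im => ->.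
  rewrite reE mass_parity in r0; rewrite imE mass_parity in i0.
  have [a b p q] := quadratic_pos Nv Nu (etrans (congr2 +%R r0 i0) (addr0 0)).
  exact: complex_eq0.
apply: (le_trans (ereal_inf_lbound _)); first by exists (vC, uC).
apply: ge_ereal_sup => _ [c /= c0 <-]; rewrite lee_fin rayleighE//.
have tl a b : test_function setT (fun x => a * v x + b * u x) by exact: test_lin.
rewrite reE imE !mass_parity.
set N := complex.Re c.1 ^+ 2 * mass A v + _ + _.
have N0 : 0 < N.
  rewrite lt0r; apply/andP; split.
    apply: contra_neq c0 => /(quadratic_pos Nv Nu)[a b p q]; exact: complex_eq0.
  by rewrite /N; do !apply: addr_ge0; apply: mulr_ge0; rewrite ?sqr_ge0// ltW.
have form a b : dirichlet A (fun x => a * v x + b * u x) + - al * boundary_mass A (fun x => a * v x + b * u x) =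
    a ^+ 2 * trial_energy A k al v + b ^+ 2 * trial_energy A k al u - k ^+ 2 * (a ^+ 2 * mass A v + b ^+ 2 * mass A u).
  by rewrite (trial_energyE AP k al (tl a b)) trial_energy_parity mass_parity.
apply: (robin_quotient_le N0 (form _ _) (form _ _)); rewrite /N.
move: ev eu; move: (trial_energy A k al v) (trial_energy A k al u) (mass A v) (mass A u) (complex.Re c.1) (complex.Re c.2) (complex.Im c.1) (complex.Im c.2).
move=> x y n n' a b p q hx hy.
have k1 := ler_wpM2l (sqr_ge0 a) hx; have k2 := ler_wpM2l (sqr_ge0 p) hx.
have k3 := ler_wpM2l (sqr_ge0 b) hy; have k4 := ler_wpM2l (sqr_ge0 q) hy.
rewrite -subr_ge0 in k1; rewrite -subr_ge0 in k2; rewrite -subr_ge0 in k3; rewrite -subr_ge0 in k4.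
rewrite -subr_ge0; have := addr_ge0 (addr_ge0 k1 k2) (addr_ge0 k3 k4).
by congr (0 <= _); ring.
Qed.

End second_eigenvalue_upper_bound.

(** * Comparison of the domain with the disk *)

Section comparison.
Context {R : realType}.
Local Notation plane := (R * R)%type.

Lemma radial_trial_even (r0 : R) phi N (x : plane) : radial_trial r0 phi N (- x) = radial_trial r0 phi N x.
Proof. by rewrite /radial_trial /radius_sqr /= !mulrNN. Qed.

Lemma angular_trial_odd (r0 : R) phi (i : plane -> R) N (x : plane) : i (- x) = - i x ->
  angular_trial r0 phi i N (- x) = - angular_trial r0 phi i N x.
Proof. by move=> ix; rewrite /angular_trial ix /radius_sqr /= !mulrNN mulNr. Qed.

(** The number [- k ^ 2] separates the two eigenvalues. Since only the sum of the two angular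
    energies is known to be negative, the coordinate with negative energy is selected by cases. *)
Lemma lambda2_lt_disk (A : set plane) rho m M L (r0 al : R) : polar_domain A rho m M L ->
  centrally_symmetric A -> 0 < r0 -> 1 / r0 < al ->
  (forall t, 0 <= t <= 2 * pi -> r0 <= rho t) -> (exists2 t, 0 <= t <= 2 * pi & r0 < rho t) ->
  exists2 k, 0 < k & (lambda2 (- al) A < (- k ^+ 2)%:E)%E /\
    ((- k ^+ 2)%:E <= lambda2 (- al) (disk 0%R r0))%E.
Proof.
move=> AP sA r00 ral rrho rgt.
have al0 : 0 < al by apply: lt_trans ral; rewrite divr_gt0.
have [k [phi [phi1 [k0 al_eq hphi al_gt]]]] := bessel_profile r00 ral.
have dphi (r : R) : 0 < r -> is_derive r 1 phi (phi1 r) by move=> /hphi[].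
have dphi1 (r : R) : 0 < r -> is_derive r 1 phi1 ((k ^+ 2 + r ^- 2) * phi r - phi1 r / r) by move=> /hphi[].
have p0 (r : R) : 0 < r -> 0 < phi r by move=> /hphi[].
have ple (r : R) : 0 < r -> phi r / r <= - phi1 r by move=> /hphi[].
exists k => //; split; last by apply: (lambda2_disk_ge r00 al_eq dphi dphi1 p0).
have [N N0 [Ev Eu]] := trial_energy_lt0 r00 dphi dphi1 p0 ple AP (ltW al0) al_eq al_gt rrho rgt.
have tv := test_radial r00 dphi dphi1 N0.
have t1 := test_angular r00 dphi dphi1 (@Cn_fst R) N0.
have t2 := test_angular r00 dphi dphi1 (@Cn_snd R) N0.
have [E1|E1] := ltP (trial_energy A k al (angular_trial r0 phi fst N)) 0.
  apply: (lambda2_lt AP sA tv t1 _ _ (ltW al0) Ev E1).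
  - exact: radial_trial_even.
  - by move=> x; exact: angular_trial_odd.
apply: (lambda2_lt AP sA tv t2 _ _ (ltW al0) Ev).
- exact: radial_trial_even.
- by move=> x; exact: angular_trial_odd.
- by apply: le_lt_trans Eu; rewrite lerDr.
Qed.

End comparison.

(** * The critical coupling constant *)

Section critical_coupling_constant.
Context {R : realType}.
Local Notation plane := (R * R)%type.
Local Notation C := (complex R).

(** A negative quotient forces [d <= al * b]. With [e = 1 / (2 (K al + 1))] the trace inequality
    then absorbs half of [b] and leaves [b <= T n], so that raising the coupling by [dl] raises the
    quotient by at most [dl T], uniformly over the space. *)
Lemma robin_perturbation (K al eps : R) : 0 <= K -> 0 <= al -> 0 < eps -> exists2 dl, 0 < dl &
  forall d b n, 0 <= d -> 0 <= b -> 0 <= n -> (forall e, 0 < e -> b <= K * (e * d + e^-1 * n)) ->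
  (d + - al * b) / n <= - eps -> (d + (- al + dl) * b) / n <= - (eps / 2).
Proof.
move=> K0 al0 eps0.
have Ka : 0 <= K * al by exact: mulr_ge0.
pose e := (2 * (K * al + 1))^-1.
have e0 : 0 < e by rewrite invr_gt0; lra.
pose T := 2 * (K * e^-1).
have T0 : 0 <= T by rewrite !mulr_ge0// invr_ge0 ltW.
exists (eps / (2 * (T + 1))); first by rewrite divr_gt0// mulr_gt0//; lra.
move=> d b n d0 b0 n0 hb h.
have n1 : 0 < n.
  rewrite lt0r n0 andbT; apply: contraTneq h => ->.
  by rewrite invr0 mulr0 -ltNge oppr_lt0.
move: h; rewrite ler_pdivrMr// => h.
have ne : 0 <= eps * n by rewrite mulr_ge0// ltW.
have dab : d <= al * b by lra.
have Kea : K * e * al <= 1 / 2.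
  rewrite /e mulrAC ler_pdivrMr; last by lra.
  lra.
have Ke : 0 <= K * e by rewrite mulr_ge0// ltW.
have k1 := ler_wpM2l Ke dab.
have k2 := ler_wpM2r b0 Kea.
have bT : b <= T * n.
  have := hb _ e0; rewrite /T; move: k1 k2; rewrite !mulrDr !mulrA; lra.
have k3 : eps / (2 * (T + 1)) * b <= eps / 2 * n.
  apply: le_trans (ler_wpM2l _ bT) _; first by rewrite divr_ge0 ?(ltW eps0)//; lra.
  rewrite mulrA; apply: ler_wpM2r => //; rewrite mulrAC ler_pdivrMr; last by lra.
  have := mulr_ge0 (ltW eps0) T0; lra.
rewrite ler_pdivrMr// mulrDl; lra.
Qed.

Lemma sum_bound (K e f d d' n n' b b' : R) : b <= K * (e * d + f * n) -> b' <= K * (e * d' + f * n') ->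
  b + b' <= K * (e * (d + d') + f * (n + n')).
Proof. by move=> h h'; apply: le_trans (lerD h h') _; rewrite -mulrDr !(mulrDr e) !(mulrDr f) addrACA. Qed.

(** The trace inequality for [boundary_mass], including functions without trace, for which the
    left-hand side is 0. *)
Lemma boundary_mass_le (A : set plane) rho m M L u e : polar_domain A rho m M L -> H1r (exterior A) u -> 0 < e ->
  boundary_mass A u <= Num.sqrt (L ^+ 2 + M ^+ 2) / m * (e * dirichlet A u + e^-1 * mass A u).
Proof.
move=> AP hu e0; have [ht|[_ h]] := trace_or_junk A u.
  by have := is_trace_inequality AP e0 hu ht; rewrite /dirichlet (mulrDr e).
have -> : boundary_mass A u = 0.
  by rewrite /boundary_mass h /dot; under eq_Rintegral do rewrite mulr0; rewrite /Rintegral integral0.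
apply: mulr_ge0; first by rewrite divr_ge0 ?sqrtr_ge0// ltW// (pd_pos AP).
by apply: addr_ge0; apply: mulr_ge0; rewrite ?dirichlet_ge0 ?mass_ge0 ?invr_ge0// ltW.
Qed.

Lemma rayleigh_le (A : set plane) al be w : H1 (exterior A) w -> al <= be -> rayleigh al A w <= rayleigh be A w.
Proof.
move=> hw ab; rewrite !rayleighE//; apply: ler_wpM2r.
  by rewrite invr_ge0 addr_ge0// mass_ge0.
by rewrite lerD2l ler_wpM2r// addr_ge0// boundary_mass_ge0.
Qed.

Lemma lambda2_le (A : set plane) al be : al <= be -> (lambda2 al A <= lambda2 be A)%E.
Proof.
move=> ab; apply: le_ereal_inf_tmp => _ [[u1 u2] hu <-].
have [h1 h2 _] := hu.
apply: (@le_trans _ _ (ereal_sup [set (rayleigh al A (lincomb c (u1, u2)))%:E | c in [set c : C * C | c != 0]])).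
  by apply: ereal_inf_lbound; exists (u1, u2).
apply: ge_ereal_sup => _ [c c0 <-].
apply: (@le_trans _ _ (rayleigh be A (lincomb c (u1, u2)))%:E).
  by rewrite lee_fin rayleigh_le//; apply: H1_lincomb => //; exact: open_exterior.
by apply: ereal_sup_ubound; exists c.
Qed.

Lemma lambda2_lt0_open (A : set plane) rho m M L al : polar_domain A rho m M L -> 0 <= al ->
  (lambda2 (- al) A < 0)%E -> exists2 dl, 0 < dl & (lambda2 (- al + dl) A < 0)%E.
Proof.
move=> AP al0 /ereal_inf_lt[_ [[u1 u2] hu <-]] s0.
have [h1 h2 _] := hu.
have hH c : H1 (exterior A) (lincomb c (u1, u2)) by apply: H1_lincomb => //; exact: open_exterior.
have [eps eps0 he] : exists2 eps : R, 0 < eps & forall c : C * C, c != 0 ->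
    rayleigh (- al) A (lincomb c (u1, u2)) <= - eps.
  set S := ereal_sup _ in s0.
  have SS c : c != 0 -> ((rayleigh (- al) A (lincomb c (u1, u2)))%:E <= S)%E.
    by move=> c0; apply: ereal_sup_ubound; exists c.
  (* If the supremum is [-oo], a real quotient would be below it, so any [eps] will do. *)
  move: S s0 SS => [s| |]//.
    by rewrite lte_fin => s0 SS; exists (- s); [rewrite oppr_gt0|move=> c /SS; rewrite lee_fin opprK].
  by move=> _ SS; exists 1 => // c /SS; rewrite leeNy_eq.
set K := Num.sqrt (L ^+ 2 + M ^+ 2) / m.
have K0 : 0 <= K by rewrite divr_ge0 ?sqrtr_ge0// ltW// (pd_pos AP).
have [dl dl0 hd] := robin_perturbation K0 al0 eps0.
exists dl => //.
apply: (@le_lt_trans _ _ (- (eps / 2))%:E); last by rewrite lte_fin oppr_lt0 divr_gt0.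
apply: (le_trans (ereal_inf_lbound _)); first by exists (u1, u2).
apply: ge_ereal_sup => _ [c /= c0 <-]; rewrite lee_fin rayleighE//.
have := he c c0; rewrite rayleighE//; have [hr hi] := hH c.
apply: hd; rewrite ?addr_ge0 ?dirichlet_ge0 ?boundary_mass_ge0 ?mass_ge0// => e e0.
have b1 := boundary_mass_le AP hr e0; have b2 := boundary_mass_le AP hi e0.
exact: sum_bound b1 b2.
Qed.

(** [lambda2] is monotone in the coupling, so every coupling below the supremum of [S] gives a
    negative value; by openness each element of [S] is exceeded by another one, which makes the
    inequality with the supremum strict. *)
Lemma critical_coupling_exists (A : set plane) rho m M L (a0 : R) : polar_domain A rho m M L ->
  a0 <= 0 -> (forall al, al < a0 -> (lambda2 al A < 0)%E) ->
  exists2 a, critical_coupling A a & a0 <= a.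
Proof.
move=> AP a00 ha.
pose S := [set al : R | al < 0 /\ (lambda2 al A < 0)%E].
have below (al : R) : al < a0 -> S al by move=> h; split; [exact: lt_le_trans a00|exact: ha].
have S0 : S !=set0 by exists (a0 - 1); apply: below; lra.
have uS : ubound S 0 by move=> al [/ltW].
have sS : has_sup S by split => //; exists 0.
exists (sup S); last first.
  rewrite leNgt; apply/negP => h.
  have : (a0 + sup S) / 2 <= sup S by apply: (ub_le_sup sS.2); apply: below; lra.
  lra.
split; first exact: ge_sup.
move=> al al0; split.
  move=> l0; have hal : 0 <= - al by rewrite oppr_ge0 ltW.
  have l0' : (lambda2 (- - al) A < 0)%E by rewrite opprK.
  have [dl dl0] := @lambda2_lt0_open A rho m M L (- al) AP hal l0'; rewrite opprK => hd.
  (* The bound [- al / 2] keeps the larger coupling [al + d] negative, as membership in [S]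
     requires. *)
  pose d := Num.min dl (- al / 2).
  have d0 : 0 < d by rewrite lt_min dl0 divr_gt0// oppr_gt0.
  have d1 : d <= dl by rewrite ge_min lexx.
  have d2 : d <= - al / 2 by rewrite ge_min lexx orbT.
  apply: (@lt_le_trans _ _ (al + d)); first by rewrite ltrDl.
  apply: (ub_le_sup sS.2); split; first by lra.
  by apply: le_lt_trans hd; apply: lambda2_le; rewrite lerD2l.
move=> /(sup_gt S0)[be [_ hb] ab].
by apply: le_lt_trans hb; apply: lambda2_le; exact: ltW.
Qed.

End critical_coupling_constant.

Theorem theorem3p1 (R : realType) (Omega : set (R * R)) (r : R) :
  0 < r ->
  bounded_smooth_domain Omega ->
  strictly_star_shaped Omega ->
  centrally_symmetric Omega ->
  disk 0 r `<` Omega ->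
  (forall alpha : R, alpha < - (1 / r) ->
     (lambda2 alpha Omega < lambda2 alpha (disk 0%R r))%E) /\
  (exists2 alpha_star : R,
     critical_coupling Omega alpha_star & - (1 / r) <= alpha_star).
Proof.
move=> r0 bO sO cO rO.
have [rho [m [M [L [AP rrho rgt]]]]] := polar_domain_star_shaped r0 bO sO rO.
have key alpha : alpha < - (1 / r) -> exists2 k, 0 < k & (lambda2 alpha Omega < (- k ^+ 2)%:E)%E /\
    ((- k ^+ 2)%:E <= lambda2 alpha (disk 0%R r))%E.
  rewrite -ltrNr => h; have := lambda2_lt_disk AP cO r0 h rrho rgt.
  by rewrite opprK.
split=> [alpha /key[k _ [h1 h2]]|]; first exact: lt_le_trans h2.
apply: (critical_coupling_exists AP); first by rewrite oppr_le0 divr_ge0// ltW.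
move=> alpha /key[k k0 [h _]]; apply: lt_trans h _.
by rewrite lte_fin oppr_lt0 exprn_gt0.
Qed.
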